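(* Let $U \subset \mathbb{R}^3$ be an open set and let $f : U \to \mathbb{R}$ be a nonvanishing real analytic function with $\nabla f \neq 0$ everywhere on $U$. Consider the system $$\operatorname{curl}\mathbf{u} = f\,\mathbf{u}, \qquad \operatorname{div}\mathbf{u} = 0 \qquad (\ast)$$ for a vector field $\mathbf{u}$ on $U$. (i) Suppose the level surfaces of $f$ are totally umbilic (i.e., open subsets of planes or spheres). Then $f$ admits no nonzero Beltrami fields (i.e., $(\ast)$ has no nonzero solution) unless the level surfaces of $f$ are contained in either parallel planes or concentric spheres, in which case the solution space of $(\ast)$ is locally parametrized by 2 functions of 1 variable. (ii) Suppose the level surfaces of $f$ contain no umbilic points. Then $f$ admits at most a 3-dimensional space of Beltrami fields, i.e., the real vector space of solutions $\mathbf{u}$ of $(\ast)$ has dimension at most 3.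
   Context: Definition. A Beltrami field on $U$ with proportionality factor $f$ is a solution $\mathbf{u}$ on $U$ of $\operatorname{curl}\mathbf{u} = f\mathbf{u}$, $\operatorname{div}\mathbf{u} = 0$. The function $f$ ''admits a nonzero Beltrami field'' if this system has a nonzero solution. Standing conventions. Only locally defined, real analytic functions $f$ and Beltrami fields $\mathbf{u}$ are considered. All statements are local: $U$ may be replaced by a smaller (in particular connected) open set whenever necessary. An assumption ''$X$ is nonzero'' is to be read as ''$X$ is not identically zero, and we restrict to the open set where $X$ is nonzero''. In the case of concentric spheres, the hypotheses imply that the common center of the spheres is not contained in $U$. Meaning of ''locally parametrized by $k$ functions of $n$ variables''. This is the usual function count of the Cauchy–Kowalevski and Cartan–Kähler theorems: near a generic point, real analytic local solutions of the PDE system under consideration are in correspondence with freely chosen initial data consisting of $k$ arbitrary real analytic functions of $n$ variables, up to arbitrary functions of fewer than $n$ variables and constants, which are not counted. Equivalently, the associated involutive exterior differential system (after prolongation if needed) has last nonzero Cartan character $s_n = k$. *)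

(* Defs.v *)
From HB Require Import structures.
From mathcomp Require Import all_boot all_order all_algebra.
From mathcomp Require Import all_classical all_reals all_analysis.

Set Implicit Arguments.
Unset Strict Implicit.
Unset Printing Implicit Defensive.

Import Order.TTheory GRing.Theory Num.Theory.
Import numFieldNormedType.Exports.

Local Open Scope classical_set_scope.
Local Open Scope ring_scope.

Section RealAnalytic.
Context {R : realType} {m : nat}.

Definition monomial (y : 'rV[R]_m) (al : {ffun 'I_m -> nat}) : R :=
  \prod_(i < m) y ord0 i ^+ al i.

(* Partial sum over the multi-indices with all entries < N. *)
Definition box_sum (c : {ffun 'I_m -> nat} -> R) (N : nat) : R :=
  \sum_(al : {ffun 'I_m -> 'I_N}) c [ffun i => nat_of_ord (al i)].

Definition analytic_at (F : 'rV[R]_m -> R) (p : 'rV[R]_m) : Prop :=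
  exists (a : {ffun 'I_m -> nat} -> R) (r : R), 0 < r /\
    forall x, ball p r x ->
      cvgn (box_sum (fun al => `|a al * monomial (x - p) al|)) /\
      box_sum (fun al => a al * monomial (x - p) al) @ \oo --> F x.

Definition analytic_field_at (u : 'rV[R]_m -> 'rV[R]_m) (p : 'rV[R]_m) : Prop :=
  forall i, analytic_at (fun x => u x ord0 i) p.

End RealAnalytic.

Section VectorCalculus.
Context {R : realType}.
Local Notation E := 'rV[R]_3.

Definition dot (v w : E) : R := \sum_(i < 3) v ord0 i * w ord0 i.

Definition partial (i : 'I_3) (F : E -> R) : E -> R :=
  fun x => 'D_(delta_mx ord0 i) F x.

Definition grad (F : E -> R) (x : E) : E := \row_i partial i F x.

Definition divergence (u : E -> E) (x : E) : R :=
  \sum_(i < 3) partial i (fun y => u y ord0 i) x.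

(* Indices are added in 'I_3, that is, modulo 3. *)
Definition curl (u : E -> E) (x : E) : E :=
  \row_(i < 3) (partial (i + 1) (fun y => u y ord0 (i + 1 + 1)) x
              - partial (i + 1 + 1) (fun y => u y ord0 (i + 1)) x).

Definition beltrami (f : E -> R) (V : set E) (u : E -> E) : Prop :=
  forall x, V x ->
    [/\ analytic_field_at u x, curl u x = f x *: u x & divergence u x = 0].

End VectorCalculus.

Section LevelSurfaces.
Context {R : realType}.
Local Notation E := 'rV[R]_3.

Definition level_surface (U : set E) (f : E -> R) (c : R) : set E :=
  [set x | U x /\ f x = c].

Definition unit_normal (f : E -> R) (x : E) : E :=
  (Num.sqrt (dot (grad f x) (grad f x)))^-1 *: grad f x.

(* The shape operator v |-> - D_v n of the level surface of f through p is a
   multiple of the identity of the tangent plane. *)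
Definition umbilic (f : E -> R) (p : E) : Prop :=
  exists kappa : R, forall v : E, dot v (grad f p) = 0 ->
    - 'D_v (unit_normal f) p = kappa *: v.

Definition in_parallel_planes (U : set E) (f : E -> R) : Prop :=
  exists2 n : E, n != 0 & forall c, exists d : R,
    level_surface U f c `<=` [set x | dot n x = d].

Definition in_concentric_spheres (U : set E) (f : E -> R) : Prop :=
  exists a : E, forall c, exists2 r : R, 0 < r &
    level_surface U f c `<=` [set x | dot (x - a) (x - a) = r ^+ 2].

End LevelSurfaces.

Section SolutionSpaces.
Context {R : realType}.
Local Notation E := 'rV[R]_3.

(* Fields are identified when they agree on U. *)
Definition dim_at_most (U : set E) (S : (E -> E) -> Prop) (d : nat) : Prop :=
  forall (m : nat) (v : 'I_m -> E -> E),
    (forall i, S (v i)) ->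
    (forall c : 'I_m -> R,
      (forall x, U x -> \sum_(i < m) c i *: v i x = 0) -> forall i, c i = 0) ->
    (m <= d)%N.

Definition iter_partial (w : seq 'I_3) (F : E -> R) : E -> R :=
  foldr partial F w.

(* The linear differential operator of order at most N
   sum_(|w| <= N, j) a w j * d_w u_j. *)
Definition diff_op (N : nat) (a : seq 'I_3 -> 'I_3 -> E -> R)
    (u : E -> E) (x : E) : R :=
  \sum_(l < N.+1) \sum_(w : l.-tuple 'I_3) \sum_(j < 3)
    a w j x * iter_partial w (fun y => u y ord0 j) x.

Definition local_solution (Sol : set E -> (E -> E) -> Prop) (p : E)
    (u : E -> E) : Prop :=
  exists V : set E, [/\ open V, V p & Sol V u].

Definition coord_subspace (i : nat) : set E :=
  [set y | forall j : 'I_3, (i <= j)%N -> y ord0 j = 0].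

(* Initial data in the style of Cauchy-Kowalevski and Cartan-Kaehler.  In an
   analytic chart phi with phi 0 = p, a datum of level i is the restriction to
   y_i = ... = y_2 = 0 (hence an analytic germ in i variables) of a component,
   with analytic coefficients, of some jet of the solution; there are s i data
   of level i, and k of the top level n.  Germs at p of solutions correspond
   bijectively to arbitrary analytic data.  The counts s i with i < n are
   unconstrained.  An analytic germ on the coordinate subspace is represented
   by an analytic germ g on the whole space. *)
Definition parametrized_at (Sol : set E -> (E -> E) -> Prop) (k n : nat)
    (p : E) : Prop :=
  exists (phi : E -> E) (s : 'I_n.+1 -> nat) (N : nat)
         (a : forall i : 'I_n.+1, 'I_(s i) -> seq 'I_3 -> 'I_3 -> E -> R),
    let has_data (u : E -> E) (g : forall i : 'I_n.+1, 'I_(s i) -> E -> R) :=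
      forall (i : 'I_n.+1) (l : 'I_(s i)), \forall y \near (0 : E),
        coord_subspace i y -> diff_op N (a i l) u (phi y) = g i l y in
    [/\ [/\ analytic_field_at phi 0, phi 0 = p & jacobian phi 0 \in unitmx],
        s ord_max = k,
        forall i l w j, analytic_at (a i l w j) p &
        forall g : forall i : 'I_n.+1, 'I_(s i) -> E -> R,
          (forall i l, analytic_at (g i l) 0) ->
          (exists2 u, local_solution Sol p u & has_data u g) /\
          (forall u v, local_solution Sol p u -> local_solution Sol p v ->
             has_data u g -> has_data v g -> \forall x \near p, u x = v x)].

(* "Near a generic point": on a dense open subset of U. *)
Definition locally_parametrized (U : set E)
    (Sol : set E -> (E -> E) -> Prop) (k n : nat) : Prop :=
  exists G : set E, [/\ open G, G `<=` U, U `<=` closure G &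
    forall p, G p -> parametrized_at Sol k n p].

End SolutionSpaces.

(* Main.v *)
Require Import Defs.
From HB Require Import structures.
From mathcomp Require Import all_boot all_order all_algebra.
From mathcomp Require Import all_classical all_reals all_analysis.
From mathcomp Require Import ring lra zify.

Import Order.TTheory GRing.Theory Num.Theory.
Import numFieldNormedType.Exports.

Local Open Scope classical_set_scope.
Local Open Scope ring_scope.

(** Write N = grad f and H for the Hessian of f.

    Two identities drive the nonexistence statements.  The divergence of
    curl u = f u is u . N = 0.  The Laplacian of this relation, combined with
    Delta u = - curl (f u), is 2 H : grad u + u . grad (Delta f) = 0
    ([beltrami_orth], [beltrami_hess]).

    No umbilics.  Suppose that all derivatives of u of order less than n vanish
    at p, with n > 0.  To leading order the system and the two identities say
    that, for every word w of length n - 1, the matrix M of the numbers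
    d_w d_i u_j (p) is symmetric and traceless, kills N and is orthogonal to H.
    So M is a traceless symmetric form on the tangent plane of the level
    surface, with two coefficients A and B, and orthogonality to H is one
    equation d A + 2 h B = 0, whose coefficients (d, h) are the traceless part
    of the second fundamental form; they are not both 0 at a nonumbilic point.
    For n = 1 this leaves one parameter.  For n > 1 the d_w d_i u_j are symmetric
    in one more index, which gives the second equation d B - 2 h A = 0, so
    M = 0.  A solution is thus determined by three numbers: the two tangential
    components of u (p) and one number for its first derivatives
    ([leading_order], [jet_test_van]).

    Umbilics, rigidity.  At umbilic points H = mu I + N b^T + b N^T.  Where mu
    is nonzero the vector rho = N / mu joins the centre of the spherical leaf
    through x to x; where mu vanishes identically rho = N / N_l, for some
    coordinate l, is a normal of the planar leaf.  Either way
      d_i rho_j = k delta_ij - N_i V_j,   k = 1 for spheres, 0 for planes,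
    and V is the velocity of the centre, respectively minus the velocity of the
    normal, as the leaf varies.  The Hessian identity becomes u . Z = 0 for an
    explicit combination Z of V, V x rho and V', and the derivative of this
    relation along the normal becomes u . Z1 = 0 ([first_relation],
    [second_relation]).  As also u . rho = 0 and u is nonzero,
    det (rho, Z, Z1) = 0 ([obstruction_vanishes]).  Along a leaf f, V, V' and V''
    are constant, while rho and three scalars, tau and its normal coefficients,
    are affine functions of the position ([curve_values]); on a line in a planar
    leaf, or on a rationally parametrized circle in a spherical one, the relation
    is therefore a polynomial identity in the parameter once denominators are
    cleared.  Its value at the
    parameter at infinity, respectively at the imaginary unit, is a single
    monomial with nonzero coefficient ([flat_curve], [round_curve]), which
    forces V = 0.  Hence near a point where u is nonzero the leaves are
    concentric or parallel, and analyticity carries this over to U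
    ([umbilic_center]).

    Umbilics, existence.  For parallel planes or concentric spheres let g be the
    height or the radius.  Cartesian or stereographic coordinates xi, eta on the
    leaves satisfy grad g x grad xi = grad eta, grad g x grad eta = - grad xi.
    A Beltrami field, being tangent to the leaves, is u = P grad xi - Q grad eta,
    and the system says that P + i Q is holomorphic in xi + i eta and satisfies
    d_g (P + i Q) = i f (P + i Q) ([ansatz_beltrami], [ansatz_converse]).  So
    P + i Q = e^(i F) (A + i B), where F is a primitive of f with respect to g
    and A + i B is a holomorphic function of xi + i eta alone.  Holomorphic
    functions correspond to their restrictions to the real axis, that is to two
    real analytic functions of one variable ([datum_surjective],
    [datum_injective]).

    Analyticity is used throughout in the form of the estimates
    |d_w F| <= C K^|w| |w|! on a ball. *)

Set Implicit Arguments.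
Unset Strict Implicit.
Unset Printing Implicit Defensive.

(** * Differentiation on three-space *)

Section Calculus.
Context {R : realType}.
Local Notation E := 'rV[R]_3.
Implicit Types (F G : E -> R) (x h : E) (i j : 'I_3).

Definition linform (a : 'I_3 -> R) (h : E) : R := \sum_i h ord0 i * a i.

Lemma linform_is_linear a : linear (linform a).
Proof.
move=> k u v; rewrite /linform scaler_sumr -big_split /=.
by apply: eq_bigr => i _; rewrite !mxE mulrDl -mulrA.
Qed.

HB.instance Definition _ a :=
  GRing.isLinear.Build R E R _ (linform a) (linform_is_linear a).

Lemma norm_coord h i : `|h ord0 i| <= `|h|.
Proof.
rewrite [leRHS]/Num.norm /= mx_normrE.
by apply: (le_bigmax_cond _ (fun i : 'I_1 * 'I_3 => `|h i.1 i.2|) (j := (ord0, i))).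
Qed.

Lemma norm_le_coord h (c : R) : 0 <= c -> (forall i, `|h ord0 i| <= c) -> `|h| <= c.
Proof.
move=> c0 hc; rewrite [leLHS]/Num.norm /= mx_normrE.
by apply: bigmax_le => // -[k i] _ /=; rewrite ord1.
Qed.

Lemma linform_le a h : `|linform a h| <= (\sum_i `|a i|) * `|h|.
Proof.
rewrite /linform (le_trans (ler_norm_sum _ _ _)) // mulr_suml.
apply: ler_sum => i _; rewrite normrM mulrC; apply: ler_wpM2l => //.
exact: norm_coord.
Qed.

Lemma linform_continuous a : continuous (linform a).
Proof.
apply: bounded_linear_continuous; apply/linear_boundedP.
exists (\sum_i `|a i|); split; first exact: num_real.
move=> M aM h; apply: le_trans (linform_le a h) _.
by apply: ler_wpM2r => //; exact: ltW.
Qed.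

(** Differentiability at x with prescribed partial derivatives, as an estimate:
    the form in which it passes to limits of sequences of functions. *)
Definition hasd F x (a : 'I_3 -> R) := forall eps : R, 0 < eps ->
  \forall h \near (0 : E), `|F (h + x) - F x - linform a h| <= eps * `|h|.

Lemma hasd_diff F x a : hasd F x a -> differentiable F x /\ forall i, partial i F x = a i.
Proof.
move=> Fa.
have H : F \o shift x = cst (F x) + linform a +o_ (0 : E) id.
  apply/eqaddoP => eps eps0.
  have := Fa _ eps0; apply: filterS => h /=; by rewrite !fctE /= opprD addrA.
have dE := diff_unique (@linform_continuous a) H.
have Fd : differentiable F x.
  apply/diff_locallyP; split; rewrite dE //; exact: linform_continuous.
split=> // i; rewrite /partial deriveE // dE /linform.
rewrite -[LHS]/(linform a (delta_mx ord0 i)) /linform (bigD1 i) //= big1 ?addr0; first by rewrite mxE !eqxx mul1r.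
by move=> j ji; rewrite mxE eqxx /= (negPf ji) mul0r.
Qed.

Lemma diff_partial F x h : differentiable F x ->
  'd F x h = linform (fun i => partial i F x) h.
Proof.
move=> Fd; rewrite {1}(row_sum_delta h) linear_sum /linform.
by apply: eq_bigr => i _; rewrite linearZ /= /partial deriveE.
Qed.

Lemma derive_partial F x h : differentiable F x ->
  'D_h F x = linform (fun i => partial i F x) h.
Proof. by move=> Fd; rewrite deriveE // diff_partial. Qed.

Lemma diff_hasd F x : differentiable F x -> hasd F x (fun i => partial i F x).
Proof.
move=> Fd eps eps0.
have [_ /eqaddoP/(_ _ eps0)] := (diff_locallyP _ _).1 Fd.
apply: filterS => h /=; rewrite !fctE /= -diff_partial //.
by rewrite opprD addrA.
Qed.

Lemma hasd_near F G x a : (\forall y \near x, F y = G y) -> hasd F x a -> hasd G x a.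
Proof.
move=> FG Fa eps eps0; have Fae := Fa _ eps0; have /nbhs_singleton Fx := FG.
have FG0 : \forall h \near (0 : E), F (h + x) = G (h + x).
  by move: FG; rewrite (near_shift 0 x) subr0.
by near=> h; rewrite -(near FG0 h) // -Fx; near: h.
Unshelve. all: by end_near.
Qed.

Lemma differentiable_near F G x : (\forall y \near x, F y = G y) ->
  differentiable F x -> differentiable G x.
Proof. by move=> FG /diff_hasd/(hasd_near FG)/hasd_diff[]. Qed.

Lemma partial_near i F G x : (\forall y \near x, F y = G y) ->
  partial i F x = partial i G x.
Proof. exact: near_eq_derive. Qed.

Lemma partialD i F G x : differentiable F x -> differentiable G x ->
  partial i (fun y => F y + G y) x = partial i F x + partial i G x.
Proof. by move=> Fd Gd; rewrite /partial deriveD //; exact: diff_derivable. Qed.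

Lemma partialN i F x : differentiable F x ->
  partial i (fun y => - F y) x = - partial i F x.
Proof. by move=> Fd; rewrite /partial deriveN //; exact: diff_derivable. Qed.

Lemma partialB i F G x : differentiable F x -> differentiable G x ->
  partial i (fun y => F y - G y) x = partial i F x - partial i G x.
Proof. by move=> Fd Gd; rewrite /partial deriveB //; exact: diff_derivable. Qed.

Lemma partialM i F G x : differentiable F x -> differentiable G x ->
  partial i (fun y => F y * G y) x = partial i F x * G x + F x * partial i G x.
Proof.
move=> Fd Gd; rewrite /partial deriveM; [|exact: diff_derivable..].
by rewrite addrC; congr (_ + _); rewrite /GRing.scale /= mulrC.
Qed.

Lemma partial_cst i (c : R) x : partial i (fun=> c) x = 0.
Proof. by rewrite /partial derive_cst. Qed.

Lemma partialZ i (c : R) F x : differentiable F x ->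
  partial i (fun y => c * F y) x = c * partial i F x.
Proof.
by move=> Fd; rewrite partialM // ?partial_cst ?mul0r ?add0r //; exact: differentiable_cst.
Qed.

Lemma partial_coord i j x : partial i (fun y => y ord0 j) x = (i == j)%:R.
Proof.
have [_ ->] // : differentiable (fun y : E => y ord0 j) x /\
  forall i, partial i (fun y : E => y ord0 j) x = (i == j)%:R.
apply: hasd_diff => eps eps0; near=> h.
rewrite /linform (bigD1 j) //= eqxx mulr1 big1 ?addr0; last first.
  by move=> k /negPf ->; rewrite mulr0.
by rewrite mxE addrK subrr normr0 mulr_ge0 // ltW.
Unshelve. all: by end_near. Qed.

Lemma partialV i F x : F x != 0 -> differentiable F x ->
  partial i (fun y => (F y)^-1) x = - (F x)^-2 * partial i F x.
Proof. by move=> F0 Fd; rewrite /partial deriveV //; exact: diff_derivable. Qed.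

Lemma differentiable_sumf (I : Type) (r : seq I) (P : pred I) (F : I -> E -> R) x :
  (forall k, P k -> differentiable (F k) x) ->
  differentiable (fun y => \sum_(k <- r | P k) F k y) x.
Proof.
move=> Fd; elim: r => [|k r IH].
  rewrite (_ : (fun _ => _) = cst 0); first exact: differentiable_cst.
  by apply/funext => y; rewrite big_nil.
rewrite (_ : (fun _ => _) = if P k then F k + (fun y => \sum_(k <- r | P k) F k y)
   else (fun y => \sum_(k <- r | P k) F k y)); last first.
  by apply/funext => y; rewrite big_cons; case: ifP.
by case: ifP => [Pk|_]; [exact: differentiableD (Fd k Pk) IH|exact: IH].
Qed.

Lemma partial_sum i (I : Type) (r : seq I) (P : pred I) (F : I -> E -> R) x :
  (forall k, P k -> differentiable (F k) x) ->
  partial i (fun y => \sum_(k <- r | P k) F k y) x = \sum_(k <- r | P k) partial i (F k) x.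
Proof.
move=> Fd; elim: r => [|k r IH].
  rewrite (_ : (fun _ => _) = cst 0) ?big_nil ?partial_cst //.
  by apply/funext => y; rewrite big_nil.
rewrite (_ : (fun _ => _) = if P k then (fun y => F k y + \sum_(k <- r | P k) F k y)
   else (fun y => \sum_(k <- r | P k) F k y)); last first.
  by apply/funext => y; rewrite big_cons; case: ifP.
rewrite big_cons; case: ifP => // Pk; rewrite partialD ?IH //; first exact: Fd.
exact: differentiable_sumf.
Qed.

Lemma differentiable_rV (Phi : E -> E) x :
  (forall j, differentiable (fun y => Phi y ord0 j) x) -> differentiable Phi x.
Proof.
move=> Pd.
rewrite (_ : Phi = \sum_(j < 3) (fun y => Phi y ord0 j *: delta_mx ord0 j)); last first.
  by apply/funext => y; rewrite fct_sumE -row_sum_delta.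
by apply: differentiable_sum => j; apply: differentiableZl; exact: Pd.
Qed.

Lemma diff_rV (Phi : E -> E) x h j : differentiable Phi x ->
  'd Phi x h ord0 j = linform (fun i => partial i (fun y => Phi y ord0 j) x) h.
Proof.
move=> Pd; rewrite -diff_partial; last first.
  apply: (differentiable_comp (g := fun N : E => N ord0 j)) => //.
  exact: differentiable_coord.
have cE : (fun N : E => N ord0 j) = linform (fun i => (i == j)%:R).
  apply/funext => N; rewrite /linform (bigD1 j) //= eqxx mulr1 big1 ?addr0 //.
  by move=> k /negPf ->; rewrite mulr0.
have cd : differentiable (fun N : E => N ord0 j) (Phi x) by exact: differentiable_coord.
have -> : 'd (fun y => Phi y ord0 j) x = 'd (fun N : E => N ord0 j) (Phi x) \o 'd Phi x
  :> (E -> R) by exact: (diff_comp Pd cd).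
rewrite /comp cE diff_lin; last exact: linform_continuous.
by rewrite -[RHS]/(linform _ _) -cE.
Qed.

Lemma differentiable_comprV G (Phi : E -> E) x :
  (forall j, differentiable (fun y => Phi y ord0 j) x) ->
  differentiable G (Phi x) -> differentiable (fun y => G (Phi y)) x.
Proof.
by move=> Pd Gd; apply: (differentiable_comp (g := G)) => //; exact: differentiable_rV.
Qed.

Lemma partial_comprV i G (Phi : E -> E) x :
  (forall j, differentiable (fun y => Phi y ord0 j) x) ->
  differentiable G (Phi x) ->
  partial i (fun y => G (Phi y)) x =
    \sum_j partial j G (Phi x) * partial i (fun y => Phi y ord0 j) x.
Proof.
move=> Pd Gd; have Pd' := differentiable_rV Pd.
rewrite /partial deriveE; last exact: differentiable_comprV.
rewrite (_ : (fun y => _) = G \o Phi) // diff_comp //= diff_partial //.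
apply: eq_bigr => j _; rewrite mulrC; congr (_ * _).
by rewrite diff_rV // -diff_partial // -deriveE.
Qed.

Lemma differentiable_comp1 (g : R -> R) F x : derivable g (F x) 1 ->
  differentiable F x -> differentiable (fun y => g (F y)) x.
Proof.
by move=> gd Fd; apply: (differentiable_comp (g := g)) => //; exact/derivable1_diffP.
Qed.

Lemma partial_comp1 i (g : R -> R) F x : derivable g (F x) 1 ->
  differentiable F x ->
  partial i (fun y => g (F y)) x = derive1 g (F x) * partial i F x.
Proof.
move=> gd Fd; rewrite /partial deriveE; last exact: differentiable_comp1.
rewrite (_ : (fun y => _) = g \o F) // diff_comp //; last exact/derivable1_diffP.
by rewrite /= deriveE // deriv1E //= mulrC.
Qed.

Lemma derive_line F x h (t : R) : differentiable F (x + t *: h) ->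
  is_derive t 1 (fun s : R => F (x + s *: h))
    (linform (fun i => partial i F (x + t *: h)) h).
Proof.
move=> Fd.
have ld : is_diff t (fun s : R => x + s *: h) ( *:%R ^~ h).
  have -> : ( *:%R ^~ h : R -> E) = 0 + ( *:%R ^~ h) by rewrite add0r.
  exact: is_diffD.
have d : differentiable (fun s : R => F (x + s *: h)) t.
  by apply: (differentiable_comp (g := F)).
apply: DeriveDef; first exact: diff_derivable.
rewrite deriveE // (_ : (fun s : R => _) = F \o (fun s : R => x + s *: h)) //.
by rewrite diff_comp //= diff_val scale1r diff_partial.
Qed.

End Calculus.

(** * Analyticity as bounds on derivatives *)

Section Analytic.
Context {R : realType}.
Local Notation E := 'rV[R]_3.
Implicit Types (F G : E -> R) (x p h : E) (i j : 'I_3) (w v : seq 'I_3) (V : set E)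
  (A B : nat -> R).

Lemma iter_partial_rcons w i F :
  iter_partial (rcons w i) F = iter_partial w (partial i F).
Proof. by rewrite /iter_partial foldr_rcons. Qed.

Lemma iter_partial_cat w v F :
  iter_partial (w ++ v) F = iter_partial w (iter_partial v F).
Proof. by rewrite /iter_partial foldr_cat. Qed.

Lemma iter_partial_near w F G x : (\forall y \near x, F y = G y) ->
  \forall y \near x, iter_partial w F y = iter_partial w G y.
Proof.
move=> FG; elim: w => //= i w IH.
by move/near_join: IH; apply: filterS => y; exact: partial_near.
Qed.

Lemma open_near V x (P : E -> Prop) : open V -> V x -> (forall y, V y -> P y) ->
  \forall y \near x, P y.
Proof. by move=> Vo Vx VP; near=> y; apply: VP; near: y; exact: open_nbhs_nbhs. 
Unshelve. all: by end_near. Qed.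

(** A bounds the derivatives of each order up to n.  The truncation at order n
    makes closure under operations provable by induction on n. *)
Definition bnd n V F A := forall w x, (size w <= n)%N -> V x ->
  differentiable (iter_partial w F) x /\ `|iter_partial w F x| <= A (size w).

Lemma bnd_eq n V F G A : open V -> (forall x, V x -> F x = G x) ->
  bnd n V F A -> bnd n V G A.
Proof.
move=> Vo FG FA w x wn Vx; have [Fd Fb] := FA w x wn Vx.
have e := iter_partial_near w (open_near Vo Vx FG).
by split; [exact: (differentiable_near e)|rewrite -(nbhs_singleton e)].
Qed.

Lemma bnd_sub n m V F A : (m <= n)%N -> bnd n V F A -> bnd m V F A.
Proof. by move=> mn Fb w x wm; apply: Fb; exact: leq_trans wm mn. Qed.

Lemma bnd_le n V F A B : (forall k, (k <= n)%N -> A k <= B k) -> bnd n V F A -> bnd n V F B.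
Proof.
move=> AB Fb w x wm Vx; have [? Fx] := Fb w x wm Vx.
by split=> //; exact: le_trans Fx (AB _ _).
Qed.

Lemma bnd_shift n V F A i : bnd n.+1 V F A -> bnd n V (partial i F) (A \o S).
Proof.
move=> Fb w x wn Vx; rewrite -iter_partial_rcons.
by have := Fb (rcons w i) x; rewrite size_rcons ltnS; exact.
Qed.

(** Words are split at their last letter, the derivative taken first; so the
    derivatives of order n + 1 of F are those of order n of its partials, and an
    induction on n with F general applies. *)
Lemma bnd_step n V F A : (forall x, V x -> differentiable F x) ->
  (forall x, V x -> `|F x| <= A 0) ->
  (forall i, bnd n V (partial i F) (A \o S)) -> bnd n.+1 V F A.
Proof.
move=> Fd F0 FS w x; case: (lastP w) => [_ Vx|w' i]; first by split; [exact: Fd|exact: F0].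
by rewrite size_rcons ltnS iter_partial_rcons => w'n Vx; exact: FS.
Qed.

Lemma bnd0 V F A : (forall x, V x -> differentiable F x) ->
  (forall x, V x -> `|F x| <= A 0) -> bnd 0 V F A.
Proof. by move=> Fd F0 [|//] x _ Vx; split; [exact: Fd|exact: F0]. Qed.

Lemma bndP n V F A : bnd n V F A -> (forall x, V x -> differentiable F x) /\
  (forall x, V x -> `|F x| <= A 0).
Proof. by move=> Fb; split=> x Vx; have [] := Fb [::] x isT Vx. Qed.

Lemma bndD n V F G A B : open V -> bnd n V F A -> bnd n V G B ->
  bnd n V (fun y => F y + G y) (fun k => A k + B k).
Proof.
move=> Vo; elim: n F G A B => [|n IH] F G A B FA GB.
  have [Fd F0] := bndP FA; have [Gd G0] := bndP GB.
  apply: bnd0 => x Vx; first by apply: differentiableD; [exact: Fd|exact: Gd].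
  by apply: le_trans (ler_normD _ _) (lerD _ _); [exact: F0|exact: G0].
have [Fd F0] := bndP FA; have [Gd G0] := bndP GB.
apply: bnd_step => [x Vx|x Vx|i]; first by apply: differentiableD; [exact: Fd|exact: Gd].
  by apply: le_trans (ler_normD _ _) (lerD _ _); [exact: F0|exact: G0].
apply: (@bnd_eq _ _ (fun y => partial i F y + partial i G y)) => //.
  by move=> x Vx; rewrite partialD //; [exact: Fd|exact: Gd].
by apply: (IH _ _ (A \o S) (B \o S)); exact: bnd_shift.
Qed.

(** The Leibniz rule for bounds: no matter how the letters of a word are
    distributed over two factors, only the number of letters given to each
    factor enters. *)
Definition lconv n A B := \sum_(l < n.+1) 'C(n, l)%:R * (A l * B (n - l)%N).

Lemma lconvS n A B : lconv n.+1 A B = lconv n (A \o S) B + lconv n A (B \o S).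
Proof.
rewrite /lconv [LHS]big_ord_recl /= [X in _ + X]big_ord_recr /=.
rewrite [X in _ = X + _]big_ord_recr /= [X in _ = _ + X]big_ord_recl /=.
rewrite !bin0 !binn !subn0 !subnn !mul1r [RHS]addrCA; congr (_ + _).
rewrite [RHS]addrAC; congr (_ + _).
rewrite -big_split /=; apply: eq_bigr => -[l ln] _ /=.
rewrite /bump /= !add1n binS natrD mulrDl subSS addrC; congr (_ + _).
by rewrite subnSK.
Qed.

Lemma bndM n V F G A B : open V -> bnd n V F A -> bnd n V G B ->
  bnd n V (fun y => F y * G y) (fun k => lconv k A B).
Proof.
move=> Vo; elim: n F G A B => [|n IH] F G A B FA GB.
  have [Fd F0] := bndP FA; have [Gd G0] := bndP GB.
  apply: bnd0 => x Vx; first by apply: differentiableM; [exact: Fd|exact: Gd].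
  rewrite /lconv big_ord_recl big_ord0 addr0 mul1r normrM.
  by apply: ler_pM => //; [exact: F0|exact: G0].
have [Fd F0] := bndP FA; have [Gd G0] := bndP GB.
apply: bnd_step => [x Vx|x Vx|i]; first by apply: differentiableM; [exact: Fd|exact: Gd].
  rewrite /lconv big_ord_recl big_ord0 addr0 mul1r normrM.
  by apply: ler_pM => //; [exact: F0|exact: G0].
apply: (@bnd_eq _ _ (fun y => partial i F y * G y + F y * partial i G y)) => //.
  by move=> x Vx; rewrite partialM //; [exact: Fd|exact: Gd].
apply: (@bnd_le _ _ _ (fun k => lconv k (A \o S) B + lconv k A (B \o S))).
  by move=> k _; rewrite /= lconvS.
by apply: bndD => //; apply: IH; try exact: bnd_shift; exact: bnd_sub (leqnSn _) _.
Qed.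

Lemma bnd_sum3 n V (F : 'I_3 -> E -> R) A : open V -> (forall j, bnd n V (F j) A) ->
  bnd n V (fun y => \sum_j F j y) (fun k => 3 * A k).
Proof.
move=> Vo FA.
apply: (@bnd_eq _ _ (fun y => F ord0 y + (F (lift ord0 ord0) y + F (lift ord0 (lift ord0 ord0)) y))) => //.
  by move=> x Vx; rewrite !big_ord_recl big_ord0 addr0.
apply: (@bnd_le _ _ _ (fun k => A k + (A k + A k))); first by move=> k _; lra.
by do ![apply: bndD => //].
Qed.

(** The Cauchy estimates.  They are equivalent to analyticity ([analytic_at_an],
    [an_analytic_at]), and unlike the power series they involve neither a
    recentring nor a rearrangement when the point moves or functions are
    composed. *)
Definition anb V F (C K : R) := forall n, bnd n V F (fun k => C * K ^+ k * k`!%:R).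

Definition an F p := exists r C K, [/\ 0 < r, 0 <= C, 1 <= K & anb (ball p r) F C K].

Lemma anb_le V V' F C K C' K' : V' `<=` V -> 0 <= C -> 0 <= K -> C <= C' -> K <= K' ->
  anb V F C K -> anb V' F C' K'.
Proof.
move=> VV C0 K0 CC KK Fb n w x wn Vx; have [? Fx] := Fb n w x wn (VV _ Vx).
split=> //; apply: le_trans Fx _; rewrite ler_wpM2r ?ler0n //.
by apply: ler_pM => //; [rewrite exprn_ge0|rewrite lerXn2r ?nnegrE ?(le_trans K0)].
Qed.

Lemma an_common F G p : an F p -> an G p -> exists r C K,
  [/\ 0 < r, 0 <= C, 1 <= K & anb (ball p r) F C K /\ anb (ball p r) G C K].
Proof.
move=> [r [C [K [r0 C0 K1 Fb]]]] [r' [C' [K' [r'0 C'0 K'1 Gb]]]].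
exists (Num.min r r'), (C + C'), (K + K'); split.
- by rewrite lt_min r0.
- by rewrite addr_ge0.
- by lra.
split.
  by apply: anb_le Fb => //; [apply: le_ball; rewrite ge_min lexx|lra|lra|lra].
by apply: anb_le Gb => //; [apply: le_ball; rewrite ge_min lexx orbT|lra|lra|lra].
Qed.

Lemma an_near F G p : (\forall y \near p, F y = G y) -> an F p -> an G p.
Proof.
move=> FG [r [C [K [r0 C0 K1 Fb]]]].
have [r' /= r'0 FG'] := (nbhs_ballP _ _).1 FG.
exists (Num.min r r'), C, K; split=> //; first by rewrite lt_min r0.
move=> n; apply: (@bnd_eq _ _ F); first exact: ball_open; last first.
  have := @anb_le (ball p r) (ball p (Num.min r r')) F C K C K.
  by apply=> //; [apply: le_ball; rewrite ge_min lexx|lra].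
by move=> x xr; apply: FG'; apply: le_ball xr; rewrite ge_min lexx orbT.
Qed.

Lemma an_nbhs F p : an F p -> \forall x \near p, an F x.
Proof.
move=> [r [C [K [r0 C0 K1 Fb]]]]; near=> x.
have : ball p r x by near: x; exact: nbhsx_ballx.
move=> xr; have /nbhs_ballP[s /= s0 sr] := open_nbhs_nbhs (conj (ball_open p r) xr).
exists s, C, K; split=> // n w y wn ys; apply: (Fb n) => //; exact: sr.
Unshelve. all: by end_near. Qed.

Lemma an_diff_iter w F p : an F p -> differentiable (iter_partial w F) p.
Proof.
move=> [r [C [K [r0 C0 K1 Fb]]]].
by have [] := Fb (size w) w p (leqnn _) (ballxx p r0).
Qed.

Lemma an_diff F p : an F p -> differentiable F p.
Proof. exact: (@an_diff_iter [::]). Qed.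

Lemma geo_nat k : (k.+1%:R : R) <= 2 ^+ k.
Proof. by rewrite -natrX ler_nat; elim: k => // k IH; rewrite expnS; lia. Qed.

(** One derivative more costs a factor k + 1, absorbed by doubling K. *)
Lemma an_partial i F p : an F p -> an (partial i F) p.
Proof.
move=> [r [C [K [r0 C0 K1 Fb]]]].
exists r, (C * K), (2 * K); split=> //; first by rewrite mulr_ge0 //; lra.
  by lra.
move=> n; apply: bnd_le (bnd_shift i (Fb n.+1)) => k _ /=.
rewrite factS natrM exprS exprMn.
have := geo_nat k; set t := _%:R; set s := 2 ^+ k => ts.
have : 0 <= C * K * K ^+ k * k`!%:R by rewrite !mulr_ge0 // ?exprn_ge0 //; lra.
nra.
Qed.

Lemma anD F G p : an F p -> an G p -> an (fun y => F y + G y) p.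
Proof.
move=> Fa Ga; have [r [C [K [r0 C0 K1 [Fb Gb]]]]] := an_common Fa Ga.
exists r, (C + C), K; split=> //; first lra.
move=> n; apply: bnd_le (bndD (ball_open p r) (Fb n) (Gb n)) => k _.
by rewrite !mulrDl.
Qed.

(** The k + 1 terms of the Leibniz sum are equal, since
    C(k, l) l! (k - l)! = k!; the factor k + 1 is absorbed by doubling K. *)
Lemma anM F G p : an F p -> an G p -> an (fun y => F y * G y) p.
Proof.
move=> Fa Ga; have [r [C [K [r0 C0 K1 [Fb Gb]]]]] := an_common Fa Ga.
exists r, (C * C), (2 * K); split=> //; [by rewrite mulr_ge0|lra|].
move=> n; apply: bnd_le (bndM (ball_open p r) (Fb n) (Gb n)) => k _.
rewrite /lconv (eq_bigr (fun=> C * C * K ^+ k * k`!%:R)); last first.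
  move=> [l /=]; rewrite ltnS => lk _.
  have -> : K ^+ k = K ^+ l * K ^+ (k - l) by rewrite -exprD subnKC.
  by rewrite -(bin_fact lk) !natrM; ring.
rewrite sumr_const card_ord -mulr_natr exprMn.
have := geo_nat k; set t := _%:R; set s := 2 ^+ k => ts.
have : 0 <= C * C * K ^+ k * k`!%:R by rewrite !mulr_ge0 // exprn_ge0 //; lra.
nra.
Qed.

Lemma iter_partial_cst w (c : R) :
  iter_partial w (fun=> c) = (fun=> if w is [::] then c else 0) :> (E -> R).
Proof. by elim: w => //= a l ->; apply/funext => y; rewrite partial_cst. Qed.

Lemma anb_cst V (c : R) : anb V (fun=> c) `|c| 1.
Proof.
move=> n w x _ _; rewrite iter_partial_cst; split; first exact: differentiable_cst.
rewrite expr1n mulr1; case: w => [|a l]; first by rewrite mulr1.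
by rewrite normr0 mulr_ge0.
Qed.

Lemma an_cst (c : R) p : an (fun=> c) p.
Proof. by exists 1, `|c|, 1; split=> //; exact: anb_cst. Qed.

Lemma an_coord j p : an (fun y => y ord0 j) p.
Proof.
exists 1, (`|p| + 1), 1; split=> //.
have p0 := normr_ge0 p.
have H0 x : ball p 1 x -> `|x ord0 j| <= `|p| + 1.
  rewrite -ball_normE /= => xr.
  have := norm_coord x j; have := ler_distD p x 0; rewrite !subr0 distrC; lra.
case=> [|n].
  by apply: bnd0 => x xr; [exact: differentiable_coord|rewrite !mulr1; exact: H0].
apply: bnd_step => [x xr|x xr|i]; first exact: differentiable_coord.
  by rewrite !mulr1; exact: H0.
apply: (@bnd_eq _ _ (fun=> (i == j)%:R)); first exact: ball_open.
  by move=> x _; rewrite partial_coord.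
apply: bnd_le (@anb_cst (ball p 1) (i == j)%:R n) => k _ /=.
rewrite !expr1n !mulr1 normr_nat; apply: ler_pM => //.
  by apply: le_trans (_ : 1 <= _); [rewrite lern1 leq_b1|lra].
by rewrite ler_nat factS leq_pmull.
Qed.

End Analytic.

Lemma fact_mono k l d : (l <= k)%N -> (k`! * (l + d)`! <= (k + d)`! * l`!)%N.
Proof.
move=> /subnKC <-; elim: (k - l)%N => [|n IH]; first by rewrite addn0 mulnC.
rewrite addnS factS addSn factS -!mulnA.
by apply: leq_mul => //; rewrite ltnS leq_addr.
Qed.

Lemma bin_fact_le k l d : (l <= k)%N ->
  ('C(k, l) * ((l + d)`! * (k - l)`!) <= (k + d)`!)%N.
Proof.
move=> lk; rewrite -(leq_pmul2r (fact_gt0 l)); apply: leq_trans (fact_mono d lk).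
by rewrite -(bin_fact lk) leq_eqVlt; apply/orP; left; apply/eqP; ring.
Qed.

(** * Composition of analytic functions *)

Section Composition.
Context {R : realType}.
Local Notation E := 'rV[R]_3.
Implicit Types (F G : E -> R) (x p h : E) (i j : 'I_3) (w v : seq 'I_3) (V : set E)
  (A B : nat -> R).

Lemma arith_geo_sum n : \sum_(l < n) (l.+1%:R / 2 ^+ l) <= (4 : R).
Proof.
have -> : \sum_(l < n) (l.+1%:R / 2 ^+ l) = 4 - (2 * n%:R + 4) / 2 ^+ n :> R.
  elim: n => [|n IH]; first by rewrite big_ord0 expr0; lra.
  rewrite big_ord_recr /= IH exprS -[n.+1%:R]natr1; field.
  by rewrite expf_neq0.
by rewrite gerBl divr_ge0 ?exprn_ge0 // addr_ge0 // mulr_ge0.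
Qed.

(** The common core of all composition theorems.  The functions Q_a are the
    derivatives of the outer function, composed with the inner one, so that the
    chain rule maps the family into itself: differentiation raises the degree of
    a by one and produces a derivative of F.  The factor 2 L in M makes the
    Leibniz sum geometric, with ratio 1/2, and 12 K C' L leaves room for its
    value, for the sum over three indices and for the constant of F. *)
Lemma chain_bnd (T : Type) (deg : T -> nat) (nxt : 'I_3 -> T -> T) (Q : T -> E -> R)
    (F : 'I_3 -> E -> R) V (C K C' L : R) : open V ->
  0 <= C -> 0 <= K -> 0 <= C' -> 1 <= L ->
  (forall j a, deg (nxt j a) = (deg a).+1) ->
  (forall a x, V x -> differentiable (Q a) x) ->
  (forall a i x, V x -> partial i (Q a) x = \sum_j Q (nxt j a) x * partial i (F j) x) ->
  (forall a x, V x -> `|Q a x| <= C * K ^+ deg a * (deg a)`!%:R) ->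
  (forall j, anb V (F j) C' L) ->
  let M := 2 * L + 12 * K * C' * L in
  forall n a, bnd n V (Q a) (fun k => C * M ^+ k * K ^+ deg a * (k + deg a)`!%:R).
Proof.
move=> Vo C0 K0 C'0 L1 dnxt Qd Qp Qb Fb M.
have KCL : 0 <= 12 * K * C' * L by rewrite !mulr_ge0 //; lra.
have M0 : 2 * L <= M by rewrite /M lerDl.
have M1 : 12 * K * C' * L <= M by rewrite /M lerDr; lra.
elim=> [|n IH] a.
  by apply: bnd0 => x Vx; [exact: Qd|rewrite expr0 mulr1; exact: Qb].
apply: bnd_step => [x Vx|x Vx|i]; [exact: Qd|by rewrite expr0 mulr1; exact: Qb|].
apply: (@bnd_eq _ _ _ (fun x => \sum_j Q (nxt j a) x * partial i (F j) x)) => //.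
  by move=> x Vx; rewrite Qp.
have H j : bnd n V (fun x => Q (nxt j a) x * partial i (F j) x) (fun k =>
    lconv k (fun l => C * M ^+ l * K ^+ (deg a).+1 * (l + (deg a).+1)`!%:R)
            (fun l => C' * L ^+ l.+1 * l.+1`!%:R)).
  apply: bndM => //; first by rewrite -(dnxt j a); exact: IH.
  by have := bnd_shift i (Fb j n.+1).
apply: bnd_le (bnd_sum3 Vo H) => k _ /=; move: (deg a) => d.
have K3 : 0 <= K * C' * L by rewrite !mulr_ge0 //; lra.
set X := C * M ^+ k * K ^+ d * (k.+1 + d)`!%:R.
have M00 : 0 <= M by lra.
have X0 : 0 <= X by rewrite /X !mulr_ge0 // ?exprn_ge0.
have -> : C * M ^+ k.+1 * K ^+ d * (k.+1 + d)`!%:R = M * X by rewrite /X exprS; ring.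
apply: le_trans (_ : 12 * K * C' * L * X <= _); last exact: ler_wpM2r.
apply: le_trans (_ : 3 * (K * C' * L * X * 4) <= _); last by rewrite le_eqVlt; apply/orP; left; apply/eqP; ring.
rewrite ler_pM2l //.
apply: le_trans (_ : K * C' * L * X * \sum_(l < k.+1) (l.+1%:R / 2 ^+ l) <= _); last first.
  by apply: ler_wpM2l; [exact: mulr_ge0|exact: arith_geo_sum].
rewrite (reindex_inj rev_ord_inj) /= mulr_sumr; apply: ler_sum => -[l /=]; rewrite ltnS => lk _.
rewrite subSS.
have e1 : 'C(k, l)%:R * ((l + d.+1)`!%:R * (k - l)`!%:R) <= (k.+1 + d)`!%:R :> R.
  by rewrite -!natrM ler_nat addSnnS; exact: bin_fact_le.
have e2 : M ^+ l * L ^+ (k - l) <= M ^+ k / 2 ^+ (k - l).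
  rewrite ler_pdivlMr ?exprn_gt0 // -mulrA -exprMn -[X in _ <= M ^+ X](subnKC lk) exprD.
  apply: ler_wpM2l; first by rewrite exprn_ge0.
  by rewrite lerXn2r ?nnegrE // [L * 2]mulrC //; lra.
rewrite factS natrM (exprS K) (exprS L).
have -> : 'C(k, l)%:R *
  (C * M ^+ l * (K * K ^+ d) * (l + d.+1)`!%:R *
   (C' * (L * L ^+ (k - l)) * ((k - l).+1%:R * (k - l)`!%:R))) =
  (K * C' * L * C * K ^+ d * (k - l).+1%:R) * ((M ^+ l * L ^+ (k - l)) *
  ('C(k, l)%:R * ((l + d.+1)`!%:R * (k - l)`!%:R))) by ring.
have -> : K * C' * L * X * ((k - l).+1%:R / 2 ^+ (k - l)) =
  (K * C' * L * C * K ^+ d * (k - l).+1%:R) * ((M ^+ k / 2 ^+ (k - l)) * (k.+1 + d)`!%:R).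
  by rewrite /X; ring.
apply: ler_wpM2l; first by rewrite !mulr_ge0 // ?exprn_ge0 //; lra.
by apply: ler_pM => //; rewrite ?mulr_ge0 ?exprn_ge0 //; lra.
Qed.

Lemma anb_common3 (F : 'I_3 -> E -> R) p : (forall j, an (F j) p) -> exists r C K,
  [/\ 0 < r, 0 <= C, 1 <= K & forall j, anb (ball p r) (F j) C K].
Proof.
move=> Fa; have H n : exists r C K, [/\ 0 < r, 0 <= C, 1 <= K &
    forall j : 'I_3, (j < n)%N -> anb (ball p r) (F j) C K].
  elim: n => [|n [r [C [K [r0 C0 K1 Fb]]]]]; first by exists 1, 1, 1; split.
  case: (ltnP n 3) => n3; last first.
    by exists r, C, K; split=> // j jn; apply: Fb; exact: leq_trans (ltn_ord j) n3.
  have [r' [C' [K' [r'0 C'0 K'1 Gb]]]] := Fa (Ordinal n3).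
  exists (Num.min r r'), (C + C'), (K + K'); split; rewrite ?lt_min ?r0 //; [lra|lra|].
  move=> j; rewrite ltnS leq_eqVlt => /orP[/eqP jn|jn].
    have -> : j = Ordinal n3 by apply: val_inj.
    by apply: anb_le Gb => //; [apply: le_ball; rewrite ge_min lexx orbT|lra|lra|lra].
  by apply: anb_le (Fb _ jn) => //; [apply: le_ball; rewrite ge_min lexx|lra|lra|lra].
by have [r [C [K [r0 C0 K1 Fb]]]] := H 3; exists r, C, K; split=> // j; exact: Fb.
Qed.

(** Instances: all words, for composition with an analytic function of three
    variables; the natural numbers, for functions of one variable with explicit
    higher derivatives. *)
Lemma an_chain (T : Type) (deg : T -> nat) (nxt : 'I_3 -> T -> T) (Q : T -> E -> R)
    (F : 'I_3 -> E -> R) p (C K : R) (a : T) :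
  0 <= C -> 0 <= K ->
  (forall j b, deg (nxt j b) = (deg b).+1) -> deg a = 0 ->
  (forall j, an (F j) p) ->
  (\forall x \near p, forall b, [/\ differentiable (Q b) x,
     (forall i, partial i (Q b) x = \sum_j Q (nxt j b) x * partial i (F j) x) &
     `|Q b x| <= C * K ^+ deg b * (deg b)`!%:R]) ->
  an (Q a) p.
Proof.
move=> C0 K0 dn a0 Fa /nbhs_ballP[r1 /= r10 Qr].
have [r [C' [L [r0 C'0 L1 Fb]]]] := anb_common3 Fa.
set s := Num.min r r1.
have sr : ball p s `<=` ball p r by apply: le_ball; rewrite ge_min lexx.
have sr1 : ball p s `<=` ball p r1 by apply: le_ball; rewrite ge_min lexx orbT.
have KCL : 0 <= 12 * K * C' * L by rewrite !mulr_ge0 //; lra.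
exists s, C, (2 * L + 12 * K * C' * L); split=> //; first by rewrite lt_min r0.
  by lra.
move=> n.
have := @chain_bnd T deg nxt Q F (ball p s) C K C' L (ball_open _ _) C0 K0 C'0 L1 dn
  (fun b x xs => let: And3 d _ _ := Qr x (sr1 x xs) b in d)
  (fun b i x xs => let: And3 _ d _ := Qr x (sr1 x xs) b in d i)
  (fun b x xs => let: And3 _ _ d := Qr x (sr1 x xs) b in d) _ n a.
move=> /(_ _)/bnd_le; apply.
  by move=> k _; rewrite a0 addn0 expr0 mulr1.
by move=> j; apply: anb_le (Fb j) => //; lra.
Qed.

Lemma near_forall3 (P : 'I_3 -> E -> Prop) p : (forall j, \forall x \near p, P j x) ->
  \forall x \near p, forall j, P j x.
Proof.
by move=> H; exact: (@filter_forall _ _ _ _ _ H).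
Qed.

Lemma is_derive_exprV (k : nat) (t : R) : t != 0 ->
  is_derive t 1 (fun s : R => s ^- k) (- k%:R * t ^- k.+1).
Proof.
move=> t0; have tk : t ^+ k != 0 by rewrite expf_neq0.
apply: DeriveDef; first by apply: derivableV => //; exact: exprn_derivable.
rewrite deriveV //; last exact: exprn_derivable.
rewrite exp_derive /GRing.scale /= mulr1; case: k tk => [|k] tk.
  by rewrite mulr0n mul0r mulr0 oppr0 mul0r.
rewrite /= !exprS; rewrite exprS mulf_eq0 negb_or t0 /= in tk.
by field; rewrite t0 tk.
Qed.

Lemma an_comp G (Phi : E -> E) p : (forall j, an (fun y => Phi y ord0 j) p) ->
  an G (Phi p) -> an (fun y => G (Phi y)) p.
Proof.
move=> Pa [r [C [K [r0 C0 K1 Gb]]]].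
have Pc : {for p, continuous Phi}.
  by apply: differentiable_continuous; apply: differentiable_rV => j; exact: an_diff.
have PV : \forall x \near p, ball (Phi p) r (Phi x).
  by apply: Pc; exact: nbhsx_ballx.
have Pn : \forall x \near p, forall j, differentiable (fun y => Phi y ord0 j) x.
  have H j : \forall x \near p, differentiable (fun y => Phi y ord0 j) x.
    by have := an_nbhs (Pa j); apply: filterS => x; exact: an_diff.
  exact: near_forall3 H.
apply: (@an_chain _ size (fun j w => j :: w) (fun w y => iter_partial w G (Phi y))
   (fun j y => Phi y ord0 j) p C K [::]) => //; first lra.
near=> x => w.
have Px : ball (Phi p) r (Phi x) by near: x.
have Pdx : forall j, differentiable (fun y => Phi y ord0 j) x by near: x.
have [Gd GB] := Gb _ w _ (leqnn _) Px.
by split=> // [|i]; [exact: differentiable_comprV|rewrite partial_comprV].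
Unshelve. all: by end_near. Qed.

Lemma an_comp1 (g : nat -> R -> R) F p (C K : R) : 0 <= C -> 0 <= K ->
  (\forall t \near F p, forall k, is_derive (t : R) 1 (g k) (g k.+1 t) /\
     `|g k t| <= C * K ^+ k * k`!%:R) ->
  an F p -> an (fun y => g 0%N (F y)) p.
Proof.
move=> C0 K0 gF Fa.
have Fc : {for p, continuous F} by apply: differentiable_continuous; exact: an_diff.
have gn := Fc _ gF; have Fn := an_nbhs Fa.
apply: (@an_chain _ id (fun _ => S) (fun k y => g k (F y))
   (fun j y => if j == ord0 then F y else 0) p C K 0%N) => //.
  by move=> j; case: (j == ord0) => //; exact: an_cst.
near=> x => k.
have : an F x by near: x.
move=> /an_diff Fd.
have [gd gb] : is_derive (F x) 1 (g k) (g k.+1 (F x)) /\ `|g k (F x)| <= C * K ^+ k * k`!%:R.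
  by move: (k); near: x.
split=> //; first by apply: differentiable_comp1 => //; exact: ex_derive.
move=> i; rewrite partial_comp1 //.
rewrite derive1E derive_val !big_ord_recl big_ord0 /=.
by rewrite !partial_cst !mulr0 !addr0.
Unshelve. all: by end_near. Qed.

Lemma anN F p : an F p -> an (fun y => - F y) p.
Proof.
move=> Fa; apply: an_near (anM (an_cst (-1) p) Fa).
by near=> y; rewrite mulN1r.
Unshelve. all: by end_near. Qed.

Lemma anB F G p : an F p -> an G p -> an (fun y => F y - G y) p.
Proof. by move=> Fa Ga; apply: anD Fa (anN Ga). Qed.

Lemma an_sum (I : Type) (r : seq I) (P : pred I) (F : I -> E -> R) p :
  (forall k, P k -> an (F k) p) -> an (fun y => \sum_(k <- r | P k) F k y) p.
Proof.
move=> Fa; elim: r => [|k r IH].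
  by apply: an_near (an_cst 0 p); near=> y; rewrite big_nil.
case: (boolP (P k)) => Pk.
  by apply: an_near (anD (Fa k Pk) IH); near=> y; rewrite big_cons Pk.
by apply: an_near IH; near=> y; rewrite big_cons (negPf Pk).
Unshelve. all: by end_near. Qed.

Lemma anX F p n : an F p -> an (fun y => F y ^+ n) p.
Proof.
move=> Fa; elim: n => [|n IH].
  by apply: an_near (an_cst 1 p); near=> y; rewrite expr0.
by apply: an_near (anM Fa IH); near=> y; rewrite exprS.
Unshelve. all: by end_near. Qed.

Lemma anV F p : F p != 0 -> an F p -> an (fun y => (F y)^-1) p.
Proof.
move=> F0 Fa.
have a0 : 0 < `|F p| by rewrite normr_gt0.
(* the successive derivatives of the inverse *)
pose g k (t : R) := (-1) ^+ k * k`!%:R * t ^- k.+1.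
apply: (@an_near _ (fun y => g 0%N (F y))).
  by near=> y; rewrite /g !mul1r expr1.
apply: (@an_comp1 g F p (2 / `|F p|) (2 / `|F p|)) => //; [by rewrite divr_ge0..|].
near=> t => k.
have td : `|F p - t| < `|F p| / 2 by near: t; apply: nbhsx_ballx => /=; lra.
have tn : `|F p| / 2 <= `|t|.
  have := ler_distD t (F p) 0; rewrite !subr0; lra.
have t0 : t != 0 by rewrite -normr_gt0; lra.
split.
  have dg := @is_deriveZ _ _ _ (fun t : R => t ^- k.+1) ((-1) ^+ k * k`!%:R) t 1 _
    (is_derive_exprV k.+1 t0).
  have -> : g k = ((-1) ^+ k * k`!%:R) \*: (fun t : R => t ^- k.+1) by apply/funext.
  apply: is_derive_eq dg _.
  by rewrite /g /GRing.scale /= factS natrM (exprS (-1)); ring.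
rewrite /g !normrM normrX normrN1 expr1n mul1r normr_nat mulrC.
apply: ler_wpM2r => //; rewrite normfV normrX -exprS -[2 / _]invf_div -exprVn.
by apply: lerXn2r; rewrite ?nnegrE ?invr_ge0 ?divr_ge0 //; rewrite lef_pV2 ?posrE //; lra.
Unshelve. all: by end_near. Qed.

Lemma an_sin F p : an F p -> an (fun y => sin (F y)) p.
Proof.
move=> Fa; pose g k (t : R) := sin (t + k%:R * (pi / 2)).
apply: (@an_near _ (fun y => g 0%N (F y))).
  by near=> y; rewrite /g mul0r addr0.
apply: (@an_comp1 g F p 1 1) => //; near=> t => k; split.
  have -> : g k.+1 t = cos (t + k%:R * (pi / 2)).
    by rewrite /g -natr1 mulrDl mul1r addrA sinDpihalf.
  rewrite -[cos _]mulr1 -[g k]/(sin \o (fun t => t + k%:R * (pi / 2))).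
  have d1 : is_derive t 1 (fun t : R => t + k%:R * (pi / 2)) 1 := is_derive_shift _ _ _.
  exact: is_derive1_comp.
rewrite expr1n !mul1r; apply: le_trans (_ : 1 <= _).
  by rewrite ler_norml sin_geN1 sin_le1.
by rewrite ler1n fact_gt0.
Unshelve. all: by end_near. Qed.

Lemma an_cos F p : an F p -> an (fun y => cos (F y)) p.
Proof.
move=> Fa; apply: an_near (an_sin (anD Fa (an_cst (pi / 2) p))).
by near=> y; rewrite sinDpihalf.
Unshelve. all: by end_near. Qed.

Lemma an_sqrt F p : 0 < F p -> an F p -> an (fun y => Num.sqrt (F y)) p.
Proof.
move=> F0 Fa.
(* the k-th derivative of the square root is c_k times t^(1/2 - k) *)
pose c := fix c k : R := if k is k'.+1 then c k' * (2^-1 - k'%:R) else 1.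
have cb k : `|c k| <= k`!%:R.
  elim: k => [|k IH] /=; first by rewrite normr1.
  rewrite normrM factS mulnC natrM; apply: ler_pM => //.
  by rewrite ler_norml; have : 0 <= k%:R :> R by []; rewrite -natr1; lra.
pose g k (t : R) := c k * (Num.sqrt t * t ^- k).
apply: (@an_near _ (fun y => g 0%N (F y))).
  by near=> y; rewrite /g /= expr0 invr1 mulr1 mul1r.
apply: (@an_comp1 g F p (Num.sqrt (2 * F p)) (2 / F p)) => //.
  by rewrite divr_ge0 // ltW.
near=> t => k.
have td : `|F p - t| < F p / 2 by near: t; apply: nbhsx_ballx => /=; lra.
have [t1 t2] : F p / 2 < t /\ t < 2 * F p by move: td; rewrite ltr_norml; lra.
have t0 : 0 < t by lra.
have s0 : 0 < Num.sqrt t by rewrite sqrtr_gt0.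
have tk : t ^+ k != 0 by rewrite expf_neq0 // gt_eqF.
split.
  have ds : is_derive t 1 (@Num.sqrt R) ((2 * Num.sqrt t)^-1) by exact: is_derive1_sqrt.
  have dk := is_derive_exprV k (lt0r_neq0 t0).
  have dg := @is_deriveZ _ _ _ _ (c k) t 1 _ (@is_deriveM _ _ (@Num.sqrt R) _ t 1 _ _ ds dk).
  have -> : g k = c k \*: (@Num.sqrt R * (fun t : R => t ^- k)) by apply/funext.
  apply: is_derive_eq dg _.
  rewrite /g /GRing.scale /= exprS.
  have e : t = Num.sqrt t * Num.sqrt t by rewrite -expr2 sqr_sqrtr // ltW.
  move: tk; move: (t ^+ k) => T T0.
  move: e s0; move: (Num.sqrt t) => s e s0; rewrite e; field.
  by rewrite T0 gt_eqF.
rewrite /g normrM [leLHS]mulrC; apply: ler_pM => //.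
rewrite normrM (ger0_norm (ltW s0)); apply: ler_pM => //.
  by rewrite ler_sqrt; lra.
rewrite normfV normrX gtr0_norm // -exprVn; apply: lerXn2r; rewrite ?nnegrE ?invr_ge0 ?divr_ge0 //; try lra.
by rewrite -[2 / _]invf_div lef_pV2 ?posrE //; lra.
Unshelve. all: by end_near. Qed.

End Composition.

(** * Taylor expansion and the identity theorem *)

Section Taylor.
Context {R : realType}.
Local Notation E := 'rV[R]_3.
Implicit Types (F G : E -> R) (x p h : E) (i j : 'I_3) (w v : seq 'I_3) (V : set E)
  (A B : nat -> R).

Lemma ball_seg p (r : R) x h (t : R) : ball p r x -> ball p r (x + h) -> 0 <= t <= 1 ->
  ball p r (x + t *: h).
Proof.
rewrite -!ball_normE /= => b1 b2 /andP[t0 t1].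
have -> : p - (x + t *: h) = (1 - t) *: (p - x) + t *: (p - (x + h)).
  by apply/rowP => i; rewrite !mxE; ring.
apply: le_lt_trans (ler_normD _ _) _; rewrite !normrZ !ger0_norm; [|lra..].
set a := `|_| in b1 *; set b := `|_| in b2 *.
case: (eqVneq t 0) => [->|tn0]; first by rewrite subr0 mul1r mul0r addr0.
have : 0 < t by rewrite lt_neqAle eq_sym tn0.
nra.
Qed.

Lemma mvt_seg F x h : (forall t : R, 0 <= t <= 1 -> differentiable F (x + t *: h)) ->
  exists2 t : R, 0 <= t <= 1 &
    F (x + h) - F x = linform (fun i => partial i F (x + t *: h)) h.
Proof.
move=> Fd; pose g (s : R) := F (x + s *: h).
have gd (s : R) : 0 <= s <= 1 -> is_derive s 1 g (linform (fun i => partial i F (x + s *: h)) h).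
  by move=> s01; apply: derive_line; exact: Fd.
have [||c c01] := @MVT_segment R g (fun s => linform (fun i => partial i F (x + s *: h)) h) 0 1 ler01.
- by move=> s; rewrite in_itv /= => /andP[s0 s1]; apply: gd; rewrite !ltW.
- apply: derivable_within_continuous => s; rewrite in_itv /= => s01.
  by have [] := gd s s01.
rewrite /g scale1r scale0r addr0 subr0 mulr1 => e.
by exists c => //; move: c01; rewrite in_itv.
Qed.

Lemma lip_ball F p (r : R) (B : R) x h : 
  (forall y, ball p r y -> differentiable F y) ->
  (forall y i, ball p r y -> `|partial i F y| <= B) ->
  ball p r x -> ball p r (x + h) -> `|F (x + h) - F x| <= 3 * B * `|h|.
Proof.
move=> Fd FB bx bh.
have [t|t t01 ->] := @mvt_seg F x h; first by move=> t01; exact/Fd/ball_seg.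
apply: le_trans (linform_le _ _) _; apply: ler_wpM2r => //.
apply: le_trans (_ : \sum_(i < 3) B <= _).
  by apply: ler_sum => i _; apply: FB; exact: ball_seg.
by rewrite sumr_const card_ord mulr_natl.
Qed.

Lemma taylor2 F p (r : R) A x h : bnd 2%N (ball p r) F A -> ball p r x -> ball p r (x + h) ->
  `|F (x + h) - F x - linform (fun i => partial i F x) h| <= 9 * A 2%N * `|h| ^+ 2.
Proof.
move=> Fb bx bh.
have [t|t t01 ->] := @mvt_seg F x h.
  by move=> t01; have [] := Fb [::] (x + t *: h) isT (ball_seg bx bh t01).
rewrite /linform -sumrB.
under eq_bigr => i _ do rewrite -mulrBr.
apply: le_trans (ler_norm_sum _ _ _) _.
have H i : `|h ord0 i * (partial i F (x + t *: h) - partial i F x)| <= 3 * A 2%N * `|h| ^+ 2.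
  rewrite normrM mulrC expr2 mulrA; apply: ler_pM => //; last exact: norm_coord.
  apply: le_trans (_ : 3 * A 2%N * `|t *: h| <= _).
    apply: (lip_ball (B := A 2%N) _ _ bx); first by move=> y /(Fb [:: i] y isT)[].
      by move=> y j /(Fb [:: j; i] y isT)[].
    exact: (ball_seg bx bh t01).
  have : 0 <= A 2%N by have [_] := Fb [:: i; i] x isT bx; exact: le_trans.
  case/andP: t01 => t0 t1 A0; rewrite normrZ ger0_norm //.
  by apply: ler_wpM2l; [rewrite mulr_ge0|rewrite ler_piMl].
apply: le_trans (ler_sum _ (fun i _ => H i)) _.
by rewrite sumr_const card_ord -mulr_natl; lra.
Qed.

(** The second difference of F with steps t e_i and t e_j is symmetric in i and
    j, and divided by t^2 it differs from either mixed derivative by O(t). *)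
Lemma an_partialC i j F x : an F x -> partial i (partial j F) x = partial j (partial i F) x.
Proof.
move=> [r [C [K [r0 C0 K1 Fb]]]].
pose e k : E := delta_mx ord0 k.
have en k : `|e k| <= 1.
  by apply: norm_le_coord => // l; rewrite mxE eqxx /=; case: (l == k); rewrite ?normr1 ?normr0.
pose D (t : R) k l := F (x + t *: e k + t *: e l) - F (x + t *: e k) - (F (x + t *: e l) - F x).
set M : R := 100 * (C * K ^+ 3 * 3`!%:R).
have M0 : 0 <= C * K ^+ 3 * 3`!%:R by rewrite !mulr_ge0 // ?exprn_ge0 //; lra.
have inb (s t : R) k l : 0 <= s < r / 2 -> 0 <= t < r / 2 -> ball x r (x + (s *: e k + t *: e l)).
  move=> /andP[s0 s1] /andP[t0 t1]; rewrite -ball_normE /= opprD addrA subrr sub0r normrN.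
  apply: le_lt_trans (ler_normD _ _) _; rewrite !normrZ !ger0_norm //.
  have := en k; have := en l; nra.
have Pe k (y : E) : linform (fun i => partial i F y) (e k) = partial k F y.
  rewrite /linform (bigD1 k) //= big1 ?addr0; first by rewrite mxE !eqxx mul1r.
  by move=> m /negPf mk; rewrite mxE eqxx /= mk mul0r.
have lin2 (a : 'I_3 -> R) (s t : R) k l : linform a (s *: e k + t *: e l) = s * a k + t * a l.
  rewrite linearP /= linearZ /=; congr (_ * _ + _ * _).
    rewrite /linform (bigD1 k) //= big1 ?addr0; first by rewrite mxE !eqxx mul1r.
    by move=> m /negPf mk; rewrite mxE eqxx /= mk mul0r.
  rewrite /linform (bigD1 l) //= big1 ?addr0; first by rewrite mxE !eqxx mul1r.
  by move=> m /negPf mk; rewrite mxE eqxx /= mk mul0r.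
have H k l (t : R) : 0 < t < r / 2 -> `|D t k l - t ^+ 2 * partial l (partial k F) x| <= M * t ^+ 3.
  move=> /andP[t0 tr].
  pose g (y : E) := F (y + t *: e l) - F y.
  have Fd y : ball x r y -> differentiable F y by move=> /(Fb 0%N [::] y isT)[].
  have gd (s : R) : 0 <= s <= 1 -> is_derive s 1 (fun s : R => F (x + t *: e l + s *: (t *: e k)) - F (x + s *: (t *: e k)))
     (t * (partial k F (x + t *: e l + (s * t) *: e k) - partial k F (x + (s * t) *: e k))).
    move=> /andP[s0 s1].
    have st : 0 <= s * t < r / 2 by apply/andP; split; nra.
    have t' : 0 <= t < r / 2 by lra.
    have z' : 0 <= (0 : R) < r / 2 by lra.
    rewrite mulrBr; apply: is_deriveB.
      have -> : t * partial k F (x + t *: e l + (s * t) *: e k) =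
          linform (fun i => partial i F (x + t *: e l + s *: (t *: e k))) (t *: e k).
        by rewrite scalerA linearZ /= Pe.
      by apply: derive_line; apply: Fd; rewrite scalerA -addrA; exact: inb.
    have -> : t * partial k F (x + (s * t) *: e k) =
        linform (fun i => partial i F (x + s *: (t *: e k))) (t *: e k).
      by rewrite scalerA linearZ /= Pe.
    by apply: derive_line; apply: Fd; have := inb _ _ k k st z'; rewrite scalerA scale0r addr0.
  have [||c c01] := @MVT_segment R
     (fun s : R => F (x + t *: e l + s *: (t *: e k)) - F (x + s *: (t *: e k)))
     (fun s => t * (partial k F (x + t *: e l + (s * t) *: e k) - partial k F (x + (s * t) *: e k)))
     0 1 ler01.
  - by move=> s; rewrite in_itv /= => /andP[? ?]; apply: gd; rewrite !ltW.
  - apply: derivable_within_continuous => s; rewrite in_itv /= => s01.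
    by have [] := gd s s01.
  rewrite !scale1r !scale0r !addr0 subr0 mulr1 => De.
  have -> : D t k l = t * (partial k F (x + t *: e l + (c * t) *: e k) - partial k F (x + (c * t) *: e k)).
    by rewrite -De /D [x + _ + _]addrAC; ring.
  move: c01; rewrite in_itv /= => /andP[c0 c1].
  have st : 0 <= c * t < r / 2 by apply/andP; split; nra.
  have t' : 0 <= t < r / 2 by lra.
  have z' : 0 <= (0 : R) < r / 2 by lra.
  have Gb : bnd 2%N (ball x r) (partial k F) (fun m => C * K ^+ m.+1 * m.+1`!%:R).
    exact: (bnd_shift k (Fb 3%N)).
  have bx : ball x r x by exact: ballxx.
  have T1 := taylor2 Gb bx (inb t (c * t) l k t' st).
  have T2 := taylor2 Gb bx (inb (c * t) 0 k k st z').
  rewrite (lin2 (fun i0 => partial i0 (partial k F) x) t (c * t) l k) in T1.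
  rewrite (lin2 (fun i0 => partial i0 (partial k F) x) (c * t) 0 k k) mul0r addr0 in T2.
  have y1E : x + (t *: e l + (c * t) *: e k) = x + t *: e l + (c * t) *: e k by rewrite addrA.
  have y2E : (c * t) *: e k + 0 *: e k = (c * t) *: e k by rewrite scale0r addr0.
  rewrite y1E in T1; rewrite y2E in T2; move: T2 T1.
  have nb (s s' : R) m n : 0 <= s <= t -> 0 <= s' <= t -> `|s *: e m + s' *: e n| ^+ 2 <= 4 * t ^+ 2.
    move=> /andP[s0 s1] /andP[s'0 s'1]; rewrite (_ : 4 * t ^+ 2 = (2 * t) ^+ 2); last by ring.
    have z1 : `|s *: e m + s' *: e n| <= 2 * t.
      apply: le_trans (ler_normD _ _) _; rewrite !normrZ !ger0_norm //.
      have := en m; have := en n; nra.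
    by apply: lerXn2r => //; rewrite nnegrE //; lra.
  have ct : 0 <= c * t <= t by apply/andP; split; nra.
  have tt : 0 <= t <= t by lra.
  have zt : 0 <= (0 : R) <= t by lra.
  have n1 := nb _ _ l k tt ct.
  have n2 := nb _ _ k k ct zt; rewrite scale0r addr0 in n2.
  move: M0 @M n1 n2; set A := C * K ^+ 3 * 3`!%:R => A0 M n1 n2.
  set b := partial k F _; set a := partial k F _; set d := partial k F _.
  set u := partial l _ _; set v := partial k _ _ => h1 h2.
  have h1' : `|b - a - c * t * v| <= 36 * A * t ^+ 2.
    by apply: le_trans h1 _; nra.
  have h2' : `|d - a - (t * u + c * t * v)| <= 36 * A * t ^+ 2.
    by apply: le_trans h2 _; nra.
  have -> : t * (d - b) - t ^+ 2 * u =
    t * ((d - a - (t * u + c * t * v)) - (b - a - c * t * v)) by ring.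
  rewrite normrM gtr0_norm //.
  have := ler_normB (d - a - (t * u + c * t * v)) (b - a - c * t * v).
  move: (`|_ - _|) => z hz.
  have hz2 : z <= 72 * A * t ^+ 2 by lra.
  have A3 : 0 <= A * t ^+ 3 by rewrite mulr_ge0 // exprn_ge0 // ltW.
  have := ler_wpM2l (ltW t0) hz2; rewrite exprS in A3 *; rewrite /M; lra.
have M1 : 0 <= M by rewrite /M; lra.
clearbody M.
have DC (t : R) : D t i j = D t j i by rewrite /D [x + _ + _]addrAC; ring.
clearbody D.
have key (t : R) : 0 < t < r / 2 ->
    `|partial i (partial j F) x - partial j (partial i F) x| <= 2 * M * t.
  move=> t0; have h1 := H i j t t0; have h2 := H j i t t0.
  rewrite DC in h1; case/andP: t0 => t0 _.
  rewrite -(ler_pM2l (exprn_gt0 2 t0)) -[t ^+ 2 in leLHS]gtr0_norm ?exprn_gt0 // -normrM.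
  have := ler_normB (D t j i - t ^+ 2 * partial j (partial i F) x) (D t j i - t ^+ 2 * partial i (partial j F) x).
  rewrite opprB addrC addrA subrK -mulrBr.
  have -> : t ^+ 2 * (2 * M * t) = M * t ^+ 3 + M * t ^+ 3 by ring.
  by move=> h; exact: (le_trans h (lerD h1 h2)).
clear H.
apply/eqP; rewrite -subr_eq0 -normr_le0 leNgt; apply/negP.
set z := `|_| in key * => z0.
pose t := Num.min (r / 4) (z / (4 * M + 1)).
have M4 : 0 < 4 * M + 1 by lra.
have t0 : 0 < t by rewrite lt_min !divr_gt0.
have tr : t < r / 2 by apply: le_lt_trans (_ : r / 4 < _); [rewrite /t ge_min lexx|lra].
have tz : t <= z / (4 * M + 1) by rewrite /t ge_min lexx orbT.
have := key t; rewrite t0 tr => /(_ isT).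
rewrite ler_pdivlMr // in tz.
nra.
Qed.

Lemma dominated_zero (g dg G dG : R -> R) :
  (forall t : R, 0 <= t <= 1 -> is_derive t 1 g (dg t)) ->
  (forall t : R, 0 <= t <= 1 -> is_derive t 1 G (dG t)) ->
  (forall t, 0 <= t <= 1 -> `|dg t| <= dG t) -> g 0 = 0 -> G 0 = 0 ->
  forall t, 0 <= t <= 1 -> `|g t| <= G t.
Proof.
move=> gd Gd gG g0 G0 t /andP[t0 t1].
have main (f df : R -> R) : (forall t : R, 0 <= t <= 1 -> is_derive t 1 f (df t)) ->
    (forall t, 0 <= t <= 1 -> 0 <= df t) -> f 0 = 0 -> 0 <= f t.
  move=> fd df0 f0.
  have [||c] := @MVT_segment R f df 0 t t0.
  - move=> s; rewrite in_itv /= => /andP[s0 s1]; apply: fd; lra.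
  - apply: derivable_within_continuous => s; rewrite in_itv /= => /andP[s0 s1].
    by have [|] := fd s; first lra.
  rewrite in_itv /= => /andP[c0 c1]; rewrite f0 !subr0 => ->.
  by apply: mulr_ge0 => //; apply: df0; lra.
rewrite ler_norml; apply/andP; split.
  rewrite lerNl -subr_ge0 opprK.
  apply: (main (fun t : R => G t + g t) (fun t => dG t + dg t)).
  - by move=> s s01; apply: is_deriveD; [exact: Gd|exact: gd].
  - move=> s s01; have := gG s s01; rewrite ler_norml; lra.
  - by rewrite g0 G0 addr0.
rewrite -subr_ge0.
apply: (main (fun t : R => G t - g t) (fun t => dG t - dg t)).
- by move=> s s01; apply: is_deriveB; [exact: Gd|exact: gd].
- move=> s s01; have := gG s s01; rewrite ler_norml; lra.
- by rewrite g0 G0 subr0.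
Qed.

Lemma is_derive_powfact (c : R) n (t : R) :
  is_derive t 1 (fun s : R => c * s ^+ n.+1 / n.+1`!%:R) (c * t ^+ n / n`!%:R).
Proof.
have -> : (fun s : R => c * s ^+ n.+1 / n.+1`!%:R) = (c / n.+1`!%:R) \*: (@GRing.exp R ^~ n.+1).
  by apply/funext => s; rewrite /= /GRing.scale /=; ring.
apply: DeriveDef; first by apply: derivableZ; exact: exprn_derivable.
rewrite deriveZ; last exact: exprn_derivable.
rewrite exp_derive /GRing.scale /= mulr1 factS natrM; field.
by rewrite pnatr_eq0 -lt0n fact_gt0 /= addrC natr1 pnatr_eq0.
Qed.

(** The remainder is dominated, derivative by derivative, by B t^N / N!. *)
Lemma taylor1 N (phi : nat -> R -> R) (B : R) :
  (forall k (t : R), 0 <= t <= 1 -> is_derive t 1 (phi k) (phi k.+1 t)) ->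
  (forall t, 0 <= t <= 1 -> `|phi N t| <= B) ->
  forall t, 0 <= t <= 1 ->
    `|phi 0%N t - \sum_(k < N) phi k 0 * t ^+ k / k`!%:R| <= B * t ^+ N / N`!%:R.
Proof.
elim: N phi => [|N IH] phi dphi hB t t01.
  by rewrite big_ord0 subr0 expr0 mulr1 divr1; exact: hB.
apply: (dominated_zero (g := fun t => phi 0%N t - \sum_(k < N.+1) phi k 0 * t ^+ k / k`!%:R)
  (dg := fun t => phi 1%N t - \sum_(k < N) phi k.+1 0 * t ^+ k / k`!%:R)
  (G := fun t => B * t ^+ N.+1 / N.+1`!%:R) (dG := fun t => B * t ^+ N / N`!%:R)) t01.
- move=> s s01; apply: is_deriveB; first exact: dphi.
  have -> : (fun t : R => \sum_(k < N.+1) phi k 0 * t ^+ k / k`!%:R) =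
    cst (phi 0%N 0) + \sum_(k < N) (fun t : R => phi k.+1 0 * t ^+ k.+1 / k.+1`!%:R).
    apply/funext => u; rewrite big_ord_recl expr0 mulr1 divr1 !fctE fct_sumE; congr (_ + _).
  rewrite -[X in is_derive _ _ _ X]add0r; apply: is_deriveD.
  by apply: is_derive_sum => k; exact: is_derive_powfact.
- by move=> s _; exact: is_derive_powfact.
- by move=> s s01; apply: (IH (fun k => phi k.+1)).
- rewrite big_ord_recl expr0 mulr1 divr1 big1 ?addr0 ?subrr // => k _.
  by rewrite lift0 expr0n mulr0 mul0r.
- by rewrite expr0n mulr0 mul0r.
Qed.

(** Taylor polynomials are written as sums over words, not over multi-indices:
    differentiation along a line then prepends a letter, and the multinomial
    coefficients are implicit in the number of words. *)
Fixpoint words n : seq (seq 'I_3) :=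
  if n is n'.+1 then [seq i :: w | i <- enum 'I_3, w <- words n'] else [:: [::]].

Lemma size_words n w : w \in words n -> size w = n.
Proof.
elim: n w => [|n IH] w /=; first by rewrite inE => /eqP ->.
by move=> /allpairsP[[i v] /= [_ /IH vn ->]] /=; rewrite vn.
Qed.

Lemma big_words n (f : seq 'I_3 -> R) :
  \sum_(w <- words n.+1) f w = \sum_(i < 3) \sum_(w <- words n) f (i :: w).
Proof. by rewrite /= big_allpairs_dep big_enum. Qed.

Definition vpow (h : E) w : R := \prod_(i <- w) h ord0 i.

Lemma vpow_le h w : `|vpow h w| <= `|h| ^+ size w.
Proof.
rewrite /vpow; elim: w => [|i w IH]; first by rewrite big_nil normr1.
by rewrite big_cons normrM exprS; apply: ler_pM => //; exact: norm_coord.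
Qed.

Lemma sum_words_le n (f : seq 'I_3 -> R) (c : R) :
  (forall w, size w = n -> f w <= c) -> \sum_(w <- words n) f w <= 3 ^+ n * c.
Proof.
elim: n f => [|n IH] f fc; first by rewrite big_seq1 expr0 mul1r; exact: fc.
rewrite big_words exprS -mulrA.
have <- : \sum_(i < 3) 3 ^+ n * c = 3 * (3 ^+ n * c) by rewrite sumr_const card_ord mulr_natl.
by apply: ler_sum => i _; apply: IH => w wn; apply: fc; rewrite /= wn.
Qed.

(** The restriction of F to the segment from p to p + h is a function of one
    variable whose k-th derivative is the sum over words of length k; there are
    3^k of them. *)
Lemma taylor F p (r C K : R) h N : anb (ball p r) F C K -> ball p r (p + h) ->
  `|F (p + h) - \sum_(k < N) (\sum_(w <- words k) vpow h w * iter_partial w F p) / k`!%:R|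
    <= C * (3 * K * `|h|) ^+ N.
Proof.
move=> Fb bh.
have r0 : 0 < r by move: bh; rewrite -ball_normE /=; apply: le_lt_trans.
have bt (t : R) : 0 <= t <= 1 -> ball p r (p + t *: h).
  by apply: ball_seg => //; exact: ballxx.
pose phi k (t : R) := \sum_(w <- words k) vpow h w * iter_partial w F (p + t *: h).
have C0 : 0 <= C.
  by have [_] := Fb 0%N [::] p isT (ballxx p r0); rewrite expr0 !mulr1; exact: le_trans.
have := @taylor1 N phi (N`!%:R * (C * (3 * `|h| * K) ^+ N)).
move=> /(_ _ _ 1).
rewrite lexx ler01 expr1n mulr1 /phi big_seq1 /vpow big_nil mul1r scale1r /=.
under eq_bigr => k _ do rewrite expr1n mulr1.
under eq_bigr => k _ do under eq_bigr => w _ do rewrite scale0r addr0.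
have N0 : N`!%:R != 0 :> R by rewrite pnatr_eq0 -lt0n fact_gt0.
rewrite [N`!%:R * _ / _]mulrAC divff // mul1r (mulrAC 3); apply=> //.
- move=> k t t01.
  have -> : \sum_(w <- words k.+1) (\prod_(i <- w) h ord0 i) * iter_partial w F (p + t *: h) =
    \sum_(w <- words k) vpow h w * linform (fun i => partial i (iter_partial w F) (p + t *: h)) h.
    rewrite big_words exchange_big /=; apply: eq_bigr => w _.
    rewrite mulr_sumr; apply: eq_bigr => i _; rewrite big_cons /vpow; ring.
  have D w : is_derive t 1 (fun t : R => vpow h w * iter_partial w F (p + t *: h))
     (vpow h w * linform (fun i => partial i (iter_partial w F) (p + t *: h)) h).
    have Fd : differentiable (iter_partial w F) (p + t *: h).
      by have [] := Fb (size w) w _ (leqnn _) (bt t t01).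
    exact: (@is_deriveZ _ _ _ _ (vpow h w) t 1 _ (derive_line Fd)).
  have Dl l : is_derive t 1 (fun t : R => \sum_(w <- l) vpow h w * iter_partial w F (p + t *: h))
     (\sum_(w <- l) vpow h w * linform (fun i => partial i (iter_partial w F) (p + t *: h)) h).
    elim: l => [|w l IHl].
      have -> : (fun t : R => \sum_(w <- [::]) vpow h w * iter_partial w F (p + t *: h)) = cst 0.
        by apply/funext => s; rewrite big_nil.
      by rewrite big_nil; exact: is_derive_cst.
    rewrite big_cons.
    have -> : (fun t : R => \sum_(w <- w :: l) vpow h w * iter_partial w F (p + t *: h)) =
      (fun t : R => vpow h w * iter_partial w F (p + t *: h)) +
      (fun t : R => \sum_(w <- l) vpow h w * iter_partial w F (p + t *: h)).
      by apply/funext => s; rewrite big_cons.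
    exact: is_deriveD.
  exact: Dl.
- move=> t t01; apply: le_trans (ler_norm_sum _ _ _) _.
  have -> : N`!%:R * (C * (3 * K * `|h|) ^+ N) = 3 ^+ N * (`|h| ^+ N * (C * K ^+ N * N`!%:R)).
    by rewrite !exprMn; ring.
  apply: sum_words_le => w wN; rewrite normrM -wN; apply: ler_pM => //; first exact: vpow_le.
  by have [] := Fb (size w) w _ (leqnn _) (bt t t01).
Qed.

Lemma pow_small (q : R) : 0 <= q -> q < 1 -> forall e : R, 0 < e -> exists N, q ^+ N < e.
Proof.
move=> q0 q1 e e0.
have := cvg_geometric 1 (_ : `|q| < 1); rewrite ger0_norm // => /(_ q1).
move=> /cvgrPdist_lt/(_ e e0) [N _ /(_ N (leqnn _))] /=.
rewrite sub0r normrN mul1r ger0_norm ?exprn_ge0 // => h.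
by exists N.
Qed.

Lemma an_zero_near F p : an F p -> (forall w, iter_partial w F p = 0) ->
  \forall x \near p, F x = 0.
Proof.
move=> [r [C [K [r0 C0 K1 Fb]]]] F0.
have K0 : 0 < 3 * K by lra.
have s0 : 0 < Num.min r ((3 * K)^-1) by rewrite lt_min r0 invr_gt0.
near=> x; have bx : ball p (Num.min r ((3 * K)^-1)) x by near: x; exact: nbhsx_ballx.
move: (bx); rewrite -ball_normE /= lt_min => /andP[xr xK].
have q1 : 3 * K * `|x - p| < 1.
  by rewrite distrC mulrC -ltr_pdivlMr // mul1r.
have q0 : 0 <= 3 * K * `|x - p| by rewrite mulr_ge0 // ltW.
apply/eqP; rewrite -normr_le0 leNgt; apply/negP => Fx.
have [N] := pow_small q0 q1 (divr_gt0 Fx (ltr_wpDl C0 ltr01)).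
rewrite ltNge => /negP; apply.
have bpx : ball p r (p + (x - p)) by rewrite addrC subrK -ball_normE.
have := taylor N Fb bpx; rewrite [p + _]addrC subrK big1 ?subr0; last first.
  by move=> k _; rewrite big1 ?mul0r // => w _; rewrite F0 mulr0.
move=> h; rewrite ler_pdivrMr; last lra.
apply: le_trans h _; rewrite mulrC; apply: ler_wpM2l; last lra.
by rewrite exprn_ge0.
Unshelve. all: by end_near. Qed.

Lemma an_continuous w F p : an F p -> {for p, continuous (iter_partial w F)}.
Proof. by move=> Fa; apply: differentiable_continuous; exact: an_diff_iter. Qed.

(** The points where all derivatives of F vanish form a closed set by
    continuity, and an open one by the Taylor estimate. *)
Lemma identity_theorem (D : set E) F p : connected D -> (forall x, D x -> an F x) -> D p ->
  (\forall x \near p, F x = 0) -> forall x, D x -> \forall y \near x, F y = 0.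
Proof.
move=> Dc Fa Dp Fp.
pose Z := [set x | D x /\ forall w, iter_partial w F x = 0].
have ZE x : D x -> (\forall y \near x, F y = 0) -> Z x.
  move=> Dx Fx; split=> // w.
  have -> : iter_partial w F x = iter_partial w (fun=> 0) x.
    exact: nbhs_singleton (iter_partial_near w Fx).
  by rewrite iter_partial_cst; case: w.
suff -> : D = Z by move=> x [Dx F0]; apply: an_zero_near => //; exact: Fa.
apply/esym; apply: Dc; first by exists p; exact: ZE.
  exists [set x | \forall y \near x, F y = 0].
    by rewrite openE => x /= Fx; have /near_join := Fx.
  apply/seteqP; split=> x /=; last by move=> [Dx Fx]; exact: ZE.
  by move=> [Dx F0]; split=> //; apply: an_zero_near => //; exact: Fa.
exists (closure Z); first exact: closed_closure.
apply/seteqP; split=> x /=; first by move=> Zx; split; [case: Zx|exact: subset_closure].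
move=> [Dx cx]; split=> // w; apply/eqP; rewrite -normr_le0 leNgt; apply/negP => Fx.
have := an_continuous (w := w) (Fa x Dx) => /cvgrPdist_lt/(_ _ Fx) nx.
have [y [[_ /(_ w) y0]]] := cx _ nx.
by rewrite /= y0 subr0 ltxx.
Qed.

End Taylor.

(** * Power series and bounds on derivatives *)

Section Boxes.
Context {R : realType}.
Local Notation Idx := {ffun 'I_3 -> nat}.
Implicit Types (c : Idx -> R).

Definition natidx N (al : {ffun 'I_3 -> 'I_N}) : Idx := [ffun i => nat_of_ord (al i)].

Lemma box_restrict c N M : (N <= M)%N ->
  box_sum c N = \sum_(al : {ffun 'I_3 -> 'I_M} | [forall i, (al i < N)%N]) c (natidx al).
Proof.
case: N => [|n] NM.
  rewrite /box_sum big1 => [|al _]; last by case: (al ord0).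
  by rewrite big1 // => al /forallP/(_ ord0).
rewrite /box_sum (reindex_onto (fun al : {ffun 'I_3 -> 'I_n.+1} => [ffun i => widen_ord NM (al i)])
  (fun al => [ffun i => inord (al i)])) /=; last first.
  move=> al /forallP aln; apply/ffunP => i; rewrite !ffunE; apply: val_inj => /=.
  by rewrite inordK.
apply: eq_big => [al|al _]; last by congr c; apply/ffunP => i; rewrite !ffunE.
apply/esym/andP; split; first by apply/forallP => i; rewrite ffunE /=.
by apply/eqP/ffunP => i; rewrite !ffunE /= inord_val.
Qed.

Lemma box_mono c N M : (forall al, 0 <= c al) -> (N <= M)%N -> box_sum c N <= box_sum c M.
Proof.
move=> c0 NM; rewrite (box_restrict c NM) big_mkcond /box_sum; apply: ler_sum => al _.
by case: ifP => // _; exact: c0.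
Qed.

Lemma box_sumD c c' N : box_sum (fun al => c al + c' al) N = box_sum c N + box_sum c' N.
Proof. exact: big_split. Qed.

Lemma box_sumB c c' N : box_sum (fun al => c al - c' al) N = box_sum c N - box_sum c' N.
Proof. by rewrite /box_sum sumrB. Qed.

Lemma box_cvg_ge0 c (B : R) : (forall al, 0 <= c al) -> (forall N, box_sum c N <= B) ->
  cvgn (box_sum c).
Proof.
move=> c0 cB; apply: nondecreasing_is_cvgn; first by move=> n m; exact: box_mono.
by exists B => _ [n _ <-].
Qed.

Lemma box_cvg c (B : R) : (forall N, box_sum (fun al => `|c al|) N <= B) -> cvgn (box_sum c).
Proof.
move=> cB.
have -> : box_sum c = (fun N => box_sum (fun al => c al + `|c al|) N - box_sum (fun al => `|c al|) N).
  apply/funext => N; rewrite -box_sumB; apply: eq_bigr => al _; ring.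
apply: is_cvgB; last exact: box_cvg_ge0 cB.
apply: (@box_cvg_ge0 _ (B + B)) => [al|N].
  by have := ler_norm (- c al); rewrite normrN; lra.
rewrite box_sumD; apply: lerD => //; apply: le_trans (cB N).
by apply: ler_sum => al _; exact: ler_norm.
Qed.

Lemma box_norm_le c N : `|box_sum c N| <= box_sum (fun al => `|c al|) N.
Proof. exact: ler_norm_sum. Qed.

Lemma box_lim_le c : (forall al, 0 <= c al) -> cvgn (box_sum c) ->
  exists B, forall N, box_sum c N <= B.
Proof.
move=> c0 cc; exists (limn (box_sum c)) => N.
by apply: (nondecreasing_cvgn_le _ cc) => n m; exact: box_mono.
Qed.

End Boxes.

Section Series.
Context {R : realType}.
Local Notation E := 'rV[R]_3.
Local Notation Idx := {ffun 'I_3 -> nat}.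
Implicit Types (F G : E -> R) (x p h : E) (i j : 'I_3) (w v : seq 'I_3) (V : set E)
  (A B : nat -> R).

Lemma bndZ n V (c : R) F A : open V -> bnd n V F A -> bnd n V (fun y => c * F y) (fun k => `|c| * A k).
Proof.
move=> Vo; elim: n F A => [|n IH] F A Fb.
  have [Fd F0] := bndP Fb; apply: bnd0 => x Vx.
    by apply: differentiableZ; exact: Fd.
  by rewrite normrM ler_wpM2l // F0.
have [Fd F0] := bndP Fb; apply: bnd_step => [x Vx|x Vx|i].
- by apply: differentiableZ; exact: Fd.
- by rewrite normrM ler_wpM2l // F0.
apply: (@bnd_eq _ _ _ (fun y => c * partial i F y)) => //.
  by move=> x Vx; rewrite partialZ //; exact: Fd.
exact: (IH _ (A \o S) (bnd_shift i Fb)).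
Qed.

(** The k-th derivative of a monomial of degree d, bounded as in the Cauchy
    estimates: the left side is k! times one term of the binomial expansion of
    (rho + (sg - rho))^d, divided by (sg - rho)^k. *)
Lemma ffact_bound d k (rho sg : R) : 0 <= rho -> rho < sg ->
  (d ^_ k)%:R * rho ^+ (d - k) <= k`!%:R * (sg ^+ d / (sg - rho) ^+ k).
Proof.
move=> r0 rs; rewrite -bin_ffact natrM mulrAC mulrC; apply: ler_wpM2l => //.
have s0 : 0 < sg - rho by lra.
rewrite ler_pdivlMr ?exprn_gt0 // -mulrA.
case: (leqP k d) => kd; last by rewrite bin_small // mul0r exprn_ge0 //; lra.
have -> : sg ^+ d = (rho + (sg - rho)) ^+ d by rewrite addrC subrK.
rewrite [X in _ <= X]exprDn (bigD1 (Ordinal (kd : (k < d.+1)%N))) //=.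
rewrite mulr_natl lerDl; apply: sumr_ge0 => l _.
by rewrite mulrn_wge0 // mulr_ge0 // exprn_ge0 // ltW.
Qed.

(** For families closed under differentiation up to a scalar, such as the
    monomials, or the real and imaginary parts of the powers of x + i y. *)
Lemma family_bnd (T : Type) (deg : T -> nat) (q : T -> E -> R) (dc : 'I_3 -> T -> R)
    (pr : 'I_3 -> T -> T) V (rho sg : R) : open V -> 0 <= rho -> rho < sg ->
  (forall t x, V x -> differentiable (q t) x) ->
  (forall i t x, V x -> partial i (q t) x = dc i t * q (pr i t) x) ->
  (forall i t, `|dc i t| <= (deg t)%:R) ->
  (forall i t, dc i t != 0 -> deg (pr i t) = (deg t).-1) ->
  (forall t x, V x -> `|q t x| <= rho ^+ deg t) ->
  forall n t, bnd n V (q t) (fun k => k`!%:R * (sg ^+ deg t / (sg - rho) ^+ k)).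
Proof.
move=> Vo r0 rs qd qp dcb dpr qb n t.
apply: bnd_le (fun k _ => ffact_bound (deg t) k r0 rs) _.
elim: n t => [|n IH] t.
  by apply: bnd0 => x Vx; [exact: qd|rewrite ffactn0 mul1r subn0; exact: qb].
apply: bnd_step => [x Vx|x Vx|i]; [exact: qd|rewrite ffactn0 mul1r subn0; exact: qb|].
apply: (@bnd_eq _ _ _ (fun x => dc i t * q (pr i t) x)) => //.
  by move=> x Vx; rewrite qp.
have := bndZ (dc i t) Vo (IH (pr i t)); apply: bnd_le => k _ /=.
case: (eqVneq (dc i t) 0) => [->|d0].
  by rewrite normr0 mul0r mulr_ge0 // exprn_ge0.
rewrite (dpr _ _ d0) ffactnS natrM -mulrA; apply: ler_pM => //.
  by rewrite mulr_ge0 // exprn_ge0.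
by rewrite -subn1 -subnDA add1n.
Qed.

Lemma hasd_sq F x (a : 'I_3 -> R) (C : R) : 0 <= C ->
  (\forall h \near (0 : E), `|F (x + h) - F x - linform a h| <= C * `|h| ^+ 2) -> hasd F x a.
Proof.
move=> C0 H eps eps0.
have hn : \forall h \near (0 : E), `|h| <= eps / (C + 1).
  by apply: nbhs0_le; rewrite divr_gt0 //; lra.
near=> h; have h1 : `|h| <= eps / (C + 1) by near: h.
rewrite [h + x]addrC; apply: le_trans (_ : C * `|h| ^+ 2 <= _); first by near: h.
rewrite expr2 mulrA; apply: ler_wpM2r => //.
have C1 : 0 < C + 1 by lra.
rewrite ler_pdivlMr // in h1; have := normr_ge0 h; nra.
Unshelve. all: by end_near. Qed.

(** Term-by-term differentiation.  The uniform bound on derivatives of order two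
    makes the first-order Taylor remainders of all s_N quadratic with the same
    constant, so pointwise convergence of the derivatives is enough. *)
Lemma limit_anb (s : nat -> E -> R) p (r C K : R) : 0 < r -> 0 <= C -> 0 <= K ->
  (forall N, anb (ball p r) (s N) C K) ->
  (forall w x, ball p r x -> cvgn (fun N => iter_partial w (s N) x)) ->
  anb (ball p r) (fun x => limn (fun N => s N x)) C K /\
  forall w x, ball p r x -> iter_partial w (fun x => limn (fun N => s N x)) x =
    limn (fun N => iter_partial w (s N) x).
Proof.
move=> r0 C0 K0 sb sc.
pose L w x := limn (fun N => iter_partial w (s N) x).
have Ld w x : ball p r x -> hasd (L w) x (fun i => L (i :: w) x).
  move=> bx; pose A := C * K ^+ (size w).+2 * ((size w).+2)`!%:R.
  have A0 : 0 <= A by apply: mulr_ge0 => //; apply: mulr_ge0 => //; exact: exprn_ge0.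
  apply: (@hasd_sq _ _ _ (9 * A)); first by rewrite mulr_ge0.
  near=> h.
  have bh : ball p r (x + h).
    near: h; have : \forall y \near x, ball p r y by exact: open_nbhs_nbhs (conj (ball_open p r) bx).
    by rewrite (near_shift 0 x) subr0; apply: filterS => h /=; rewrite addrC.
  have T N : `|iter_partial w (s N) (x + h) - iter_partial w (s N) x -
      linform (fun i => iter_partial (i :: w) (s N) x) h| <= 9 * A * `|h| ^+ 2.
    apply: (@taylor2 _ _ p r (fun k => C * K ^+ (k + size w) * (k + size w)`!%:R)) => //.
    move=> v y vn vy; rewrite -iter_partial_cat -size_cat.
    by have [] := sb N _ (v ++ w) y (leqnn _) vy.
  have c : (fun N => `|iter_partial w (s N) (x + h) - iter_partial w (s N) x -
      linform (fun i => iter_partial (i :: w) (s N) x) h|) @ \oo -->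
      `|L w (x + h) - L w x - linform (fun i => L (i :: w) x) h|.
    apply: cvg_norm; apply: cvgB; first by apply: cvgB; exact: sc.
    have eL (b : 'I_3 -> R) : linform b h = h ord0 ord0 * b ord0 + (h ord0 (lift ord0 ord0) *
        b (lift ord0 ord0) + h ord0 (lift ord0 (lift ord0 ord0)) * b (lift ord0 (lift ord0 ord0))).
      by rewrite /linform !big_ord_recl big_ord0 addr0.
    rewrite eL (eq_cvg _ _ (fun N => eL _)).
    by apply: cvgD; [|apply: cvgD]; apply: cvgMl_tmp; exact: sc.
  have T' : \forall N \near \oo, `|iter_partial w (s N) (x + h) - iter_partial w (s N) x -
      linform (fun i => iter_partial (i :: w) (s N) x) h| <= 9 * A * `|h| ^+ 2.
    by near=> N; exact: T.
  rewrite -(cvg_lim _ c) //; apply: limr_le T'; exact: (cvgP _ c).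
have Lw w x : ball p r x -> iter_partial w (L [::]) x = L w x.
  elim: w x => [//|i w IH] x bx /=.
  rewrite (partial_near _ (open_near (ball_open p r) bx IH)).
  by have [_ ->] := hasd_diff (Ld w x bx).
split=> // n w x wn bx; split.
  apply: (@differentiable_near _ (L w)).
    by apply: (open_near (ball_open p r) bx) => y by_; rewrite Lw.
  by have [] := hasd_diff (Ld w x bx).
rewrite -/(L [::]) Lw //.
have c : (fun N => `|iter_partial w (s N) x|) @ \oo --> `|L w x|.
  by apply: cvg_norm; exact: sc.
rewrite -(cvg_lim _ c) //; apply: limr_le; first exact: (cvgP _ c).
by near=> N; have [] := sb N _ w x (leqnn _) bx.
Unshelve. all: by end_near. Qed.

Definition mdeg (al : Idx) := (\sum_i al i)%N.

Lemma monomial_le (h : E) (al : Idx) (rho : R) : `|h| <= rho -> `|monomial h al| <= rho ^+ mdeg al.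
Proof.
move=> hr; rewrite /monomial normr_prod /mdeg -[leRHS]prodrXr; apply: ler_prod => i _.
rewrite normr_ge0 normrX; apply: lerXn2r; rewrite ?nnegrE //.
  exact: le_trans hr.
exact: le_trans (norm_coord _ _) hr.
Qed.

Definition mpred (i : 'I_3) (al : Idx) : Idx := [ffun j => if j == i then (al i).-1 else al j].

Lemma partial_powcoord p i j k x :
  differentiable (fun y : E => (y ord0 j - p ord0 j) ^+ k) x /\
  partial i (fun y : E => (y ord0 j - p ord0 j) ^+ k) x =
    (i == j)%:R * k%:R * (x ord0 j - p ord0 j) ^+ k.-1.
Proof.
have cd : differentiable (fun y : E => y ord0 j - p ord0 j) x.
  by apply: differentiableB; [exact: differentiable_coord|exact: differentiable_cst].
elim: k => [|k [IHd IHp]].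
  rewrite (_ : (fun y : E => _) = cst 1); last by apply/funext => y; rewrite expr0.
  by split; [exact: differentiable_cst|rewrite partial_cst mulr0 mul0r].
rewrite (_ : (fun y : E => _) = (fun y : E => (y ord0 j - p ord0 j) * (y ord0 j - p ord0 j) ^+ k)); last first.
  by apply/funext => y; rewrite exprS.
split; first exact: differentiableM.
rewrite partialM // IHp partialB; [|exact: differentiable_coord|exact: differentiable_cst].
rewrite partial_coord partial_cst subr0 -[k.+1%:R]natr1 /=.
by case: k {IHd IHp} => [|k] /=; rewrite ?expr0 ?exprS; ring.
Qed.

Lemma monomialE (h : E) (al : Idx) : monomial h al =
  h ord0 ord0 ^+ al ord0 * (h ord0 (lift ord0 ord0) ^+ al (lift ord0 ord0) *
   h ord0 (lift ord0 (lift ord0 ord0)) ^+ al (lift ord0 (lift ord0 ord0))).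
Proof. by rewrite /monomial !big_ord_recl big_ord0 mulr1. Qed.

Lemma mdegE (al : Idx) : mdeg al = (al ord0 + (al (lift ord0 ord0) + al (lift ord0 (lift ord0 ord0))))%N.
Proof. by rewrite /mdeg !big_ord_recl big_ord0 addn0. Qed.

Lemma ord3P (P : 'I_3 -> Prop) : P ord0 -> P (lift ord0 ord0) -> P (lift ord0 (lift ord0 ord0)) ->
  forall i, P i.
Proof.
move=> p0 p1 p2 [[|[|[|//]]] i3].
- by have -> : Ordinal i3 = ord0 by apply: val_inj.
- by have -> : Ordinal i3 = lift ord0 ord0 by apply: val_inj.
- by have -> : Ordinal i3 = lift ord0 (lift ord0 ord0) by apply: val_inj.
Qed.

Lemma partial_monomial p i (al : Idx) x :
  differentiable (fun y => monomial (y - p) al) x /\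
  partial i (fun y => monomial (y - p) al) x = (al i)%:R * monomial (x - p) (mpred i al).
Proof.
rewrite (_ : (fun y : E => _) = (fun y : E => (y ord0 ord0 - p ord0 ord0) ^+ al ord0 *
  ((y ord0 (lift ord0 ord0) - p ord0 (lift ord0 ord0)) ^+ al (lift ord0 ord0) *
   (y ord0 (lift ord0 (lift ord0 ord0)) - p ord0 (lift ord0 (lift ord0 ord0))) ^+ al (lift ord0 (lift ord0 ord0))))); last first.
  by apply/funext => y; rewrite monomialE !mxE.
have [d0 p0] := partial_powcoord p i ord0 (al ord0) x.
have [d1 p1] := partial_powcoord p i (lift ord0 ord0) (al (lift ord0 ord0)) x.
have [d2 p2] := partial_powcoord p i (lift ord0 (lift ord0 ord0)) (al (lift ord0 (lift ord0 ord0))) x.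
have d12 := differentiableM d1 d2.
split; first exact: (differentiableM d0 d12).
rewrite partialM // [in X in _ + X]partialM // p0 p1 p2 monomialE !ffunE !mxE.
by move: i {p0 p1 p2}; apply: ord3P => /=; ring.
Qed.

Lemma mdeg_pred i (al : Idx) : (al i)%:R != 0 :> R -> mdeg (mpred i al) = (mdeg al).-1.
Proof.
rewrite !mdegE !ffunE; move: i; apply: ord3P => /=; rewrite pnatr_eq0; lia.
Qed.

Lemma le_mdeg i (al : Idx) : (al i <= mdeg al)%N.
Proof. by rewrite mdegE; move: i; apply: ord3P; lia. Qed.

(** The series converges absolutely at the corner p + (r/2, r/2, r/2), so
    |a_al| (r/2)^|al| is summable, and [family_bnd] bounds the derivatives of the
    monomials on the ball of radius r/4. *)
Lemma analytic_at_an F p : analytic_at F p -> an F p.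
Proof.
move=> [a [r [r0 Fr]]].
pose e : E := p + const_mx (r / 2).
have be : ball p r e.
  rewrite -ball_normE /= /e opprD addrA subrr sub0r normrN.
  apply: le_lt_trans (_ : r / 2 < r); last lra.
  by apply: norm_le_coord => [|i]; [lra|rewrite mxE ger0_norm; lra].
have [ce _] := Fr e be.
have me al : monomial (e - p) al = (r / 2) ^+ mdeg al.
  rewrite /monomial /mdeg -[RHS]prodrXr; apply: eq_bigr => i _.
  by rewrite /e addrC addKr mxE.
have [D HD] := box_lim_le (fun al => normr_ge0 _) ce.
have D0 : 0 <= D by have := HD 0%N; apply: le_trans; apply: sumr_ge0.
have r4 : 0 < r / 4 by lra.
pose K := Num.max 1 ((r / 4)^-1).
have K1 : 1 <= K by rewrite le_max lexx.
pose s N x := box_sum (fun al => a al * monomial (x - p) al) N.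
have mb al : anb (ball p (r / 4)) (fun x => monomial (x - p) al) ((r / 2) ^+ mdeg al) K.
  move=> n; have r42 : r / 4 < r / 2 by lra.
  have := @family_bnd Idx mdeg (fun al x => monomial (x - p) al) (fun i al => (al i)%:R)
    mpred (ball p (r / 4)) (r / 4) (r / 2) (ball_open _ _) (ltW r4) r42.
  move=> /(_ _ _ _ _ _ n al)/bnd_le; apply.
  - move=> k _; rewrite mulrC -!mulrA; apply: ler_wpM2l; first by rewrite exprn_ge0 //; lra.
    apply: ler_wpM2r => //; rewrite -exprVn; apply: lerXn2r; rewrite ?nnegrE ?invr_ge0; [lra|lra|].
    by rewrite (_ : r / 2 - r / 4 = r / 4); [rewrite le_max lexx orbT|field].
  - by move=> be' x _; have [] := partial_monomial p ord0 be' x.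
  - by move=> i be' x _; have [] := partial_monomial p i be' x.
  - by move=> i be'; rewrite normr_nat ler_nat le_mdeg.
  - by move=> i be'; exact: mdeg_pred.
  - by move=> be' x; rewrite -ball_normE /= distrC => /ltW/monomial_le.
have bs w N x : ball p (r / 4) x -> iter_partial w (s N) x =
    box_sum (fun al => a al * iter_partial w (fun y => monomial (y - p) al) x) N /\
    differentiable (iter_partial w (s N)) x.
  elim: w x => [|i w IH] x bx.
    split=> //; apply: differentiable_sumf => al _; apply: differentiableZ.
    by have [] := partial_monomial p ord0 (natidx al) x.
  have e1 := open_near (ball_open _ _) bx (fun y by_ => (IH y by_).1).
  have md al : differentiable (fun y => a al * iter_partial w (fun y => monomial (y - p) al) y) x.
    by apply: differentiableZ; have [] := mb al _ w x (leqnn _) bx.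
  have e2 : forall y, ball p (r / 4) y -> iter_partial (i :: w) (s N) y =
     box_sum (fun al => a al * iter_partial (i :: w) (fun y => monomial (y - p) al) y) N.
    move=> y by_ /=.
    rewrite (partial_near _ (open_near (ball_open _ _) by_ (fun y by_ => (IH y by_).1))).
    rewrite partial_sum => [|al _].
      apply: eq_bigr => al _; rewrite partialZ //.
      by have [] := mb (natidx al) _ w y (leqnn _) by_.
    by apply: differentiableZ; have [] := mb (natidx al) _ w y (leqnn _) by_.
  split; first exact: e2.
  apply: (differentiable_near (F := fun y => box_sum (fun al => a al * iter_partial (i :: w) (fun y => monomial (y - p) al) y) N)).
    by apply: (open_near (ball_open _ _) bx) => y by_; rewrite e2.
  apply: differentiable_sumf => al _; apply: differentiableZ.
  by have [] := mb (natidx al) _ (i :: w) x (leqnn _) bx.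
have tb w N x : ball p (r / 4) x ->
    box_sum (fun al => `|a al * iter_partial w (fun y => monomial (y - p) al) x|) N <=
    D * K ^+ size w * (size w)`!%:R.
  move=> bx; rewrite -mulrA.
  apply: le_trans (_ : box_sum (fun al => `|a al * monomial (e - p) al|) N * (K ^+ size w * (size w)`!%:R) <= _).
    rewrite /box_sum mulr_suml; apply: ler_sum => al _; rewrite !normrM -mulrA.
    have r20 : 0 <= r / 2 by lra.
    apply: ler_wpM2l => //; rewrite me [X in _ <= X * _]ger0_norm ?exprn_ge0 // mulrA.
    by have [] := mb (natidx al) _ w x (leqnn _) bx.
  by apply: ler_wpM2r => //; rewrite mulr_ge0 // exprn_ge0 //; lra.
exists (r / 4), D, K; split=> //.
have sb N : anb (ball p (r / 4)) (s N) D K.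
  move=> n w x wn bx; have [-> ?] := bs w N x bx; split=> //.
  exact: le_trans (box_norm_le _ _) (tb w N x bx).
have sc w x : ball p (r / 4) x -> cvgn (fun N => iter_partial w (s N) x).
  move=> bx; have -> : (fun N => iter_partial w (s N) x) =
      box_sum (fun al => a al * iter_partial w (fun y => monomial (y - p) al) x).
    by apply/funext => N; have [] := bs w N x bx.
  by apply: box_cvg => N; exact: tb.
have [Lb _] := limit_anb r4 D0 (le_trans ler01 K1) sb sc.
move=> n; apply: (bnd_eq (ball_open _ _) _ (Lb n)) => x bx.
have brx : ball p r x by apply: le_ball bx; lra.
by have [_] := Fr x brx; exact: cvg_lim.
Qed.

Definition content w : Idx := [ffun i => count_mem i w].

Lemma vpow_content (h : E) w : vpow h w = monomial h (content w).
Proof.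
rewrite /vpow monomialE !ffunE; elim: w => [|i w IH]; first by rewrite big_nil !expr0 !mulr1.
by rewrite big_cons IH; move: i; apply: ord3P => /=; rewrite ?add0n ?add1n ?exprS; ring.
Qed.

Lemma mdeg_content w : mdeg (content w) = size w.
Proof.
rewrite mdegE !ffunE; elim: w => //= i w <-; move: i; apply: ord3P => /=; lia.
Qed.

Lemma box_words (g : seq 'I_3 -> R) N :
  box_sum (fun al => \sum_(w <- words (mdeg al) | content w == al) g w) N =
  \sum_(k < 3 * N) \sum_(w <- words k | [forall i, (content w i < N)%N]) g w.
Proof.
rewrite /box_sum.
have H (al : {ffun 'I_3 -> 'I_N}) :
    \sum_(w <- words (mdeg (natidx al)) | content w == natidx al) g w =
    \sum_(k < 3 * N) \sum_(w <- words k | content w == natidx al) g w.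
  have lt : (mdeg (natidx al) < 3 * N)%N.
    rewrite mdegE !ffunE; have := ltn_ord (al ord0); have := ltn_ord (al (lift ord0 ord0)).
    have := ltn_ord (al (lift ord0 (lift ord0 ord0))); lia.
  rewrite (bigD1 (Ordinal lt)) //= [X in _ + X]big1 ?addr0 // => k kn.
  rewrite big_seq_cond big1 // => w /andP[/size_words wk /eqP wa].
  by case/negP: kn; apply/eqP/val_inj; rewrite /= -wa mdeg_content.
rewrite (eq_bigr _ (fun al _ => H al)) exchange_big /=; apply: eq_bigr => k _.
rewrite (exchange_big_dep (fun w => [forall i, (content w i < N)%N])) /=; last first.
  by move=> al w _ /eqP ->; apply/forallP => i; rewrite ffunE.
apply: eq_bigr => w /forallP wN.
pose al0 : {ffun 'I_3 -> 'I_N} := [ffun i => Ordinal (wN i)].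
have e0 : natidx al0 = content w by apply/ffunP => i; rewrite !ffunE.
rewrite (big_pred1 al0) // => al /=; rewrite -e0 eq_sym.
apply/eqP/eqP => [e|-> //]; apply/ffunP => i; apply: val_inj.
by have := congr1 (fun f : Idx => f i) e; rewrite !ffunE.
Qed.

(** The coefficient of a monomial is the sum over its words of the derivatives
    of F, divided by the factorial of the degree.  The partial sum over the box
    of size N contains all words shorter than N and only words shorter than 3 N,
    so it differs from the Taylor polynomial of order N by a geometric tail. *)
Lemma an_analytic_at F p : an F p -> analytic_at F p.
Proof.
move=> [r [C [K [r0 C0 K1 Fb]]]].
pose g (h : E) w := vpow h w * iter_partial w F p / (size w)`!%:R.
pose a (al : Idx) := \sum_(w <- words (mdeg al) | content w == al) iter_partial w F p / (size w)`!%:R.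
have K0 : 0 < 6 * K by lra.
pose s := Num.min r ((6 * K)^-1).
have s0 : 0 < s by rewrite lt_min r0 invr_gt0.
have aE h al : a al * monomial h al = \sum_(w <- words (mdeg al) | content w == al) g h w.
  rewrite /a mulr_suml; apply: eq_bigr => w /eqP <-; rewrite /g vpow_content; ring.
exists a, s; split=> // x bx.
pose h := x - p; rewrite -/h.
have [hr hK] : `|h| < r /\ `|h| < (6 * K)^-1.
  by move: bx; rewrite -ball_normE /= distrC lt_min => /andP[].
have bh : ball p r (p + h) by rewrite -ball_normE /= opprD addrA subrr sub0r normrN.
pose q := 3 * K * `|h|.
have q0 : 0 <= q by rewrite /q !mulr_ge0 //; lra.
have q2 : q <= 1 / 2.
  by move: hK; rewrite -[(6 * K)^-1]mul1r ltr_pdivlMr // /q; lra.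
have gb k (P : pred (seq 'I_3)) : \sum_(w <- words k | P w) `|g h w| <= C * q ^+ k.
  rewrite big_mkcond /=.
  have -> : C * q ^+ k = 3 ^+ k * (`|h| ^+ k * (C * K ^+ k)) by rewrite /q !exprMn; ring.
  apply: sum_words_le => w <-; case: ifP => _; last by rewrite !mulr_ge0 ?exprn_ge0 //; lra.
  rewrite /g !normrM -mulrA; apply: ler_pM => //; first exact: vpow_le.
  have f0 : 0 < (size w)`!%:R :> R by rewrite ltr0n fact_gt0.
  rewrite normfV (gtr0_norm f0) ler_pdivrMr //.
  by have [] := Fb _ w p (leqnn _) (ballxx p r0).
have geo N M : \sum_(N <= k < M) C * q ^+ k <= 2 * C * q ^+ N.
  case: (leqP N M) => NM; last by rewrite big_geq ?mulr_ge0 ?exprn_ge0 // ltnW.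
  have qn n : 0 <= C * q ^+ n by rewrite mulr_ge0 // exprn_ge0.
  have : \sum_(N <= k < M) C * q ^+ k <= 2 * C * q ^+ N - 2 * C * q ^+ M.
    rewrite -(subnKC NM); elim: (M - N)%N => [|n IH]; first by rewrite addn0 big_geq // subrr.
    rewrite addnS big_nat_recr /=; last exact: leq_addr.
    by rewrite exprS; have := qn (N + n)%N; move: IH; nra.
  have := qn M; lra.
have absb N : box_sum (fun al => `|a al * monomial h al|) N <= 2 * C.
  apply: le_trans (_ : box_sum (fun al => \sum_(w <- words (mdeg al) | content w == al) `|g h w|) N <= _).
    by apply: ler_sum => al _; rewrite aE; exact: ler_norm_sum.
  rewrite box_words; apply: le_trans (_ : \sum_(0 <= k < 3 * N) C * q ^+ k <= _).
    by rewrite big_mkord; apply: ler_sum => k _; exact: gb.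
  by have := geo 0%N (3 * N)%N; rewrite expr0 mulr1.
split; first by apply: (@box_cvg_ge0 _ _ (2 * C)).
have main N : `|F x - box_sum (fun al => a al * monomial h al) N| <= 3 * C * q ^+ N.
  have T := taylor N Fb bh.
  have e1 : p + h = x by rewrite /h addrC subrK.
  rewrite e1 in T.
  have e2 : \sum_(k < N) (\sum_(w <- words k) vpow h w * iter_partial w F p) / k`!%:R =
            \sum_(k < N) \sum_(w <- words k) g h w.
    apply: eq_bigr => k _; rewrite mulr_suml; apply: eq_big_seq => w /size_words wk.
    by rewrite /g wk.
  have e3 : box_sum (fun al => a al * monomial h al) N =
     \sum_(k < N) \sum_(w <- words k) g h w +
     \sum_(N <= k < 3 * N) \sum_(w <- words k | [forall i, (content w i < N)%N]) g h w.
    transitivity (box_sum (fun al => \sum_(w <- words (mdeg al) | content w == al) g h w) N).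
      by apply: eq_bigr => al _; exact: aE.
    rewrite box_words -(big_mkord xpredT (fun k => \sum_(w <- words k | [forall i, (content w i < N)%N]) g h w)).
    rewrite (big_cat_nat (n := N)); [|exact: leq0n|by rewrite leq_pmull].
    congr (_ + _); rewrite big_mkord; apply: eq_bigr => k _.
    rewrite [LHS]big_seq_cond [RHS]big_seq_cond; apply: eq_bigl => w.
    case wk: (w \in words k) => //=; apply/forallP => i.
    apply: leq_ltn_trans (ltn_ord k); rewrite -(size_words wk) -(mdeg_content w).
    exact: le_mdeg.
  rewrite e2 in T; rewrite e3 opprD addrA.
  apply: le_trans (ler_normB _ _) _.
  have -> : 3 * C * q ^+ N = C * q ^+ N + 2 * C * q ^+ N by ring.
  apply: lerD; first exact: T.
  apply: le_trans (geo N (3 * N)%N); apply: le_trans (ler_norm_sum _ _ _) _.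
  apply: ler_sum => k _; apply: le_trans (ler_norm_sum _ _ _) _; exact: gb.
apply/cvgrPdist_le => eps eps0.
have q1 : q < 1 by lra.
have C1 : 0 < 3 * C + 1 by lra.
have [N hN] := pow_small q0 q1 (divr_gt0 eps0 C1).
exists N => // M /= NM; apply: le_trans (main M) _.
have qM : q ^+ M <= q ^+ N by apply: ler_wiXn2l => //; lra.
rewrite ltr_pdivlMr // in hN.
have : 0 <= q ^+ M by rewrite exprn_ge0.
nra.
Qed.

End Series.

(** * Identities for Beltrami fields *)

(** The partial derivative as a sealed constant, so that comparing two
    derivatives never unfolds the limit that defines them. *)
Definition pd {R : realType} := locked (@partial R).

Lemma pdE {R : realType} : @pd R = @partial R.
Proof. by rewrite /pd -lock. Qed.

Section SealedPartial.
Context {R : realType}.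
Local Notation E := 'rV[R]_3.
Implicit Types (F G : E -> R) (x : E) (i j : 'I_3) (V : set E).

Lemma pd_an i F x : an F x -> an (pd i F) x.
Proof. rewrite pdE; exact: an_partial. Qed.

Lemma pdD i F G x : an F x -> an G x -> pd i (fun y => F y + G y) x = pd i F x + pd i G x.
Proof. by move=> Fa Ga; rewrite pdE partialD //; exact: an_diff. Qed.

Lemma pdB i F G x : an F x -> an G x -> pd i (fun y => F y - G y) x = pd i F x - pd i G x.
Proof. by move=> Fa Ga; rewrite pdE partialB //; exact: an_diff. Qed.

Lemma pdN i F x : an F x -> pd i (fun y => - F y) x = - pd i F x.
Proof. by move=> Fa; rewrite pdE partialN //; exact: an_diff. Qed.

Lemma pdM i F G x : an F x -> an G x ->
  pd i (fun y => F y * G y) x = pd i F x * G x + F x * pd i G x.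
Proof. by move=> Fa Ga; rewrite pdE partialM //; exact: an_diff. Qed.

Lemma pdV i F x : F x != 0 -> an F x ->
  pd i (fun y => (F y)^-1) x = - (F x)^-2 * pd i F x.
Proof. by move=> F0 Fa; rewrite pdE partialV //; exact: an_diff. Qed.

Lemma pd_cst i (c : R) x : pd i (fun=> c) x = 0.
Proof. by rewrite pdE partial_cst. Qed.

Lemma pd_coord i j x : pd i (fun y => y ord0 j) x = (i == j)%:R.
Proof. by rewrite pdE partial_coord. Qed.

Lemma pd_sum i (I : Type) (r : seq I) (P : pred I) (F : I -> E -> R) x :
  (forall k, P k -> an (F k) x) ->
  pd i (fun y => \sum_(k <- r | P k) F k y) x = \sum_(k <- r | P k) pd i (F k) x.
Proof. by move=> Fa; rewrite pdE partial_sum // => k Pk; exact/an_diff/Fa. Qed.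

Lemma pdC i j F x : an F x -> pd i (pd j F) x = pd j (pd i F) x.
Proof. rewrite pdE; exact: an_partialC. Qed.

Lemma pd_on V i F G x : open V -> (forall y, V y -> F y = G y) -> V x ->
  pd i F x = pd i G x.
Proof. by move=> Vo FG Vx; rewrite pdE; apply: partial_near; exact: open_near FG. Qed.

Lemma pd_near i F G x : (\forall y \near x, F y = G y) -> pd i F x = pd i G x.
Proof. rewrite pdE; exact: partial_near. Qed.

Lemma pd_comp i G (Phi : E -> E) x : (forall j, an (fun y => Phi y ord0 j) x) ->
  an G (Phi x) ->
  pd i (fun y => G (Phi y)) x = \sum_j pd j G (Phi x) * pd i (fun y => Phi y ord0 j) x.
Proof.
by move=> Pa Ga; rewrite pdE partial_comprV // => [j|]; exact: an_diff.
Qed.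

Lemma grad_pd F x i : grad F x ord0 i = pd i F x.
Proof. by rewrite mxE pdE. Qed.

End SealedPartial.

(** Analyticity of an expression from the analyticity of its constituents, which
    are found among the hypotheses. *)
Ltac an_ := repeat first [assumption
  | match goal with
    | H : forall j : 'I_3, an _ _ |- _ => solve [apply: H]
    | H : forall x, _ -> an _ x |- _ => solve [apply: H; assumption]
    end
  | exact: an_coord | exact: an_cst
  | apply: pd_an
  | apply: anM | apply: anD | apply: anB | apply: anN | apply: anX | apply: an_sum => ? _].

#[global] Hint Extern 0 (differentiable _ _) => (apply: an_diff; an_; fail) : core.
#[global] Hint Extern 0 (an _ _) => (an_; fail) : core.

Ltac gen_atoms := repeat match goal with
  | |- context [pd ?i ?F ?x] => let z := fresh "z" in set z := (pd i F x); clearbody z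
  | |- context [fun_of_matrix ?A ?i ?j] => let z := fresh "z" in set z := (fun_of_matrix A i j); clearbody z
  end.

Section Indices.
(** The indices of coordinates are added modulo 3, so cyclic identities are
    proved for all indices at once and evaluated by normalizing i + 1 + 1 + 1. *)
Lemma i3K (i : 'I_3) : i + 1 + 1 + 1 = i.
Proof. by apply: val_inj; case: i => -[|[|[|]]]. Qed.

Lemma big3 (V : nmodType) (i : 'I_3) (F : 'I_3 -> V) :
  \sum_k F k = F i + F (i + 1) + F (i + 1 + 1).
Proof.
have e : \sum_k F k = F 0 + F 1 + F (1 + 1).
  rewrite !big_ord_recl big_ord0 addr0 addrA.
  by congr (_ + F _ + F _); apply: val_inj.
rewrite e; case: i => -[|[|[|//]]] i3.
- by congr (F _ + F _ + F _); apply: val_inj.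
- by rewrite -addrA addrC; congr (F _ + F _ + F _); apply: val_inj.
- by rewrite addrC addrA; congr (F _ + F _ + F _); apply: val_inj.
Qed.

Lemma all3 (P : 'I_3 -> Prop) : P 0 -> P 1 -> P (1 + 1) -> forall i, P i.
Proof.
move=> p0 p1 p2 [[|[|[|//]]] i3].
- by have -> : Ordinal i3 = 0 by apply: val_inj.
- by have -> : Ordinal i3 = 1 by apply: val_inj.
- by have -> : Ordinal i3 = 1 + 1 by apply: val_inj.
Qed.

Lemma i3_3 : (1 + 1 + 1 : 'I_3) = 0. Proof. exact: val_inj. Qed.
Lemma i3_1 : (0 + 1 : 'I_3) = 1. Proof. exact: val_inj. Qed.
End Indices.

Section Fields.
Context {R : realType}.
Local Notation E := 'rV[R]_3.
Implicit Types (F G f : E -> R) (x p h : E) (i j : 'I_3) (w v : seq 'I_3) (V : set E)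
  (u : E -> E).

Lemma dot3 (v w : E) : dot v w = v ord0 0 * w ord0 0 + v ord0 1 * w ord0 1 + v ord0 (1 + 1) * w ord0 (1 + 1).
Proof. by rewrite /dot (big3 0) i3_1. Qed.

Lemma dotC (v w : E) : dot v w = dot w v.
Proof. by rewrite !dot3; ring. Qed.

Lemma dotDl (v w z : E) : dot (v + w) z = dot v z + dot w z.
Proof. by rewrite !dot3 !mxE; ring. Qed.

Lemma dotZl (c : R) (v z : E) : dot (c *: v) z = c * dot v z.
Proof. by rewrite !dot3 !mxE; ring. Qed.

Lemma dotDr (v w z : E) : dot z (v + w) = dot z v + dot z w.
Proof. by rewrite !dot3 !mxE; ring. Qed.

Lemma dotZr (c : R) (v z : E) : dot z (c *: v) = c * dot z v.
Proof. by rewrite !dot3 !mxE; ring. Qed.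

Lemma dot_ge0 (v : E) : 0 <= dot v v.
Proof. by apply: sumr_ge0 => i _; rewrite -expr2 sqr_ge0. Qed.

Lemma dot_eq0 (v : E) : (dot v v == 0) = (v == 0).
Proof.
apply/eqP/eqP => [|->]; last by rewrite /dot big1 // => i _; rewrite mxE mul0r.
move=> v0; apply/rowP => i; rewrite mxE; apply/eqP; rewrite -sqrf_eq0.
have := v0 => /eqP; rewrite psumr_eq0 => [/allP/(_ i (mem_index_enum _))|k _].
  by rewrite /= -expr2.
by rewrite -expr2 sqr_ge0.
Qed.

Lemma dot_gt0 (v : E) : v != 0 -> 0 < dot v v.
Proof. by move=> v0; rewrite lt_neqAle dot_ge0 eq_sym dot_eq0 v0. Qed.

Definition cross (v w : E) : E :=
  \row_(i < 3) (v ord0 (i + 1) * w ord0 (i + 1 + 1) - v ord0 (i + 1 + 1) * w ord0 (i + 1)).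

Lemma crossE0 (v w : E) : cross v w ord0 0 = v ord0 1 * w ord0 (1 + 1) - v ord0 (1 + 1) * w ord0 1.
Proof. by rewrite mxE i3_1. Qed.
Lemma crossE1 (v w : E) : cross v w ord0 1 = v ord0 (1 + 1) * w ord0 0 - v ord0 0 * w ord0 (1 + 1).
Proof. by rewrite mxE i3_3. Qed.
Lemma crossE2 (v w : E) : cross v w ord0 (1 + 1) = v ord0 0 * w ord0 1 - v ord0 1 * w ord0 0.
Proof. by rewrite mxE i3_3 i3_1. Qed.
Definition crossE := (crossE0, crossE1, crossE2).

Lemma rowP3 (v w : E) : v ord0 0 = w ord0 0 -> v ord0 1 = w ord0 1 ->
  v ord0 (1 + 1) = w ord0 (1 + 1) -> v = w.
Proof. by move=> e0 e1 e2; apply/rowP; apply: all3. Qed.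

Lemma an_on V F G x : open V -> (forall y, V y -> F y = G y) -> V x -> an F x -> an G x.
Proof. by move=> Vo FG Vx; apply: an_near; exact: open_near FG. Qed.

(** The system in coordinates.  Together with the bounds on derivatives this is
    the form in which it is differentiated. *)
Definition beltr f V u := forall x, V x ->
  [/\ forall j, an (fun y => u y ord0 j) x,
      forall i, pd (i + 1) (fun y => u y ord0 (i + 1 + 1)) x
              - pd (i + 1 + 1) (fun y => u y ord0 (i + 1)) x = f x * u x ord0 i &
      \sum_i pd i (fun y => u y ord0 i) x = 0].

Lemma beltramiP f V u : beltrami f V u <-> beltr f V u.
Proof.
split=> H x Vx; have [ua uc ud] := H x Vx; split=> //.
- by move=> j; exact: analytic_at_an (ua j).
- by move=> i; have := congr1 (fun z : E => z ord0 i) uc; rewrite !mxE pdE.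
- by rewrite pdE.
- by move=> j; exact: an_analytic_at (ua j).
- by apply/rowP => i; rewrite !mxE -uc pdE.
- by rewrite -ud pdE.
Qed.

Section BeltramiIdentities.
Variables (f : E -> R) (V : set E) (u : E -> E).
Hypotheses (Vo : open V) (fa : forall x, V x -> an f x) (ub : beltr f V u).

Let ua j x : V x -> an (fun y => u y ord0 j) x. Proof. by move=> /ub[]. Qed.
Let uc i x : V x -> pd (i + 1) (fun y => u y ord0 (i + 1 + 1)) x =
  pd (i + 1 + 1) (fun y => u y ord0 (i + 1)) x + f x * u x ord0 i.
Proof. by move=> Vx; have [_ /(_ i) <- _] := ub Vx; ring. Qed.
Let ud i x : V x -> pd i (fun y => u y ord0 i) x =
  - pd (i + 1) (fun y => u y ord0 (i + 1)) x - pd (i + 1 + 1) (fun y => u y ord0 (i + 1 + 1)) x.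
Proof.
move=> Vx; have [_ _] := ub Vx; rewrite (big3 i) => /eqP.
by rewrite -addrA addr_eq0 opprD => /eqP.
Qed.

(** The divergence of curl u = f u, as div curl = 0 and div u = 0. *)
Lemma beltrami_orth x : V x -> \sum_j pd j f x * u x ord0 j = 0.
Proof.
move=> Vx; have fx := fa Vx; have ux j := ua j Vx.
have H i : pd i (pd (i + 1) (fun y => u y ord0 (i + 1 + 1))) x =
    pd i (pd (i + 1 + 1) (fun y => u y ord0 (i + 1))) x +
    (pd i f x * u x ord0 i + f x * pd i (fun y => u y ord0 i) x).
  rewrite (pd_on i Vo (fun y Vy => uc i Vy) Vx) pdD //.
  by rewrite pdM.
have h0 := H 0; have h1 := H 1; have h2 := H (1 + 1).
rewrite ?i3_3 ?i3_1 in h0 h1 h2.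
have d := ud 0 Vx; rewrite ?i3_1 in d.
rewrite (big3 0) i3_1.
have c01 j := pdC 0 1 (ux j).
have c02 j := pdC 0 (1 + 1) (ux j).
have c12 j := pdC 1 (1 + 1) (ux j).
move: h0 h1 h2; rewrite c01 c02 c12 d; lra.
Qed.

(** Delta u = - curl curl u = - curl (f u). *)
Lemma laplacian_beltrami i x : V x ->
  \sum_k pd k (pd k (fun y => u y ord0 i)) x =
  pd (i + 1 + 1) (fun y => f y * u y ord0 (i + 1)) x -
  pd (i + 1) (fun y => f y * u y ord0 (i + 1 + 1)) x.
Proof.
move=> Vx; have fx := fa Vx; have ux j := ua j Vx.
rewrite (big3 i).
rewrite (pd_on i Vo (fun y Vy => ud i Vy) Vx).
have e1 y : V y -> pd (i + 1) (fun y => u y ord0 i) y =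
   pd i (fun y => u y ord0 (i + 1)) y - f y * u y ord0 (i + 1 + 1).
  by move=> Vy; have := uc (i + 1 + 1) Vy; rewrite !i3K => ->; rewrite addrK.
have e2 y : V y -> pd (i + 1 + 1) (fun y => u y ord0 i) y =
   pd i (fun y => u y ord0 (i + 1 + 1)) y + f y * u y ord0 (i + 1).
  by move=> Vy; have := uc (i + 1) Vy; rewrite !i3K.
rewrite (pd_on (i + 1) Vo e1 Vx) (pd_on (i + 1 + 1) Vo e2 Vx).
rewrite !pdB // !pdN // !pdD //.
rewrite (pdC i (i + 1)) // (pdC i (i + 1 + 1)) //; ring.
Qed.

(** The Laplacian of grad f . u = 0 is the identity below plus
    grad f . Delta u = - grad f . curl (f u).  The latter is
    - f grad f . curl u = - f^2 grad f . u = 0, because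
    grad f . (grad f x u) = 0. *)
Lemma beltrami_hess x : V x ->
  2 * (\sum_i \sum_j pd i (pd j f) x * pd i (fun y => u y ord0 j) x) +
  \sum_j u x ord0 j * pd j (fun y => \sum_i pd i (pd i f) y) x = 0.
Proof.
move=> Vx; have fx := fa Vx; have ux j := ua j Vx.
have S1 k y : V y -> \sum_j (pd k (pd j f) y * u y ord0 j +
    pd j f y * pd k (fun y => u y ord0 j) y) = 0.
  move=> Vy; have fy := fa Vy; have uy j := ua j Vy.
  have := pd_on k Vo (fun y Vy => beltrami_orth Vy) Vy.
  rewrite pd_cst pd_sum //.
  by move=> e; apply: etrans e; apply: eq_bigr => j _; rewrite pdM.
have S2 k : \sum_j (pd k (pd k (pd j f)) x * u x ord0 j +
    2 * (pd k (pd j f) x * pd k (fun y => u y ord0 j) x) +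
    pd j f x * pd k (pd k (fun y => u y ord0 j)) x) = 0.
  have := pd_on k Vo (S1 k) Vx.
  rewrite pd_cst pd_sum // => e; apply: etrans e; apply: eq_bigr => j _.
  by rewrite pdD // !pdM //; ring.
have : \sum_k \sum_j (pd k (pd k (pd j f)) x * u x ord0 j +
    2 * (pd k (pd j f) x * pd k (fun y => u y ord0 j) x) +
    pd j f x * pd k (pd k (fun y => u y ord0 j)) x) = 0.
  by rewrite big1.
under eq_bigr => k _ do rewrite !big_split /=.
rewrite !big_split /= => T.
have L : \sum_k \sum_j pd j f x * pd k (pd k (fun y => u y ord0 j)) x = 0.
  rewrite exchange_big /=.
  under eq_bigr => j _ do rewrite -mulr_sumr laplacian_beltrami // !pdM //.
  have h0 := uc 0 Vx; have h1 := uc 1 Vx; have h2 := uc (1 + 1) Vx.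
  rewrite ?i3_3 ?i3_1 in h0 h1 h2.
  rewrite (big3 0) ?i3_1 ?i3_3 ?i3_1 h0 h1 h2.
  have := beltrami_orth Vx; rewrite (big3 0) ?i3_1 => o.
  have -> : forall (a b c a0 b0 c0 t r s ff : R), a * (c * b0 + ff * r - (b * c0 + ff * (r + ff * a0)))
     + b * (a * c0 + ff * s - (c * a0 + ff * (s + ff * b0)))
     + c * (b * a0 + ff * t - (a * b0 + ff * (t + ff * c0))) = - ff ^+ 2 * (a * a0 + b * b0 + c * c0).
    by move=> *; ring.
  by rewrite o mulr0.
rewrite L addr0 in T; apply: etrans T; rewrite [LHS]addrC; congr (_ + _).
  rewrite exchange_big /=; apply: eq_bigr => j _.
  rewrite pd_sum // mulrC mulr_suml; apply: eq_bigr => k _.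
  congr (_ * _).
  have fC y : V y -> pd j (pd k f) y = pd k (pd j f) y.
    by move=> Vy; apply: pdC; exact: fa.
  by rewrite (pdC j k) //; exact: pd_on fC Vx.
by rewrite mulr_sumr; apply: eq_bigr => k _; rewrite mulr_sumr.
Qed.

End BeltramiIdentities.

Lemma exists_perp (n : E) : n != 0 -> exists2 t : E, dot t n = 0 & dot t t = 1.
Proof.
move=> n0.
suff [v v0 vn] : exists2 v : E, v != 0 & dot v n = 0.
  exists ((Num.sqrt (dot v v))^-1 *: v); first by rewrite dotZl vn mulr0.
  rewrite dotZl dotZr mulrA -expr2 exprVn sqr_sqrtr ?dot_ge0 // mulVf //.
  by rewrite dot_eq0.
pose z i : E := delta_mx ord0 i.
have [c|[c|c]] : cross n (z 0) != 0 \/ (cross n (z 1) != 0 \/ cross n (z (1 + 1)) != 0).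
  case: (eqVneq (cross n (z 0)) 0) => c0; last by left.
  case: (eqVneq (cross n (z 1)) 0) => c1; last by right; left.
  case: (eqVneq (cross n (z (1 + 1))) 0) => c2; last by right; right.
  case/eqP: n0; move: (congr1 (fun v : E => v ord0 0) c1) (congr1 (fun v : E => v ord0 1) c0)
    (congr1 (fun v : E => v ord0 0) c2) (congr1 (fun v : E => v ord0 (1 + 1)) c0).
  rewrite !crossE !mxE /= !(mulr0, mulr1, subr0, sub0r) => a b c d.
  apply: rowP3; rewrite mxE //.
  move: (congr1 (fun v : E => v ord0 (1 + 1)) c1); rewrite !crossE !mxE /=; lra.
all: eexists; first exact: c.
all: by rewrite !dot3 !crossE; ring.
Qed.

Lemma orthonormal_frame (n : E) : n != 0 -> exists t1 t2 : E,
  [/\ dot t1 n = 0, dot t2 n = 0 & [/\ dot t1 t1 = 1, dot t2 t2 = 1 & dot t1 t2 = 0]] /\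
  [/\ Num.sqrt (dot n n) *: t2 = cross n t1, Num.sqrt (dot n n) *: cross t1 t2 = n &
  forall i j, t1 ord0 i * t1 ord0 j + t2 ord0 i * t2 ord0 j + n ord0 i * n ord0 j / dot n n = (i == j)%:R].
Proof.
move=> n0; have [t1 t1n t11] := exists_perp n0.
have nn := dot_gt0 n0; set q := dot n n in nn *.
set s := Num.sqrt q; have s0 : 0 < s by rewrite sqrtr_gt0.
have ss : s * s = q by rewrite -expr2 sqr_sqrtr // ltW.
have s1 : s != 0 by rewrite gt_eqF.
pose t2 := s^-1 *: cross n t1.
have L : dot (cross n t1) (cross n t1) = q * dot t1 t1 - dot t1 n ^+ 2.
  by rewrite /q !dot3 !crossE; ring.
have t2n : dot t2 n = 0 by rewrite dotZl !dot3 !crossE; ring.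
have t12 : dot t1 t2 = 0 by rewrite dotZr !dot3 !crossE; ring.
have t22 : dot t2 t2 = 1.
  by rewrite dotZl dotZr L t1n t11 -ss; field.
have f1 : s *: t2 = cross n t1 by rewrite scalerA mulfV // scale1r.
have f2 : s *: cross t1 t2 = n.
  have -> : cross t1 t2 = s^-1 *: (dot t1 t1 *: n - dot t1 n *: t1).
    by apply: rowP3; rewrite !(mxE, crossE, dot3) ?i3_3 ?i3_1; ring.
  by rewrite t1n t11 scale0r subr0 scale1r scalerA mulfV // scale1r.
clearbody t2; exists t1, t2; split; first by split.
split=> //.
(* the rows of Q are orthonormal, hence so are its columns *)
pose Q : 'M[R]_3 := \matrix_(a, i) (if a == 0 then t1 ord0 i else if a == 1 then t2 ord0 i else n ord0 i / s).
have QQ : Q *m Q^T = 1%:M.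
  have e (v w : E) : \sum_i v ord0 i * w ord0 i = dot v w by [].
  apply/matrixP => a b; rewrite !mxE.
  under eq_bigr => k _ do rewrite !mxE.
  have d3 : forall v : E, \sum_i v ord0 i * (n ord0 i / s) = dot v n / s.
    by move=> v; rewrite mulr_suml; apply: eq_bigr => i _; rewrite mulrA.
  have d3' : forall v : E, \sum_i n ord0 i / s * v ord0 i = dot v n / s.
    by move=> v; rewrite mulr_suml; apply: eq_bigr => i _; ring.
  have d33 : \sum_i n ord0 i / s * (n ord0 i / s) = q / (s * s).
    by rewrite /q /dot mulr_suml; apply: eq_bigr => i _; field.
  move: a b; apply: all3; apply: all3 => /=;
    rewrite ?e ?d3 ?d3' ?d33 ?t11 ?t22 ?t12 ?t1n ?t2n ?(dotC t2 t1) ?t12 ?mul0r ?ss ?divff ?gt_eqF //.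
have /matrixP QQ' := mulmx1C QQ.
move=> i j; have := QQ' i j; rewrite !mxE (big3 0) !mxE ?i3_1 /= => <-.
by congr (_ + _); rewrite -ss; field.
Qed.

Lemma frame_expand (n t1 t2 a : E) :
  (forall i j, t1 ord0 i * t1 ord0 j + t2 ord0 i * t2 ord0 j + n ord0 i * n ord0 j / dot n n = (i == j)%:R) ->
  a = dot a t1 *: t1 + dot a t2 *: t2 + (dot a n / dot n n) *: n.
Proof.
move=> c; apply/rowP => i; rewrite !mxE.
transitivity (\sum_j a ord0 j * (i == j)%:R).
  rewrite (bigD1 i) //= eqxx mulr1 big1 ?addr0 // => j ji.
  by rewrite eq_sym (negPf ji) mulr0.
under eq_bigr => j _ do rewrite -c.
by rewrite !(big3 0) !dot3 ?i3_1; ring.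
Qed.

Definition hess f x (v w : E) : R := \sum_i \sum_j pd i (pd j f) x * v ord0 i * w ord0 j.

Lemma hess_derive f x (v : E) j : an f x -> 'D_v (pd j f) x = \sum_i pd i (pd j f) x * v ord0 i.
Proof.
move=> fx; rewrite derive_partial // pdE; apply: eq_bigr => i _; exact: mulrC.
Qed.

Lemma hessE f x (v w : E) : hess f x v w = dot (\row_j \sum_i pd i (pd j f) x * v ord0 i) w.
Proof.
rewrite /hess exchange_big /=; apply: eq_bigr => j _.
by rewrite mxE mulr_suml.
Qed.

(** The derivative of the unit normal is the Hessian, scaled, up to a multiple
    of the normal; that multiple is fixed by orthogonality to the normal, the
    derivative of |n|^2 = 1. *)
Lemma derive_unit_normal f x (v : E) : an f x -> grad f x != 0 ->
  exists c : R, 'D_v (unit_normal f) x =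
    (Num.sqrt (dot (grad f x) (grad f x)))^-1 *: (\row_j \sum_i pd i (pd j f) x * v ord0 i)
    + c *: grad f x /\ dot ('D_v (unit_normal f) x) (grad f x) = 0.
Proof.
move=> fx g0; have q0 := dot_gt0 g0.
pose q y := \sum_i pd i f y * pd i f y.
have qE y : dot (grad f y) (grad f y) = q y.
  by apply: eq_bigr => i _; rewrite !grad_pd.
have qa y : an f y -> an q y by move=> fy; an_.
pose s y := (Num.sqrt (q y))^-1.
have qx : 0 < q x by rewrite -qE.
have sa : an s x.
  apply: anV; first by rewrite gt_eqF // sqrtr_gt0.
  by apply: an_sqrt => //; exact: qa.
have Ua j : an (fun y => s y * pd j f y) x by an_.
have UE j : (fun y => unit_normal f y ord0 j) = (fun y => s y * pd j f y).
  by apply/funext => y; rewrite mxE grad_pd qE.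
have Ud : differentiable (unit_normal f) x.
  by apply: differentiable_rV => j; rewrite UE //.
have DU j : 'D_v (unit_normal f) x ord0 j = 'D_v s x * pd j f x +
     s x * \sum_i pd i (pd j f) x * v ord0 i.
  rewrite deriveE // diff_rV // UE -derive_partial //.
  rewrite deriveM; [|exact: diff_derivable..].
  by rewrite hess_derive // addrC /GRing.scale /=; congr (_ + _); rewrite mulrC.
exists ('D_v s x).
have e : 'D_v (unit_normal f) x =
    (Num.sqrt (dot (grad f x) (grad f x)))^-1 *: (\row_j \sum_i pd i (pd j f) x * v ord0 i)
    + 'D_v s x *: grad f x.
  by apply/rowP => j; rewrite DU !mxE qE -pdE addrC.
split=> //.
pose W y := \sum_j (s y * pd j f y) * (s y * pd j f y).
have W1 : \forall y \near x, W y = 1.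
  have qc : {for x, continuous q} by apply: differentiable_continuous; exact/an_diff/qa.
  have qn : \forall y \near x, `|q x - q y| < q x by move: qc => /cvgrPdist_lt/(_ _ qx).
  near=> y; have qy : 0 < q y.
    have : `|q x - q y| < q x by near: y.
    by rewrite ltr_norml; lra.
  rewrite /W; under eq_bigr => j _ do rewrite mulrACA.
  rewrite -mulr_sumr -/(q y) -expr2 exprVn sqr_sqrtr ?ltW // mulVf ?gt_eqF //.
have DW : 'D_v W x = 0 by rewrite (near_eq_derive _ W1) derive_cst.
have Wa : an W x by an_.
have : 'D_v W x = 2 * s x * dot ('D_v (unit_normal f) x) (grad f x).
  rewrite derive_partial // /linform -pdE.
  under eq_bigr => i _ do rewrite /W pd_sum //.
  under eq_bigr => i _ do under eq_bigr => j _ do rewrite pdM //.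
  rewrite /dot mulr_sumr.
  under eq_bigr => i _ do rewrite mulr_sumr.
  rewrite exchange_big /=; apply: eq_bigr => j _.
  rewrite deriveE // diff_rV // UE /linform -pdE mulr_suml mulr_sumr.
  by apply: eq_bigr => i _; rewrite grad_pd; ring.
rewrite DW => /esym/eqP; rewrite !mulf_eq0 pnatr_eq0 /= invr_eq0 sqrtr_eq0 leNgt qx /=.
by move=> /eqP.
Unshelve. all: by end_near. Qed.

(** Between tangent vectors the derivative of the unit normal is the Hessian divided
    by |grad f|, by [derive_unit_normal]. *)
Lemma umbilicP f x : an f x -> grad f x != 0 ->
  umbilic f x <-> exists la : R, forall v w : E, dot v (grad f x) = 0 -> dot w (grad f x) = 0 ->
    hess f x v w = la * dot v w.
Proof.
move=> fx g0; have q0 := dot_gt0 g0.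
set s := Num.sqrt (dot (grad f x) (grad f x)).
have s0 : s != 0 by rewrite gt_eqF // sqrtr_gt0.
split=> [[k kv]|[la hl]].
  exists (- k * s) => v w vn wn.
  have [c [e _]] := derive_unit_normal v fx g0.
  have := congr1 (fun z => dot z w) (kv v vn).
  rewrite e -scaleN1r !dotZl dotDl !dotZl -hessE (dotC (grad f x)) wn mulr0 addr0 -/s => h.
  have -> : hess f x v w = s * (s^-1 * hess f x v w) by rewrite mulrA mulfV // mul1r.
  move: h; move: (s^-1 * _) => z; rewrite mulN1r => /(canRL (@opprK _)) ->; ring.
exists (- (s^-1 * la)) => v vn.
have [c [e on]] := derive_unit_normal v fx g0.
have [t1 [t2 [[t1n t2n _] [_ _ fr]]]] := orthonormal_frame g0.
have D t : dot t (grad f x) = 0 -> dot ('D_v (unit_normal f) x) t = s^-1 * la * dot v t.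
  move=> tn; rewrite e dotDl !dotZl -hessE (dotC (grad f x)) tn mulr0 addr0 hl //; ring.
rewrite (frame_expand ('D_v (unit_normal f) x) fr) D // D // on mul0r scale0r addr0.
rewrite [in RHS](frame_expand v fr) vn mul0r scale0r addr0 scaleNr; congr (- _).
by rewrite scalerDr !scalerA.
Qed.

End Fields.

(** * Level surfaces without umbilics *)

Section Vanishing.
Context {R : realType}.
Local Notation E := 'rV[R]_3.
Implicit Types (F G f : E -> R) (x p h : E) (i j : 'I_3) (w : seq 'I_3) (V : set E)
  (u : E -> E).

Definition ipd w F : E -> R := foldr pd F w.

Lemma ipdE w F : ipd w F = iter_partial w F.
Proof. by rewrite /ipd pdE. Qed.

Lemma ipd_rcons w i F : ipd (rcons w i) F = ipd w (pd i F).
Proof. by rewrite /ipd foldr_rcons. Qed.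

Lemma ipd_near w F G x : (\forall y \near x, F y = G y) -> ipd w F x = ipd w G x.
Proof. by move=> FG; rewrite !ipdE; exact: nbhs_singleton (iter_partial_near w FG). Qed.

Lemma ipd_on w V F G x : open V -> (forall y, V y -> F y = G y) -> V x ->
  ipd w F x = ipd w G x.
Proof. by move=> Vo FG Vx; apply: ipd_near; exact: open_near FG. Qed.

Lemma ipd0 w x : ipd w (fun=> 0) x = 0.
Proof. by rewrite ipdE iter_partial_cst; case: w. Qed.

Lemma ipdD w F G x : an F x -> an G x ->
  ipd w (fun y => F y + G y) x = ipd w F x + ipd w G x.
Proof.
elim/last_ind: w F G => [//|w i IH] F G Fa Ga.
rewrite !ipd_rcons -IH //; apply: ipd_near.
have := an_nbhs Fa; have := an_nbhs Ga; apply: filterS2 => y Gy Fy.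
by rewrite pdD.
Qed.

Lemma ipd_sum w (F : 'I_3 -> E -> R) x : (forall j, an (F j) x) ->
  ipd w (fun y => \sum_j F j y) x = \sum_j ipd w (F j) x.
Proof.
move=> Fa; rewrite (big3 0) -!ipdD //; apply: ipd_near.
by near=> y; rewrite (big3 0).
Unshelve. all: by end_near. Qed.

(** Vanishing to order n at p. *)
Definition van n F p := forall w, (size w < n)%N -> ipd w F p = 0.

Lemma van_pd n i F p : van n F p -> van n.-1 (pd i F) p.
Proof. by move=> Fv w wn; rewrite -ipd_rcons; apply: Fv; rewrite size_rcons; lia. Qed.

(** In the Leibniz rule only the term with all derivatives on G survives. *)
Lemma van_mul n F G p w : an F p -> an G p -> van n G p -> (size w <= n)%N ->
  ipd w (fun y => F y * G y) p = F p * ipd w G p.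
Proof.
elim/last_ind: w n F G => [//|w i IH] n F G Fa Ga Gv.
rewrite size_rcons => wn; rewrite !ipd_rcons.
have -> : ipd w (pd i (fun y => F y * G y)) p =
    ipd w (fun y => pd i F y * G y + F y * pd i G y) p.
  apply: ipd_near; have := an_nbhs Fa; have := an_nbhs Ga; apply: filterS2 => y Gy Fy.
  by rewrite pdM.
rewrite ipdD // (IH n) //; last exact: ltnW.
rewrite (Gv w wn) mulr0 add0r (IH n.-1) //; first exact: van_pd.
by lia.
Qed.

Lemma van_mul0 n F G p w : an F p -> an G p -> van n G p -> (size w < n)%N ->
  ipd w (fun y => F y * G y) p = 0.
Proof. by move=> Fa Ga Gv wn; rewrite (van_mul Fa Ga Gv (ltnW wn)) Gv // mulr0. Qed.

Definition bil (M : 'I_3 -> 'I_3 -> R) (a b : E) := \sum_i \sum_j M i j * a ord0 i * b ord0 j.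

(** Both indices are expanded in the frame, and the terms with n vanish. *)
Lemma sym_frame (M : 'I_3 -> 'I_3 -> R) (n t1 t2 : E) :
  (forall i j, t1 ord0 i * t1 ord0 j + t2 ord0 i * t2 ord0 j + n ord0 i * n ord0 j / dot n n = (i == j)%:R) ->
  (forall i j, M i j = M j i) -> (forall i, \sum_j n ord0 j * M i j = 0) ->
  forall i j, M i j = bil M t1 t1 * (t1 ord0 i * t1 ord0 j)
    + bil M t1 t2 * (t1 ord0 i * t2 ord0 j + t2 ord0 i * t1 ord0 j)
    + bil M t2 t2 * (t2 ord0 i * t2 ord0 j).
Proof.
move=> fr Ms Mn i j.
have d (k : 'I_3) (g : 'I_3 -> R) : g k = \sum_l (k == l)%:R * g l.
  rewrite (bigD1 k) //= eqxx mul1r big1 ?addr0 // => l lk.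
  by rewrite eq_sym (negPf lk) mul0r.
have row (k : 'I_3) : M k j = t1 ord0 j * (\sum_l M k l * t1 ord0 l) + t2 ord0 j * (\sum_l M k l * t2 ord0 l).
  rewrite (d j (M k)) !mulr_sumr -big_split /=.
  under eq_bigr => l _ do rewrite -fr.
  have -> : \sum_l (t1 ord0 j * t1 ord0 l + t2 ord0 j * t2 ord0 l + n ord0 j * n ord0 l / dot n n) * M k l
     = \sum_l (t1 ord0 j * (M k l * t1 ord0 l) + t2 ord0 j * (M k l * t2 ord0 l))
      + n ord0 j / dot n n * \sum_l n ord0 l * M k l.
    by rewrite mulr_sumr -big_split /=; apply: eq_bigr => l _; ring.
  by rewrite Mn mulr0 addr0.
have col (a : E) : \sum_l M i l * a ord0 l = t1 ord0 i * bil M t1 a + t2 ord0 i * bil M t2 a.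
  rewrite (d i (fun k => \sum_l M k l * a ord0 l)).
  under eq_bigr => k _ do rewrite -fr.
  have -> : \sum_k (t1 ord0 i * t1 ord0 k + t2 ord0 i * t2 ord0 k + n ord0 i * n ord0 k / dot n n)
      * (\sum_l M k l * a ord0 l) =
      t1 ord0 i * bil M t1 a + t2 ord0 i * bil M t2 a +
      n ord0 i / dot n n * \sum_l a ord0 l * \sum_k n ord0 k * M l k.
    rewrite /bil !mulr_sumr.
    have -> : \sum_l n ord0 i / dot n n * (a ord0 l * \sum_k n ord0 k * M l k) =
       \sum_k \sum_l n ord0 i / dot n n * (a ord0 l * (n ord0 k * M k l)).
      rewrite exchange_big /=; apply: eq_bigr => l _; rewrite !mulr_sumr.
      by apply: eq_bigr => k _; rewrite (Ms l k).
    rewrite -!big_split /=; apply: eq_bigr => k _.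
    rewrite !mulr_sumr -!big_split /=; apply: eq_bigr => l _; ring.
  by rewrite big1 ?mulr0 ?addr0 // => l _; rewrite Mn mulr0.
have b21 : bil M t2 t1 = bil M t1 t2.
  rewrite /bil exchange_big /=; apply: eq_bigr => k _; apply: eq_bigr => l _.
  by rewrite Ms; ring.
by rewrite row !col b21; ring.
Qed.

(** The traceless symmetric forms on the tangent plane are a plane with
    coordinates A = M(t1, t1) and B = M(t1, t2); pairing with H sees only the
    traceless part of H. *)
Lemma bil_zero (M : 'I_3 -> 'I_3 -> R) (n t1 t2 : E) :
  (forall i j, t1 ord0 i * t1 ord0 j + t2 ord0 i * t2 ord0 j + n ord0 i * n ord0 j / dot n n = (i == j)%:R) ->
  dot t1 t1 = 1 -> dot t2 t2 = 1 -> dot t1 t2 = 0 ->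
  (forall i j, M i j = M j i) -> (forall i, \sum_j n ord0 j * M i j = 0) ->
  \sum_i M i i = 0 ->
  bil M t2 t2 = - bil M t1 t1 /\
  (forall H : 'I_3 -> 'I_3 -> R, (forall i j, H i j = H j i) -> \sum_i \sum_j H i j * M i j = 0 ->
    (bil H t1 t1 - bil H t2 t2) * bil M t1 t1 + 2 * bil H t1 t2 * bil M t1 t2 = 0) /\
  (bil M t1 t1 = 0 -> bil M t1 t2 = 0 -> forall i j, M i j = 0).
Proof.
move=> fr t11 t22 t12 Ms Mn Mt.
have F := sym_frame fr Ms Mn.
have C : bil M t2 t2 = - bil M t1 t1.
  have G (a b c : R) : (forall i j, M i j = a * (t1 ord0 i * t1 ord0 j)
      + b * (t1 ord0 i * t2 ord0 j + t2 ord0 i * t1 ord0 j) + c * (t2 ord0 i * t2 ord0 j)) ->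
      \sum_i M i i = a * dot t1 t1 + 2 * b * dot t1 t2 + c * dot t2 t2.
    move=> e; rewrite /dot !mulr_sumr -!big_split /=; apply: eq_bigr => i _; rewrite e; ring.
  by move: (G _ _ _ F); rewrite t11 t22 t12 Mt; lra.
split=> //; split=> [H Hs HM|A0 B0 i j]; last first.
  by rewrite F C A0 B0 oppr0 !mul0r !addr0.
have H21 : bil H t2 t1 = bil H t1 t2.
  rewrite /bil exchange_big /=; apply: eq_bigr => k _; apply: eq_bigr => l _.
  by rewrite Hs; ring.
have G (a b c : R) : (forall i j, M i j = a * (t1 ord0 i * t1 ord0 j)
      + b * (t1 ord0 i * t2 ord0 j + t2 ord0 i * t1 ord0 j) + c * (t2 ord0 i * t2 ord0 j)) ->
    \sum_i \sum_j H i j * M i j =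
      a * bil H t1 t1 + b * (bil H t1 t2 + bil H t2 t1) + c * bil H t2 t2.
  move=> e; rewrite /bil.
  rewrite -big_split /= !mulr_sumr -!big_split /=; apply: eq_bigr => i _.
  rewrite -big_split /= !mulr_sumr -!big_split /=; apply: eq_bigr => j _.
  rewrite e; ring.
by move: (G _ _ _ F); rewrite HM C H21; lra.
Qed.

Section LeadingOrder.
Variables (f : E -> R) (V : set E) (u : E -> E) (p : E).
Hypotheses (Vo : open V) (fa : forall x, V x -> an f x) (ub : beltr f V u) (Vp : V p).
Local Notation u_ j := (fun y => u y ord0 j).

(** All lower-order terms drop out: curl, divergence, the derivative of
    N . u = 0, and the Hessian identity. *)
Lemma leading_order k w : (forall j, van k.+1 (u_ j) p) -> size w = k ->
  [/\ forall i j, ipd w (pd i (u_ j)) p = ipd w (pd j (u_ i)) p,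
      \sum_i ipd w (pd i (u_ i)) p = 0,
      forall i, \sum_j grad f p ord0 j * ipd w (pd i (u_ j)) p = 0 &
      \sum_i \sum_j pd i (pd j f) p * ipd w (pd i (u_ j)) p = 0].
Proof.
move=> uv wk; have fp := fa Vp; have [ua _ _] := ub Vp.
have sw : (size w < k.+1)%N by rewrite wk.
have uc i : ipd w (pd (i + 1) (u_ (i + 1 + 1))) p = ipd w (pd (i + 1 + 1) (u_ (i + 1))) p.
  have e y : V y -> pd (i + 1) (u_ (i + 1 + 1)) y = pd (i + 1 + 1) (u_ (i + 1)) y + f y * u y ord0 i.
    by move=> Vy; have [_ /(_ i) <- _] := ub Vy; ring.
  rewrite (ipd_on w Vo e Vp) ipdD // (van_mul0 fp (ua i) (uv i) sw) addr0 //.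
split.
- have c0 := uc 0; have c1 := uc 1; have c2 := uc (1 + 1).
  rewrite ?i3_1 ?i3_3 ?i3_1 in c0 c1 c2.
  by apply: all3; apply: all3 => //.
- rewrite -ipd_sum //.
  have e y : V y -> \sum_j pd j (u_ j) y = 0 by move=> /ub[].
  by rewrite (ipd_on w Vo e Vp) ipd0.
- move=> i; have e y : V y -> \sum_j pd j f y * u y ord0 j = 0.
    by move=> Vy; exact: (beltrami_orth Vo fa ub Vy).
  have := ipd_on (rcons w i) Vo e Vp; rewrite ipd0 ipd_sum // => e0; apply: etrans e0.
  apply: eq_bigr => j _; rewrite grad_pd -ipd_rcons.
  by rewrite (van_mul (n := k.+1)) // size_rcons wk.
have e y : V y -> 2 * (\sum_i \sum_j pd i (pd j f) y * pd i (u_ j) y) +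
    \sum_j u y ord0 j * pd j (fun y => \sum_i pd i (pd i f) y) y = 0.
  by move=> Vy; exact: (beltrami_hess Vo fa ub Vy).
have := ipd_on w Vo e Vp; rewrite ipd0 ipdD //.
rewrite [X in _ + X]ipd_sum // [X in _ + X]big1 ?addr0; last first.
  move=> j _; have e' y : V y -> u y ord0 j * pd j (fun y => \sum_i pd i (pd i f) y) y =
     pd j (fun y => \sum_i pd i (pd i f) y) y * u y ord0 j by move=> _; rewrite mulrC.
  by rewrite (ipd_on w Vo e' Vp) (van_mul0 _ (ua j) (uv j)).
have -> : ipd w (fun y => 2 * (\sum_i \sum_j pd i (pd j f) y * pd i (u_ j) y)) p =
   2 * ipd w (fun y => \sum_i \sum_j pd i (pd j f) y * pd i (u_ j) y) p.
  have e' y : V y -> 2 * (\sum_i \sum_j pd i (pd j f) y * pd i (u_ j) y) =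
      (\sum_i \sum_j pd i (pd j f) y * pd i (u_ j) y) + \sum_i \sum_j pd i (pd j f) y * pd i (u_ j) y.
    by move=> _; ring.
  by rewrite (ipd_on w Vo e' Vp) ipdD // mulr2n mulrDl mul1r.
move=> /eqP; rewrite mulf_eq0 pnatr_eq0 /= => /eqP e0; apply: etrans e0.
rewrite ipd_sum //; apply: eq_bigr => i _; rewrite ipd_sum //; apply: eq_bigr => j _.
by rewrite (van_mul (n := k)) ?wk //; exact: (van_pd i (uv j)).
Qed.

(** The additional symmetry that is available from second derivatives on. *)
Lemma ipd_swap w i j k : ipd (rcons w i) (pd j (u_ k)) p = ipd (rcons w j) (pd i (u_ k)) p.
Proof.
rewrite !ipd_rcons; apply: (ipd_on w Vo) Vp => y Vy.
by have [ua _ _] := ub Vy; rewrite pdC.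
Qed.

End LeadingOrder.

Section NonUmbilic.
Variables (f : E -> R) (V : set E) (p : E) (t1 t2 : E).
Hypotheses (Vo : open V) (fa : forall x, V x -> an f x) (Vp : V p).
Let n := grad f p.
Let H i j := pd i (pd j f) p.
Hypotheses (fr : forall i j, t1 ord0 i * t1 ord0 j + t2 ord0 i * t2 ord0 j + n ord0 i * n ord0 j / dot n n = (i == j)%:R).
Hypotheses (t11 : dot t1 t1 = 1) (t22 : dot t2 t2 = 1) (t12 : dot t1 t2 = 0).
Let d := bil H t1 t1 - bil H t2 t2.
Let h := bil H t1 t2.
Hypothesis nu : d != 0 \/ h != 0.

(** The determinant of the system is d^2 + 4 h^2. *)
Lemma nonumbilic_det (A B : R) : d * A + 2 * h * B = 0 -> d * B - 2 * h * A = 0 -> A = 0 /\ B = 0.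
Proof.
move=> e1 e2.
have D0 : d ^+ 2 + (2 * h) ^+ 2 != 0.
  rewrite paddr_eq0 ?sqr_ge0 // !sqrf_eq0 mulf_eq0 pnatr_eq0 /=.
  by apply/negP => /andP[/eqP d0 /eqP h0]; case: nu; rewrite ?d0 ?h0 eqxx.
have a : (d ^+ 2 + (2 * h) ^+ 2) * A = d * (d * A + 2 * h * B) - 2 * h * (d * B - 2 * h * A) by ring.
have b : (d ^+ 2 + (2 * h) ^+ 2) * B = 2 * h * (d * A + 2 * h * B) + d * (d * B - 2 * h * A) by ring.
move: a b; rewrite e1 e2 !mulr0 subrr addr0 => /eqP a /eqP b.
by move: a b; rewrite !mulf_eq0 (negPf D0) /= => /eqP -> /eqP ->.
Qed.

Lemma Hsym i j : H i j = H j i. Proof. by apply: pdC; exact: fa. Qed.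

(** Three linear functionals of the 1-jet of u at p.  The third is chosen so that
    its vanishing is the second equation of [nonumbilic_det] for the first
    derivatives, where the symmetry [ipd_swap] is not available. *)
Definition jet_test (u : E -> E) : 'I_3 -> R := fun k =>
  if k == 0 then dot (u p) t1 else if k == 1 then dot (u p) t2 else
  d * bil (fun i j => pd i (fun y => u y ord0 j) p) t1 t2
   - 2 * h * bil (fun i j => pd i (fun y => u y ord0 j) p) t1 t1.

(** For derivatives of order at least 2 let A_l and B_l be the coefficients of
    d_w d_l d_i u_j.  By symmetry in l, i, j the sums a1, b1 of t1_l A_l and
    t1_l B_l satisfy t2 . A = b1 and t2 . B = - a1, because the forms are
    traceless.  The equation d A_l + 2 h B_l = 0, contracted with t1 and with t2,
    gives both equations of [nonumbilic_det] for a1 and b1. *)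
Lemma jet_test_van u : beltr f V u -> (forall k, jet_test u k = 0) ->
  forall k j, van k (fun y => u y ord0 j) p.
Proof.
move=> ub L0; have [ua _ _] := ub p Vp.
have un : dot (u p) n = 0.
  rewrite dotC; have := beltrami_orth Vo fa ub Vp => e; apply: etrans e.
  by apply: eq_bigr => j _; rewrite grad_pd.
have v1 j : van 1 (fun y => u y ord0 j) p.
  case=> // _; rewrite /= (frame_expand (u p) fr) un.
  have := L0 0; have := L0 1; rewrite /jet_test /= => -> ->.
  by rewrite !mul0r !scale0r !addr0 mxE.
have v2 j : van 2 (fun y => u y ord0 j) p.
  move=> w; rewrite ltnS leq_eqVlt => /orP[/eqP|w0]; last exact: v1.
  case: w => [//|i [|//]] _ /=.
  have [s t o hh] := leading_order Vo fa ub Vp (w := [::]) v1 erefl.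
  have [_ [/(_ H Hsym hh) e1 z]] := bil_zero fr t11 t22 t12 s o t.
  have e2 := L0 (1 + 1); rewrite /jet_test /= in e2.
  have [a0 b0] := nonumbilic_det e1 e2.
  exact: (z a0 b0).
elim=> [//|[|[|k]] IH] j; [exact: v1|exact: v2|].
move=> w; rewrite ltnS leq_eqVlt => /orP[/eqP wk|]; last exact: IH.
case: (lastP w) wk => [//|w1 i]; rewrite size_rcons => -[wk]; rewrite ipd_rcons.
case: (lastP w1) wk => [//|w' l]; rewrite size_rcons => -[wk].
pose T l i j := ipd (rcons w' l) (pd i (fun y => u y ord0 j)) p.
have LO l0 := leading_order Vo fa ub Vp (k := k.+1) (w := rcons w' l0) IH
   (etrans (size_rcons _ _) (congr1 S wk)).
have Ts l0 i0 j0 : T l0 i0 j0 = T i0 l0 j0 by exact: (ipd_swap Vo ub Vp).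
pose A l0 := bil (T l0) t1 t1; pose B l0 := bil (T l0) t1 t2.
have BZ l0 : [/\ bil (T l0) t2 t2 = - A l0, d * A l0 + 2 * h * B l0 = 0 &
    A l0 = 0 -> B l0 = 0 -> forall i j, T l0 i j = 0].
  have [s t o hh] := LO l0.
  have [e0 [/(_ H Hsym hh) e1 z]] := bil_zero fr t11 t22 t12 s o t.
  by split.
have sw (a b c : E) : \sum_l0 a ord0 l0 * bil (T l0) b c = \sum_l0 b ord0 l0 * bil (T l0) a c.
  rewrite /bil; under eq_bigr => l0 _ do rewrite mulr_sumr.
  rewrite exchange_big /=; apply: eq_bigr => i0 _; rewrite mulr_sumr.
  apply: eq_bigr => l0 _; rewrite !mulr_sumr; apply: eq_bigr => j0 _.
  by rewrite Ts; ring.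
have Tn (b c : E) : \sum_l0 n ord0 l0 * bil (T l0) b c = 0.
  rewrite sw big1 // => l0 _; rewrite /bil exchange_big /= big1 ?mulr0 // => j0 _.
  have [s _ o _] := LO l0.
  transitivity (c ord0 j0 * \sum_i0 n ord0 i0 * T l0 j0 i0); last by rewrite o mulr0.
  by rewrite mulr_sumr; apply: eq_bigr => i0 _; rewrite /T (s i0 j0); ring.
pose a1 := \sum_l0 t1 ord0 l0 * A l0; pose b1 := \sum_l0 t1 ord0 l0 * B l0.
have a2 : \sum_l0 t2 ord0 l0 * A l0 = b1.
  rewrite /A sw /b1; apply: eq_bigr => l0 _; congr (_ * _); rewrite /B /bil exchange_big /=.
  have [s _ _ _] := LO l0.
  by apply: eq_bigr => i0 _; apply: eq_bigr => j0 _; rewrite /T (s j0 i0); ring.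
have b2 : \sum_l0 t2 ord0 l0 * B l0 = - a1.
  rewrite /B sw /a1 -sumrN; apply: eq_bigr => l0 _.
  by have [-> _ _] := BZ l0; rewrite mulrN.
have lc (c1 c2 : R) (X Y : 'I_3 -> R) :
    c1 * \sum_l0 X l0 + c2 * \sum_l0 Y l0 = \sum_l0 (c1 * X l0 + c2 * Y l0).
  by rewrite !mulr_sumr -big_split.
have e1 : d * a1 + 2 * h * b1 = 0.
  rewrite /a1 /b1 lc big1 // => l0 _.
  by have [_ e _] := BZ l0; rewrite -[RHS](mulr0 (t1 ord0 l0)) -e; ring.
have e2 : d * b1 - 2 * h * a1 = 0.
  rewrite -a2 -mulrN -b2 lc big1 // => l0 _.
  by have [_ e _] := BZ l0; rewrite -[RHS](mulr0 (t2 ord0 l0)) -e; ring.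
have [a0 b0] := nonumbilic_det e1 e2.
have z (X : 'I_3 -> R) : \sum_l0 t1 ord0 l0 * X l0 = 0 -> \sum_l0 t2 ord0 l0 * X l0 = 0 ->
    \sum_l0 n ord0 l0 * X l0 = 0 -> X l = 0.
  move=> z1 z2 z3.
  have e (a : E) : dot (\row_j X j) a = \sum_l0 a ord0 l0 * X l0.
    by apply: eq_bigr => l0 _; rewrite mxE mulrC.
  have := congr1 (fun v : E => v ord0 l) (frame_expand (\row_j X j) fr).
  by rewrite !e z1 z2 z3 mul0r !scale0r !addr0 !mxE.
have [_ _ q] := BZ l.
apply: q; apply: z => //; [by rewrite a2|exact: Tn|by rewrite b2 a0 oppr0|exact: Tn].
Qed.

End NonUmbilic.

Lemma beltr_comb f V m (v : 'I_m -> E -> E) (c : 'I_m -> R) : (forall i : 'I_m, beltr f V (v i)) ->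
  beltr f V (fun x => \sum_i c i *: v i x).
Proof.
move=> vb x Vx.
have va (i : 'I_m) j : an (fun y => v i y ord0 j) x by have [] := vb i x Vx.
have cE j : (fun y => (\sum_i c i *: v i y) ord0 j) = (fun y => \sum_i c i * v i y ord0 j).
  by apply/funext => y; rewrite summxE; apply: eq_bigr => i _; rewrite mxE.
have pE k j : pd k (fun y => (\sum_i c i *: v i y) ord0 j) x = \sum_i c i * pd k (fun y => v i y ord0 j) x.
  rewrite cE pd_sum => [|i _]; last by apply: anM; [exact: an_cst|exact: va].
  by apply: eq_bigr => i _; rewrite pdM ?pd_cst ?mul0r ?add0r //; exact: an_cst.
split.
- by move=> j; rewrite cE; apply: an_sum => i _; apply: anM; [exact: an_cst|exact: va].
- move=> i; rewrite !pE -sumrB summxE mulr_sumr; apply: eq_bigr => k _.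
  by have [_ /(_ i) e _] := vb k x Vx; rewrite mxE -mulrBr e; ring.
under eq_bigr => i _ do rewrite pE.
rewrite exchange_big big1 //= => k _; rewrite -mulr_sumr.
by have [_ _ ->] := vb k x Vx; rewrite mulr0.
Qed.

Lemma beltr_identity f V u p : open V -> connected V -> beltr f V u -> V p ->
  (forall k j, van k (fun y => u y ord0 j) p) -> forall x, V x -> u x = 0.
Proof.
move=> Vo Vc ub Vp uv x Vx; apply/rowP => j; rewrite mxE.
have ua y : V y -> an (fun y => u y ord0 j) y by move=> /ub[].
have u0 : \forall y \near p, u y ord0 j = 0.
  apply: an_zero_near; first exact: ua.
  by move=> w; rewrite -ipdE; exact: (uv (size w).+1).
exact: nbhs_singleton (identity_theorem Vc ua Vp u0 Vx).
Qed.

Theorem nonumbilic_dim (U : set E) f : open U -> connected U ->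
  (forall x, U x -> an f x) -> (forall x, U x -> grad f x != 0) ->
  (forall x, U x -> ~ umbilic f x) -> dim_at_most U (beltrami f U) 3.
Proof.
move=> Uo Uc fa g0 nu m v vS vI; rewrite leqNgt; apply/negP => m3.
have [U0|/set0P[p Up]] := eqVneq U set0.
  have := vI (fun=> 1) _ (Ordinal m3); rewrite U0 => /(_ (fun x => False_ind _)) /eqP.
  by rewrite oner_eq0.
have vb (i : 'I_m) : beltr f U (v i) by apply/beltramiP.
have [t1 [t2 [[t1n t2n [t11 t22 t12]] [_ _ fr]]]] := orthonormal_frame (g0 p Up).
pose H i j := pd i (pd j f) p.
have hE (a b : E) : hess f p a b = bil H a b by [].
have Hs i j : H i j = H j i by apply: pdC; exact: fa.
have hC a b : bil H a b = bil H b a.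
  rewrite /bil exchange_big /=; apply: eq_bigr => k _; apply: eq_bigr => l _.
  by rewrite Hs; ring.
have nup : bil H t1 t1 - bil H t2 t2 != 0 \/ bil H t1 t2 != 0.
  case: (eqVneq (bil H t1 t2) 0) => [h0|]; last by right.
  left; apply/eqP => /subr0_eq d0; apply: (nu p Up).
  apply/umbilicP; [exact: fa|exact: g0|].
  exists (bil H t1 t1) => a b an0 bn0; rewrite hE.
  have bl (c : R) (x y z : E) : bil H (c *: x + y) z = c * bil H x z + bil H y z.
    rewrite /bil mulr_sumr -big_split /=; apply: eq_bigr => k _.
    by rewrite mulr_sumr -big_split /=; apply: eq_bigr => l _; rewrite !mxE; ring.
  have aE := frame_expand a fr; have bE := frame_expand b fr.
  rewrite an0 mul0r scale0r addr0 in aE; rewrite bn0 mul0r scale0r addr0 in bE.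
  rewrite [in RHS]aE [in RHS]bE [in LHS]aE [in LHS]bE.
  rewrite -[dot a t2 *: t2]addr0 -[dot b t2 *: t2]addr0.
  have bl0 z : bil H 0 z = 0 by rewrite /bil big1 // => k _; rewrite big1 // => l _; rewrite !mxE; ring.
  rewrite !bl !(hC _ (_ *: t1 + _)) !bl !bl0 !(hC _ 0) !bl0 (hC t2 t1) h0 -d0.
  rewrite !addr0 dotDl !dotDr !dotZl !dotZr t11 t22 t12 (dotC t2 t1) t12; ring.
pose L : 'M[R]_(m, 3) := \matrix_(i < m, k < 3) jet_test f p t1 t2 (v i) k.
have kn : kermx L != 0.
  rewrite -mxrank_eq0 mxrank_ker subn_eq0 -ltnNge.
  exact: leq_ltn_trans (rank_leq_col L) m3.
pose c (i : 'I_m) := (nz_row (kermx L)) ord0 i.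
have cL : nz_row (kermx L) *m L = 0.
  by apply/sub_kermxP; exact: nz_row_sub.
have c0 : nz_row (kermx L) != 0 by rewrite nz_row_eq0.
pose u x := \sum_i c i *: v i x.
have ub : beltr f U u by exact: beltr_comb.
have u0 : forall x, U x -> u x = 0.
  apply: (beltr_identity Uo Uc ub Up).
  apply: (jet_test_van Uo fa Up fr t11 t22 t12 nup ub) => k.
  have va (i : 'I_m) j : an (fun y => v i y ord0 j) p by have [] := vb i p Up.
  have uE j : u p ord0 j = \sum_i c i * v i p ord0 j.
    by rewrite summxE; apply: eq_bigr => i _; rewrite mxE.
  have pE k' j : pd k' (fun y => u y ord0 j) p = \sum_i c i * pd k' (fun y => v i y ord0 j) p.
    rewrite (_ : (fun y => u y ord0 j) = (fun y => \sum_i c i * v i y ord0 j)); last first.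
      by apply/funext => y; rewrite summxE; apply: eq_bigr => i _; rewrite mxE.
    rewrite pd_sum => [|i _]; last by apply: anM; [exact: an_cst|exact: va].
    by apply: eq_bigr => i _; rewrite pdM ?pd_cst ?mul0r ?add0r //; exact: an_cst.
  have dE (t : E) : dot (u p) t = \sum_i c i * dot (v i p) t.
    rewrite /dot; under eq_bigr => j _ do rewrite uE mulr_suml.
    rewrite exchange_big /=; apply: eq_bigr => i _; rewrite mulr_sumr.
    by apply: eq_bigr => j _; rewrite mulrA.
  have bE (a b : E) : bil (fun i j => pd i (fun y => u y ord0 j) p) a b =
     \sum_i c i * bil (fun i0 j => pd i0 (fun y => v i y ord0 j) p) a b.
    rewrite /bil.
    under eq_bigr => k' _ do under eq_bigr => j _ do rewrite pE !mulr_suml.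
    under eq_bigr => k' _ do rewrite exchange_big /=.
    rewrite exchange_big /=; apply: eq_bigr => i _; rewrite mulr_sumr.
    apply: eq_bigr => k' _; rewrite mulr_sumr; apply: eq_bigr => j _; ring.
  have := congr1 (fun M : 'rV_3 => M ord0 k) cL; rewrite !mxE => e; apply: etrans e.
  rewrite /jet_test; under [RHS]eq_bigr => i _ do rewrite mxE /jet_test.
  case: ifP => _; first exact: dE.
  case: ifP => _; first exact: dE.
  rewrite !bE !mulr_sumr -sumrB; apply: eq_bigr => i _; rewrite /c; ring.
case/eqP: c0; apply/rowP => i; rewrite mxE; exact: (vI c u0 i).
Qed.

End Vanishing.

(** * The determinant obstruction and its top coefficient *)

Section Algebra.
Context {R : realType}.
Local Notation E := 'rV[R]_3.

Lemma det_zero (u a b c : E) : u != 0 -> dot u a = 0 -> dot u b = 0 -> dot u c = 0 ->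
  dot a (cross b c) = 0.
Proof.
move=> u0 ua ub uc; apply/eqP; apply: contraNT u0 => d0.
have e : dot a (cross b c) *: u = dot u a *: cross b c + dot u b *: cross c a + dot u c *: cross a b.
  by apply: rowP3; rewrite !(mxE, crossE, dot3) ?i3_3 ?i3_1; ring.
by move/eqP: e; rewrite ua ub uc !scale0r !addr0 scaler_eq0 (negPf d0).
Qed.

(** The determinant of r, Z and Z1 expanded in Gram minors and triple products
    of r and the vectors V, V', V''.  The r-component of Z1 drops out. *)
Lemma bracket_table (r V V1 V2 : E) (al be ga a1 a2 b1 b2 g' c : R) :
  let Rr := dot r r in let t := dot r V in let m := dot r V1 in let m2 := dot r V2 in
  let S := Rr * dot V V - t ^+ 2 in
  let S1 := Rr * dot V V1 - t * m in
  let S2 := Rr * dot V V2 - t * m2 in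
  let S11 := Rr * dot V1 V1 - m ^+ 2 in
  let T1 := dot r (cross V V1) in let T2 := dot r (cross V V2) in let T3 := dot r (cross V1 V2) in
  dot r (cross (al *: V + be *: cross V r + ga *: V1)
     (a1 *: V + a2 *: V1 + g' *: V2 + b1 *: cross V r + b2 *: cross V1 r + c *: r)) =
  al * a2 * T1 + al * g' * T2 - al * b1 * S - al * b2 * S1
  + be * a1 * S + be * a2 * S1 + be * g' * S2 + be * b2 * Rr * T1
  - ga * a1 * T1 + ga * g' * T3 - ga * b1 * S1 - ga * b2 * S11.
Proof.
move=> Rr t m m2 S S1 S2 S11 T1 T2 T3.
have cD (x y z : E) : cross x (y + z) = cross x y + cross x z.
  by apply: rowP3; rewrite !(mxE, crossE) ?i3_3 ?i3_1; ring.
have cDl (x y z : E) : cross (y + z) x = cross y x + cross z x.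
  by apply: rowP3; rewrite !(mxE, crossE) ?i3_3 ?i3_1; ring.
have cZ (a : R) (x y : E) : cross x (a *: y) = a *: cross x y.
  by apply: rowP3; rewrite !(mxE, crossE) ?i3_3 ?i3_1; ring.
have cZl (a : R) (x y : E) : cross (a *: x) y = a *: cross x y.
  by apply: rowP3; rewrite !(mxE, crossE) ?i3_3 ?i3_1; ring.
have br (x : E) : dot r (cross x r) = 0 by rewrite !dot3 !crossE; ring.
have bb (x : E) : dot r (cross x x) = 0 by rewrite !dot3 !crossE; ring.
have bs (x y : E) : dot r (cross y x) = - dot r (cross x y) by rewrite !dot3 !crossE; ring.
have bB (x y : E) : dot r (cross x (cross y r)) = dot r x * dot r y - Rr * dot x y.
  by rewrite /Rr !dot3 !crossE; ring.
have BB (x y : E) : dot r (cross (cross x r) (cross y r)) = Rr * dot r (cross x y).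
  by rewrite /Rr !dot3 !crossE; ring.
rewrite !cD !cDl !cZ !cZl !dotDr !dotZr !br !BB !bb (bs V (cross V r)) (bs V1 (cross V r)).
rewrite (bs V2 (cross V r)) !bB (bs V V1) -/T1 -/T2 -/T3 -/t -/m -/m2 (dotC V1 V) (dotC V2 V).
rewrite /S /S1 /S2 /S11; ring.
Qed.

(** The determinant of rho, Z and Z1, with ri = 1 / |rho|^2 as the only
    denominator; k is 0 for planes and 1 for spheres.  Rr, t, m, S, S1, S2, S11
    and T1, T2, T3 are the products of [bracket_table]; ta, sg and pi are tau and
    its successive normal coefficients.  The quantities dta, dR, dsg, ... are
    derivatives along the normal; al, be, ga are the coefficients of Z, and a1, a2,
    ga, b1, b2 those of Z1.  The ring is arbitrary because the formula is evaluated
    at polynomials and at their residues modulo 1 + h^2. *)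
Definition obstruction (C : comNzRingType) (k f Rr ri t m ta sg pi S S1 S2 S11 T1 T2 T3 : C) : C :=
  let al := sg * Rr - k * ta ^+ 2 in
  let be := 2 * f * ta ^+ 2 in
  let ga := - (Rr * ta) in
  let dta := ta * t * ri + sg in
  let dR := 2 * k * ta - 2 * t in
  let dsg := ta * m * ri + pi in
  let dal := dsg * Rr + sg * dR - 2 * k * ta * dta in
  let dbe := 2 * ta ^+ 2 + 4 * f * ta * dta in
  let dga := - (dR * ta + Rr * dta) in
  let a1 := dal + (al * t + ga * m) * ri + f * ta * be in
  let a2 := al + dga in
  let b1 := dbe + be * k * ta * ri - f * ta * al * ri in
  let b2 := be - f * ta * ga * ri in
  al * a2 * T1 + al * ga * T2 - al * b1 * S - al * b2 * S1
  + be * a1 * S + be * a2 * S1 + be * ga * S2 + be * b2 * Rr * T1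
  - ga * a1 * T1 + ga * ga * T3 - ga * b1 * S1 - ga * b2 * S11.

(** The case k = 0 with ta, sg, pi replaced by ta / w, sg / w, pi / w and cleared
    of the powers of w.  Its value at w = 0 is the coefficient of the highest
    power when ta, sg and pi are affine in a parameter 1 / w. *)
Definition obstruction_flat (C : comNzRingType) (w f Rr ri t m ta sg pi S S1 S2 S11 T1 T2 T3 : C) : C :=
  let al := sg * Rr in
  let be := 2 * f * ta ^+ 2 in
  let ga := - (Rr * ta) in
  let dta := ta * t * ri + sg in
  let dR := - (2 * t) in
  let dsg := ta * m * ri + pi in
  let dal := dsg * Rr + sg * dR in
  let dbe := 2 * ta ^+ 2 + 4 * f * ta * dta in
  let dga := - (dR * ta + Rr * dta) in
  let a1 := (dal + (al * t + ga * m) * ri) * w ^+ 2 + f * ta * be in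
  let a2 := al + dga in
  let b1 := dbe - f * ta * al * ri in
  let b2 := be - f * ta * ga * ri in
  w ^+ 3 * (al * a2 * T1 + al * ga * T2 + ga * ga * T3)
  + w ^+ 2 * (be * a2 * S1 - al * b1 * S - al * b2 * S1 + be * ga * S2  - ga * b1 * S1 - ga * b2 * S11)
  + be * a1 * S + w * (be * b2 * Rr * T1 - ga * a1 * T1).

Lemma obstruction_flatE (w f Rr ri t m ta sg pi S S1 S2 S11 T1 T2 T3 : R) : w != 0 ->
  obstruction_flat w f Rr ri t m ta sg pi S S1 S2 S11 T1 T2 T3 =
  w ^+ 5 * obstruction 0 f Rr ri t m (ta / w) (sg / w) (pi / w) S S1 S2 S11 T1 T2 T3.
Proof. by move=> w0; rewrite /obstruction_flat /obstruction /=; field. Qed.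

Lemma obstruction_flat0 (C : comNzRingType) (f Rr ri t m ta sg pi S S1 S2 S11 T1 T2 T3 : C) :
  obstruction_flat 0 f Rr ri t m ta sg pi S S1 S2 S11 T1 T2 T3 = 4 * f ^+ 3 * ta ^+ 5 * S.
Proof. by rewrite /obstruction_flat /=; ring. Qed.

(** The case k = 1, likewise cleared of the denominators w of all quantities that
    are trigonometric along a circle, w = 1 + h^2 being the denominator of the
    rational parametrization. *)
Definition obstruction_round (C : comNzRingType) (w f Rr ri t m m2 ta sg pi g g1 g2 g11 T1 T2 T3 : C) : C :=
  let al := w * sg * Rr - ta ^+ 2 in
  let be := 2 * f * ta ^+ 2 in
  let ga := - (Rr * ta) in
  let dta := ta * t * ri + w * sg in
  let dR := 2 * ta - 2 * t in
  let dsg := ta * m * ri + w * pi in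
  let dal := w * (dsg * Rr + sg * dR) - 2 * ta * dta in
  let dbe := 2 * w * ta ^+ 2 + 4 * f * ta * dta in
  let dga := - (dR * ta + Rr * dta) in
  let a1 := dal + (al * t + w * ga * m) * ri + f * ta * be in
  let a2 := al + dga in
  let b1 := dbe + be * ta * ri - f * ta * al * ri in
  let b2 := be - f * ta * ga * ri in
  let S := w ^+ 2 * Rr * g - t ^+ 2 in
  let S1 := w ^+ 2 * Rr * g1 - t * m in
  let S2 := w ^+ 2 * Rr * g2 - t * m2 in
  let S11 := w ^+ 2 * Rr * g11 - m ^+ 2 in
  w ^+ 2 * (al * a2 * T1) + w ^+ 3 * al * ga * T2 - al * b1 * S - w * (al * b2 * S1)
  + be * a1 * S + w * (be * a2 * S1) + w ^+ 2 * (be * ga * S2) + w ^+ 2 * (be * b2 * Rr * T1)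
  - w ^+ 2 * (ga * a1 * T1) + w ^+ 4 * (ga * ga * T3) - w * (ga * b1 * S1) - w ^+ 2 * (ga * b2 * S11).

Lemma obstruction_roundE (w f Rr ri t m m2 ta sg pi g g1 g2 g11 T1 T2 T3 : R) : w != 0 ->
  obstruction_round w f Rr ri t m m2 ta sg pi g g1 g2 g11 T1 T2 T3 =
  w ^+ 7 * obstruction 1 f Rr ri (t / w) (m / w) (ta / w) (sg / w) (pi / w)
    (Rr * g - (t / w) ^+ 2) (Rr * g1 - t / w * (m / w)) (Rr * g2 - t / w * (m2 / w))
    (Rr * g11 - (m / w) ^+ 2) (T1 / w) (T2 / w) (T3 / w).
Proof. by move=> w0; rewrite /obstruction_round /obstruction /=; field. Qed.

Lemma obstruction_round0 (C : comNzRingType) (f Rr ri t m m2 sg pi g g1 g2 g11 T1 T2 T3 : C) :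
  Rr * ri = 1 ->
  obstruction_round 0 f Rr ri t m m2 t sg pi g g1 g2 g11 T1 T2 T3 = - (f * (ri + 4 * f ^+ 2)) * t ^+ 7.
Proof.
move=> h; rewrite /obstruction_round /=.
have -> : ri = ri * (Rr * ri) by rewrite h mulr1.
ring: h.
Qed.

(** Ring morphisms are pushed through the intermediate definitions one at a time,
    which keeps the terms at their written size. *)
Lemma rmorph_let_in (A B : comNzRingType) (phi : {rmorphism A -> B}) (v : A) v' (b : A -> A) (b' : B -> B) :
  phi v = v' -> (forall x, phi (b x) = b' (phi x)) -> phi (let x := v in b x) = (let y := v' in b' y).
Proof. by move=> <- /= ->. Qed.

Ltac rmorph_let phi := repeat
  match goal with |- ?g (let x := ?v in @?b x) = (let y := ?v' in @?b' y) =>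
    refine (@rmorph_let_in _ _ phi v v' b b' _ _);
    [by rewrite !(rmorphD, rmorphB, rmorphN, rmorphM, rmorphXn, rmorph_nat, rmorph1) | cbv beta; intro]
  end.

Lemma rmorph_obstruction_flat (A B : comNzRingType) (phi : {rmorphism A -> B})
    (w f Rr ri t m ta sg pi S S1 S2 S11 T1 T2 T3 : A) :
  phi (obstruction_flat w f Rr ri t m ta sg pi S S1 S2 S11 T1 T2 T3) =
  obstruction_flat (phi w) (phi f) (phi Rr) (phi ri) (phi t) (phi m) (phi ta) (phi sg) (phi pi)
    (phi S) (phi S1) (phi S2) (phi S11) (phi T1) (phi T2) (phi T3).
Proof.
cbv delta [obstruction_flat]; cbv beta; rmorph_let phi.
by rewrite !(rmorphD, rmorphB, rmorphN, rmorphM, rmorphXn, rmorph_nat).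
Qed.

Lemma rmorph_obstruction_round (A B : comNzRingType) (phi : {rmorphism A -> B})
    (w f Rr ri t m m2 ta sg pi g g1 g2 g11 T1 T2 T3 : A) :
  phi (obstruction_round w f Rr ri t m m2 ta sg pi g g1 g2 g11 T1 T2 T3) =
  obstruction_round (phi w) (phi f) (phi Rr) (phi ri) (phi t) (phi m) (phi m2) (phi ta) (phi sg)
    (phi pi) (phi g) (phi g1) (phi g2) (phi g11) (phi T1) (phi T2) (phi T3).
Proof.
cbv delta [obstruction_round]; cbv beta; rmorph_let phi.
by rewrite !(rmorphD, rmorphB, rmorphN, rmorphM, rmorphXn, rmorph_nat).
Qed.

Lemma poly_zero_itv (p : {poly R}) (a b : R) : a < b ->
  (forall x, a <= x <= b -> p.[x] = 0) -> p = 0.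
Proof.
move=> ab p0; pose d := (b - a); have d0 : 0 < d by rewrite subr_gt0.
pose rs := [seq a + d / i.+1%:R | i <- iota 0 (size p)].
apply: (@roots_geq_poly_eq0 _ p rs).
- apply/allP => x /mapP[i _ ->]; apply/rootP; apply: p0.
  have i0 : 0 < (i.+1%:R : R) by [].
  have -> : a <= a + d / i.+1%:R by rewrite lerDl divr_ge0 // ltW.
  rewrite -lerBrDl -/d ler_pdivrMr // ler_peMr ?ler1n // ltW //.
- rewrite map_inj_uniq ?iota_uniq // => i j /addrI /(mulfI (lt0r_neq0 d0)) /invr_inj /eqP.
  by rewrite eqr_nat => /eqP[].
- by rewrite size_map size_iota.
Qed.

(** With w = 1 / (1 + h) the data are affine in w up to the factor 1 / w, so the
    vanishing for small h makes a polynomial in w vanish identically.  Its value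
    at w = 0 is the claim. *)
Lemma flat_curve (f Rr ri t m ta0 ta1 sg0 sg1 pi0 pi1 S S1 S2 S11 T1 T2 T3 de : R) : 0 < de ->
  (forall h, 0 <= h <= de -> obstruction 0 f Rr ri t m (ta0 + h * ta1) (sg0 + h * sg1)
     (pi0 + h * pi1) S S1 S2 S11 T1 T2 T3 = 0) ->
  4 * f ^+ 3 * ta1 ^+ 5 * S = 0.
Proof.
move=> de0 H.
pose L a b : {poly R} := b%:P + (a - b)%:P * 'X.
pose p := obstruction_flat 'X f%:P Rr%:P ri%:P t%:P m%:P (L ta0 ta1) (L sg0 sg1) (L pi0 pi1)
  S%:P S1%:P S2%:P S11%:P T1%:P T2%:P T3%:P.
have pE w : p.[w] = obstruction_flat w f Rr ri t m (ta1 + (ta0 - ta1) * w) (sg1 + (sg0 - sg1) * w)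
    (pi1 + (pi0 - pi1) * w) S S1 S2 S11 T1 T2 T3.
  by rewrite -[p.[w]]/(horner_eval w p) rmorph_obstruction_flat /= /horner_eval /L !hornerE.
have d1 : 1 < 1 + de by rewrite ltrDl.
have p0 : p = 0.
  apply: (@poly_zero_itv _ (1 + de)^-1 1); first by rewrite invf_lt1 //; lra.
  move=> w /andP[w1 w2].
  have w0 : 0 < w by apply: lt_le_trans w1; rewrite invr_gt0; lra.
  rewrite pE obstruction_flatE ?gt_eqF //.
  have e a b : (b + (a - b) * w) / w = a + (w^-1 - 1) * b by field; rewrite gt_eqF.
  rewrite !e H ?mulr0 //.
  have : w^-1 <= 1 + de by rewrite -[leRHS]invrK lef_pV2 // posrE invr_gt0; lra.
  have : 1 <= w^-1 by rewrite invf_ge1.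
  lra.
have := pE 0; rewrite p0 horner0 obstruction_flat0 => /esym; rewrite mulr0 addr0; exact.
Qed.

(** The circle is parametrized by cos = (1 - h^2) / (1 + h^2) and
    sin = 2 h / (1 + h^2).  Cleared of denominators the obstruction is a polynomial
    in h that vanishes identically.  At h = i, that is modulo 1 + h^2, the
    denominator is 0, all constants disappear, and the remaining term is a multiple
    of the seventh power of 2 (xa + i xb). *)
Lemma round_curve (f Rr ri ta xa xb sg ma mb pi na nb g g1 g2 g11 Ta Tb Ua Ub Wa Wb de : R) :
  0 < de -> Rr * ri = 1 -> f * (ri + 4 * f ^+ 2) != 0 ->
  (forall h, 0 <= h <= de ->
    let c a b := ((1 - h ^+ 2) * a + 2 * h * b) / (1 + h ^+ 2) in
    obstruction 1 f Rr ri (c xa xb) (c ma mb) (ta + c xa xb) (sg + c ma mb) (pi + c na nb)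
     (Rr * g - c xa xb ^+ 2) (Rr * g1 - c xa xb * c ma mb) (Rr * g2 - c xa xb * c na nb)
     (Rr * g11 - c ma mb ^+ 2) (c Ta Tb) (c Ua Ub) (c Wa Wb) = 0) ->
  xa = 0 /\ xb = 0.
Proof.
move=> de0 Rri c0 H.
pose L a b : {poly R} := (1 - 'X ^+ 2) * a%:P + 2 * 'X * b%:P.
pose e : {poly R} := 1 + 'X ^+ 2.
pose p := obstruction_round e f%:P Rr%:P ri%:P (L xa xb) (L ma mb) (L na nb)
  (ta%:P * e + L xa xb) (sg%:P * e + L ma mb) (pi%:P * e + L na nb)
  g%:P g1%:P g2%:P g11%:P (L Ta Tb) (L Ua Ub) (L Wa Wb).
have p0 : p = 0.
  apply: (@poly_zero_itv _ 0 de) => // h hd.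
  have e0 : 1 + h ^+ 2 != 0 by rewrite gt_eqF // ltr_pwDl // sqr_ge0.
  have LE a b : (L a b).[h] = (1 - h ^+ 2) * a + 2 * h * b.
    by rewrite /L -(rmorph_nat polyC) !hornerE.
  have eE : e.[h] = 1 + h ^+ 2 by rewrite /e !hornerE.
  rewrite -[p.[h]]/(horner_eval h p) rmorph_obstruction_round /= /horner_eval.
  have LtE c a b : (c%:P * e + L a b).[h] = c * (1 + h ^+ 2) + ((1 - h ^+ 2) * a + 2 * h * b).
    by rewrite hornerD hornerM hornerC eE LE.
  rewrite !LtE !LE eE !hornerC obstruction_roundE //.
  have E a b : (a * (1 + h ^+ 2) + b) / (1 + h ^+ 2) = a + b / (1 + h ^+ 2) by field.
  by rewrite !E (H h hd) mulr0.
pose phi : {rmorphism {poly R} -> {poly %/ e}} := in_qpoly e.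
have se : size e = 3 by rewrite /e addrC size_polyDl size_polyXn ?size_poly1.
have em : e \is monic by rewrite monicE lead_coefE se /e coefD coefXn coefC add0r eqxx.
have me : mk_monic e = e by rewrite /mk_monic se em.
have phie : phi e = 0 by apply: val_inj; rewrite /= me Pdiv.RingMonic.rmodpp.
have I2 : phi 'X ^+ 2 = -1.
  by apply/eqP; rewrite -subr_eq0 opprK addrC -rmorphXn -(rmorph1 phi) -rmorphD /= -/e phie.
have phiL a b : phi (L a b) = 2 * (phi a%:P + phi 'X * phi b%:P).
  rewrite /L rmorphD !rmorphM rmorphB rmorph1 rmorphXn rmorph_nat /= I2; ring.
have phiLe c a b : phi (c%:P * e + L a b) = phi (L a b) by rewrite rmorphD rmorphM /= phie mulr0 add0r.
have : phi p = 0 by rewrite p0 rmorph0.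
rewrite rmorph_obstruction_round phie !phiLe obstruction_round0; last first.
  by rewrite -rmorphM /= -polyCM Rri rmorph1.
rewrite phiL => pz.
(* multiplication by the conjugate of the seventh power makes the relation real *)
have : phi (- (f * (ri + 4 * f ^+ 2)) * (4 * (xa ^+ 2 + xb ^+ 2)) ^+ 7)%:P = 0.
  transitivity (- (phi f%:P * (phi ri%:P + 4 * phi f%:P ^+ 2)) *
      (2 * (phi xa%:P + phi 'X * phi xb%:P)) ^+ 7 * (2 * (phi xa%:P - phi 'X * phi xb%:P)) ^+ 7).
    rewrite -[RHS]mulrA -exprMn.
    have -> : 2 * (phi xa%:P + phi 'X * phi xb%:P) * (2 * (phi xa%:P - phi 'X * phi xb%:P))
       = 4 * (phi xa%:P ^+ 2 - phi 'X ^+ 2 * phi xb%:P ^+ 2) by ring.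
    rewrite I2 mulN1r opprK.
    pose rc : {rmorphism R -> {poly %/ e}} := phi \o polyC.
    have rcE c : phi c%:P = rc c by [].
    have rcX z n : rc (z ^+ n) = rc z ^+ n by exact: rmorphXn.
    have rcM z z' : rc (z * z') = rc z * rc z' by exact: rmorphM.
    have rcD z z' : rc (z + z') = rc z + rc z' by exact: rmorphD.
    have rc4 : rc 4 = 4 by exact: rmorph_nat.
    by rewrite !rcE rcM (rmorphN rc) !(rc4, rcX, rcM, rcD).
  by rewrite pz mul0r.
move=> /(congr1 val); rewrite /= me Pdiv.CommonRing.rmodp_small ?size_polyC ?se; last by case: eqP.
move=> /eqP; rewrite polyC_eq0 mulf_eq0 oppr_eq0 (negPf c0) /= expf_eq0 /= mulf_eq0 pnatr_eq0 /=.
by rewrite paddr_eq0 ?sqr_ge0 // !sqrf_eq0 => /andP[/eqP -> /eqP ->].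
Qed.

End Algebra.

(** * Analysis along curves *)

Section Curves.
Context {R : realType}.
Local Notation E := 'rV[R]_3.
Implicit Types (i j : 'I_3) (x y : E).

Lemma gronwall0 (y dy : R -> R) (C de : R) :
  (forall t : R, 0 <= t <= de -> is_derive t 1 y (dy t)) ->
  (forall t, 0 <= t <= de -> dy t <= C * y t) -> y 0 = 0 ->
  (forall t, 0 <= t <= de -> 0 <= y t) -> forall t, 0 <= t <= de -> y t = 0.
Proof.
move=> yd yC y0 yp t /andP[t0 t1].
pose g s := y s * expR (- C * s); pose dg s := (dy s - C * y s) * expR (- C * s).
have gd s : 0 <= s <= de -> is_derive s 1 g (dg s).
  move=> /yd ys.
  have es : is_derive s 1 (fun s => expR (- C * s)) (- C * expR (- C * s)).
    have ls : is_derive s 1 ((- C) *: (@idfun R)) ((- C) *: 1) by exact: is_deriveZ.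
    have ce : is_derive s 1 (expR \o ((- C) *: (@idfun R))) (expR (- C * s) * ((- C) *: 1)).
      exact: is_derive1_comp.
    by apply: (is_derive_eq ce); rewrite /GRing.scale /=; ring.
  rewrite (_ : dg s = y s *: (- C * expR (- C * s)) + expR (- C * s) *: dy s).
    exact: is_deriveM.
  by rewrite /dg /GRing.scale /=; ring.
have [||c] := @MVT_segment R g dg 0 t t0.
- move=> s; rewrite in_itv /= => /andP[s0 s1]; apply: gd; lra.
- apply: derivable_within_continuous => s; rewrite in_itv /= => /andP[s0 s1].
  by have [|] := gd s; first lra.
rewrite in_itv /= => /andP[c0 c1]; rewrite {1 2}/g y0 mul0r !subr0 => gt.
have cd : 0 <= c <= de by lra.
have : y t * expR (- C * t) <= 0.
  rewrite gt mulr_le0_ge0 // /dg mulr_le0_ge0 ?expR_ge0 //.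
  by rewrite subr_le0 yC.
rewrite pmulr_lle0 ?expR_gt0 // => yt.
by apply/eqP; rewrite eq_le yt yp // t0 t1.
Qed.

Lemma const_on_segment (h dh : R -> R) (de : R) :
  (forall t : R, 0 <= t <= de -> is_derive t 1 h (dh t)) ->
  (forall t, 0 <= t <= de -> dh t = 0) -> forall t, 0 <= t <= de -> h t = h 0.
Proof.
move=> hd h0 t td; have de0 : 0 <= de by lra.
have := @gronwall0 (fun t => (h t - h 0) * (h t - h 0)) (fun t => 0) 0 de _ _ _ _ t td.
move=> /(_ _ _ _ _)/eqP; rewrite mulf_eq0 orbb subr_eq0 => e; apply/eqP/e => [s sd|s _||s _].
- have hs := hd s sd; rewrite h0 // in hs.
  have hc : is_derive s 1 (fun t => h t - h 0) (0 - 0) by exact: is_deriveB.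
  by apply: (is_derive_eq (is_deriveM hc hc)); rewrite subr0 scaler0 addr0.
- by rewrite mul0r.
- by rewrite subrr mul0r.
- by rewrite -expr2 sqr_ge0.
Qed.

Lemma chain_curve (g : E -> R) (c : R -> E) (dc : E) (t : R) : differentiable g (c t) ->
  (forall j, is_derive t 1 (fun s => c s ord0 j) (dc ord0 j)) ->
  is_derive t 1 (fun s => g (c s)) (\sum_j pd j g (c t) * dc ord0 j).
Proof.
move=> gd cd; pose e : E := delta_mx ord0 0.
have e0 s : (0 + s *: e) ord0 0 = s by rewrite !mxE /= add0r mulr1.
pose F (y : E) := g (c (y ord0 0)).
have cdj j : derivable (fun s => c s ord0 j) ((0 + t *: e) ord0 0) 1 by rewrite e0; case: (cd j).
have co : differentiable (fun y : E => y ord0 0) (0 + t *: e) by exact/an_diff/an_coord.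
have Pd j : differentiable (fun y : E => c (y ord0 0) ord0 j) (0 + t *: e).
  exact: (differentiable_comp1 (g := fun s => c s ord0 j)).
have gd' : differentiable g (c ((0 + t *: e) ord0 0)) by rewrite e0.
have Fd : differentiable F (0 + t *: e) by exact: (differentiable_comprV (Phi := fun y => c (y ord0 0))).
have := derive_line Fd.
rewrite (_ : (fun s => F (0 + s *: e)) = (fun s => g (c s))); last first.
  by apply/funext => s; rewrite /F e0.
congr (is_derive _ _ _ _); rewrite /linform (big3 0) i3_1 !mxE /= mul1r !mul0r !addr0.
rewrite (partial_comprV 0 (Phi := fun y => c (y ord0 0))) //.
apply: eq_bigr => j _; rewrite e0 pdE; congr (_ * _).
rewrite (partial_comp1 0 (g := fun s => c s ord0 j)) // partial_coord eqxx mulr1 e0.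
by rewrite derive1E; case: (cd j).
Qed.

End Curves.

(** * Normal forms for umbilic foliations *)

Section OrthAlgebra.
Context {R : realType}.
Local Notation E := 'rV[R]_3.
Implicit Types (i j : 'I_3) (x y : E).

(** The Hessian identity, rewritten at a point.  The letters stand for the
    derivatives of f and u: d i j = d_i u_j, lap = Delta f and L = grad (Delta f).
    H has the normal form of an umbilic foliation and L comes from differentiating
    its trace.  The terms with first derivatives of u are eliminated by the
    derivative of N . u = 0, by the curl and by the divergence. *)
Lemma orth_algebra (N V W u L : 'I_3 -> R) (H d : 'I_3 -> 'I_3 -> R) (k f ta sg pi lap q : R) :
  ta != 0 ->
  (forall i j, ta * H i j = k * (i == j)%:R - N i * V j - V i * N j - sg * (N i * N j)) ->
  q = \sum_i N i ^+ 2 ->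
  ta * lap = 3 * k - 2 * (\sum_i N i * V i) - sg * q ->
  \sum_j N j * u j = 0 ->
  (forall i, \sum_j (H i j * u j + N j * d i j) = 0) ->
  (forall i, d (i + 1) (i + 1 + 1) - d (i + 1 + 1) (i + 1) = f * u i) ->
  \sum_i d i i = 0 ->
  2 * (\sum_i \sum_j H i j * d i j) + \sum_j u j * L j = 0 ->
  (forall j, (V j + N j * sg) * lap + ta * L j =
    - (2 * \sum_i (H j i * V i + N i * (N j * W i))) - ((W j + N j * pi) * q + sg * (2 * \sum_i N i * H j i))) ->
  (sg * q - k) * (\sum_j u j * V j) + 2 * f * ta * (\sum_j u j * (V (j + 1) * N (j + 1 + 1) - V (j + 1 + 1) * N (j + 1)))
   - q * ta * (\sum_j u j * W j) = 0.
Proof.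
move=> ta0 HE qE lapE uN h2 h3 h4 h5 h6.
pose h := \sum_i V i * (\sum_j H i j * u j); pose n := \sum_i N i * (\sum_j H i j * u j).
have Y : \sum_i \sum_j V i * N j * d i j = - h.
  apply/eqP; rewrite -addr_eq0; apply/eqP; rewrite /h -big_split /= big1 // => i _.
  transitivity (V i * \sum_j (H i j * u j + N j * d i j)); last by rewrite h2 mulr0.
  rewrite !mulr_sumr -big_split /=; apply: eq_bigr => j _; ring.
have Y2 : \sum_i \sum_j N i * N j * d i j = - n.
  apply/eqP; rewrite -addr_eq0; apply/eqP; rewrite /n -big_split /= big1 // => i _.
  transitivity (N i * \sum_j (H i j * u j + N j * d i j)); last by rewrite h2 mulr0.
  rewrite !mulr_sumr -big_split /=; apply: eq_bigr => j _; ring.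
pose z := \sum_j u j * (V (j + 1) * N (j + 1 + 1) - V (j + 1 + 1) * N (j + 1)).
have X : \sum_i \sum_j N i * V j * d i j = - h - f * z.
  rewrite -Y /z !(big3 0) ?i3_1 ?i3_3 ?i3_1.
  have := h3 0; have := h3 1; have := h3 (1 + 1); rewrite ?i3_1 ?i3_3 ?i3_1.
  set d01 := d 0 1; set d10 := d 1 0; set d02 := d 0 (1 + 1); set d20 := d (1 + 1) 0.
  set d12 := d 1 (1 + 1); set d21 := d (1 + 1) 1; move=> e2 e1 e0.
  have -> : d12 = f * u 0 + d21 by rewrite -e0; ring.
  have -> : d20 = f * u 1 + d02 by rewrite -e1; ring.
  have -> : d01 = f * u (1 + 1) + d10 by rewrite -e2; ring.
  ring.
have Hd : ta * (\sum_i \sum_j H i j * d i j) = 2 * h + f * z + sg * n.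
  have -> : ta * (\sum_i \sum_j H i j * d i j) = k * (\sum_i d i i)
     - (\sum_i \sum_j N i * V j * d i j) - (\sum_i \sum_j V i * N j * d i j)
     - sg * (\sum_i \sum_j N i * N j * d i j).
    rewrite !mulr_sumr -!sumrB; apply: eq_bigr => i _.
    rewrite !mulr_sumr -[in RHS]addrA.
    transitivity (\sum_j (k * (i == j)%:R * d i j - N i * V j * d i j - V i * N j * d i j - sg * (N i * N j * d i j))).
      by apply: eq_bigr => j _; rewrite mulrA HE; ring.
    rewrite !sumrB -addrA; congr (_ - _ + (_ - _)).
    rewrite (bigD1 i) //= eqxx mulr1 big1 ?addr0 // => j ji.
    by rewrite eq_sym (negPf ji) mulr0 mul0r.
  by rewrite h4 X Y Y2; ring.
pose uV := \sum_j u j * V j.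
have hE : ta * h = (k - \sum_i N i * V i) * uV.
  rewrite /h mulr_sumr.
  transitivity (\sum_i V i * (k * u i - N i * uV - (V i + sg * N i) * \sum_j N j * u j)).
    apply: eq_bigr => i _; rewrite mulrCA; congr (_ * _).
    transitivity (\sum_j (k * (i == j)%:R * u j - N i * (u j * V j) - (V i + sg * N i) * (N j * u j))).
      by rewrite [LHS]mulr_sumr; apply: eq_bigr => j _; rewrite [LHS]mulrA HE; ring.
    rewrite !sumrB -!mulr_sumr; congr (_ - _ - _).
    rewrite (bigD1 i) //= eqxx mulr1 big1 ?addr0 // => j ji.
    by rewrite eq_sym (negPf ji) mulr0 mul0r.
  rewrite uN [in RHS]mulrBl mulr_suml {2}/uV mulr_sumr -sumrB; apply: eq_bigr => i _; ring.
have nE : ta * n = - q * uV.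
  rewrite /n mulr_sumr.
  transitivity (\sum_i N i * (k * u i - N i * uV - (V i + sg * N i) * \sum_j N j * u j)).
    apply: eq_bigr => i _; rewrite mulrCA; congr (_ * _).
    transitivity (\sum_j (k * (i == j)%:R * u j - N i * (u j * V j) - (V i + sg * N i) * (N j * u j))).
      by rewrite [LHS]mulr_sumr; apply: eq_bigr => j _; rewrite [LHS]mulrA HE; ring.
    rewrite !sumrB -!mulr_sumr; congr (_ - _ - _).
    rewrite (bigD1 i) //= eqxx mulr1 big1 ?addr0 // => j ji.
    by rewrite eq_sym (negPf ji) mulr0 mul0r.
  rewrite uN qE; transitivity (k * (\sum_i N i * u i) - (\sum_i N i ^+ 2) * uV); last first.
    by rewrite uN; ring.
  rewrite mulr_sumr mulr_suml -sumrB; apply: eq_bigr => i _; ring.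
pose uW := \sum_j u j * W j.
have Hs i j : H i j = H j i.
  by apply: (mulfI ta0); rewrite !HE (eq_sym i j); ring.
have L6 : uV * lap + ta * (\sum_j u j * L j) = - (2 * h) - uW * q - 2 * sg * n.
  have -> : uV * lap + ta * (\sum_j u j * L j) =
    \sum_j u j * ((V j + N j * sg) * lap + ta * L j) - sg * lap * \sum_j N j * u j.
    rewrite /uV mulr_suml !mulr_sumr -big_split -sumrB /=; apply: eq_bigr => j _; ring.
  rewrite uN mulr0 subr0; under eq_bigr => j _ do rewrite h6.
  rewrite /h /n /uW.
  transitivity (- 2 * (\sum_j \sum_i u j * (H j i * V i)) - 2 * (\sum_i N i * W i) * (\sum_j N j * u j)
    - (\sum_j u j * W j) * q - pi * q * (\sum_j N j * u j) - 2 * sg * (\sum_j \sum_i u j * (N i * H j i))).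
    rewrite mulr_suml !mulr_sumr -!sumrN -!big_split /=; apply: eq_bigr => j _.
    rewrite -!mulr_sumr big_split /=.
    rewrite (_ : \sum_i N i * (N j * W i) = N j * \sum_i N i * W i); last first.
      by rewrite mulr_sumr; apply: eq_bigr => i _; ring.
    ring.
  rewrite uN !mulr0 subr0 subr0.
  rewrite exchange_big /= [X in _ - _ * X]exchange_big /=.
  under eq_bigr => i _ do under eq_bigr => j _ do rewrite (Hs j i).
  under [X in _ - _ * X = _]eq_bigr => i _ do under eq_bigr => j _ do rewrite (Hs j i).
  have e (A : 'I_3 -> R) : \sum_i \sum_j u j * (H i j * A i) = \sum_i A i * \sum_j H i j * u j.
    by apply: eq_bigr => i _; rewrite mulr_sumr; apply: eq_bigr => j _; ring.
  rewrite e (_ : \sum_i \sum_j u j * (N i * H i j) = \sum_i N i * \sum_j H i j * u j); last first.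
    by rewrite -e; apply: eq_bigr => i _; apply: eq_bigr => j _; ring.
  ring.
rewrite -/z -/uV -/uW.
have e1 : ta * (2 * (\sum_i \sum_j H i j * d i j) + \sum_j u j * L j) = 0 by rewrite h5 mulr0.
have e2 : ta * (2 * (\sum_i \sum_j H i j * d i j) + \sum_j u j * L j) =
  2 * (2 * h + f * z + sg * n) - (2 * h) - uW * q - 2 * sg * n - uV * lap.
  rewrite mulrDr mulrCA Hd; move: L6; set x := ta * (\sum_j u j * L j) => e.
  by rewrite (canRL (addKr _) e); ring.
have e3 : ta * (2 * h + 2 * f * z - uW * q - uV * lap) = 0.
  by rewrite -[RHS](mulr0 ta) -e1 e2; ring.
move: e3; rewrite mulrBr [ta * (uV * _)]mulrCA lapE !mulrDr mulrCA hE => e3.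
by rewrite -e3; ring.
Qed.

End OrthAlgebra.

Section Structure.
Context {R : realType}.
Local Notation E := 'rV[R]_3.
Implicit Types (i j : 'I_3) (x y : E).
Variables (f : E -> R) (W : set E).
Hypotheses (Wo : open W) (fa : forall x, W x -> an f x) (g0 : forall x, W x -> grad f x != 0).

Definition normsq x := \sum_i pd i f x * pd i f x.

Lemma normsq_neq0 x : W x -> normsq x != 0.
Proof.
move=> Wx; have := dot_gt0 (g0 Wx); rewrite lt0r => /andP[+ _]; rewrite /dot /normsq.
by under eq_bigr => i _ do rewrite !grad_pd.
Qed.

Lemma normsq_an x : W x -> an normsq x.
Proof. by move=> Wx; have fx := fa Wx; rewrite /normsq; an_. Qed.

(** The derivative along N / |N|^2, that is d/df along the normal. *)
Definition dn (F : E -> R) x := (\sum_i pd i f x * pd i F x) / normsq x.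

Lemma dnD F G x : an F x -> an G x -> dn (fun y => F y + G y) x = dn F x + dn G x.
Proof.
move=> Fa Ga; rewrite /dn -mulrDl -big_split /=; congr (_ / _).
by apply: eq_bigr => i _; rewrite pdD // mulrDr.
Qed.

Lemma dnN F x : an F x -> dn (fun y => - F y) x = - dn F x.
Proof.
move=> Fa; rewrite /dn -mulNr -sumrN; congr (_ / _).
by apply: eq_bigr => i _; rewrite pdN // mulrN.
Qed.

Lemma dnB F G x : an F x -> an G x -> dn (fun y => F y - G y) x = dn F x - dn G x.
Proof. by move=> Fa Ga; rewrite dnD ?dnN //; exact: anN. Qed.

Lemma dnM F G x : an F x -> an G x -> dn (fun y => F y * G y) x = dn F x * G x + F x * dn G x.
Proof.
move=> Fa Ga; rewrite /dn mulrAC mulrA -mulrDl; congr (_ / _).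
by rewrite mulr_suml mulr_sumr -big_split /=; apply: eq_bigr => i _; rewrite pdM //; ring.
Qed.

Lemma dn_cst (c : R) x : dn (fun=> c) x = 0.
Proof. by rewrite /dn big1 ?mul0r // => i _; rewrite pd_cst mulr0. Qed.

Lemma dn_self x : W x -> dn f x = 1.
Proof. by move=> Wx; rewrite /dn -/(normsq x) divff // normsq_neq0. Qed.

Lemma dn_on F G x : W x -> (forall y, W y -> F y = G y) -> dn F x = dn G x.
Proof.
by move=> Wx FG; rewrite /dn; congr (_ / _); apply: eq_bigr => i _; rewrite (pd_on i Wo FG Wx).
Qed.

Lemma dn_step F x (A : 'I_3 -> R) c : W x -> (forall i, pd i F x = A i + pd i f x * c) ->
  dn F x = (\sum_i pd i f x * A i) / normsq x + c.
Proof.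
move=> Wx FA; apply: (mulIf (normsq_neq0 Wx)); rewrite mulrDl !divfK ?normsq_neq0 //.
rewrite /normsq mulr_sumr -big_split /=; apply: eq_bigr => i _; rewrite FA; ring.
Qed.

Lemma collinear_step x (a : 'I_3 -> R) : W x -> (forall i j, a i * pd j f x = a j * pd i f x) ->
  forall i, a i = pd i f x * ((\sum_j pd j f x * a j) / normsq x).
Proof.
move=> Wx aN i; apply: (mulIf (normsq_neq0 Wx)); rewrite mulrA mulfVK ?normsq_neq0 //.
rewrite /normsq !mulr_sumr; apply: eq_bigr => j _.
by rewrite [LHS]mulrA aN; ring.
Qed.

(** The coefficient of N in grad g - A, when that difference is normal.  It is
    sealed so that iterating it does not create growing terms. *)
Definition ncoef := locked (fun (A : 'I_3 -> E -> R) (g : E -> R) x =>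
  (\sum_j pd j f x * (pd j g x - A j x)) / normsq x).

Lemma ncoef_an A g x : W x -> (forall j, an (A j) x) -> an g x -> an (ncoef A g) x.
Proof.
move=> Wx Aa ga; have fx := fa Wx; rewrite /ncoef -lock; apply: anM; first by an_.
by apply: anV; [exact: normsq_neq0|exact: normsq_an].
Qed.

Lemma ncoefP A g x : W x ->
  (forall i j, (pd i g x - A i x) * pd j f x = (pd j g x - A j x) * pd i f x) ->
  forall i, pd i g x = A i x + pd i f x * ncoef A g x.
Proof.
move=> Wx H i; rewrite /ncoef -lock -(collinear_step (a := fun i => pd i g x - A i x) Wx H).
by rewrite addrC subrK.
Qed.

(** If grad g = A + g1 N with A constant along the leaves, then the symmetry of the
    second derivatives of g and of f makes grad g1 of the same form, with A
    replaced by its normal derivative A1. *)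
Lemma tangential_step (g g1 : E -> R) (A A1 : 'I_3 -> E -> R) :
  (forall x, W x -> an g x) -> (forall x, W x -> an g1 x) -> (forall x i, W x -> an (A i) x) ->
  (forall x i, W x -> pd i g x = A i x + pd i f x * g1 x) ->
  (forall x i j, W x -> pd j (A i) x = pd j f x * A1 i x) ->
  forall x i, W x -> pd i g1 x = A1 i x + pd i f x * ncoef A1 g1 x.
Proof.
move=> ga g1a Aa gE AE x i Wx; apply: ncoefP => // {}i j.
have fx := fa Wx; have gx := ga x Wx; have g1x := g1a x Wx; have Ax k := Aa x k Wx.
have e k l : pd k (pd l g) x = pd k f x * A1 l x + (pd k (pd l f) x * g1 x + pd l f x * pd k g1 x).
  by rewrite (pd_on k Wo (fun y Wy => gE y l Wy) Wx) pdD // pdM // AE.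
have := pdC i j gx; rewrite !e (pdC i j fx).
by move=> h; apply/eqP; rewrite -subr_eq0; apply/eqP; move: h; lra.
Qed.

(** The setting common to spheres (k = 1) and planes (k = 0): the normal field rho
    is tau N, and its derivative is that of the position, times k, up to the
    motion V of the centre (or of the normal direction) from leaf to leaf. *)
Section Normalised.
Variables (k : R) (rho V : 'I_3 -> E -> R) (tau : E -> R).
Hypotheses (Va : forall x, W x -> forall j, an (V j) x) (taua : forall x, W x -> an tau x).
Hypotheses (tau0 : forall x, W x -> tau x != 0).
Hypotheses (rhoE : forall x, W x -> forall j, rho j x = tau x * pd j f x).
Hypotheses (drho : forall x, W x -> forall i j, pd i (rho j) x = k * (i == j)%:R - pd i f x * V j x).

(** V, V1, V2 are successive normal derivatives, constant along the leaves, while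
    tau, sg, pi_ are affine along the leaves with gradients V, V1, V2 there. *)
Definition V1 j := ncoef (fun _ _ => 0) (V j).
Definition V2 j := ncoef (fun _ _ => 0) (V1 j).
Definition sg := ncoef V tau.
Definition pi_ := ncoef V1 sg.
Definition om := ncoef V2 pi_.

Lemma rho_an x : W x -> forall j, an (rho j) x.
Proof.
move=> Wx j; apply: (an_on Wo _ Wx (F := fun y => tau y * pd j f y)).
  by move=> y Wy; rewrite rhoE.
by have fx := fa Wx; have tx := taua Wx.
Qed.

Lemma V1_an x : W x -> forall j, an (V1 j) x.
Proof. by move=> Wx j; apply: ncoef_an => //; exact: Va. Qed.

Lemma V2_an x : W x -> forall j, an (V2 j) x.
Proof. by move=> Wx j; apply: ncoef_an => //; exact: V1_an. Qed.

Lemma sg_an x : W x -> an sg x.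
Proof. by move=> Wx; have Vx := Va Wx; have tx := taua Wx; apply: ncoef_an. Qed.

Lemma pi_an x : W x -> an pi_ x.
Proof. by move=> Wx; apply: ncoef_an => //; [exact: V1_an|exact: sg_an]. Qed.

Lemma dV x : W x -> forall i j, pd i (V j) x = pd i f x * V1 j x.
Proof.
move=> Wx i j.
rewrite (tangential_step (g := fun x => k * x ord0 j - rho j x) (g1 := V j)
  (A := fun _ _ => 0) (A1 := fun _ _ => 0) _ _ _ _ _ _ Wx) ?add0r //.
- by move=> y Wy; have rx := rho_an Wy j; an_.
- by move=> y Wy; exact: Va.
- move=> y l Wy; have rx := rho_an Wy j.
  by rewrite pdB // pdM // pd_cst pd_coord drho //; ring.
- by move=> y l m Wy; rewrite pd_cst mulr0.
Qed.

Lemma dV1 x : W x -> forall i j, pd i (V1 j) x = pd i f x * V2 j x.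
Proof.
move=> Wx i j.
rewrite (tangential_step (g := V j) (g1 := V1 j)
  (A := fun _ _ => 0) (A1 := fun _ _ => 0) _ _ _ _ _ _ Wx) ?add0r //.
- by move=> y Wy; exact: Va.
- by move=> y Wy; exact: V1_an.
- by move=> y l Wy; rewrite dV // add0r.
- by move=> y l m Wy; rewrite pd_cst mulr0.
Qed.

Lemma dtau x : W x -> forall i, pd i tau x = V i x + pd i f x * sg x.
Proof.
move=> Wx; apply: ncoefP => // i j; have fx := fa Wx; have tx := taua Wx.
have e a b : pd a (rho b) x = pd a tau x * pd b f x + tau x * pd a (pd b f) x.
  by rewrite (pd_on a Wo (fun y Wy => rhoE Wy b) Wx) pdM.
have := e i j; have := e j i; rewrite !drho // (pdC j i fx) (eq_sym j i).
by lra.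
Qed.

Lemma dsg x : W x -> forall i, pd i sg x = V1 i x + pd i f x * pi_ x.
Proof.
move=> Wx i.
rewrite (tangential_step (g := tau) (g1 := sg) (A := V) (A1 := V1) _ _ _ _ _ _ Wx) //.
- exact: sg_an.
- by move=> y l Wy; exact: Va.
- by move=> y l Wy; exact: dtau.
- by move=> y l m Wy; exact: dV.
Qed.

Lemma dpi x : W x -> forall i, pd i pi_ x = V2 i x + pd i f x * om x.
Proof.
move=> Wx i.
rewrite (tangential_step (g := sg) (g1 := pi_) (A := V1) (A1 := V2) _ _ _ _ _ _ Wx) //.
- exact: sg_an.
- exact: pi_an.
- by move=> y l Wy; exact: V1_an.
- by move=> y l Wy; exact: dsg.
- by move=> y l m Wy; exact: dV1.
Qed.

Lemma hess_normal x : W x -> forall i j, tau x * pd i (pd j f) x =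
  k * (i == j)%:R - pd i f x * V j x - V i x * pd j f x - sg x * (pd i f x * pd j f x).
Proof.
move=> Wx i j; have fx := fa Wx; have tx := taua Wx.
have e : pd i (rho j) x = pd i tau x * pd j f x + tau x * pd i (pd j f) x.
  by rewrite (pd_on i Wo (fun y Wy => rhoE Wy j) Wx) pdM.
by move: e; rewrite drho // dtau //; lra.
Qed.

Definition vec (X : 'I_3 -> E -> R) x : E := \row_j X j x.
Local Notation r := (vec rho).
Definition rr x := \sum_j rho j x * rho j x.
Definition al x := sg x * rr x - k * (tau x * tau x).
Definition be x := 2 * f x * (tau x * tau x).
Definition ga x := - (rr x * tau x).

Lemma rrE x : rr x = dot (r x) (r x).
Proof. by rewrite /rr /dot; apply: eq_bigr => j _; rewrite !mxE. Qed.

Lemma rr_normsq x : W x -> rr x = tau x ^+ 2 * normsq x.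
Proof.
by move=> Wx; rewrite /rr /normsq mulr_sumr; apply: eq_bigr => j _; rewrite !rhoE //; ring.
Qed.

Lemma rr_neq0 x : W x -> rr x != 0.
Proof.
by move=> Wx; rewrite rr_normsq // mulf_neq0 ?normsq_neq0 // expf_neq0 // tau0.
Qed.

Section WithField.
Variable u : E -> E.
Hypotheses (ub : beltr f W u).

Lemma u_rho x : W x -> dot (u x) (r x) = 0.
Proof.
move=> Wx; have := beltrami_orth Wo fa ub Wx => o.
rewrite -[RHS](mulr0 (tau x)) -o mulr_sumr /dot; apply: eq_bigr => j _.
by rewrite mxE rhoE //; ring.
Qed.

Lemma u_grad_diff x i : W x ->
  \sum_j (pd i (pd j f) x * u x ord0 j + pd j f x * pd i (fun y => u y ord0 j) x) = 0.
Proof.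
move=> Wx; have fx := fa Wx; have [ua _ _] := ub Wx.
have := pd_on i Wo (fun y Wy => beltrami_orth Wo fa ub Wy) Wx.
rewrite pd_cst pd_sum // => e; apply: etrans e; apply: eq_bigr => j _.
by rewrite pdM.
Qed.

(** [orth_algebra] multiplied by tau^2, with N = rho / tau. *)
Lemma first_relation x : W x ->
  al x * dot (u x) (vec V x) + be x * dot (u x) (cross (vec V x) (r x)) + ga x * dot (u x) (vec V1 x) = 0.
Proof.
move=> Wx; have fx := fa Wx; have [ua uc ud] := ub Wx.
have sx := sg_an Wx; have Vx := Va Wx; have tx := taua Wx.
pose lap y := \sum_i pd i (pd i f) y.
have lapE y : W y -> tau y * lap y = 3 * k - 2 * (\sum_i pd i f y * V i y) - sg y * normsq y.
  move=> Wy; rewrite /lap [LHS]mulr_sumr.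
  transitivity (\sum_i (k - 2 * (pd i f y * V i y) - sg y * (pd i f y * pd i f y))).
      by apply: eq_bigr => i _; rewrite hess_normal // eqxx mulr1; ring.
  rewrite !sumrB -!mulr_sumr -/(normsq y) sumr_const card_ord; ring.
have lapa : an lap x by rewrite /lap; an_.
have dlap j : (V j x + pd j f x * sg x) * lap x + tau x * pd j lap x =
    - (2 * \sum_i (pd j (pd i f) x * V i x + pd i f x * (pd j f x * V1 i x)))
    - ((V1 j x + pd j f x * pi_ x) * normsq x + sg x * (2 * \sum_i pd i f x * pd j (pd i f) x)).
  have qa := normsq_an Wx.
  have := pd_on j Wo lapE Wx; rewrite pdM // dtau // => ->.
  rewrite !pdB ?pdM //; try by an_.
  rewrite !pd_cst dsg // pd_sum; last by move=> *; an_.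
  rewrite !mul0r mulr0 !add0r [pd j normsq x]pd_sum; last by move=> *; an_.
  congr (- _ - (_ + _)).
    congr (2 * _); apply: eq_bigr => i _; rewrite pdM // dV //.
  congr (_ * _); rewrite mulr_sumr; apply: eq_bigr => i _; rewrite pdM //; ring.
have := orth_algebra (tau0 Wx) (hess_normal Wx) (q := normsq x) (f := f x) (pi := pi_ x) (lap := lap x)
  (L := fun j => pd j lap x) (W := fun j => V1 j x) (u := fun j => u x ord0 j)
  (d := fun i j => pd i (fun y => u y ord0 j) x) _ (lapE x Wx) (beltrami_orth Wo fa ub Wx)
  (fun i => u_grad_diff i Wx) uc ud (beltrami_hess Wo fa ub Wx) dlap.
have qE : normsq x = \sum_i pd i f x ^+ 2 by apply: eq_bigr => i _; rewrite expr2.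
move=> /(_ qE) key.
rewrite /al /be /ga rr_normsq // -[RHS](mulr0 (tau x ^+ 2)) -key.
have -> : \sum_j u x ord0 j * V j x = dot (u x) (vec V x).
  by apply: eq_bigr => j _; rewrite mxE.
have -> : \sum_j u x ord0 j * V1 j x = dot (u x) (vec V1 x).
  by apply: eq_bigr => j _; rewrite mxE.
have -> : dot (u x) (cross (vec V x) (r x)) = tau x * (\sum_j u x ord0 j * (V (j + 1) x * pd (j + 1 + 1) f x - V (j + 1 + 1) x * pd (j + 1) f x)).
  by rewrite mulr_sumr; apply: eq_bigr => j _; rewrite !mxE !rhoE //; ring.
ring.
Qed.

Local Notation D := dn.
Definition ri x := (rr x)^-1.

Lemma rri x : W x -> rr x * ri x = 1.
Proof. by move=> Wx; rewrite mulfV // rr_neq0. Qed.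

Lemma inv_normsq x : W x -> (normsq x)^-1 = tau x ^+ 2 * ri x.
Proof.
move=> Wx; apply: (mulfI (normsq_neq0 Wx)); rewrite mulfV ?normsq_neq0 //.
by rewrite mulrA [normsq x * _]mulrC -rr_normsq // rri.
Qed.

Lemma normal_dot (X : 'I_3 -> E -> R) x : W x ->
  (\sum_i pd i f x * X i x) / normsq x = tau x * ri x * dot (r x) (vec X x).
Proof.
move=> Wx; rewrite inv_normsq // /dot mulr_suml mulr_sumr; apply: eq_bigr => i _.
by rewrite !mxE rhoE //; ring.
Qed.

Lemma dn_rho x j : W x -> D (rho j) x = k * tau x * ri x * rho j x - V j x.
Proof.
move=> Wx; rewrite (dn_step (A := fun i => k * (i == j)%:R) (c := - V j x) Wx); last first.
  by move=> i; rewrite drho //; ring.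
congr (_ + _); rewrite (bigD1 j) //= eqxx mulr1 big1 ?addr0 => [|i ij].
  by rewrite inv_normsq // rhoE //; ring.
by rewrite (negPf ij) !mulr0.
Qed.

Lemma dn_V x j : W x -> D (V j) x = V1 j x.
Proof.
move=> Wx; rewrite (dn_step (A := fun=> 0) (c := V1 j x) Wx); last by move=> i; rewrite dV // add0r.
by rewrite big1 ?mul0r ?add0r // => i _; rewrite mulr0.
Qed.

Lemma dn_V1 x j : W x -> D (V1 j) x = V2 j x.
Proof.
move=> Wx; rewrite (dn_step (A := fun=> 0) (c := V2 j x) Wx); last by move=> i; rewrite dV1 // add0r.
by rewrite big1 ?mul0r ?add0r // => i _; rewrite mulr0.
Qed.

Lemma dn_tau x : W x -> D tau x = tau x * dot (r x) (vec V x) * ri x + sg x.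
Proof.
move=> Wx; rewrite (dn_step (A := fun i => V i x) (c := sg x) Wx) ?normal_dot //.
  by rewrite mulrAC.
exact: dtau.
Qed.

Lemma dn_sg x : W x -> D sg x = tau x * dot (r x) (vec V1 x) * ri x + pi_ x.
Proof.
move=> Wx; rewrite (dn_step (A := fun i => V1 i x) (c := pi_ x) Wx) ?normal_dot //.
  by rewrite mulrAC.
exact: dsg.
Qed.

Lemma dn_rr x : W x -> D rr x = 2 * k * tau x - 2 * dot (r x) (vec V x).
Proof.
move=> Wx; have rx := rho_an Wx.
have e : D rr x = 2 * \sum_j rho j x * D (rho j) x.
  rewrite /rr (big3 0) mulrDr mulrDr.
  have -> : D (fun y => \sum_j rho j y * rho j y) x =
     D (fun y => rho 0 y * rho 0 y + rho (0 + 1) y * rho (0 + 1) y + rho (0 + 1 + 1) y * rho (0 + 1 + 1) y) x.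
    by apply: dn_on => // y _; rewrite (big3 0).
  by rewrite !dnD ?dnM //; try (by an_); ring.
rewrite e; under eq_bigr => j _ do rewrite dn_rho //.
have -> : \sum_j rho j x * (k * tau x * ri x * rho j x - V j x) =
   k * tau x * (rr x * ri x) - dot (r x) (vec V x).
  rewrite /rr /dot mulr_suml mulr_sumr -sumrB; apply: eq_bigr => j _; rewrite !mxE; ring.
by rewrite rri //; ring.
Qed.

(** The curl turns N_i d_i u_j into N_i d_j u_i, and the derivative of N . u = 0
    turns this into - H_ij u_i. *)
Lemma dn_u x j : W x -> D (fun y => u y ord0 j) x =
  - (k * tau x * ri x) * u x ord0 j - f x * tau x * ri x * cross (r x) (u x) ord0 j
  + dot (u x) (vec V x) * ri x * rho j x.
Proof.
move=> Wx; have [ua uc ud] := ub Wx; have fx := fa Wx.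
have c i : pd i (fun y => u y ord0 j) x = pd j (fun y => u y ord0 i) x
    - f x * ((j == i + 1)%:R * u x ord0 (i + 1 + 1) * (-1) + (j == i + 1 + 1)%:R * u x ord0 (i + 1)).
  have := uc i; have := uc (i + 1); have := uc (i + 1 + 1); rewrite !i3K.
  have : j = i \/ j = i + 1 \/ j = i + 1 + 1.
    by move: i j; apply: all3; apply: all3; rewrite ?i3_1 ?i3_3 ?i3_1; tauto.
  have n1 (l : 'I_3) : (l == l + 1) = false by move: l; apply: all3; rewrite ?i3_1 ?i3_3.
  have n2 (l : 'I_3) : (l == l + 1 + 1) = false by move: l; apply: all3; rewrite ?i3_1 ?i3_3 ?i3_1.
  have n3 (l : 'I_3) : (l + 1 == l + 1 + 1) = false by move: l; apply: all3; rewrite ?i3_1 ?i3_3 ?i3_1.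
  move=> [->|[->|->]] e2 e1 e0; rewrite ?eqxx ?n1 ?n2 ?n3 ?(eq_sym _ (i + 1)) ?n3 /=.
  - by ring.
  - by move: e2; lra.
  - by move: e1; lra.
have s : \sum_i pd i f x * pd j (fun y => u y ord0 i) x = - \sum_i pd j (pd i f) x * u x ord0 i.
  apply/eqP; rewrite -addr_eq0 -big_split /= -[X in _ == X](u_grad_diff j Wx).
  by apply/eqP; apply: eq_bigr => i _; rewrite addrC.
have hs : tau x * (\sum_i pd j (pd i f) x * u x ord0 i) = k * u x ord0 j - pd j f x * dot (u x) (vec V x).
  rewrite mulr_sumr.
  transitivity (\sum_i (k * (j == i)%:R * u x ord0 i - pd j f x * (u x ord0 i * V i x) - (V j x + sg x * pd j f x) * (pd i f x * u x ord0 i))).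
    by apply: eq_bigr => i _; rewrite [LHS]mulrA hess_normal //; ring.
  rewrite !sumrB -!mulr_sumr (beltrami_orth Wo fa ub Wx) mulr0 subr0; congr (_ - _ * _).
    rewrite (bigD1 j) //= eqxx mulr1 big1 ?addr0 // => i ij.
    by rewrite eq_sym (negPf ij) mulr0 mul0r.
  by apply: eq_bigr => i _; rewrite mxE.
rewrite /dn inv_normsq //; under eq_bigr => i _ do rewrite c mulrBr.
rewrite sumrB s.
have -> : \sum_i pd i f x * (f x * ((j == i + 1)%:R * u x ord0 (i + 1 + 1) * -1 + (j == i + 1 + 1)%:R * u x ord0 (i + 1)))
  = f x * (pd (j + 1) f x * u x ord0 (j + 1 + 1) - pd (j + 1 + 1) f x * u x ord0 (j + 1)).
  clear; move: j; apply: all3; rewrite (big3 0) ?i3_1 ?i3_3 ?i3_1 /=; ring.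
rewrite mulrBl mulNr [X in _ = X + _ * _ * _]addrC.
have -> : cross (r x) (u x) ord0 j = tau x * (pd (j + 1) f x * u x ord0 (j + 1 + 1) - pd (j + 1 + 1) f x * u x ord0 (j + 1)).
  by rewrite !mxE !rhoE //; ring.
have -> : (\sum_i pd j (pd i f) x * u x ord0 i) * (tau x ^+ 2 * ri x) =
   (tau x * (\sum_i pd j (pd i f) x * u x ord0 i)) * (tau x * ri x) by ring.
by rewrite hs rhoE //; ring.
Qed.

Definition dnv (X : E -> E) x : E := \row_j D (fun y => X y ord0 j) x.

Lemma vecE (X : 'I_3 -> E -> R) j : (fun y => vec X y ord0 j) = X j.
Proof. by apply/funext => y; rewrite mxE. Qed.

Lemma an_dot (X Y : E -> E) x : (forall j, an (fun y => X y ord0 j) x) ->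
  (forall j, an (fun y => Y y ord0 j) x) -> an (fun y => dot (X y) (Y y)) x.
Proof. by move=> Xa Ya; apply: an_sum => j _; apply: anM. Qed.

Lemma dn_dot (X Y : E -> E) x : (forall j, an (fun y => X y ord0 j) x) ->
  (forall j, an (fun y => Y y ord0 j) x) ->
  D (fun y => dot (X y) (Y y)) x = dot (dnv X x) (Y x) + dot (X x) (dnv Y x).
Proof.
move=> Xa Ya.
rewrite (_ : (fun y => dot (X y) (Y y)) = (fun y => X y ord0 0 * Y y ord0 0 + X y ord0 1 * Y y ord0 1 + X y ord0 (1 + 1) * Y y ord0 (1 + 1))).
  by rewrite !dnD ?dnM //; try (by an_); rewrite !dot3 !mxE; ring.
by apply/funext => y; rewrite dot3.
Qed.

Lemma dnv_cross (X Y : E -> E) x : (forall j, an (fun y => X y ord0 j) x) ->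
  (forall j, an (fun y => Y y ord0 j) x) ->
  dnv (fun y => cross (X y) (Y y)) x = cross (dnv X x) (Y x) + cross (X x) (dnv Y x).
Proof.
move=> Xa Ya; apply/rowP => j; rewrite !mxE.
rewrite (_ : (fun y => _) = (fun y => X y ord0 (j + 1) * Y y ord0 (j + 1 + 1) - X y ord0 (j + 1 + 1) * Y y ord0 (j + 1))).
  by rewrite dnB ?dnM //; ring.
by apply/funext => y; rewrite mxE.
Qed.

Lemma an_cross (X Y : E -> E) x : (forall j, an (fun y => X y ord0 j) x) ->
  (forall j, an (fun y => Y y ord0 j) x) -> forall j, an (fun y => cross (X y) (Y y) ord0 j) x.
Proof.
move=> Xa Ya j.
rewrite (_ : (fun y => _) = (fun y => X y ord0 (j + 1) * Y y ord0 (j + 1 + 1) - X y ord0 (j + 1 + 1) * Y y ord0 (j + 1))) //.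
by apply/funext => y; rewrite mxE.
Qed.

Lemma rr_an x : W x -> an rr x.
Proof. by move=> Wx; have rx := rho_an Wx; rewrite /rr; an_. Qed.

(** The normal derivative of [first_relation]; a multiple of [first_relation]
    itself is subtracted. *)
Lemma second_relation x : W x ->
  let t := dot (r x) (vec V x) in let m := dot (r x) (vec V1 x) in
  let uV := dot (u x) (vec V x) in let uV1 := dot (u x) (vec V1 x) in
  let uV2 := dot (u x) (vec V2 x) in let uB := dot (u x) (cross (vec V x) (r x)) in
  let uB1 := dot (u x) (cross (vec V1 x) (r x)) in
  let dta := tau x * t * ri x + sg x in
  let dR := 2 * k * tau x - 2 * t in
  let dsg := tau x * m * ri x + pi_ x in
  let dal := dsg * rr x + sg x * dR - 2 * k * tau x * dta in
  let dbe := 2 * tau x ^+ 2 + 4 * f x * tau x * dta in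
  let dga := - (dR * tau x + rr x * dta) in
  dal * uV + al x * uV1 + dbe * uB + be x * (uB1 + k * tau x * ri x * uB) + dga * uV1 + ga x * uV2
  - f x * tau x * ri x * (al x * uB - be x * rr x * uV + ga x * uB1) + uV * ri x * (al x * t + ga x * m) = 0.
Proof.
move=> Wx t m uV uV1 uV2 uB uB1 dta dR dsg dal dbe dga.
have fx := fa Wx; have [ua uc ud] := ub Wx.
have rx := rho_an Wx; have Vx := Va Wx; have V1x := V1_an Wx.
have tx := taua Wx; have sx := sg_an Wx; have Rx := rr_an Wx.
have va (X : 'I_3 -> E -> R) : (forall j, an (X j) x) -> forall j, an (fun y => vec X y ord0 j) x.
  by move=> Xa j; rewrite vecE.
have rv := va _ rx; have Vv := va _ Vx; have V1v := va _ V1x.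
have ala : an al x by rewrite /al; an_.
have bea : an be x by rewrite /be; an_.
have gaa : an ga x by rewrite /ga; an_.
have Bv := an_cross Vv rv.
have aV := an_dot ua Vv; have aB := an_dot ua Bv; have aV1 := an_dot ua V1v.
have e0 : D (fun y => al y * dot (u y) (vec V y) + be y * dot (u y) (cross (vec V y) (r y))
     + ga y * dot (u y) (vec V1 y)) x = 0.
  by rewrite (dn_on Wx (G := fun=> 0)) ?dn_cst // => y Wy; exact: first_relation.
have dalE : D al x = dal.
  rewrite /al dnB; [|by an_|by an_]; rewrite !dnM //; try by an_.
  rewrite dn_cst dn_sg // dn_rr // dn_tau //; rewrite /dal /dsg /dR /dta /t /m; ring.
have dbeE : D be x = dbe.
  rewrite /be !dnM //; try by an_.
  rewrite dn_cst dn_self // dn_tau //; rewrite /dbe /dta /t; ring.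
have dgaE : D ga x = dga.
  by rewrite /ga dnN ?dnM // dn_rr // dn_tau.
have Vd : dnv (vec V) x = vec V1 x by apply/rowP => j; rewrite !mxE vecE dn_V.
have V1d : dnv (vec V1) x = vec V2 x by apply/rowP => j; rewrite !mxE vecE dn_V1.
have rd : dnv r x = (k * tau x * ri x) *: r x - vec V x.
  by apply/rowP => j; rewrite !mxE vecE dn_rho.
have ud' : dnv u x = - (k * tau x * ri x) *: u x - (f x * tau x * ri x) *: cross (r x) (u x)
   + (uV * ri x) *: r x.
  by apply/rowP => j; rewrite !mxE dn_u // -/uV !mxE; ring.
have Bd : dnv (fun y => cross (vec V y) (r y)) x =
    cross (vec V1 x) (r x) + (k * tau x * ri x) *: cross (vec V x) (r x).
  rewrite dnv_cross // Vd rd; congr (_ + _).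
  by apply: rowP3; rewrite !(mxE, crossE) ?i3_3 ?i3_1; ring.
have ur := u_rho Wx.
have c1 (X : E) : dot (cross (r x) (u x)) X = dot (u x) (cross X (r x)).
  by rewrite !dot3 !crossE; ring.
have c2 : dot (u x) (cross (cross (vec V x) (r x)) (r x)) = - (rr x * uV).
  rewrite rrE /uV.
  transitivity (dot (u x) (r x) * dot (r x) (vec V x) - dot (r x) (r x) * dot (u x) (vec V x)).
    by rewrite !dot3 !crossE; ring.
  by rewrite ur mul0r sub0r.
have c3 : dot (r x) (cross (vec V x) (r x)) = 0 by rewrite !dot3 !crossE; ring.
have first := first_relation Wx; rewrite -/uV -/uB -/uV1 in first.
have dots : forall c d e (X Y Z Q : E), dot (c *: X - d *: Y + e *: Z) Q = c * dot X Q - d * dot Y Q + e * dot Z Q.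
  by move=> *; rewrite !dotDl -scaleNr !dotZl; ring.
move: e0; rewrite !dnD; try (by an_); rewrite (dnM ala aV) (dnM bea aB) (dnM gaa aV1) !dn_dot // dalE dbeE dgaE Vd V1d ud' Bd.
rewrite !dots !c1 c2 c3 !dotDr !dotZr -/uV -/uB -/uV1 -/uV2 -/uB1 -/t -/m.
move=> e0; rewrite -[RHS]addr0 -[X in _ = X + _]e0 -[X in _ = _ + X](mulr0 (k * tau x * ri x)) -[X in _ = _ + _ * X]first; ring.
Qed.

(** u is nonzero and orthogonal to rho, Z and Z1, which are thus dependent. *)
Lemma obstruction_vanishes x : W x -> u x != 0 ->
  let t := dot (r x) (vec V x) in let m := dot (r x) (vec V1 x) in let m2 := dot (r x) (vec V2 x) in
  obstruction k (f x) (rr x) (ri x) t m (tau x) (sg x) (pi_ x)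
    (rr x * dot (vec V x) (vec V x) - t ^+ 2)
    (rr x * dot (vec V x) (vec V1 x) - t * m)
    (rr x * dot (vec V x) (vec V2 x) - t * m2)
    (rr x * dot (vec V1 x) (vec V1 x) - m ^+ 2)
    (dot (r x) (cross (vec V x) (vec V1 x))) (dot (r x) (cross (vec V x) (vec V2 x)))
    (dot (r x) (cross (vec V1 x) (vec V2 x))) = 0.
Proof.
move=> Wx u0 t m m2.
pose dta := tau x * t * ri x + sg x.
pose dR := 2 * k * tau x - 2 * t.
pose dsg := tau x * m * ri x + pi_ x.
pose dal := dsg * rr x + sg x * dR - 2 * k * tau x * dta.
pose dbe := 2 * tau x ^+ 2 + 4 * f x * tau x * dta.
pose dga := - (dR * tau x + rr x * dta).
pose a1 := dal + (al x * t + ga x * m) * ri x + f x * tau x * be x.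
pose a2 := al x + dga.
pose b1 := dbe + be x * k * tau x * ri x - f x * tau x * al x * ri x.
pose b2 := be x - f x * tau x * ga x * ri x.
pose Z := al x *: vec V x + be x *: cross (vec V x) (r x) + ga x *: vec V1 x.
pose Z1 := a1 *: vec V x + a2 *: vec V1 x + ga x *: vec V2 x
  + b1 *: cross (vec V x) (r x) + b2 *: cross (vec V1 x) (r x) + 0 *: r x.
suff Z0 : dot (r x) (cross Z Z1) = 0.
  have := etrans (esym (bracket_table (r x) (vec V x) (vec V1 x) (vec V2 x)
     (al x) (be x) (ga x) a1 a2 b1 b2 (ga x) 0)) Z0.
  rewrite -rrE -/t -/m -/m2 => e; apply: etrans e.
  rewrite /obstruction -/dta -/dR -/dsg -/dal -/dbe -/dga.
  have <- : al x = sg x * rr x - k * tau x ^+ 2 by rewrite /al expr2.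
  have <- : be x = 2 * f x * tau x ^+ 2 by rewrite /be expr2.
  by rewrite -/(ga x) -/a1 -/a2 -/b1 -/b2.
apply: (det_zero u0); first exact: u_rho.
  by rewrite /Z !dotDr !dotZr first_relation.
have := second_relation Wx; rewrite /= -/t -/m -/dta -/dR -/dsg -/dal -/dbe -/dga => e2.
rewrite /Z1 !dotDr !dotZr mul0r addr0 -[RHS]e2 /a1 /a2 /b1 /b2.
have := rri Wx; move: (rr x) (ri x) => R' i' h.
have -> : f x * tau x * be x = f x * tau x * be x * (R' * i') by rewrite h mulr1.
ring.
Qed.

(** A curve that starts at x0 and is orthogonal to the normals predicted by rho
    stays in the leaf of x0: the gap between actual and predicted normals
    satisfies a linear differential equation with zero initial value. *)
Section Curve.
Variables (x0 : E) (c dc : R -> E) (de B : R).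
Local Notation inI t := (0 <= t <= de).
Hypotheses (c0 : c 0 = x0) (cW : forall t, inI t -> W (c t)).
Hypothesis cd : forall t, inI t -> forall j, is_derive (t : R) 1 (fun s => c s ord0 j) (dc t ord0 j).
Hypothesis perp : forall t, inI t -> \sum_j (rho j x0 + k * (c t ord0 j - x0 ord0 j)) * dc t ord0 j = 0.
Hypothesis bnd : forall t, inI t -> forall i j, `|V j (c t) / tau (c t) * dc t ord0 i| <= B.

Let gap t j := rho j (c t) - k * c t ord0 j - (rho j x0 - k * x0 ord0 j).

Let gap_normal t : inI t -> tau (c t) * (\sum_i pd i f (c t) * dc t ord0 i) = \sum_i gap t i * dc t ord0 i.
Proof.
move=> tI; have Wt := cW tI.
transitivity (\sum_i gap t i * dc t ord0 i + \sum_j (rho j x0 + k * (c t ord0 j - x0 ord0 j)) * dc t ord0 j).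
  rewrite mulr_sumr -big_split /=; apply: eq_bigr => i _.
  by rewrite /gap rhoE //; ring.
by rewrite perp // addr0.
Qed.

Let gap_zero t j : inI t -> gap t j = 0.
Proof.
move=> tI; pose n s := \sum_i pd i f (c s) * dc s ord0 i.
have gd s l : inI s -> is_derive s 1 (fun s => gap s l) (- (V l (c s) * n s)).
  move=> sI; have Ws := cW sI; have rs := rho_an Ws.
  have h1 := chain_curve (an_diff (rs l)) (cd sI).
  have h2 : is_derive s 1 (k *: (fun s => c s ord0 l)) (k *: dc s ord0 l) by apply: is_deriveZ; exact: cd.
  have h3 := is_deriveB (is_deriveB h1 h2) (is_derive_cst (rho l x0 - k * x0 ord0 l) s 1).
  apply: (is_derive_eq h3); rewrite subr0 /n mulr_sumr -[RHS]sumrN.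
  rewrite (_ : k *: dc s ord0 l = \sum_i k * (i == l)%:R * dc s ord0 i).
    by rewrite -sumrB; apply: eq_bigr => i _; rewrite drho //; ring.
  rewrite (bigD1 l) //= eqxx mulr1 big1 ?addr0 // => i il.
  by rewrite (negPf il) mulr0 mul0r.
pose y s := \sum_l gap s l * gap s l.
pose dy s := \sum_l 2 * gap s l * (- (V l (c s) * n s)).
have yd s : inI s -> is_derive s 1 y (dy s).
  move=> sI.
  have h l : is_derive s 1 (fun s => gap s l * gap s l) (2 * gap s l * - (V l (c s) * n s)).
    by apply: (is_derive_eq (is_deriveM (gd s l sI) (gd s l sI))); rewrite /GRing.scale /=; ring.
  have -> : y = \sum_l (fun s => gap s l * gap s l) by apply/funext => z; rewrite /y fct_sumE.
  exact: is_derive_sum.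
have yb s : inI s -> dy s <= 6 * B * y s.
  move=> sI; have Ws := cW sI.
  have nE : n s = \sum_i gap s i * (dc s ord0 i / tau (c s)).
    apply: (mulfI (tau0 Ws)); rewrite gap_normal // mulr_sumr; apply: eq_bigr => i _.
    by field; exact: tau0.
  have -> : dy s = \sum_l \sum_i - (2 * (gap s l * gap s i) * (V l (c s) / tau (c s) * dc s ord0 i)).
    apply: eq_bigr => l _; rewrite nE mulrN mulr_sumr mulr_sumr -sumrN; apply: eq_bigr => i _; ring.
  have -> : 6 * B * y s = \sum_l \sum_i (gap s l ^+ 2 + gap s i ^+ 2) * B.
    by rewrite /y !(big3 0); ring.
  apply: ler_sum => l _; apply: ler_sum => i _.
  apply: le_trans (ler_norm _) _; rewrite normrN normrM.
  apply: ler_pM => //; last exact: bnd.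
  rewrite ler_norml; apply/andP; split; first by have := sqr_ge0 (gap s l + gap s i); nra.
  by have := sqr_ge0 (gap s l - gap s i); nra.
have y0 : y 0 = 0.
  by rewrite /y big1 // => l _; rewrite /gap c0 subrr mul0r.
have yp s : inI s -> 0 <= y s by move=> _; apply: sumr_ge0 => l _; rewrite -expr2 sqr_ge0.
have := gronwall0 yd yb y0 yp tI => /eqP; rewrite psumr_eq0 => [|l _]; last by rewrite -expr2 sqr_ge0.
by move=> /allP/(_ j (mem_index_enum _)); rewrite /= mulf_eq0 orbb => /eqP.
Qed.

Lemma curve_rho t j : inI t -> rho j (c t) = rho j x0 + k * (c t ord0 j - x0 ord0 j).
Proof. by move=> tI; have := gap_zero j tI; rewrite /gap; lra. Qed.

Lemma curve_tangential (g g1 : E -> R) (A : 'I_3 -> E -> R) t :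
  (forall y, W y -> an g y) -> (forall y i, W y -> pd i g y = A i y + pd i f y * g1 y) ->
  (forall s i, inI s -> A i (c s) = A i x0) -> inI t ->
  g (c t) = g x0 + \sum_i A i x0 * (c t ord0 i - x0 ord0 i).
Proof.
move=> gan gE Ac tI.
pose h s := g (c s) - \sum_i A i x0 * c s ord0 i.
suff e : h t = h 0.
  move: e; rewrite /h c0 => e.
  rewrite (_ : \sum_i _ = \sum_i A i x0 * c t ord0 i - \sum_i A i x0 * x0 ord0 i); first by lra.
  by rewrite -sumrB; apply: eq_bigr => i _; rewrite mulrBr.
apply: (const_on_segment (dh := fun=> 0) _ _ tI) => [s sI|//].
have Ws := cW sI.
have h1 := chain_curve (an_diff (gan _ Ws)) (cd sI).
have h2 : is_derive s 1 (\sum_i (A i x0 *: (fun s => c s ord0 i))) (\sum_i A i x0 *: dc s ord0 i).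
  by apply: is_derive_sum => i; apply: is_deriveZ; exact: cd.
have -> : h = (fun s => g (c s)) - \sum_i (A i x0 *: (fun s => c s ord0 i)).
  by apply/funext => z; rewrite /h !fctE fct_sumE.
apply: (is_derive_eq (is_deriveB h1 h2)).
have n0 : \sum_i pd i f (c s) * dc s ord0 i = 0.
  apply: (mulfI (tau0 Ws)); rewrite gap_normal // mulr0 big1 // => i _.
  by rewrite gap_zero // mul0r.
rewrite -sumrB; apply: etrans (_ : g1 (c s) * (\sum_i pd i f (c s) * dc s ord0 i) = 0).
  by rewrite mulr_sumr; apply: eq_bigr => i _; rewrite gE // Ac // /GRing.scale /=; ring.
by rewrite n0 mulr0.
Qed.

Lemma curve_values t : inI t -> let D := c t - x0 in
  [/\ r (c t) = r x0 + k *: D,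
      [/\ vec V (c t) = vec V x0, vec V1 (c t) = vec V1 x0, vec V2 (c t) = vec V2 x0 & f (c t) = f x0] &
      [/\ tau (c t) = tau x0 + dot (vec V x0) D, sg (c t) = sg x0 + dot (vec V1 x0) D &
          pi_ (c t) = pi_ x0 + dot (vec V2 x0) D]].
Proof.
have z (A : 'I_3 -> E -> R) s : \sum_i A i x0 * (c s ord0 i - x0 ord0 i) = dot (vec A x0) (c s - x0).
  by apply: eq_bigr => i _; rewrite !mxE.
have zc (g g1 : E -> R) s : (forall y, W y -> an g y) -> (forall y i, W y -> pd i g y = pd i f y * g1 y) ->
    inI s -> g (c s) = g x0.
  move=> gan gE sI; rewrite (curve_tangential (A := fun _ _ => 0) (g1 := g1) gan) // ?big1 ?addr0 //.
    by move=> i _; rewrite mul0r.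
  by move=> y i Wy; rewrite gE // add0r.
have Vc s j : inI s -> V j (c s) = V j x0.
  by apply: (zc _ (V1 j)) => [y Wy|y i Wy]; [exact: Va|exact: dV].
have V1c s j : inI s -> V1 j (c s) = V1 j x0.
  by apply: (zc _ (V2 j)) => [y Wy|y i Wy]; [exact: V1_an|exact: dV1].
have V2c s j : inI s -> V2 j (c s) = V2 j x0.
  apply: (zc _ (ncoef (fun _ _ => 0) (V2 j))) => [y Wy|y i Wy]; first exact: V2_an.
  rewrite (tangential_step (g := V1 j) (g1 := V2 j)
    (A := fun _ _ => 0) (A1 := fun _ _ => 0) _ _ _ _ _ _ Wy) ?add0r //.
  - by move=> q Wq; exact: V1_an.
  - by move=> q Wq; exact: V2_an.
  - by move=> q l Wq; rewrite dV1 // add0r.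
  - by move=> q l m Wq; rewrite pd_cst mulr0.
move=> tI D; split.
- by apply/rowP => j; rewrite !mxE curve_rho.
- split; try by apply/rowP => j; rewrite !mxE ?Vc ?V1c ?V2c.
  by apply: (zc _ (fun=> 1)) => // y i Wy; rewrite mulr1.
split; rewrite -z.
- by apply: (curve_tangential (g1 := sg)) => // y i Wy; exact: dtau.
- apply: (curve_tangential (g1 := pi_)) => //; first exact: sg_an.
  by move=> y i Wy; exact: dsg.
- apply: (curve_tangential (g1 := om)) => //; first exact: pi_an.
  by move=> y i Wy; exact: dpi.
Qed.

End Curve.

(** A curve of bounded speed stays, for a short time, in W and in a region where
    the coefficients of the linear equation are bounded. *)
Lemma curve_small x0 (c dc : R -> E) (M : R) : W x0 ->
  (forall t, 0 <= t <= 1 -> forall j, `|c t ord0 j - x0 ord0 j| <= M * t /\ `|dc t ord0 j| <= M) ->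
  exists de B, [/\ 0 < de, forall t, 0 <= t <= de -> t <= 1, forall t, 0 <= t <= de -> W (c t) &
    forall t, 0 <= t <= de -> forall i j, `|V j (c t) / tau (c t) * dc t ord0 i| <= B].
Proof.
move=> Wx0 cM.
have h01 : 0 <= (0 : R) <= 1 by rewrite lexx ler01.
have M0 : 0 <= M by have [_] := cM 0 h01 0; exact: le_trans.
have [K KP] : exists K : 'I_3 -> R, forall j, \forall y \near x0, `|V j y / tau y| <= K j.
  exists (fun j => `|V j x0 / tau x0| + 1) => j.
  have va : an (fun y => V j y / tau y) x0.
    by apply: anM; [exact: Va|apply: anV; [exact: tau0|exact: taua]].
  have /cvgrPdist_lt/(_ 1 ltr01) := an_continuous (w := [::]) va; apply: filterS => y /= h.
  rewrite -lerBlDl; apply: le_trans (ltW h).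
  by rewrite distrC; exact: lerB_dist.
have : \forall y \near x0, W y /\ forall j, `|V j y / tau y| <= K j.
  apply: filterS2 (near_forall3 KP) (open_near Wo Wx0 (fun y Wy => Wy)) => y; split=> //.
move=> /nbhs_ballP[e /= e0 eP].
pose de := Num.min 1 (e / (2 * (M + 1))).
have M1 : 0 < M + 1 by lra.
have de0 : 0 < de by rewrite lt_min ltr01 divr_gt0 // mulr_gt0.
have ball t : 0 <= t <= de -> ball x0 e (c t).
  move=> /andP[t0 td]; have t1 : t <= 1 by apply: le_trans td _; rewrite ge_min lexx.
  have t01 : 0 <= t <= 1 by rewrite t0 t1.
  rewrite -ball_normE /= -opprB normrN.
  apply: le_lt_trans (_ : M * t < e).
    apply: norm_le_coord; first exact: mulr_ge0.
    by move=> i; have [h _] := cM t t01 i; rewrite !mxE.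
  have : t <= e / (2 * (M + 1)) by apply: le_trans td _; rewrite ge_min lexx orbT.
  rewrite ler_pdivlMr ?mulr_gt0 // => h; apply: le_lt_trans (_ : (M + 1) * t < e); nra.
exists de, ((\sum_j `|K j|) * M); split=> //.
- by move=> t /andP[_ td]; apply: le_trans td _; rewrite ge_min lexx.
- by move=> t /ball/eP[].
move=> t td i j; have [_ /(_ j) h] := eP _ (ball t td).
have t01 : 0 <= t <= 1.
  by case/andP: td => -> td; apply: le_trans td _; rewrite ge_min lexx.
rewrite normrM; apply: ler_pM => //; last by have [] := cM t t01 i.
apply: le_trans h _; apply: le_trans (ler_norm _) _.
by rewrite (bigD1 j) //= lerDl sumr_ge0.
Qed.

Hypotheses (f0 : forall x, W x -> f x != 0) (u0 : forall x, W x -> u x != 0).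

(** The line through x0 in the direction v, the component of V tangent to the
    leaf (times |rho|^2).  Along it tau has slope S = V . v, the quantity claimed to
    vanish, and the top coefficient is 4 f^3 S^6. *)
Lemma flat_rigidity x0 : k = 0 -> W x0 ->
  rr x0 * dot (vec V x0) (vec V x0) - dot (r x0) (vec V x0) ^+ 2 = 0.
Proof.
move=> k0 Wx0; set t0 := dot (r x0) (vec V x0); set S := _ - _.
pose v := rr x0 *: vec V x0 - t0 *: r x0.
have vr : dot (r x0) v = 0.
  by rewrite /v -scaleNr dotDr !dotZr -/t0 -rrE; ring.
have vV : dot (vec V x0) v = S.
  by rewrite /v -scaleNr dotDr !dotZr (dotC (vec V x0) (r x0)) -/t0 /S; ring.
pose c t := x0 + t *: v.
have [de [B [de0 de1 cW cB]]] : exists de B, [/\ 0 < de, forall t, 0 <= t <= de -> t <= 1, forall t, 0 <= t <= de -> W (c t) &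
    forall t, 0 <= t <= de -> forall i j, `|V j (c t) / tau (c t) * v ord0 i| <= B].
  apply: (curve_small (c := c) (dc := fun=> v) (M := `|v|) Wx0) => t /andP[tp t1] j.
  split; last exact: norm_coord.
  rewrite (_ : c t ord0 j - x0 ord0 j = t * v ord0 j); last first.
    by rewrite /c mxE addrAC subrr add0r mxE.
  by rewrite normrM ger0_norm // mulrC ler_wpM2r // norm_coord.
have cd (t : R) (_ : 0 <= t <= de) j : is_derive t 1 (fun s => c s ord0 j) (v ord0 j).
  have -> : (fun s => c s ord0 j) = cst (x0 ord0 j) + v ord0 j *: (@idfun R).
    by apply/funext => s; rewrite !mxE !fctE /GRing.scale /= mulrC.
  have h1 : is_derive t 1 (cst (x0 ord0 j) : R -> R) 0 by exact: is_derive_cst.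
  have h2 : is_derive t 1 (v ord0 j *: (@idfun R)) (v ord0 j *: 1) by exact: is_deriveZ.
  by apply: (is_derive_eq (is_deriveD h1 h2)); rewrite add0r /GRing.scale /= mulr1.
have perp t : 0 <= t <= de -> \sum_j (rho j x0 + k * (c t ord0 j - x0 ord0 j)) * v ord0 j = 0.
  move=> _; apply: etrans vr; by apply: eq_bigr => j _; rewrite k0 mul0r addr0 [r x0 _ _]mxE.
have c0 : c 0 = x0 by rewrite /c scale0r addr0.
have val := curve_values c0 cW cd perp cB.
have cD t : c t - x0 = t *: v by rewrite /c addrAC subrr add0r.
have H t : 0 <= t <= de -> obstruction 0 (f x0) (rr x0) (ri x0) t0 (dot (r x0) (vec V1 x0))
    (tau x0 + t * S) (sg x0 + t * dot (vec V1 x0) v) (pi_ x0 + t * dot (vec V2 x0) v) S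
    (rr x0 * dot (vec V x0) (vec V1 x0) - t0 * dot (r x0) (vec V1 x0))
    (rr x0 * dot (vec V x0) (vec V2 x0) - t0 * dot (r x0) (vec V2 x0))
    (rr x0 * dot (vec V1 x0) (vec V1 x0) - dot (r x0) (vec V1 x0) ^+ 2)
    (dot (r x0) (cross (vec V x0) (vec V1 x0))) (dot (r x0) (cross (vec V x0) (vec V2 x0)))
    (dot (r x0) (cross (vec V1 x0) (vec V2 x0))) = 0.
  move=> tI; have Wt := cW t tI.
  have := obstruction_vanishes Wt (u0 Wt).
  have [re [Ve V1e V2e fe] [te se pe]] := val t tI.
  rewrite /ri rrE !re Ve V1e V2e fe te se pe cD k0 scale0r addr0 -rrE !dotZr vV.
  by [].
have := flat_curve de0 H; move/eqP; rewrite mulf_eq0 mulf_eq0 mulf_eq0 !expf_eq0 pnatr_eq0 /=.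
by rewrite (negPf (f0 Wx0)) /= orbb => /eqP.
Qed.

(** The great circle of the leaf through x0 in an arbitrary tangent direction b
    with |b| = |rho|.  [round_curve] gives rho . V = 0 and b . V = 0; then b is taken
    parallel to V. *)
Lemma round_rigidity x0 : k = 1 -> W x0 -> vec V x0 = 0.
Proof.
move=> k1 Wx0; have [a ae] : exists a, a = r x0 by exists (r x0).
have aj j : rho j x0 = a ord0 j by rewrite ae mxE.
have a0 : a != 0 by rewrite ae -dot_eq0 -rrE; exact: rr_neq0.
have key (b : E) : dot a b = 0 -> dot b b = dot a a -> dot a (vec V x0) = 0 /\ dot b (vec V x0) = 0.
  move=> ab bb.
  pose e t : R := 1 + t ^+ 2.
  have ep t : 1 <= e t by rewrite /e lerDl sqr_ge0.
  have e0 t : e t != 0 by rewrite gt_eqF // (lt_le_trans _ (ep t)).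
  pose c t := x0 + ((- (2 * t ^+ 2) / e t) *: a + (2 * t / e t) *: b).
  pose dc t := (- (4 * t) / e t ^+ 2) *: a + (2 * (1 - t ^+ 2) / e t ^+ 2) *: b.
  have ie t : (e t)^-1 <= 1 by rewrite invf_le1 // (lt_le_trans _ (ep t)).
  have ie0 t : 0 <= (e t)^-1 by rewrite invr_ge0 (le_trans _ (ep t)).
  have [de [B [de0 de1 cW cB]]] : exists de B, [/\ 0 < de, forall t, 0 <= t <= de -> t <= 1, forall t, 0 <= t <= de -> W (c t) &
      forall t, 0 <= t <= de -> forall i j, `|V j (c t) / tau (c t) * dc t ord0 i| <= B].
    apply: (curve_small (c := c) (dc := dc) (M := 4 * (`|a| + `|b|)) Wx0) => t /andP[tp t1] j.
    have cmb (p q A : R) : `|p| <= A -> `|q| <= A ->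
        `|p * a ord0 j + q * b ord0 j| <= A * (`|a| + `|b|).
      move=> pA qA; apply: le_trans (ler_normD _ _) _; rewrite !normrM mulrDr.
      by apply: lerD; apply: ler_pM => //; exact: norm_coord.
    have np (x i : R) : 0 <= x -> 0 <= i -> i <= 1 -> `|x * i| <= x.
      by move=> x_0 i0 i1; rewrite normrM !ger0_norm // ler_piMr.
    split.
      rewrite (_ : c t ord0 j - x0 ord0 j = - (2 * t ^+ 2) / e t * a ord0 j + 2 * t / e t * b ord0 j); last first.
        by rewrite /c !mxE addrAC subrr add0r.
      rewrite [leRHS]mulrAC; apply: cmb.
        rewrite mulNr normrN; apply: le_trans (np _ _ _ (ie0 t) (ie t)) _; nra.
      apply: le_trans (np _ _ _ (ie0 t) (ie t)) _; nra.
    have ie2 : (e t ^+ 2)^-1 <= 1 by rewrite -exprVn exprn_ile1.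
    have ie20 : 0 <= (e t ^+ 2)^-1 by rewrite -exprVn exprn_ge0.
    rewrite !mxE; apply: cmb.
      rewrite mulNr normrN; apply: le_trans (np _ _ _ ie20 ie2) _; nra.
    apply: le_trans (np _ _ _ ie20 ie2) _; nra.
  have de' (t : R) : is_derive t 1 (fun s => (e s)^-1) (- (2 * t) / e t ^+ 2).
    have h0 : is_derive t 1 (fun s : R => s * s) (t *: 1 + t *: 1) by exact: is_deriveM.
    have h1 : is_derive t 1 (fun s : R => 1 + s * s) (0 + (t *: 1 + t *: 1)).
      by apply: is_deriveD.
    have ee : e = (fun s : R => 1 + s * s) by apply/funext => s; rewrite /e expr2.
    rewrite -ee in h1.
    have h2 := is_deriveV (e0 t) h1.
    by apply: (is_derive_eq h2); rewrite /GRing.scale /= add0r; field.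
  have cd (t : R) (_ : 0 <= t <= de) j : is_derive t 1 (fun s => c s ord0 j) (dc t ord0 j).
    have id1 : is_derive t 1 (@idfun R) 1 by exact: is_derive_id.
    have h0 : is_derive t 1 (fun s : R => s * (s * (e s)^-1))
       (t *: (t *: (- (2 * t) / e t ^+ 2) + (e t)^-1 *: 1) + (t * (e t)^-1) *: 1).
      by apply: is_deriveM; exact: is_deriveM.
    have h1 : is_derive t 1 (fun s : R => s * (e s)^-1) (t *: (- (2 * t) / e t ^+ 2) + (e t)^-1 *: 1).
      by exact: is_deriveM.
    have -> : (fun s => c s ord0 j) = cst (x0 ord0 j) + ((- 2 * a ord0 j) *: (fun s : R => s * (s * (e s)^-1)) +
       (2 * b ord0 j) *: (fun s : R => s * (e s)^-1)).
      by apply/funext => s; rewrite !mxE !fctE /GRing.scale /=; ring.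
    have hc : is_derive t 1 (cst (x0 ord0 j) : R -> R) 0 by exact: is_derive_cst.
    apply: (is_derive_eq (is_deriveD hc (is_deriveD (is_deriveZ (- 2 * a ord0 j) h0) (is_deriveZ (2 * b ord0 j) h1)))).
    by rewrite add0r /GRing.scale /= !mxE /e; field; exact: e0.
  have cD t : c t - x0 = (- (2 * t ^+ 2) / e t) *: a + (2 * t / e t) *: b.
    by rewrite /c addrAC subrr add0r.
  have rc t : a + k *: (c t - x0) = ((1 - t ^+ 2) / e t) *: a + (2 * t / e t) *: b.
    by rewrite k1 scale1r cD addrA -{1}[a]scale1r -scalerDl; congr (_ *: _ + _); rewrite /e; field; exact: e0.
  have perp t : 0 <= t <= de -> \sum_j (rho j x0 + k * (c t ord0 j - x0 ord0 j)) * dc t ord0 j = 0.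
    move=> _; transitivity (dot (a + k *: (c t - x0)) (dc t)).
      by apply: eq_bigr => j _; rewrite aj !mxE.
    rewrite rc /dc !dotDl !dotDr !dotZl !dotZr ab (dotC b a) ab bb; field; exact: e0.
  have c0 : c 0 = x0.
    by rewrite /c expr0n /= !mulr0 oppr0 !mul0r !scale0r !addr0.
  have val := curve_values c0 cW cd perp cB.
  pose xa := dot a (vec V x0); pose xb := dot b (vec V x0).
  pose ma := dot a (vec V1 x0); pose mb := dot b (vec V1 x0).
  pose na := dot a (vec V2 x0); pose nb := dot b (vec V2 x0).
  apply: (round_curve (f := f x0) (Rr := dot a a) (ri := (dot a a)^-1) (ta := tau x0 - xa) (xa := xa) (xb := xb)
    (sg := sg x0 - ma) (ma := ma) (mb := mb) (pi := pi_ x0 - na) (na := na) (nb := nb)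
    (g := dot (vec V x0) (vec V x0)) (g1 := dot (vec V x0) (vec V1 x0)) (g2 := dot (vec V x0) (vec V2 x0))
    (g11 := dot (vec V1 x0) (vec V1 x0))
    (Ta := dot a (cross (vec V x0) (vec V1 x0))) (Tb := dot b (cross (vec V x0) (vec V1 x0)))
    (Ua := dot a (cross (vec V x0) (vec V2 x0))) (Ub := dot b (cross (vec V x0) (vec V2 x0)))
    (Wa := dot a (cross (vec V1 x0) (vec V2 x0))) (Wb := dot b (cross (vec V1 x0) (vec V2 x0))) de0).
  - by rewrite mulfV // dot_eq0.
  - rewrite mulf_neq0 ?f0 // gt_eqF // ltr_pwDl ?invr_gt0 ?dot_gt0 // mulr_ge0 // sqr_ge0 //.
  move=> t tI; have Wt := cW t tI.
  have := obstruction_vanishes Wt (u0 Wt).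
  have [re [Ve V1e V2e fe] [te se pe]] := val t tI.
  have re' : r (c t) = ((1 - t ^+ 2) / e t) *: a + (2 * t / e t) *: b by rewrite re -ae rc.
  have rrt : rr (c t) = dot a a.
    by rewrite rrE re' !dotDl !dotDr !dotZl !dotZr ab (dotC b a) ab bb /e; field; exact: e0.
  have dr (X : E) : dot (r (c t)) X = ((1 - t ^+ 2) * dot a X + 2 * t * dot b X) / (1 + t ^+ 2).
    by rewrite re' dotDl !dotZl -/(e t); field; exact: e0.
  have dD (X : E) : dot X (c t - x0) = - dot a X + ((1 - t ^+ 2) * dot a X + 2 * t * dot b X) / (1 + t ^+ 2).
    by rewrite dotC cD dotDl !dotZl /e; field; exact: e0.
  rewrite /ri rrt !dr Ve V1e V2e fe te se pe !dD k1 !addrA.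
  by [].
have [b ba b1] := exists_perp a0.
have [Va0 _] : dot a (vec V x0) = 0 /\ dot (Num.sqrt (dot a a) *: b) (vec V x0) = 0.
  apply: key; first by rewrite dotZr dotC ba mulr0.
  by rewrite dotZl dotZr b1 mulr1 -expr2 sqr_sqrtr // dot_ge0.
apply/eqP; apply: contraT => V0.
have q0 := dot_gt0 V0; pose s := Num.sqrt (dot a a / dot (vec V x0) (vec V x0)).
have s2 : s * s = dot a a / dot (vec V x0) (vec V x0).
  by rewrite -expr2 sqr_sqrtr // divr_ge0 ?dot_ge0.
have [_] : dot a (vec V x0) = 0 /\ dot (s *: vec V x0) (vec V x0) = 0.
  apply: key; first by rewrite dotZr Va0 mulr0.
  by rewrite dotZl dotZr mulrA s2 divfK // gt_eqF.
move/eqP; rewrite dotZl mulf_eq0 dot_eq0 (negPf V0) orbF => /eqP s0.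
have := s2; rewrite s0 mul0r => /esym/eqP; rewrite mulf_eq0 invr_eq0 !dot_eq0 (negPf V0) orbF.
by rewrite (negPf a0).
Qed.

End WithField.
End Normalised.
End Structure.

(** * A nonzero solution fixes the centre *)

Section UmbilicCenter.
Context {R : realType}.
Local Notation E := 'rV[R]_3.
Implicit Types (i j : 'I_3) (x y : E).

Lemma const_near (F : E -> R) p : an F p -> (forall i, \forall y \near p, pd i F y = 0) ->
  \forall y \near p, F y = F p.
Proof.
move=> Fp dF.
have Ga : an (fun y => F y - F p) p by an_.
have : \forall y \near p, F y - F p = 0.
  apply: an_zero_near => // w; case/lastP: w => [|w i]; first by rewrite /= subrr.
  rewrite iter_partial_rcons -pdE.
  have e : \forall y \near p, pd i (fun y => F y - F p) y = 0.
    apply: filterS2 (dF i) (an_nbhs Fp) => y h Fy.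
    by rewrite pdB // pd_cst subr0.
  rewrite (nbhs_singleton (iter_partial_near w e)) iter_partial_cst; by case: (w).
by apply: filterS => y /eqP; rewrite subr_eq0 => /eqP.
Unshelve. all: by end_near. Qed.

Lemma near_neq0 (F : E -> R) p : an F p -> F p != 0 -> \forall y \near p, F y != 0.
Proof.
move=> Fp F0; have /cvgrPdist_lt/(_ `|F p|) := an_continuous (w := [::]) Fp.
rewrite normr_gt0 => /(_ F0); apply: filterS => y /= h.
by apply: contraTneq h => ->; rewrite subr0 ltxx.
Qed.

Lemma crossZ_self (c : R) (v : E) : cross v (c *: v) = 0.
Proof. by apply: rowP3; rewrite !(mxE, crossE) ?i3_3 ?i3_1; ring. Qed.

Variables (U : set E) (f : E -> R).
Hypotheses (Uo : open U) (Uc : connected U) (fa : forall x, U x -> an f x).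
Hypotheses (f0 : forall x, U x -> f x != 0) (g0 : forall x, U x -> grad f x != 0).
Hypothesis umb : forall x, U x -> umbilic f x.
Local Notation N i x := (pd i f x).
Local Notation H i j x := (pd i (pd j f) x).
Local Notation q := (normsq f).

(** With hn = H N / |N|^2 and nu = N . hn, an umbilic Hessian is
    mu I + N bb^T + bb N^T: mu is half of the trace of H on the tangent plane, and bb
    is what makes the normal entries agree. *)
Definition hn i x := (\sum_j H i j x * N j x) / q x.
Definition nu x := \sum_i N i x * hn i x.
Definition mu x := (\sum_i H i i x - nu x) / 2.
Definition bb i x := hn i x - (mu x + nu x) / (2 * q x) * N i x.

Let q0 x : U x -> q x != 0. Proof. exact: (normsq_neq0 g0). Qed.
Let qa x : U x -> an q x. Proof. exact: (normsq_an fa). Qed.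

Lemma hn_an i x : U x -> an (hn i) x.
Proof.
move=> Ux; have fx := fa Ux; have qx := qa Ux.
by apply: anM; [an_|apply: anV => //; exact: q0].
Qed.

Lemma nu_an x : U x -> an nu x.
Proof. by move=> Ux; have fx := fa Ux; apply: an_sum => i _; apply: anM; [an_|exact: hn_an]. Qed.

Lemma mu_an x : U x -> an mu x.
Proof. by move=> Ux; have fx := fa Ux; have nx := nu_an Ux; rewrite /mu; an_. Qed.

Lemma bb_an i x : U x -> an (bb i) x.
Proof.
move=> Ux; have fx := fa Ux; have nx := nu_an Ux; have mx := mu_an Ux; have hx := hn_an i Ux.
have qx := qa Ux.
apply: anB => //; apply: anM => //; apply: anM => //; apply: anV; last by an_.
by rewrite mulf_neq0 ?pnatr_eq0 // q0.
Qed.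

Lemma umbilic_hess x : U x -> forall i j,
  H i j x = mu x * (i == j)%:R + N i x * bb j x + bb i x * N j x.
Proof.
move=> Ux; have fx := fa Ux; have qx := q0 Ux.
have [la hla] := (umbilicP fx (g0 Ux)).1 (umb Ux).
have qE : dot (grad f x) (grad f x) = q x by apply: eq_bigr => i _; rewrite !grad_pd.
have HC i j : H i j x = H j i x by exact: pdC.
pose M i j := H i j x - (la * ((i == j)%:R - N i x * N j x / q x) + N i x * hn j x + hn i x * N j x - N i x * N j x * nu x / q x).
have M0 i j : M i j = 0.
  have [t1 [t2 [[t1n t2n [t11 t22 t12]] [_ _ fr]]]] := orthonormal_frame (g0 Ux).
  have Ms k l : M k l = M l k by rewrite /M HC (eq_sym k l); ring.
  have Mn k : \sum_l grad f x ord0 l * M k l = 0.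
    under eq_bigr => l _ do rewrite grad_pd /M mulrBr.
    rewrite sumrB.
    have -> : \sum_l N l x * H k l x = q x * hn k x.
      rewrite /hn mulrC divfK //; apply: eq_bigr => l _; exact: mulrC.
    have -> : \sum_l N l x * (la * ((k == l)%:R - N k x * N l x / q x) + N k x * hn l x + hn k x * N l x - N k x * N l x * nu x / q x)
      = la * (\sum_l N l x * (k == l)%:R - N k x * (q x / q x)) + N k x * nu x + hn k x * q x - N k x * nu x * (q x / q x).
      rewrite {2}/nu; move: (q x)^-1 (nu x) => qi nx; rewrite /normsq.
      by rewrite !(big3 0); ring.
    rewrite divff // (bigD1 k) //= eqxx mulr1 big1 => [|l lk]; first by ring.
    by rewrite eq_sym (negPf lk) mulr0.
  have Mt (a b : E) : dot a (grad f x) = 0 -> dot b (grad f x) = 0 -> bil M a b = 0.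
    move=> an0 bn0; have := hla a b an0 bn0.
    have aN : \sum_k a ord0 k * N k x = 0 by apply: etrans an0; apply: eq_bigr => k _; rewrite grad_pd.
    have bN : \sum_k b ord0 k * N k x = 0 by apply: etrans bn0; apply: eq_bigr => k _; rewrite grad_pd.
    move=> h; have -> : bil M a b = hess f x a b - (la * (\sum_i \sum_j (i == j)%:R * a ord0 i * b ord0 j
       - (\sum_i a ord0 i * N i x) * (\sum_i b ord0 i * N i x) / q x)
       + (\sum_i a ord0 i * N i x) * (\sum_j hn j x * b ord0 j) + (\sum_i hn i x * a ord0 i) * (\sum_i b ord0 i * N i x)
       - (\sum_i a ord0 i * N i x) * (\sum_i b ord0 i * N i x) * nu x / q x).
      rewrite /bil /hess /M; move: (q x)^-1 (nu x) => qi nx.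
      by rewrite !(big3 0); ring.
    rewrite aN bN h !mul0r !mulr0 !subr0 !addr0.
    rewrite (_ : \sum_i \sum_j _ = dot a b) ?subrr //.
    apply: eq_bigr => k _; rewrite (bigD1 k) //= eqxx mul1r big1 ?addr0 // => l lk.
    by rewrite eq_sym (negPf lk) !mul0r.
  by rewrite (sym_frame fr Ms Mn) !Mt // !mul0r !addr0.
have HE i j : H i j x = la * ((i == j)%:R - N i x * N j x / q x) + N i x * hn j x + hn i x * N j x - N i x * N j x * nu x / q x.
  by apply/eqP; rewrite -subr_eq0; apply/eqP; exact: M0.
have muE : mu x = la.
  rewrite /mu; have -> : \sum_i H i i x = la * (3 - q x / q x) + 2 * nu x - nu x * (q x / q x).
    under eq_bigr => i _ do rewrite HE eqxx.
    rewrite {2}/nu; move: (q x)^-1 (nu x) => qi nx; rewrite /normsq.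
    by rewrite !(big3 0) /=; ring.
  by rewrite divff //; field.
by move=> i j; rewrite HE muE /bb muE; field.
Qed.

(** Collinearity with grad f is an analytic condition. *)
Lemma cross_identity (a : E -> E) p : U p -> (forall x, U x -> forall j, an (fun y => a y ord0 j) x) ->
  (\forall x \near p, cross (grad f x) (a x) = 0) -> forall x, U x -> cross (grad f x) (a x) = 0.
Proof.
move=> Up aa c0 x Ux; apply/rowP => j; rewrite [RHS]mxE.
have ca y : U y -> an (fun y => cross (grad f y) (a y) ord0 j) y.
  move=> Uy; have fy := fa Uy; have ay := aa y Uy.
  rewrite (_ : (fun y => _) = (fun y => N (j + 1) y * a y ord0 (j + 1 + 1) - N (j + 1 + 1) y * a y ord0 (j + 1))) //.
  by apply/funext => z; rewrite mxE !grad_pd.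
apply: nbhs_singleton (identity_theorem Uc ca Up _ Ux).
by apply: filterS c0 => y ->; rewrite mxE.
Qed.

Variable u : E -> E.
Hypothesis ub : beltr f U u.

Lemma beltr_sub W : W `<=` U -> beltr f W u.
Proof. by move=> WU x /WU/ub. Qed.

(** Either mu is nonzero at some point near p, or it vanishes near p.  In the first
    case rho = N / mu satisfies d_i rho_j = delta_ij + tau N_i b_j + th_i N_j, and
    equality of the mixed derivatives of rho, contracted with tangent vectors,
    shows that th is normal, whence the normal form with k = 1; then x - rho is
    constant.  In the second case rho = N / N_l has the normal form with k = 0,
    and rho is constant.  [flat_rigidity] gives only that V is parallel to rho,
    but rho_l = 1 is constant, so V_l = 0. *)
Theorem umbilic_center p : U p -> u p != 0 ->
  (exists2 n : E, n != 0 & forall x, U x -> cross (grad f x) n = 0) \/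
  (exists a : E, forall x, U x -> cross (grad f x) (x - a) = 0).
Proof.
move=> Up up0.
have unear : \forall y \near p, u y != 0.
  have [j uj] : exists j, u p ord0 j != 0.
    apply/existsP; rewrite -[X in is_true X]negbK negb_exists; apply/negP => /forallP h.
    case/eqP: up0; apply/rowP => j; rewrite mxE; apply/eqP.
    by have := h j; rewrite negbK.
  have [ua _ _] := ub Up.
  by apply: filterS (near_neq0 (ua j) uj) => y; apply: contraNneq => ->; rewrite mxE.
have ubn : \forall y \near p, U y /\ u y != 0.
  by apply: filterS2 (open_near Uo Up (fun y Uy => Uy)) unear.
have {ubn}/nbhs_ballP[e /= e0 eP] := ubn.
pose W0 := ball p e.
have W0p : W0 p by exact: ballxx.
have W0o : open W0 by exact: ball_open.
have W0U : W0 `<=` U by move=> y /eP[].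
have sub W x1 : W x1 -> (\forall y \near x1, W y) -> exists2 V : set E, open V & V x1 /\ V `<=` W.
  move=> Wx /nbhs_ballP[d /= d0 dP]; exists (ball x1 d); first exact: ball_open.
  by split; [exact: ballxx|].
have [[x1 [Wx1 mu1]]|mu0] := pselect (exists x1, W0 x1 /\ mu x1 != 0).
  right.
  have [W Wo [W1 WW]] : exists2 W : set E, open W & W x1 /\ W `<=` [set y | W0 y /\ mu y != 0].
    apply: sub => //; apply: filterS2 (open_near W0o Wx1 (fun y h => h)) (near_neq0 (mu_an (W0U _ Wx1)) mu1).
    by move=> y.
  have WU : W `<=` U by move=> y /WW[/W0U].
  have Wfa x : W x -> an f x by move=> /WU/fa.
  have Wg0 x : W x -> grad f x != 0 by move=> /WU/g0.
  have m0 x : W x -> mu x != 0 by move=> /WW[].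
  pose tau x := (mu x)^-1.
  pose rho j x := tau x * N j x.
  have taua x : W x -> an tau x by move=> Wx; apply: anV; [exact: m0|exact: mu_an (WU _ Wx)].
  (* the part of the derivative of tau N that has to be shown normal *)
  pose th i x := pd i tau x + tau x * bb i x.
  have tha i x : W x -> an (th i) x.
    move=> Wx; have tx := taua _ Wx; have bx := bb_an i (WU _ Wx); rewrite /th; an_.
  have dr x : W x -> forall i j, pd i (rho j) x = (i == j)%:R + tau x * N i x * bb j x + th i x * N j x.
    move=> Wx i j; have tx := taua _ Wx; have fx := Wfa _ Wx.
    rewrite /rho pdM // umbilic_hess; last exact: WU.
    by rewrite /th /tau; field; exact: m0.
  (* equality of the mixed derivatives of rho *)
  have cod x : W x -> forall i k j, pd k (fun y => tau y * bb j y) x * N i x - pd i (fun y => tau y * bb j y) x * N k x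
      + (pd k (th i) x - pd i (th k) x) * N j x + th i x * H k j x - th k x * H i j x = 0.
    move=> Wx i k j; have tx := taua _ Wx; have fx := Wfa _ Wx; have bx := bb_an j (WU _ Wx).
    have e0' a b : pd a (pd b (rho j)) x = pd a (fun y => tau y * bb j y) x * N b x
       + tau x * bb j x * H a b x + pd a (th b) x * N j x + th b x * H a j x.
      have e1 y : W y -> pd b (rho j) y = (b == j)%:R + (tau y * bb j y) * N b y + th b y * N j y.
        by move=> Wy; rewrite dr //; ring.
      have thx := tha b _ Wx.
      rewrite (pd_on a Wo e1 Wx) pdD; [|by an_|by an_].
      rewrite pdD; [|by an_|by an_]; rewrite pd_cst (pdM a (anM tx bx) (pd_an b fx)).
      by rewrite (pdM a thx (pd_an j fx)); ring.
    have ra : an (rho j) x by rewrite /rho; an_.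
    have := pdC i k ra; rewrite !e0' (pdC i k fx); lra.
  have thN x : W x -> forall i, th i x = N i x * ((\sum_j th j x * N j x) / q x).
    move=> Wx.
    have [t1 [t2 [[t1n t2n [t11 t22 t12]] [_ _ fr]]]] := orthonormal_frame (Wg0 _ Wx).
    have qE : dot (grad f x) (grad f x) = q x by apply: eq_bigr => i _; rewrite !grad_pd.
    have tN (t : E) : dot t (grad f x) = 0 -> \sum_j t ord0 j * N j x = 0.
      by move=> h; apply: etrans h; apply: eq_bigr => i _; rewrite grad_pd.
    have Ht (s t : E) : dot s (grad f x) = 0 -> dot t (grad f x) = 0 ->
        \sum_i \sum_j H i j x * s ord0 i * t ord0 j = mu x * dot s t.
      move=> /tN sn /tN tn.
      transitivity (mu x * (\sum_i \sum_j (i == j)%:R * s ord0 i * t ord0 j)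
         + (\sum_i s ord0 i * N i x) * (\sum_j bb j x * t ord0 j)
         + (\sum_i bb i x * s ord0 i) * (\sum_j t ord0 j * N j x)).
        have hx := umbilic_hess (WU _ Wx).
        under eq_bigr => i _ do under eq_bigr => j _ do rewrite hx.
        by rewrite !(big3 0); ring.
      rewrite sn tn mul0r mulr0 !addr0; congr (_ * _).
      apply: eq_bigr => i _; rewrite (bigD1 i) //= eqxx mul1r big1 ?addr0 // => j ji.
      by rewrite eq_sym (negPf ji) !mul0r.
    (* contraction of [cod] with t, s and t *)
    have key (s t : E) : dot s (grad f x) = 0 -> dot t (grad f x) = 0 -> dot s t = 0 -> dot t t = 1 ->
        \sum_i th i x * s ord0 i = 0.
      move=> sn tn st tt.
      have : \sum_i \sum_k \sum_j t ord0 i * s ord0 k * t ord0 j *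
          (pd k (fun y => tau y * bb j y) x * N i x - pd i (fun y => tau y * bb j y) x * N k x
      + (pd k (th i) x - pd i (th k) x) * N j x + th i x * H k j x - th k x * H i j x) = 0.
        by rewrite big1 // => i _; rewrite big1 // => k _; rewrite big1 // => j _; rewrite cod // mulr0.
      have h1 := tN s sn; have h2 := tN t tn; have h3 := Ht s t sn tn; have h4 := Ht t t tn tn.
      rewrite st mulr0 in h3; rewrite tt mulr1 in h4.
      have -> : \sum_i \sum_k \sum_j t ord0 i * s ord0 k * t ord0 j *
          (pd k (fun y => tau y * bb j y) x * N i x - pd i (fun y => tau y * bb j y) x * N k x
          + (pd k (th i) x - pd i (th k) x) * N j x + th i x * H k j x - th k x * H i j x) =
        (\sum_i t ord0 i * N i x) * (\sum_k \sum_j s ord0 k * t ord0 j * pd k (fun y => tau y * bb j y) x)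
        - (\sum_k s ord0 k * N k x) * (\sum_i \sum_j t ord0 i * t ord0 j * pd i (fun y => tau y * bb j y) x)
        + (\sum_j t ord0 j * N j x) * (\sum_i \sum_k t ord0 i * s ord0 k * (pd k (th i) x - pd i (th k) x))
        + (\sum_i th i x * t ord0 i) * (\sum_k \sum_j H k j x * s ord0 k * t ord0 j)
        - (\sum_k th k x * s ord0 k) * (\sum_i \sum_j H i j x * t ord0 i * t ord0 j).
        by rewrite !(big3 0); gen_atoms; ring.
      rewrite h1 h2 h3 h4 !mul0r mulr0 subr0 !addr0 sub0r => /eqP.
      by rewrite oppr_eq0 mulf_eq0 (negPf (m0 _ Wx)) orbF => /eqP.
    have th1 := key t1 t2 t1n t2n t12 t22.
    have th2 := key t2 t1 t2n t1n (etrans (dotC _ _) t12) t11.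
    move=> i.
    have := congr1 (fun v : E => v ord0 i) (frame_expand (\row_j th j x) fr).
    have dE (t : E) : dot (\row_j th j x) t = \sum_j th j x * t ord0 j.
      by apply: eq_bigr => j _; rewrite mxE.
    rewrite !dE th1 th2 !scale0r !add0r !mxE qE -pdE => ->; rewrite mulrC; congr (_ * (_ / _)).
    by apply: eq_bigr => j _; rewrite grad_pd.
  pose V j x := - (tau x * bb j x + (\sum_j th j x * N j x) / q x * N j x).
  have Va x : W x -> forall j, an (V j) x.
    move=> Wx j; have tx := taua _ Wx; have fx := Wfa _ Wx; have bx := bb_an j (WU _ Wx).
    have thx k := tha k _ Wx; have qx := qa (WU _ Wx).
    apply: anN; apply: anD; first by an_.
    apply: anM => //; apply: anM; first by an_.
    by apply: anV => //; exact: q0 (WU _ Wx).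
  have tau0 x : W x -> tau x != 0 by move=> Wx; rewrite invr_eq0 m0.
  have rhoE x : W x -> forall j, rho j x = tau x * N j x by [].
  have drho x : W x -> forall i j, pd i (rho j) x = 1 * (i == j)%:R - N i x * V j x.
    by move=> Wx i j; rewrite dr // thN // /V; ring.
  have V0 x : W x -> forall j, V j x = 0.
    move=> Wx j; have := round_rigidity Wo Wfa Wg0 Va taua tau0 rhoE drho (beltr_sub WU)
      (fun x Wx => f0 (WU _ Wx)) (fun x Wx => proj2 (eP _ (proj1 (WW _ Wx)))) erefl Wx.
    by move=> /(congr1 (fun v : E => v ord0 j)); rewrite !mxE.
  exists (\row_j (x1 ord0 j - rho j x1)) => x Ux.
  have ra y j : W y -> an (rho j) y.
    by move=> Wy; have tx := taua _ Wy; have fx := Wfa _ Wy; rewrite /rho; an_.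
  apply: (cross_identity (a := fun x => x - \row_j (x1 ord0 j - rho j x1)) (WU _ W1)) => //.
    move=> y Uy j.
    rewrite (_ : (fun z => _) = (fun z : E => z ord0 j - (x1 ord0 j - rho j x1))); first by an_.
    by apply/funext => z; rewrite !mxE.
  have cn : \forall y \near x1, forall j, (y : E) ord0 j - rho j y = x1 ord0 j - rho j x1.
    apply: near_forall3 => j; have rj := ra _ j W1.
    apply: (const_near (F := fun y : E => y ord0 j - rho j y)); first by an_.
    move=> i; apply: open_near Wo W1 _ => y Wy; have rjy := ra _ j Wy.
    by rewrite pdB // pd_coord drho // V0 // mulr0 subr0 mul1r subrr.
  apply: filterS2 cn (open_near Wo W1 (fun y h => h)) => y h Wy.
  have -> : y - \row_j (x1 ord0 j - rho j x1) = tau y *: grad f y.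
    by apply/rowP => j; rewrite !mxE -pdE -h /rho; ring.
  exact: crossZ_self.
left.
have [l Nl] : exists l, N l p != 0.
  apply/existsP; rewrite -[X in is_true X]negbK negb_exists; apply/negP => /forallP h.
  case/eqP: (g0 Up); apply/rowP => j; rewrite grad_pd mxE; apply/eqP.
  by have := h j; rewrite negbK.
have fp := fa Up.
have [W Wo [W1 WW]] : exists2 W : set E, open W & W p /\ W `<=` [set y | W0 y /\ N l y != 0].
  apply: sub => //; apply: filterS2 (open_near W0o W0p (fun y h => h)) (near_neq0 (pd_an l fp) Nl).
  by move=> y.
have WU : W `<=` U by move=> y /WW[/W0U].
have Wfa x : W x -> an f x by move=> /WU/fa.
have Wg0 x : W x -> grad f x != 0 by move=> /WU/g0.
have m0 x : W x -> mu x = 0.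
  by move=> /WW[W0x _]; apply/eqP; apply: contra_notT mu0 => h; exists x.
have n0 x : W x -> N l x != 0 by move=> /WW[].
pose tau x := (N l x)^-1.
pose rho j x := tau x * N j x.
have taua x : W x -> an tau x.
  by move=> Wx; have fx := Wfa _ Wx; apply: anV; [exact: n0|].
pose V j x := - (tau x * bb j x - tau x * tau x * bb l x * N j x).
have Va x : W x -> forall j, an (V j) x.
  move=> Wx j; have tx := taua _ Wx; have fx := Wfa _ Wx.
  by have bx := bb_an j (WU _ Wx); have bl := bb_an l (WU _ Wx); rewrite /V; an_.
have tau0 x : W x -> tau x != 0 by move=> Wx; rewrite invr_eq0 n0.
have rhoE x : W x -> forall j, rho j x = tau x * N j x by [].
have drho x : W x -> forall i j, pd i (rho j) x = 0 * (i == j)%:R - N i x * V j x.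
  move=> Wx i j; have tx := taua _ Wx; have fx := Wfa _ Wx; have nx := n0 _ Wx.
  rewrite /rho pdM // {1}/tau pdV // !umbilic_hess ?m0 //; try exact: WU.
  by rewrite /V /tau; field.
have V0 x : W x -> forall j, V j x = 0.
  move=> Wx; have := flat_rigidity Wo Wfa Wg0 Va taua tau0 rhoE drho (beltr_sub WU)
    (fun x Wx => f0 (WU _ Wx)) (fun x Wx => proj2 (eP _ (proj1 (WW _ Wx)))) erefl Wx.
  have Rn := rr_neq0 Wg0 tau0 rhoE Wx.
  move: Rn; rewrite rrE; set r := vec rho x; set v := vec V x => Rn S0.
  have rl : r ord0 l = 1 by rewrite mxE /rho /tau mulVf // n0.
  have vl : v ord0 l = 0 by rewrite mxE /V /tau; field; exact: n0.
  have z : dot r r *: v = dot r v *: r.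
    apply/eqP; rewrite -subr_eq0 -dot_eq0.
    rewrite -scaleNr !dotDl !dotDr !dotZl !dotZr (dotC v r); apply/eqP.
    transitivity (dot r r * (dot r r * dot v v - dot r v ^+ 2)); first by ring.
    by rewrite S0 mulr0.
  have zE (c : R) (w : E) : (c *: w) ord0 l = c * w ord0 l by rewrite mxE.
  have := congr1 (fun w : E => w ord0 l) z; rewrite /= !zE rl vl mulr0 mulr1 => rv.
  move: z; rewrite -rv scale0r => /eqP; rewrite scaler_eq0 (negPf Rn) /= => /eqP v0 j.
  by have := congr1 (fun w : E => w ord0 j) v0; rewrite !mxE.
exists (\row_j rho j p).
  apply/eqP => /(congr1 (fun w : E => w ord0 l)); rewrite !mxE /rho /tau mulVf //.
  by move/eqP; rewrite oner_eq0.
move=> x Ux.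
apply: (cross_identity (a := fun=> \row_j rho j p) Up) => //.
have ra y j : W y -> an (rho j) y.
  by move=> Wy; have tx := taua _ Wy; have fx := Wfa _ Wy; rewrite /rho; an_.
have cn : \forall y \near p, forall j, rho j y = rho j p.
  apply: near_forall3 => j; apply: const_near; first exact: ra.
  move=> i; apply: open_near Wo W1 _ => y Wy.
  by rewrite drho // V0 // mulr0 subr0 mul0r.
apply: filterS2 cn (open_near Wo W1 (fun y h => h)) => y h Wy.
have -> : \row_j rho j p = tau y *: grad f y.
  by apply/rowP => j; rewrite !mxE -pdE -h.
exact: crossZ_self.
Unshelve. all: by end_near. Qed.

End UmbilicCenter.

(** * Coordinates adapted to parallel planes and concentric spheres *)

Section Charts.
Context {R : realType}.
Local Notation E := 'rV[R]_3.
Implicit Types (i j : 'I_3) (x y : E).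

(** psi = (xi, eta, g - g p) with inverse phi.  The last condition says that xi and
    eta are isothermal coordinates on the leaves of g, that |grad g| = 1, and that
    rotation by a right angle about grad g takes grad xi to grad eta. *)
Definition chart (g : E -> R) (p : E) (phi psi : E -> E) := [/\
  phi 0 = p /\ psi p = 0,
  \forall y \near (0 : E), (forall j, an (fun z => phi z ord0 j) y) /\ psi (phi y) = y,
  \forall x \near p, (forall j, an (fun z => psi z ord0 j) x) /\ phi (psi x) = x,
  \forall x \near p, (psi x) ord0 (1 + 1) = g x - g p &
  \forall x \near p,
    cross (grad g x) (grad (fun z => psi z ord0 0) x) = grad (fun z => psi z ord0 1) x /\
    cross (grad g x) (grad (fun z => psi z ord0 1) x) = - grad (fun z => psi z ord0 0) x].

Definition comb (e1 e2 e3 : E) (a b c : R) : E := a *: e1 + b *: e2 + c *: e3.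

Lemma rowPo (v w : E) : (forall i, v ord0 i = w ord0 i) -> v = w.
Proof. by move=> h; apply/rowP. Qed.

Section Frame.
Variables e1 e2 e3 : E.
Hypotheses (h12 : cross e1 e2 = e3) (h23 : cross e2 e3 = e1) (h31 : cross e3 e1 = e2).
Hypotheses (d11 : dot e1 e1 = 1) (d22 : dot e2 e2 = 1) (d33 : dot e3 e3 = 1)
  (d12 : dot e1 e2 = 0) (d13 : dot e1 e3 = 0) (d23 : dot e2 e3 = 0).
Hypothesis fr : forall v : E, v = comb e1 e2 e3 (dot v e1) (dot v e2) (dot v e3).
Local Notation C := (comb e1 e2 e3).

Lemma crossC (v w : E) : cross v w = - cross w v.
Proof. by apply: rowP3; rewrite !(mxE, crossE) ?i3_3 ?i3_1; ring. Qed.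

Lemma cross_comb a b c a' b' c' :
  cross (C a b c) (C a' b' c') = C (b * c' - c * b') (c * a' - a * c') (a * b' - b * a').
Proof.
have -> : cross (C a b c) (C a' b' c') = (a * b' - b * a') *: cross e1 e2
  + (b * c' - c * b') *: cross e2 e3 + (c * a' - a * c') *: cross e3 e1.
  by rewrite /comb; apply: rowP3; rewrite !(mxE, crossE) ?i3_3 ?i3_1; ring.
by rewrite h12 h23 h31 /comb -addrA addrC.
Qed.

Lemma comb_dot1 a b c : dot (C a b c) e1 = a.
Proof. by rewrite /comb !dotDl !dotZl d11 (dotC e2) d12 (dotC e3) d13; ring. Qed.
Lemma comb_dot2 a b c : dot (C a b c) e2 = b.
Proof. by rewrite /comb !dotDl !dotZl d12 d22 (dotC e3) d23; ring. Qed.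
Lemma comb_dot3 a b c : dot (C a b c) e3 = c.
Proof. by rewrite /comb !dotDl !dotZl d13 d23 d33; ring. Qed.

Lemma comb_norm a b c : dot (C a b c) (C a b c) = a ^+ 2 + b ^+ 2 + c ^+ 2.
Proof. by rewrite {2}/comb !dotDr !dotZr comb_dot1 comb_dot2 comb_dot3; ring. Qed.

Lemma an_dotl (v : E) (p : E) x : an (fun z => dot (z - p) v) x.
Proof.
apply: an_sum => j _; apply: anM => //.
by rewrite (_ : (fun z : E => (z - p) ord0 j) = (fun z : E => z ord0 j - p ord0 j)) //; apply/funext => z; rewrite !mxE.
Qed.

Lemma grad_dotl (v : E) (p : E) x : grad (fun z => dot (z - p) v) x = v.
Proof.
apply: rowPo => i; rewrite grad_pd.
have e : (fun z => dot (z - p) v) = (fun z : E => \sum_j (z ord0 j - p ord0 j) * v ord0 j).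
  by apply/funext => z; apply: eq_bigr => j _; rewrite !mxE.
rewrite e pd_sum //; rewrite (bigD1 i) //= big1 ?addr0 => [|j ji].
  by rewrite pdM // pdB // pd_coord !pd_cst eqxx /=; ring.
by rewrite pdM // pdB // pd_coord !pd_cst eq_sym (negPf ji) /=; ring.
Qed.

Definition rv3 (a b c : R) : E := \row_j (if j == 0 then a else if j == 1 then b else c).

Lemma rv3E a b c : [/\ rv3 a b c ord0 0 = a, rv3 a b c ord0 1 = b & rv3 a b c ord0 (1 + 1) = c].
Proof. by rewrite !mxE. Qed.

(** Cartesian coordinates in an orthonormal frame. *)
Lemma plane_chart p : exists phi psi, chart (fun x => dot x e3) p phi psi.
Proof.
exists (fun y => p + C (y ord0 0) (y ord0 1) (y ord0 (1 + 1))),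
  (fun x => rv3 (dot (x - p) e1) (dot (x - p) e2) (dot (x - p) e3)).
have psiE : [/\ (fun z => rv3 (dot (z - p) e1) (dot (z - p) e2) (dot (z - p) e3) ord0 0) = (fun z => dot (z - p) e1),
   (fun z => rv3 (dot (z - p) e1) (dot (z - p) e2) (dot (z - p) e3) ord0 1) = (fun z => dot (z - p) e2) &
   (fun z => rv3 (dot (z - p) e1) (dot (z - p) e2) (dot (z - p) e3) ord0 (1 + 1)) = (fun z => dot (z - p) e3)].
  by split; apply/funext => z; rewrite mxE.
have [E0 E1 E2] := psiE.
split.
- split; first by rewrite /comb !mxE !scale0r !addr0.
  by apply: rowP3; rewrite !mxE /= subrr /dot big1 // => i _; rewrite mxE mul0r.
- near=> y; split=> [j|].
    rewrite (_ : (fun z => _) = (fun z : E => p ord0 j + (z ord0 0 * e1 ord0 j + z ord0 1 * e2 ord0 j + z ord0 (1 + 1) * e3 ord0 j))) //.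
    by apply/funext => z; rewrite !mxE.
  rewrite addrAC subrr add0r comb_dot1 comb_dot2 comb_dot3.
  by apply: rowP3; rewrite mxE.
- near=> x; split; first by apply: all3; rewrite ?E0 ?E1 ?E2; exact: an_dotl.
  by have [-> -> ->] := rv3E (dot (x - p) e1) (dot (x - p) e2) (dot (x - p) e3); rewrite -fr addrC subrK.
- near=> x; have [_ _ ->] := rv3E (dot (x - p) e1) (dot (x - p) e2) (dot (x - p) e3).
  by rewrite -scaleN1r dotDl dotZl mulN1r.
near=> x; rewrite E0 E1 !grad_dotl.
have -> : grad (fun x => dot x e3) x = e3.
  rewrite (_ : (fun x => dot x e3) = (fun x => dot (x - 0) e3)); first exact: grad_dotl.
  by apply/funext => z; rewrite subr0.
by split=> //; rewrite crossC h23.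
Unshelve. all: by end_near. Qed.

Lemma grad_norm (a x : E) : x != a ->
  an (fun z => Num.sqrt (dot (z - a) (z - a))) x /\
  grad (fun z => Num.sqrt (dot (z - a) (z - a))) x = (Num.sqrt (dot (x - a) (x - a)))^-1 *: (x - a).
Proof.
move=> xa; pose r z := Num.sqrt (dot (z - a) (z - a)).
pose Q (z : E) := \sum_j (z ord0 j - a ord0 j) * (z ord0 j - a ord0 j).
have QE : (fun z => dot (z - a) (z - a)) = Q by apply/funext => z; apply: eq_bigr => j _; rewrite !mxE.
have Qa z : an Q z by rewrite /Q; an_.
have q0 : 0 < dot (x - a) (x - a) by rewrite dot_gt0 // subr_eq0.
have Qx : 0 < Q x by rewrite -QE.
have ra : an r x.
  by rewrite /r (_ : (fun z => _) = (fun z => Num.sqrt (Q z))); [exact: an_sqrt|rewrite -QE].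
split=> //; apply: rowPo => i; rewrite grad_pd -/r.
have r0 : r x != 0 by rewrite gt_eqF // sqrtr_gt0.
have rQ : (fun z => r z * r z) = Q.
  by rewrite -QE; apply/funext => z; rewrite /r -expr2 sqr_sqrtr // dot_ge0.
have : pd i (fun z => r z * r z) x = 2 * (x ord0 i - a ord0 i).
  rewrite rQ /Q pd_sum //; rewrite (bigD1 i) //= big1 ?addr0 => [|j ji].
    by rewrite pdM // pdB // pd_coord pd_cst eqxx /=; ring.
  by rewrite pdM // pdB // pd_coord pd_cst eq_sym (negPf ji) /=; ring.
rewrite pdM // !mxE -/(r x) => h; apply: (mulfI r0); rewrite mulrA mulfV // mul1r.
have := h; lra.
Qed.

(** Stereographic projection from the point opposite to p, extended by
    homogeneity of degree 0.  It is conformal on each sphere; xi and eta are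
    al / (r + ga) and be / (r + ga) in Cartesian coordinates al, be, ga centred at a. *)
Lemma sphere_chart (a p : E) (r0 : R) : 0 < r0 -> p = a + r0 *: e3 ->
  exists phi psi, chart (fun x => Num.sqrt (dot (x - a) (x - a))) p phi psi.
Proof.
move=> r00 pE; pose r x := Num.sqrt (dot (x - a) (x - a)).
pose al x := dot (x - a) e1; pose be x := dot (x - a) e2; pose ga x := dot (x - a) e3.
pose de x := (r x + ga x)^-1.
pose s (y : E) := y ord0 0 ^+ 2 + y ord0 1 ^+ 2.
pose k (y : E) := (r0 + y ord0 (1 + 1)) / (1 + s y).
pose phi (y : E) : E := a + C (k y * (2 * y ord0 0)) (k y * (2 * y ord0 1)) (k y * (1 - s y)).
pose psi x := rv3 (al x * de x) (be x * de x) (r x - r0).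
exists phi, psi.
have rp : r p = r0.
  by rewrite /r pE addrAC subrr add0r dotZl dotZr d33 mulr1 -expr2 sqrtr_sqr gtr0_norm.
have ap : al p = 0 by rewrite /al pE addrAC subrr add0r dotZl dotC d13 mulr0.
have bp : be p = 0 by rewrite /be pE addrAC subrr add0r dotZl dotC d23 mulr0.
have gp : ga p = r0 by rewrite /ga pE addrAC subrr add0r dotZl d33 mulr1.
have [E0 E1 E2] : [/\ (fun z => psi z ord0 0) = (fun z => al z * de z), (fun z => psi z ord0 1) = (fun z => be z * de z)
    & (fun z => psi z ord0 (1 + 1)) = (fun z => r z - r0)].
  by split; apply/funext => z; rewrite mxE.
have s0 y : 0 <= s y by rewrite addr_ge0 // sqr_ge0.
have s1 y : 1 + s y != 0 by rewrite gt_eqF // ltr_pwDl.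
have pa : p != a.
  by rewrite pE -subr_eq0 addrAC subrr add0r scaler_eq0 gt_eqF //= -dot_eq0 d33 oner_eq0.
have ra x : x != a -> an r x by move=> /grad_norm[].
have gad x : an ga x by exact: an_dotl.
have nearp : \forall x \near p, x != a /\ 0 < r x + ga x.
  have c : an (fun x => r x + ga x) p by apply: anD; [exact: ra|exact: gad].
  have /cvgrPdist_lt/(_ (2 * r0)) := an_continuous (w := [::]) c.
  have r20 : 0 < 2 * r0 by lra.
  move=> /(_ r20) h1.
  have h2 : \forall x \near p, ~~ (x == a).
    have /cvgrPdist_lt/(_ r0 r00) := an_continuous (w := [::]) (gad p).
    apply: filterS => x /= h; apply/negP => /eqP xa; move: h.
    rewrite xa /= gp /ga subrr /dot big1 ?subr0 ?gtr0_norm ?ltxx // => i _.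
    by rewrite mxE mul0r.
  apply: filterS2 h1 h2 => x /= h xa; split=> //.
  by move: h; rewrite rp gp ltr_norml; lra.
have rsq x : r x ^+ 2 = al x ^+ 2 + be x ^+ 2 + ga x ^+ 2.
  by rewrite /r sqr_sqrtr ?dot_ge0 // {1 2}(fr (x - a)) comb_norm.
split.
- split; first by rewrite /phi /k /s !mxE /comb pE; congr (_ + _); rewrite !(expr0n, mulr0, scale0r, add0r, addr0, subr0) /= divr1 mulr1.
  by apply: rowP3; rewrite mxE /= ?ap ?bp ?mul0r ?rp ?subrr ?mxE.
- have kn : \forall y \near (0 : E), 0 < r0 + (y : E) ord0 (1 + 1).
    have c : an (fun y : E => r0 + y ord0 (1 + 1)) 0 by an_.
    have /cvgrPdist_lt/(_ r0 r00) := an_continuous (w := [::]) c.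
    by apply: filterS => y /=; rewrite mxE addr0 ltr_norml; lra.
  apply: filterS kn => y kn; split.
    have ka : an k y.
      apply: anM; first by an_.
      by apply: anV; [exact: s1|rewrite /s; an_].
    have sa : an s y by rewrite /s; an_.
    move=> j.
    rewrite (_ : (fun z => _) = (fun z : E => a ord0 j + (k z * (2 * z ord0 0) * e1 ord0 j
       + k z * (2 * z ord0 1) * e2 ord0 j + k z * (1 - s z) * e3 ord0 j))); first by an_.
    by apply/funext => z; rewrite !mxE.
  have Xe : phi y - a = C (k y * (2 * y ord0 0)) (k y * (2 * y ord0 1)) (k y * (1 - s y)).
    by rewrite /phi addrAC subrr add0r.
  have re : r (phi y) = r0 + y ord0 (1 + 1).
    rewrite /r Xe comb_norm.
    rewrite (_ : _ + _ = (r0 + y ord0 (1 + 1)) ^+ 2); first by rewrite sqrtr_sqr gtr0_norm.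
    by rewrite /k; move: (s1 y); rewrite /s => h; field.
  have ge : ga (phi y) = k y * (1 - s y) by rewrite /ga Xe comb_dot3.
  have dE : de (phi y) = (2 * k y)^-1.
    by rewrite /de re ge /k; congr (_^-1); field; exact: s1.
  have k0 : k y != 0 by rewrite mulf_neq0 ?invr_eq0 ?s1 // gt_eqF.
  have [q0 q1 q2] := rv3E (al (phi y) * de (phi y)) (be (phi y) * de (phi y)) (r (phi y) - r0).
  apply: rowP3; rewrite ?q0 ?q1 ?q2 ?dE /al /be ?Xe ?comb_dot1 ?comb_dot2.
  + by field.
  + by field.
  + by rewrite re; ring.
- apply: filterS nearp => x [xa d0]; have rx := ra x xa.
  have dn : r x + ga x != 0 by rewrite gt_eqF.
  have da : an de x by apply: anV => //; apply: anD => //; exact: gad.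
  split.
    apply: all3; rewrite ?E0 ?E1 ?E2; last by an_.
      by apply: anM => //; exact: an_dotl.
    by apply: anM => //; exact: an_dotl.
  have r1 : r x != 0 by rewrite gt_eqF // sqrtr_gt0 dot_gt0 // subr_eq0.
  have [q0 q1 q2] := rv3E (al x * de x) (be x * de x) (r x - r0).
  have q2' : psi x ord0 (1 + 1) = r x - r0 by [].
  have sE : s (psi x) = (r x - ga x) * de x.
    rewrite /s /psi q0 q1 /de; apply: (mulIf (mulf_neq0 dn dn)).
    transitivity (al x ^+ 2 + be x ^+ 2); first by field.
    by move: (rsq x) => h; field: h.
  have kE : k (psi x) = (r x + ga x) / 2.
    rewrite /k sE q2' /de.
    have h : 1 + (r x - ga x) / (r x + ga x) = 2 * r x / (r x + ga x) by field.
    by rewrite h; field; rewrite dn r1.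
  rewrite /phi kE sE /psi q0 q1 /de.
  rewrite -[RHS](subrK a) addrC; congr (_ + _).
  rewrite [RHS]fr; congr comb; rewrite -/(al x) -/(be x) -/(ga x); by field.
- near=> x; have [_ _ ->] := rv3E (al x * de x) (be x * de x) (r x - r0).
  by rewrite -{1}rp.
apply: filterS nearp => x [xa d0]; have rx := ra x xa.
have dn : r x + ga x != 0 by rewrite gt_eqF.
have da : an de x by apply: anV => //; apply: anD => //; exact: gad.
have r1 : r x != 0 by rewrite gt_eqF // sqrtr_gt0 dot_gt0 // subr_eq0.
have [_ gr] := grad_norm xa; rewrite -/(r x) in gr.
have Xf : x - a = C (al x) (be x) (ga x) by exact: fr.
have gE (v : E) : grad (fun z => dot (z - a) v * de z) x = de x *: v - (dot (x - a) v * de x ^+ 2) *: (C (al x / r x) (be x / r x) (ga x / r x + 1)).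
  apply: rowPo => i; rewrite grad_pd pdM //; last exact: an_dotl.
  have -> : pd i (fun z => dot (z - a) v) x = v ord0 i by rewrite -grad_pd grad_dotl.
  have ddx : pd i de x = - (de x ^+ 2) * ((r x)^-1 * (x - a) ord0 i + e3 ord0 i).
    rewrite /de pdV //; last by apply: anD => //; exact: gad.
    rewrite pdD //; have -> : pd i ga x = e3 ord0 i by rewrite -grad_pd grad_dotl.
    have -> : pd i r x = (r x)^-1 * (x - a) ord0 i by rewrite -grad_pd gr [LHS]mxE.
    by rewrite exprVn.
  by rewrite ddx Xf !mxE; ring.
rewrite E0 E1 gr !gE -/(al x) -/(be x).
have c1 : de x *: e1 = C (de x) 0 0 by rewrite /comb !scale0r !addr0.
have c2 : de x *: e2 = C 0 (de x) 0 by rewrite /comb !scale0r add0r addr0.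
have cZ (t a1 b1 c1' : R) : t *: C a1 b1 c1' = C (t * a1) (t * b1) (t * c1') by rewrite /comb !scalerDr !scalerA.
have cB (a1 b1 c1' a2 b2 c2' : R) : C a1 b1 c1' - C a2 b2 c2' = C (a1 - a2) (b1 - b2) (c1' - c2').
  by rewrite /comb !scalerBl; apply/rowP => j; rewrite !mxE; ring.
have cN (a1 b1 c1' : R) : - C a1 b1 c1' = C (- a1) (- b1) (- c1').
  by rewrite /comb !scaleNr !opprD.
have h := rsq x.
rewrite Xf c1 c2 !cZ !cB cN !cross_comb /de.
split; congr comb; field: h; rewrite ?dn ?r1 //.
Unshelve. all: by end_near. Qed.

End Frame.
End Charts.

(** * Functions of the height *)

Section ChartExistence.
Context {R : realType}.
Local Notation E := 'rV[R]_3.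
Implicit Types (i j : 'I_3) (x y : E).

Lemma nearI (p : E) (P Q : E -> Prop) : (\forall y \near p, P y) -> (\forall y \near p, Q y) ->
  \forall y \near p, P y /\ Q y.
Proof. by move=> Pp Qp; apply: filterS2 Pp Qp. Qed.

Definition unitv (n : E) : E := (Num.sqrt (dot n n))^-1 *: n.

Lemma frame_charts (n : E) : n != 0 ->
  (forall p, exists phi psi, chart (fun x => dot x (unitv n)) p phi psi) /\
  (forall a p : E, p - a = n -> exists phi psi, chart (fun x => Num.sqrt (dot (x - a) (x - a))) p phi psi).
Proof.
move=> n0; have [t1 [t2 [[t1n t2n [t11 t22 t12]] [nt1 t12n fr]]]] := orthonormal_frame n0.
set s := Num.sqrt (dot n n) in nt1 t12n.
have s0 : 0 < s by rewrite sqrtr_gt0 dot_gt0.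
have s1 : s != 0 by rewrite gt_eqF.
have ss : s * s = dot n n by rewrite -expr2 sqr_sqrtr // dot_ge0.
have h12 : cross t1 t2 = unitv n.
  by apply: (scalerI s1); rewrite t12n scalerA mulfV // scale1r.
have cZ (c : R) (v w : E) : cross (c *: v) w = c *: cross v w.
  by apply: rowP3; rewrite !(mxE, crossE) ?i3_3 ?i3_1; ring.
have h31 : cross (unitv n) t1 = t2 by rewrite cZ -nt1 scalerA mulVf // scale1r.
have d13 : dot t1 (unitv n) = 0 by rewrite dotZr t1n mulr0.
have d23 : dot t2 (unitv n) = 0 by rewrite dotZr t2n mulr0.
have d33 : dot (unitv n) (unitv n) = 1 by rewrite /unitv -/s dotZl dotZr -ss; field.
have h23 : cross t2 (unitv n) = t1.
  have -> : cross t2 (unitv n) = dot t2 t2 *: t1 - dot t1 t2 *: t2.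
    by rewrite -h12; apply: rowP3; rewrite !(mxE, crossE, dot3) ?i3_3 ?i3_1; ring.
  by rewrite t22 t12 scale1r scale0r subr0.
have fr' v : v = comb t1 t2 (unitv n) (dot v t1) (dot v t2) (dot v (unitv n)).
  rewrite {1}(frame_expand v fr) /comb; congr (_ + _).
  by rewrite dotZr scalerA -/s -ss; congr (_ *: _); field.
split=> [p|a p pa].
  exact: (plane_chart h23 h31 t11 t22 d33 t12 d13 d23 fr').
apply: (sphere_chart h12 h23 h31 t11 t22 d33 t12 d13 d23 fr' s0).
by rewrite scalerA mulfV // scale1r -pa addrC subrK.
Qed.

Lemma cross_eq0 (v w : E) : w != 0 -> cross v w = 0 -> v = (dot v w / dot w w) *: w.
Proof.
move=> w0 c; have q := dot_gt0 w0; have q1 : dot w w != 0 by rewrite gt_eqF.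
apply: (scalerI q1); rewrite scalerA mulrCA mulfV // mulr1.
apply/eqP; rewrite -subr_eq0; apply/eqP.
transitivity (cross w (cross v w)).
  by apply: rowP3; rewrite !(mxE, crossE, dot3) ?i3_3 ?i3_1; ring.
by rewrite c; apply: rowP3; rewrite !(mxE, crossE) ?i3_3 ?i3_1; ring.
Qed.

Section Factor.
Variables (f g : E -> R) (p : E) (phi psi : E -> E).
Hypotheses (ch : chart g p phi psi) (fa : \forall x \near p, an f x).
Hypothesis ga : \forall x \near p, an g x.
Hypothesis fg : \forall x \near p, cross (grad f x) (grad g x) = 0.

Lemma chart_pull (P : E -> Prop) : (\forall x \near p, P x) -> \forall y \near (0 : E), P (phi y).
Proof.
move=> Pp; have [[p0 _] near0 _ _ _] := ch.
have [pa _] := nbhs_singleton near0.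
have pc : {for (0 : E), continuous phi}.
  by apply: differentiable_continuous; apply: differentiable_rV => j; exact/an_diff/pa.
by apply: pc; rewrite p0.
Qed.

Lemma chart_push (P : E -> Prop) : (\forall y \near (0 : E), P y) -> \forall x \near p, P (psi x).
Proof.
move=> Pp; have [[_ p0] _ nearp _ _] := ch.
have [pa _] := nbhs_singleton nearp.
have pc : {for p, continuous psi}.
  by apply: differentiable_continuous; apply: differentiable_rV => j; exact/an_diff/pa.
by apply: pc; rewrite p0.
Qed.

Lemma chart_height : \forall y \near (0 : E), g (phi y) = g p + (y : E) ord0 (1 + 1).
Proof.
have [_ near0 _ gp _] := ch.
apply: filterS2 near0 (chart_pull gp) => y [_ yy] h.
by have := h; rewrite yy => ->; rewrite addrC subrK.
Qed.

Lemma chart_grad : \forall y \near (0 : E), forall i,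
  \sum_j pd j g (phi y) * pd i (fun z => phi z ord0 j) y = (i == 1 + 1)%:R.
Proof.
have [_ near0 _ _ _] := ch.
have := near_join chart_height; apply: filterS3 near0 (chart_pull ga) => y [pa _] gy hy i.
rewrite -(pd_comp i pa gy) (pd_near i hy).
by rewrite pdD // pd_cst pd_coord add0r.
Qed.

Lemma chart_factor_grad : \forall y \near (0 : E), exists la : R,
  [/\ grad f (phi y) = la *: grad g (phi y), an (fun z => f (phi z)) y &
     forall i, pd i (fun z => f (phi z)) y = la * (i == 1 + 1)%:R].
Proof.
have [_ near0 _ _ _] := ch.
apply: filterS3 near0 chart_grad (chart_pull (nearI fa fg)) => y [pa _] cg [fy fgy].
have gn : grad g (phi y) != 0.
  apply/eqP => g0; have := cg (1 + 1); rewrite big1 => [/eqP|j _].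
    by rewrite eqxx eq_sym oner_eq0.
  by rewrite -grad_pd g0 mxE mul0r.
exists (dot (grad f (phi y)) (grad g (phi y)) / dot (grad g (phi y)) (grad g (phi y))).
have e := cross_eq0 gn fgy; split=> //; first exact: an_comp.
move=> i; rewrite (pd_comp i pa fy) -cg mulr_sumr; apply: eq_bigr => j _.
by rewrite mulrA -!grad_pd {1}e [in LHS]mxE.
Qed.

Lemma vertical (F : E -> R) : (\forall y \near (0 : E), [/\ an F y, pd 0 F y = 0 & pd 1 F y = 0]) ->
  \forall y \near (0 : E), F y = F (rv3 0 0 ((y : E) ord0 (1 + 1))).
Proof.
move=> /nbhs_ballP[d /= d0 dP]; apply/nbhs_ballP; exists d => //= y by_.
set z := rv3 0 0 (y ord0 (1 + 1)); pose h := y - z.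
have bz : ball 0 d z.
  move: by_; rewrite -!ball_normE /= !sub0r !normrN => hy.
  apply: le_lt_trans hy; apply: norm_le_coord => //; apply: all3.
  - by rewrite mxE /= normr0.
  - by rewrite mxE /= normr0.
  - by rewrite mxE /=; exact: norm_coord.
have yh : y = z + h by rewrite /h addrC subrK.
have seg t : 0 <= t <= 1 -> ball 0 d (z + t *: h).
  by move=> t01; apply: ball_seg => //; rewrite -yh.
have [t t01 e] : exists2 t : R, 0 <= t <= 1 & F (z + h) - F z = linform (fun i => partial i F (z + t *: h)) h.
  by apply: mvt_seg => t /seg/dP[Fa _ _]; exact: an_diff.
have [_ F0 F1] := dP _ (seg t t01).
have : F (z + h) - F z = 0.
  rewrite e /linform (big3 0) i3_1 -pdE F0 F1 !mulr0 !add0r.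
  by rewrite /h !mxE /= subrr mul0r.
by rewrite -yh => /eqP; rewrite subr_eq0 => /eqP.
Qed.

Lemma chart_factor : \forall x \near p, f x = f (phi (rv3 0 0 (g x - g p))).
Proof.
have [_ _ nearp gp _] := ch.
have v : \forall y \near (0 : E), f (phi y) = f (phi (rv3 0 0 ((y : E) ord0 (1 + 1)))).
  apply: (vertical (F := fun y => f (phi y))).
  apply: filterS chart_factor_grad => y [la [_ fa' d]].
  by split=> //; rewrite d mulr0.
apply: filterS3 nearp gp (chart_push v) => x [_ xx] gx.
by rewrite xx gx.
Qed.

End Factor.

(** Analytic functions of one variable are regarded as functions of three that
    depend on the first coordinate only. *)
Definition an1 (H : R -> R) (s : R) := forall y : E, y ord0 0 = s -> an (fun z : E => H (z ord0 0)) y.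
Definition slope (H : R -> R) (s : R) := pd 0 (fun z : E => H (z ord0 0)) (rv3 s 0 0).

Lemma an1_eq (H H' : R -> R) s d : 0 < d -> (forall t, `|t - s| < d -> H t = H' t) -> an1 H s ->
  an1 H' s /\ slope H' s = slope H s.
Proof.
move=> d0 e Ha.
have en (y : E) : y ord0 0 = s -> \forall z \near y, H ((z : E) ord0 0) = H' (z ord0 0).
  move=> ys; apply/nbhs_ballP; exists d => //= z; rewrite -ball_normE /= => yz.
  apply: e; apply: le_lt_trans yz; rewrite -normrN opprB -ys.
  by have := norm_coord (z - y) 0; rewrite !mxE.
split=> [y ys|]; first by apply: an_near (Ha y ys); exact: en.
by rewrite /slope (pd_near 0 (en _ _)) // mxE.
Qed.

Lemma an1_identity (H H' : R -> R) (J : set R) c : is_interval J -> J c ->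
  (forall s, J s -> an1 H s /\ an1 H' s) -> (\forall s \near c, H s = H' s) ->
  forall s, J s -> H s = H' s.
Proof.
move=> Ji Jc Ha Hc s Js.
pose D : set E := (fun t : R => t *: (delta_mx ord0 0 : E)) @` J.
have Dc : connected D.
  apply: connected_continuous_connected; first exact/connected_intervalP.
  by apply: continuous_subspaceT => t; exact: scalel_continuous.
have e0 (t : R) : (t *: (delta_mx ord0 0 : E)) ord0 0 = t by rewrite !mxE /= mulr1.
have Da x : D x -> an (fun z : E => H (z ord0 0) - H' (z ord0 0)) x.
  by move=> [t Jt <-]; have [h h'] := Ha t Jt; apply: anB; [exact: h|exact: h'].
have Dp : D (c *: (delta_mx ord0 0 : E)) by exists c.
have z : \forall x \near (c *: (delta_mx ord0 0 : E)), H ((x : E) ord0 0) - H' (x ord0 0) = 0.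
  have /cvgrPdist_lt cc : {for (c *: (delta_mx ord0 0 : E)), continuous (fun z : E => z ord0 0)}.
    by apply: differentiable_continuous; exact/an_diff/an_coord.
  move: Hc => /nbhs_ballP[d /= d0 dP]; have := cc d d0; apply: filterS => x /=.
  by rewrite e0 => h; rewrite dP ?subrr // -ball_normE.
have := identity_theorem Dc Da Dp z (x := s *: delta_mx ord0 0) (ex_intro2 _ _ s Js erefl).
by move=> /nbhs_singleton; rewrite e0 => /eqP; rewrite subr_eq0 => /eqP.
Qed.

Lemma slope_injective (H : R -> R) (J : set R) : is_interval J ->
  (forall s, J s -> an1 H s) -> (forall s, J s -> slope H s != 0) ->
  forall s t, J s -> J t -> H s = H t -> s = t.
Proof.
move=> Ji Ha Hs s t Js Jt e.
have lin (tt : R) : rv3 s 0 0 + tt *: rv3 (t - s) 0 0 = rv3 (s + tt * (t - s)) 0 0.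
  by apply: rowP3; rewrite !mxE /= ?mulr0 ?addr0.
have inJ (tt : R) : 0 <= tt <= 1 -> J (s + tt * (t - s)).
  move=> /andP[t0 t1]; case: (lerP s t) => st.
    by apply: (Ji s t) => //; apply/andP; split; nra.
  by apply: (Ji t s) => //; apply/andP; split; nra.
have [c c01] : exists2 c : R, 0 <= c <= 1 & (fun z : E => H (z ord0 0)) (rv3 s 0 0 + rv3 (t - s) 0 0) - (fun z : E => H (z ord0 0)) (rv3 s 0 0)
    = linform (fun i => partial i (fun z : E => H (z ord0 0)) (rv3 s 0 0 + c *: rv3 (t - s) 0 0)) (rv3 (t - s) 0 0).
  apply: mvt_seg => tt tt01; rewrite lin; apply: an_diff.
  by apply: Ha (inJ tt tt01) _ _; rewrite mxE.
rewrite /linform (big3 0) ?i3_1 lin !mxE /= -pdE -/(slope H _) !mul0r !addr0.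
rewrite addrC subrK e subrr => /esym/eqP; rewrite mulf_eq0 (negPf (Hs _ (inJ c c01))) orbF.
by rewrite subr_eq0 => /eqP.
Qed.

Section Global.
Variables (U : set E) (f g : E -> R).
Hypotheses (Uo : open U) (Uc : connected U).
Hypotheses (fa : forall x, U x -> an f x) (ga : forall x, U x -> an g x).
Hypotheses (f0 : forall x, U x -> grad f x != 0).
Hypotheses (fg : forall x, U x -> cross (grad f x) (grad g x) = 0).
Hypothesis gch : forall p, U p -> exists phi psi, chart g p phi psi.

(** Near x and near z the function f is the same injective analytic function H of
    the height.  A single H on an interval containing both heights is required:
    a level surface may be disconnected, and local factorizations alone do not
    compare the heights of its components. *)
Definition related x z := exists (J : set R) (H : R -> R),
  [/\ is_interval J /\ open J, J (g x), J (g z),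
      forall s, J s -> an1 H s /\ slope H s != 0 &
      (\forall y \near x, f y = H (g y)) /\ (\forall y \near z, f y = H (g y))].

Let gcont x : U x -> {for x, continuous g}.
Proof. by move=> Ux; apply: differentiable_continuous; exact/an_diff/ga. Qed.

Lemma related_near x : U x -> \forall z \near x, related x z.
Proof.
move=> Ux; have [phi [psi ch]] := gch Ux.
have fn : \forall y \near x, an f y by exact: open_near Uo Ux fa.
have gn : \forall y \near x, an g y by exact: open_near Uo Ux ga.
have fgn : \forall y \near x, cross (grad f y) (grad g y) = 0 by exact: open_near Uo Ux fg.
have fac := chart_factor ch fn gn fgn.
have [[phi0 psi0] _ _ _ _] := ch.
have := nearI (chart_factor_grad ch fn gn fgn) (chart_pull ch (open_near Uo Ux f0)).
move=> /nbhs_ballP[d /= d0 dP].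
pose J : set R := ball (g x) d.
pose H s := f (phi (rv3 0 0 (s - g x))).
have Jx : J (g x) by exact: ballxx.
have HJ s : J s -> an1 H s /\ slope H s != 0.
  move=> Js.
  have bs : ball 0 d (rv3 0 0 (s - g x)).
    move: Js; rewrite /J -!ball_normE /= sub0r normrN => h.
    apply: le_lt_trans (_ : `|g x - s| < d) => //; rewrite distrC.
    by apply: norm_le_coord => //; apply: all3; rewrite mxE /= ?normr0.
  have [[la [gla fa' d']] fn0] := dP _ bs.
  pose G y := f (phi y).
  have He : (fun z : E => H (z ord0 0)) = (fun z => G (rv3 0 0 (z ord0 0 - g x))) by [].
  have va (y : E) : forall j, an (fun z : E => rv3 0 0 (z ord0 0 - g x) ord0 j) y.
    apply: all3.
    - by rewrite (_ : (fun z => _) = (fun=> 0)) //; apply/funext => z; rewrite mxE.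
    - by rewrite (_ : (fun z => _) = (fun=> 0)) //; apply/funext => z; rewrite mxE.
    by rewrite (_ : (fun z => _) = (fun z : E => z ord0 0 - g x)) //; apply/funext => z; rewrite mxE.
  have Ga (y : E) : y ord0 0 = s -> an G (rv3 0 0 (y ord0 0 - g x)) by move=> ->.
  split=> [y ys|]; first by rewrite He; apply: (an_comp (Phi := fun z : E => rv3 0 0 (z ord0 0 - g x))); [exact: va|exact: Ga].
  have y0 : (rv3 s 0 0 : E) ord0 0 = s by rewrite mxE.
  rewrite /slope He (pd_comp 0 (Phi := fun z : E => rv3 0 0 (z ord0 0 - g x)) (va _) (Ga _ y0)).
  rewrite (big3 0) ?i3_1 y0 !d' /= !mulr0 !mul0r !add0r mulr1.
  rewrite (_ : (fun z => _) = (fun z : E => z ord0 0 - g x)); last by apply/funext => z; rewrite mxE.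
  rewrite pdB // pd_cst pd_coord subr0 eqxx mulr1.
  by apply: contraNneq fn0 => l0; rewrite gla l0 scale0r.
have Jn : \forall z \near x, J (g z).
  have /cvgrPdist_lt/(_ d d0) := gcont Ux; apply: filterS => z /= h.
  by rewrite /J -ball_normE.
apply: filterS2 Jn (near_join fac) => z Jz fz; exists J, H; split=> //.
split; last exact: ball_open.
move=> a b; rewrite /J -ball_normE /= => ha hb c /andP[ac cb].
by move: ha hb; rewrite !ltr_norml; lra.
Qed.

Lemma related_sym x z : related x z -> related z x.
Proof. by move=> [J [H [JJ Jx Jz HJ [fx fz]]]]; exists J, H; split. Qed.

(** The two functions agree near the height of y, hence on the intersection of
    the intervals, and glue. *)
Lemma related_trans x y z : U x -> U y -> U z -> related x y -> related y z -> related x z.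
Proof.
move=> Ux Uy Uz [J1 [H1 [[I1 O1] J1x J1y A1' [F1x F1y]]]] [J2 [H2 [[I2 O2] J2y J2z A2' [F2y F2z]]]].
have agree s : J1 s -> J2 s -> H1 s = H2 s.
  move=> s1 s2; apply: (an1_identity (J := J1 `&` J2) (c := g y)) => //.
  - move=> a b [a1 a2] [b1 b2] c acb.
    by split; [exact: (I1 a b)|exact: (I2 a b)].
  - by move=> t [/A1'[h _] /A2'[h' _]].
  have [phi [psi ch]] := gch Uy.
  have [[phi0 psi0] _ _ _ _] := ch.
  have := nearI (chart_height ch) (chart_pull ch (nearI F1y F2y)).
  move=> /nbhs_ballP[d /= d0 dP]; apply/nbhs_ballP; exists d => //= t.
  rewrite -ball_normE /= => h.
  have b : ball 0 d (rv3 0 0 (t - g y)).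
    rewrite -ball_normE /= sub0r normrN; apply: le_lt_trans h; rewrite distrC.
    by apply: norm_le_coord => //; apply: all3; rewrite mxE /= ?normr0.
  have [gt [f1 f2]] := dP _ b.
  have e : g (phi (rv3 0 0 (t - g y))) = t by rewrite gt mxE /= addrC subrK.
  by move: f1 f2; rewrite e => -> ->.
pose H s := if pselect (J1 s) then H1 s else H2 s.
have HE1 s : J1 s -> H s = H1 s by rewrite /H; case: pselect.
have HE2 s : J2 s -> H s = H2 s.
  by rewrite /H; case: pselect => // s1 s2; exact: agree.
exists (J1 `|` J2), H; split.
- split; last exact: openU.
  have gen (a b c d : R) (K L : set R) : is_interval K -> is_interval L -> K a -> L b -> K d -> L d ->
      a <= c <= b \/ b <= c <= a -> K c \/ L c.
    move=> IK IL Ka Lb Kd Ld h; case: (lerP c d) => cd.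
      by case: h => h; [left; apply: (IK a d)|right; apply: (IL b d)] => //; lra.
    by case: h => h; [right; apply: (IL d b)|left; apply: (IK d a)] => //; lra.
  move=> a b [a1|a2] [b1|b2] c acb.
  + by left; exact: (I1 a b).
  + by apply: (gen a b c (g y)) => //; left.
  + by apply: (gen b a c (g y)) => //; right.
  + by right; exact: (I2 a b).
- by left.
- by right.
- have loc (K : set R) (L : R -> R) s : open K -> K s -> (forall t, K t -> H t = L t) ->
     an1 L s /\ slope L s != 0 -> an1 H s /\ slope H s != 0.
    move=> Ko Ks HL [La Ls].
    have := open_nbhs_nbhs (conj Ko Ks) => /nbhs_ballP[d /= d0 dP].
    have [h1 h2] : an1 H s /\ slope H s = slope L s.
      apply: (an1_eq d0) => // t ts; rewrite HL //; apply: dP.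
      by rewrite -ball_normE /= distrC.
    by rewrite h2.
  move=> s [s1|s2]; first exact: (loc J1 H1 _ O1 s1 HE1 (A1' _ s1)).
  exact: (loc J2 H2 _ O2 s2 HE2 (A2' _ s2)).
have nearJ (K : set R) w : U w -> open K -> K (g w) -> \forall v \near w, K (g v).
  by move=> Uw Ko Kw; apply: (gcont Uw); exact: open_nbhs_nbhs.
split.
  by apply: filterS2 F1x (nearJ J1 x Ux O1 J1x) => v -> J1v; rewrite HE1.
by apply: filterS2 F2z (nearJ J2 z Uz O2 J2z) => v -> J2v; rewrite HE2.
Qed.

(** By connectedness all points of U are related, and H is injective. *)
Lemma levels_global x z : U x -> U z -> f x = f z -> g x = g z.
Proof.
move=> Ux Uz fxz.
suff : related x z.
  move=> [J [H [[Ji _] Jx Jz HJ [fx fz]]]].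
  apply: (slope_injective Ji (fun s Js => proj1 (HJ s Js)) (fun s Js => proj2 (HJ s Js))) => //.
  by rewrite -(nbhs_singleton fx) -(nbhs_singleton fz).
pose A := [set y | U y /\ related x y].
suff AU : A = U by have [] : A z by rewrite AU.
have pt y : U y -> \forall v \near y, U v /\ related y v.
  move=> Uy; apply: filterS2 (open_near Uo Uy (fun v h => h)) (related_near Uy) => v; by split.
apply: Uc.
- by exists x; split=> //; exact: nbhs_singleton (related_near Ux).
- exists A; last by rewrite setIidr // => y [].
  rewrite openE => y [Uy xy]; apply: filterS (pt y Uy) => v [Uv yv].
  by split=> //; exact: (related_trans Ux Uy Uv xy yv).
exists (~` [set y | U y /\ ~ related x y]).
  rewrite closedC openE => y [Uy xy]; apply: filterS (pt y Uy) => v [Uv yv].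
  by split=> // xv; apply: xy; exact: (related_trans Ux Uv Uy xv (related_sym yv)).
apply/seteqP; split=> y; rewrite /A /=.
  by move=> [Uy xy]; split=> // -[].
move=> [Uy h]; split=> //; apply: contrapT => xy; exact: h.
Qed.

End Global.
End ChartExistence.

(** * Planes, spheres and heights *)

Section Foliations.
Context {R : realType}.
Local Notation E := 'rV[R]_3.
Implicit Types (i j : 'I_3) (x y : E).
Variables (U : set E) (f : E -> R).
Hypotheses (Uo : open U) (fa : forall x, U x -> an f x).
Hypotheses (g0 : forall x, U x -> grad f x != 0).

Definition height (g : E -> R) := [/\ forall x, U x -> an g x,
  forall x, U x -> cross (grad f x) (grad g x) = 0 &
  forall p, U p -> exists phi psi, chart g p phi psi].

Lemma dot_unitv (n x y : E) : n != 0 -> dot x (unitv n) = dot y (unitv n) -> dot n x = dot n y.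
Proof.
move=> n0; have s0 : Num.sqrt (dot n n) != 0 by rewrite gt_eqF // sqrtr_gt0 dot_gt0.
by rewrite /unitv !dotZr !(dotC n) => /(mulfI _); apply; rewrite invr_eq0.
Qed.

Lemma plane_height_an (v x : E) : an (fun z => dot z v) x /\ grad (fun z => dot z v) x = v.
Proof.
have e : (fun z => dot z v) = (fun z => dot (z - 0) v) by apply/funext => z; rewrite subr0.
by rewrite e; split; [exact: an_dotl|exact: grad_dotl].
Qed.

Lemma crossZr (c : R) (v w : E) : cross v (c *: w) = c *: cross v w.
Proof. by apply: rowP3; rewrite !(mxE, crossE) ?i3_3 ?i3_1; ring. Qed.

Lemma plane_height (n : E) : n != 0 -> (forall x, U x -> cross (grad f x) n = 0) ->
  height (fun x => dot x (unitv n)).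
Proof.
move=> n0 fn; split=> [x _|x Ux|p _]; first by have [] := plane_height_an (unitv n) x.
  by have [_ ->] := plane_height_an (unitv n) x; rewrite crossZr fn // scaler0.
by have [h _] := frame_charts n0; exact: h.
Qed.

Lemma sphere_height (a : E) : ~ U a -> (forall x, U x -> cross (grad f x) (x - a) = 0) ->
  height (fun x => Num.sqrt (dot (x - a) (x - a))).
Proof.
move=> Ua fn; have xa x : U x -> x != a by move=> Ux; apply: contra_notN Ua => /eqP <-.
split=> [x Ux|x Ux|p Up]; first by have [] := grad_norm (xa x Ux).
  by have [_ ->] := grad_norm (xa x Ux); rewrite crossZr fn // scaler0.
have pa : p - a != 0 by rewrite subr_eq0; exact: xa.
by have [_ h] := frame_charts pa; exact: h.
Qed.

Lemma center_notin (a : E) : (forall x, U x -> cross (grad f x) (x - a) = 0) -> ~ U a.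
Proof.
move=> fn Ua; have fx := fa Ua; case/eqP: (g0 Ua); apply: rowPo => j; rewrite [RHS]mxE grad_pd.
pose i := j + 1 + 1.
have e y : U y -> pd (i + 1) f y * (y ord0 (i + 1 + 1) - a ord0 (i + 1 + 1)) -
    pd (i + 1 + 1) f y * (y ord0 (i + 1) - a ord0 (i + 1)) = 0.
  by move=> Uy; have := congr1 (fun v : E => v ord0 i) (fn y Uy); rewrite !mxE -pdE.
have := pd_on (i + 1 + 1) Uo e Ua.
rewrite pdB ?pdM ?pdB // !pd_coord !pd_cst !subrr !mulr0 !subr0 !add0r eqxx mulr1.
have -> : (i + 1 + 1 == i + 1 :> 'I_3) = false by move: (i); apply: all3; rewrite ?i3_1 ?i3_3 ?i3_1.
by rewrite mulr0 subr0 /i i3K.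
Qed.

(** [umbilic_center] gives collinear gradients, [levels_global] turns this into a
    statement about whole level sets, which need not be connected. *)
Lemma umbilic_rigidity (u : E -> E) p : connected U -> (forall x, U x -> f x != 0) ->
  (forall x, U x -> umbilic f x) -> beltr f U u -> U p -> u p != 0 ->
  in_parallel_planes U f \/ in_concentric_spheres U f.
Proof.
move=> Uc f0 umb ub Up up0.
have [[n n0 fn]|[a fa']] := umbilic_center Uo Uc fa f0 g0 umb ub Up up0.
  left; exists n => // c; have [ga gf gc] := plane_height n0 fn.
  have [[x0 [Ux0 fx0]]|no] := pselect (exists x0, level_surface U f c x0); last first.
    by exists 0 => x hx; case: no; exists x.
  exists (dot n x0) => x [Ux fx] /=; apply: dot_unitv => //.
  by apply: (levels_global Uo Uc fa ga g0 gf gc) => //; rewrite fx.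
right; exists a => c; have Ua := center_notin fa'.
have [ga gf gc] := sphere_height Ua fa'.
have [[x0 [Ux0 fx0]]|no] := pselect (exists x0, level_surface U f c x0); last first.
  by exists 1 => // x hx; case: no; exists x.
have xa : x0 - a != 0 by rewrite subr_eq0; apply: contra_notN Ua => /eqP <-.
exists (Num.sqrt (dot (x0 - a) (x0 - a))); first by rewrite sqrtr_gt0 dot_gt0.
move=> x [Ux fx] /=.
rewrite -(levels_global Uo Uc fa ga g0 gf gc Ux Ux0) ?fx ?fx0 //.
by rewrite sqr_sqrtr // dot_ge0.
Qed.

(** If the component v of grad g tangent to the level of f were nonzero, then on the
    short segment p + t v + s n with |s| <= al t the intermediate value theorem
    would give a point of the level of f at which g is larger than at p. *)
Lemma levels_parallel (g : E -> R) : (forall x, U x -> an g x) ->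
  (forall x y, U x -> U y -> f x = f y -> g x = g y) ->
  forall p, U p -> cross (grad f p) (grad g p) = 0.
Proof.
move=> ga lev p Up; have fp := fa Up; have gp := ga p Up.
pose n := grad f p; have n0 : n != 0 by exact: g0.
have q0 := dot_gt0 n0; set q := dot n n in q0.
pose v := grad g p - (dot (grad g p) n / q) *: n.
have vn : dot v n = 0 by rewrite /v -scaleN1r !(dotDl, dotZl) -/q; field; rewrite gt_eqF.
have [v0|v0] := eqVneq v 0.
  have -> : grad g p = (dot (grad g p) n / q) *: n by apply/eqP; rewrite -subr_eq0 -/v v0.
  exact: crossZ_self.
exfalso; have v2 := dot_gt0 v0.
have vg : dot v (grad g p) = dot v v.
  by rewrite {3}/v -scaleN1r !(dotDr, dotZr) vn; ring.
have linE (F : E -> R) h : linform (fun i => partial i F p) h = dot h (grad F p).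
  by apply: eq_bigr => i _; rewrite mxE.
pose M := 1 + `|v| + `|n|; have M0 : 1 <= M by rewrite /M -addrA lerDl addr_ge0.
pose al := dot v v / (2 * (`|dot n (grad g p)| + 1)).
have al0 : 0 < al by rewrite divr_gt0 // mulr_gt0 //; have := normr_ge0 (dot n (grad g p)); lra.
(* With this error in the first-order expansions, f - f p has the sign of s at the
   ends s = al t and s = - al t, and g - g p is at least t |v|^2 / 4 in between. *)
pose e1 := Num.min (al * q) (dot v v / 2) / (2 * M * (1 + al)).
have A1 : 0 < 1 + al by lra.
have e1p : 0 < e1.
  by rewrite divr_gt0 ?mulr_gt0 ?lt_min ?mulr_gt0 ?divr_gt0 //; lra.
have fd := diff_hasd (an_diff fp) e1p; have gd := diff_hasd (an_diff gp) e1p.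
have Un : \forall h \near (0 : E), U (h + p).
  have /nbhs_ballP[d /= d0 dP] : \forall y \near p, U y by exact: open_near Uo Up (fun y h => h).
  apply/nbhs_ballP; exists d => //= h; rewrite -ball_normE /= sub0r normrN => hd.
  by apply: dP; rewrite -ball_normE /= opprD addrCA subrr addr0 normrN.
have := nearI Un (nearI fd gd) => /nbhs_ballP[d /= d0 dP].
pose t := Num.min 1 (d / (2 * M * (1 + al))).
have t0 : 0 < t by rewrite lt_min ltr01 divr_gt0 ?mulr_gt0 //; lra.
have at0 : 0 <= al * t by rewrite mulr_ge0 // ltW.
have hb s : - (al * t) <= s <= al * t -> `|t *: v + s *: n| <= t * M * (1 + al).
  move=> /andP[s1 s2]; apply: le_trans (ler_normD _ _) _; rewrite !normrZ (gtr0_norm t0).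
  have sa : `|s| <= al * t by rewrite ler_norml s1 s2.
  have h1 : `|s| * `|n| <= al * t * `|n| by rewrite ler_wpM2r.
  have := normr_ge0 v; have := normr_ge0 n; rewrite /M.
  move=> nn vv; have := mulr_ge0 (ltW al0) (ltW t0); nra.
have tb : t * M * (1 + al) < d.
  have : t <= d / (2 * M * (1 + al)) by rewrite ge_min lexx orbT.
  rewrite ler_pdivlMr ?mulr_gt0 //; last lra.
  have tp : 0 < t * M * (1 + al) by rewrite !mulr_gt0 //; lra.
  rewrite (_ : t * (2 * M * (1 + al)) = 2 * (t * M * (1 + al))); last by ring.
  lra.
have inb s : - (al * t) <= s <= al * t -> ball 0 d (t *: v + s *: n).
  by move=> /hb h; rewrite -ball_normE /= sub0r normrN; exact: le_lt_trans tb.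
have e1M s : - (al * t) <= s <= al * t -> e1 * `|t *: v + s *: n| <= t * (Num.min (al * q) (dot v v / 2) / 2).
  move=> /hb h; apply: le_trans (ler_wpM2l (ltW e1p) h) _; rewrite /e1.
  have M1 : M != 0 by rewrite gt_eqF //; lra.
  by rewrite le_eqVlt; apply/orP; left; apply/eqP; field; rewrite M1 gt_eqF.
have lf s : dot (t *: v + s *: n) n = s * q by rewrite dotDl !dotZl vn mulr0 add0r.
have lg s : dot (t *: v + s *: n) (grad g p) = t * dot v v + s * dot n (grad g p).
  by rewrite dotDl !dotZl vg.
have mq : Num.min (al * q) (dot v v / 2) <= al * q by rewrite ge_min lexx.
have mv : Num.min (al * q) (dot v v / 2) <= dot v v / 2 by rewrite ge_min lexx orbT.
pose F s := f (t *: v + s *: n + p).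
have F1 : f p <= F (al * t).
  have at_ : - (al * t) <= al * t <= al * t by rewrite lexx andbT ge0_cp.
  have [_ [h _]] := dP _ (inb _ at_); have k := e1M _ at_.
  have := le_trans h k; rewrite linE -/n lf ler_norml -/(F _) => /andP[h1 _].
  have : 0 < t * (al * q) by rewrite !mulr_gt0.
  have : t * (Num.min (al * q) (dot v v / 2) / 2) <= t * (al * q / 2).
    by apply: ler_wpM2l; [exact: ltW|move: mq; lra].
  rewrite -/(F _) in h1 *; move: h1; have -> : al * t * q = t * (al * q) by ring.
  have -> : t * (al * q / 2) = t * (al * q) / 2 by ring.
  move: (F _) (f p) (t * (al * q)) (t * _) => a1 a2 a3 a4; lra.
have F2 : F (- (al * t)) <= f p.
  have at_ : - (al * t) <= - (al * t) <= al * t by rewrite lexx ge0_cp.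
  have [_ [h _]] := dP _ (inb _ at_); have k := e1M _ at_.
  have := le_trans h k; rewrite linE -/n lf ler_norml -/(F _) => /andP[_ h1].
  have : 0 < t * (al * q) by rewrite !mulr_gt0.
  have : t * (Num.min (al * q) (dot v v / 2) / 2) <= t * (al * q / 2).
    by apply: ler_wpM2l; [exact: ltW|move: mq; lra].
  rewrite -/(F _) in h1 *; move: h1; have -> : - (al * t) * q = - (t * (al * q)) by ring.
  have -> : t * (al * q / 2) = t * (al * q) / 2 by ring.
  move: (F _) (f p) (t * (al * q)) (t * _) => a1 a2 a3 a4; lra.
have [s sI Fs] : exists2 s, s \in `[- (al * t), al * t] & F s = f p.
  apply: IVT; first by rewrite ge0_cp.
    apply: derivable_within_continuous => s; rewrite in_itv /= => sI.
    have [Us _] := dP _ (inb s sI).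
    have Fd : differentiable f ((t *: v + p) + s *: n).
      by apply: an_diff; apply: fa; rewrite addrAC.
    have -> : F = (fun s => f ((t *: v + p) + s *: n)).
      by apply/funext => z; rewrite /F addrAC.
    by have [] := derive_line Fd.
  by rewrite ge_min F2 le_max F1 orbT.
move: sI; rewrite in_itv /= => sI.
have [Us [_ h]] := dP _ (inb s sI).
have gg : g (t *: v + s *: n + p) = g p by apply: lev => //; rewrite -Fs.
have := le_trans h (e1M s sI); rewrite linE lg gg subrr sub0r normrN => h2.
have h3 : `|s * dot n (grad g p)| <= t * (dot v v / 2).
  rewrite normrM; apply: le_trans (_ : al * t * `|dot n (grad g p)| <= _).
    by apply: ler_wpM2r => //; rewrite ler_norml.
  rewrite mulrAC mulrC; apply: ler_wpM2l; first exact: ltW.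
  rewrite /al mulrAC ler_pdivrMr; last by rewrite mulr_gt0 //; have := normr_ge0 (dot n (grad g p)); lra.
  have := normr_ge0 (dot n (grad g p)); nra.
have h4 : t * (Num.min (al * q) (dot v v / 2) / 2) <= t * (dot v v / 4).
  by apply: ler_wpM2l; [exact: ltW|lra].
move: h2 h3; rewrite !ler_norml => /andP[_ h2] /andP[h3 _].
have : 0 < t * dot v v by rewrite mulr_gt0.
lra.
Qed.

Lemma foliation_height : in_parallel_planes U f \/ in_concentric_spheres U f -> exists g, height g.
Proof.
move=> [[n n0 pl]|[a sp]].
  exists (fun x => dot x (unitv n)); apply: plane_height => // x Ux.
  have s0 : Num.sqrt (dot n n) != 0 by rewrite gt_eqF // sqrtr_gt0 dot_gt0.
  have := @levels_parallel (fun x => dot x n) (fun y _ => proj1 (plane_height_an n y)) _ x Ux.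
  have [_ ->] := plane_height_an n x; apply=> y z Uy Uz e; rewrite !(dotC _ n).
  have [d dP] := pl (f z).
  by rewrite (dP y) ?(dP z).
have Ua : ~ U a.
  move=> Ua; have [r r0 rP] := sp (f a); have := rP a (conj Ua erefl).
  rewrite /= subrr /dot big1 => [/esym/eqP|i _]; last by rewrite mxE mul0r.
  by rewrite sqrf_eq0 gt_eqF.
exists (fun x => Num.sqrt (dot (x - a) (x - a))).
have xa x : U x -> x != a by move=> Ux; apply: contra_notN Ua => /eqP <-.
have ga x : U x -> an (fun x => Num.sqrt (dot (x - a) (x - a))) x.
  by move=> Ux; have [] := grad_norm (xa x Ux).
apply: sphere_height => // x Ux.
have := levels_parallel ga _ Ux.
have [_ ->] := grad_norm (xa x Ux); rewrite crossZr.
have s0 : Num.sqrt (dot (x - a) (x - a)) != 0.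
  by rewrite gt_eqF // sqrtr_gt0 dot_gt0 // subr_eq0 xa.
move=> /(_ _)/eqP; rewrite scaler_eq0 invr_eq0 (negPf s0) /= => h; apply/eqP/h => y z Uy Uz e.
have [r r0 rP] := sp (f z).
by congr Num.sqrt; rewrite (rP y) ?(rP z).
Qed.

End Foliations.

(** * Holomorphic functions with given values on the axis *)

Section HarmonicExtension.
Context {R : realType}.
Local Notation E := 'rV[R]_3.
Implicit Types (i j : 'I_3) (x y p : E) (w : seq 'I_3).

(** The sum of c_k Q_k when the bounds b_k on the Q_k, weighted by |c_k|, are
    summable. *)
Section Series.
Variables (c : nat -> R) (Q : nat -> E -> R) (b : nat -> R) (p : E) (r K D : R).
Hypotheses (r0 : 0 < r) (K0 : 0 <= K).
Hypothesis Qb : forall k, anb (ball p r) (Q k) (b k) K.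
Hypothesis cD : forall N, \sum_(k < N) `|c k| * b k <= D.

Definition series_sum x : R := limn (fun N => \sum_(k < N) c k * Q k x).

Let s N x := \sum_(k < N) c k * Q k x.

Let sE w N x : ball p r x -> iter_partial w (s N) x = \sum_(k < N) c k * iter_partial w (Q k) x /\
  differentiable (iter_partial w (s N)) x.
Proof.
elim: w x => [|i w IH] x bx.
  split=> //; apply: differentiable_sumf => k _; apply: differentiableZ.
  by have [] := Qb k (leqnn 0) bx (w := [::]).
have e2 : forall y, ball p r y -> iter_partial (i :: w) (s N) y =
    \sum_(k < N) c k * iter_partial (i :: w) (Q k) y.
  move=> y by_ /=.
  rewrite (partial_near _ (open_near (ball_open _ _) by_ (fun y by_ => (IH y by_).1))).
  rewrite partial_sum => [|k _].
    apply: eq_bigr => k _; rewrite partialZ //.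
    by have [] := Qb k (leqnn (size w)) by_.
  by apply: differentiableZ; have [] := Qb k (leqnn (size w)) by_.
split; first exact: e2.
apply: (differentiable_near (F := fun y => \sum_(k < N) c k * iter_partial (i :: w) (Q k) y)).
  by apply: (open_near (ball_open _ _) bx) => y by_; rewrite e2.
apply: differentiable_sumf => k _; apply: differentiableZ.
by have [] := Qb k (leqnn (size (i :: w))) bx.
Qed.

Let sb w N x : ball p r x ->
  \sum_(k < N) `|c k * iter_partial w (Q k) x| <= D * K ^+ size w * (size w)`!%:R.
Proof.
move=> bx; apply: le_trans (_ : (\sum_(k < N) `|c k| * b k) * (K ^+ size w * (size w)`!%:R) <= _).
  rewrite mulr_suml; apply: ler_sum => k _; rewrite normrM -mulrA ler_wpM2l // mulrA.
  by have [] := Qb k (leqnn (size w)) bx.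
by rewrite -mulrA; apply: ler_wpM2r => //; rewrite mulr_ge0 // exprn_ge0.
Qed.

Let sc w x : ball p r x -> cvgn (fun N => iter_partial w (s N) x).
Proof.
move=> bx; have -> : (fun N => iter_partial w (s N) x) = series (fun k => c k * iter_partial w (Q k) x).
  apply/funext => N; have [-> _] := sE w N bx.
  by rewrite /series /= big_mkord.
apply: normed_cvg; set v := fun k => _.
rewrite (_ : [normed series v] = (fun N => \sum_(k < N) `|v k|)); last first.
  by apply/funext => N; exact: (big_mkord xpredT (fun k => `|v k|)).
apply: nondecreasing_is_cvgn.
  by apply/nondecreasing_seqP => n; rewrite big_ord_recr /= lerDl.
by exists (D * K ^+ size w * (size w)`!%:R) => _ [N _ <-]; exact: sb.
Qed.

Lemma series_sumP : anb (ball p r) series_sum D K /\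
  forall w x, ball p r x ->
    cvgn (fun N => \sum_(k < N) c k * iter_partial w (Q k) x) /\
    iter_partial w series_sum x = limn (fun N => \sum_(k < N) c k * iter_partial w (Q k) x).
Proof.
have D0 : 0 <= D by have := cD 0; rewrite big_ord0.
have [|h1 h2] := limit_anb r0 D0 K0 (s := s) _ sc.
  move=> N n w x wn bx; have [-> ?] := sE w N bx; split=> //.
  by apply: le_trans (ler_norm_sum _ _ _) (sb w N bx).
split=> // w x bx; have e : (fun N => iter_partial w (s N) x) = (fun N => \sum_(k < N) c k * iter_partial w (Q k) x).
  by apply/funext => N; have [] := sE w N bx.
by rewrite -e; split; [exact: sc|exact: h2].
Qed.

End Series.

(** Real and imaginary parts of (y0 + i y1)^k. *)
Fixpoint cpow k (y : E) : R * R := if k is k'.+1 then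
  (y ord0 0 * (cpow k' y).1 - y ord0 1 * (cpow k' y).2,
   y ord0 0 * (cpow k' y).2 + y ord0 1 * (cpow k' y).1) else (1, 0).

(** The boolean selects the imaginary part; [cdc] and [cpr] give coefficient and
    index of the derivatives, in the form that [family_bnd] takes. *)
Definition cq (t : nat * bool) (y : E) : R := if t.2 then (cpow t.1 y).2 else (cpow t.1 y).1.
Definition cdc (i : 'I_3) (t : nat * bool) : R :=
  if i == 0 then t.1%:R else if i == 1 then (if t.2 then t.1%:R else - t.1%:R) else 0.
Definition cpr (i : 'I_3) (t : nat * bool) : nat * bool := (t.1.-1, if i == 1 then ~~ t.2 else t.2).

Lemma cpow_an k y : an (fun z => (cpow k z).1) y /\ an (fun z => (cpow k z).2) y.
Proof.
elim: k => [|k [h1 h2]] /=; first by split; exact: an_cst.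
by split; [apply: anB; exact: anM|apply: anD; exact: anM].
Qed.

Lemma cq_an t y : an (cq t) y.
Proof. by case: t => k [] ; have [] := cpow_an k y. Qed.

Lemma cq_pd i t y : pd i (cq t) y = cdc i t * cq (cpr i t) y.
Proof.
case: t => k b; elim: k b => [|k IH] b.
  rewrite /cq /cdc /cpr /=; case: b => /=; rewrite pd_cst;
  by case: ifP => _; rewrite ?mul0r //; case: ifP => _; rewrite ?oppr0 ?mul0r.
have [h1 h2] := cpow_an k y.
have I1 := IH false; have I2 := IH true; rewrite /cq /cdc /cpr /= in I1 I2.
rewrite /cq /cdc /cpr /=; case: b => /=.
  rewrite pdD; [|by an_|by an_]; rewrite !pdM // !pd_coord I1 I2.
  move: i {IH I1 I2}; apply: all3 => /=; case: k h1 h2 => [|k] _ _ /=; rewrite ?[k.+2%:R]mulrSr ?mulr1n; ring.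
rewrite pdB; [|by an_|by an_]; rewrite !pdM // !pd_coord I1 I2.
move: i {IH I1 I2}; apply: all3 => /=; case: k h1 h2 => [|k] _ _ /=; rewrite ?[k.+2%:R]mulrSr ?mulr1n; ring.
Qed.

Lemma cpow_norm k y : (cpow k y).1 ^+ 2 + (cpow k y).2 ^+ 2 = (y ord0 0 ^+ 2 + y ord0 1 ^+ 2) ^+ k.
Proof. by elim: k => [|k IH] /=; [rewrite expr0n /= expr1n addr0 expr0|rewrite [RHS]exprS -IH; ring]. Qed.

Lemma cq_bnd (rho : R) t y : 0 < rho -> ball 0 (rho / 2) y -> `|cq t y| <= rho ^+ t.1.
Proof.
move=> r0; rewrite -ball_normE /= sub0r normrN => yr.
have h : `|cq t y| ^+ 2 <= (rho ^+ t.1) ^+ 2.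
  rewrite real_normK ?num_real //.
  apply: le_trans (_ : (y ord0 0 ^+ 2 + y ord0 1 ^+ 2) ^+ t.1 <= _).
    rewrite -cpow_norm /cq; case: (t.2); first by rewrite lerDr sqr_ge0.
    by rewrite lerDl sqr_ge0.
  rewrite -exprM mulnC exprM; apply: lerXn2r; rewrite ?nnegrE ?sqr_ge0 ?addr_ge0 ?sqr_ge0 //.
  have := norm_coord y 0; have := norm_coord y 1.
  have a0 := normr_ge0 (y ord0 0); have a1 := normr_ge0 (y ord0 1).
  rewrite -[y ord0 0 ^+ 2]real_normK ?num_real // -[y ord0 1 ^+ 2]real_normK ?num_real //.
  by move=> h1 h2; nra.
by rewrite -(@ler_pXn2r _ 2) // ?nnegrE // exprn_ge0 // ltW.
Qed.

Lemma cq_axis (y : E) k : y ord0 1 = 0 -> cpow k y = (y ord0 0 ^+ k, 0).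
Proof. by move=> y1; elim: k => [|k IH] //=; rewrite IH y1 /= !mul0r mulr0 subr0 addr0 exprS. Qed.

Lemma axis_words (h : E) k (X : seq 'I_3 -> R) : h ord0 1 = 0 -> h ord0 (1 + 1) = 0 ->
  \sum_(w <- words k) vpow h w * X w = h ord0 0 ^+ k * X (nseq k 0).
Proof.
move=> h1 h2; elim: k X => [|k IH] X; first by rewrite /= big_seq1 /vpow big_nil expr0.
rewrite big_words (big3 0) i3_1 /=.
have e i : \sum_(w <- words k) vpow h (i :: w) * X (i :: w) = h ord0 i * \sum_(w <- words k) vpow h w * X (i :: w).
  by rewrite mulr_sumr; apply: eq_bigr => w _; rewrite /vpow big_cons mulrA.
by rewrite !e h1 h2 !mul0r !addr0 (IH (fun w => X (0 :: w))) exprS mulrA.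
Qed.

(** The series of (1/k!) d_0^k g(0) (y0 + i y1)^k.  The Cauchy estimates for g
    bound its coefficients by C K^k. *)
Lemma harmonic_extension (g : E -> R) : an g 0 -> exists P Q : E -> R,
  (\forall y \near (0 : E), [/\ an P y, an Q y,
     pd 0 P y = pd 1 Q y /\ pd 1 P y = - pd 0 Q y & pd (1 + 1) P y = 0 /\ pd (1 + 1) Q y = 0]) /\
  (\forall y \near (0 : E), coord_subspace 1 y -> P y = g y /\ Q y = 0).
Proof.
move=> [r [C [K [r0 C0 K1 gb]]]].
pose c k := iter_partial (nseq k 0) g 0 / k`!%:R.
have f0 k : 0 < (k`!%:R : R) by rewrite ltr0n fact_gt0.
have b0 : ball (0 : E) r 0 by exact: ballxx.
have cb k : `|c k| <= C * K ^+ k.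
  rewrite /c normrM normfV (gtr0_norm (f0 k)) ler_pdivrMr //.
  by have [_] := gb k (nseq k 0) 0 (eq_leq (size_nseq _ _)) b0; rewrite size_nseq.
have K0 : 0 < K by lra.
(* K sg = 1/2 makes the coefficients geometric *)
pose rho := (4 * K)^-1; pose sg := (2 * K)^-1.
have rho0 : 0 < rho by rewrite invr_gt0 mulr_gt0.
have sg2 : sg = 2 * rho by rewrite /sg /rho; field; rewrite gt_eqF.
have rs : rho < sg by lra.
have rr0 : 0 < rho / 2 by lra.
have fam (t : nat * bool) : anb (ball 0 (rho / 2)) (cq t) (sg ^+ t.1) (4 * K).
  move=> n; have := @family_bnd R _ (fun t : nat * bool => t.1) cq cdc cpr (ball 0 (rho / 2)) rho sg
    (ball_open _ _) (ltW rho0) rs.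
  move=> /(_ _ _ _ _ _ n t)/bnd_le; apply.
  - move=> k _; rewrite mulrC -!mulrA; apply: ler_wpM2l; first by rewrite exprn_ge0 // sg2; lra.
    apply: ler_wpM2r => //; rewrite -exprVn; apply: lerXn2r; rewrite ?nnegrE ?invr_ge0; try lra.
    by rewrite sg2 (_ : 2 * rho - rho = rho); [rewrite /rho invrK|ring].
  - by move=> t' y _; exact/an_diff/cq_an.
  - by move=> i t' y _; rewrite -pdE cq_pd.
  - move=> i t'; rewrite /cdc; case: ifP => _; first by rewrite normr_nat.
    by case: ifP => _; [case: (t'.2); rewrite ?normrN normr_nat|rewrite normr0].
  - by [].
  - by move=> t' y; exact: cq_bnd.
have cD N : \sum_(k < N) `|c k| * sg ^+ k <= 2 * C.
  apply: le_trans (_ : \sum_(k < N) C * (2^-1) ^+ k <= _).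
    apply: ler_sum => k _.
    apply: le_trans (_ : C * K ^+ k * sg ^+ k <= _).
      by apply: ler_wpM2r; [rewrite exprn_ge0 // sg2; lra|exact: cb].
    rewrite -mulrA -exprMn /sg (_ : K * (2 * K)^-1 = 2^-1) //; field; rewrite gt_eqF //.
  rewrite -mulr_sumr mulrC; apply: ler_wpM2r => //.
  have e : \sum_(k < N) (2^-1 : R) ^+ k = 2 - 2 * 2^-1 ^+ N.
    elim: N => [|N IH]; first by rewrite big_ord0 expr0; ring.
    by rewrite big_ord_recr /= IH exprS; field.
  by rewrite e gerBl mulr_ge0 // exprn_ge0 // invr_ge0.
have K4 : 0 <= 4 * K by lra.
have [Pa PE] := series_sumP rr0 K4 (fun k => fam (k, false)) cD.
have [Qa QE] := series_sumP rr0 K4 (fun k => fam (k, true)) cD.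
set P := series_sum c (fun k => cq (k, false)) in Pa PE.
set Q := series_sum c (fun k => cq (k, true)) in Qa QE.
have D0 : 0 <= 2 * C by lra.
have Pan : an P 0 by exists (rho / 2), (2 * C), (4 * K); split=> //; lra.
have Qan : an Q 0 by exists (rho / 2), (2 * C), (4 * K); split=> //; lra.
exists P, Q; split.
  have bn : \forall y \near (0 : E), ball (0 : E) (rho / 2) y.
    by apply: open_near (ball_open _ _) (ballxx _ rr0) (fun y h => h).
  apply: filterS3 (an_nbhs Pan) (an_nbhs Qan) bn => y Py Qy by_; split=> //.
  - have [_ p0] := PE [:: 0] y by_; have [_ p1] := PE [:: 1] y by_.
    have [_ q0] := QE [:: 0] y by_; have [_ q1] := QE [:: 1] y by_.
    rewrite /= -pdE in p0 p1 q0 q1; rewrite p0 p1 q0 q1; split.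
      congr (limn _); apply/funext => N; apply: eq_bigr => k _.
      by rewrite !cq_pd /cdc /cpr /=.
    have qc : cvgn (fun N => \sum_(k < N) c k * pd 0 (cq (nat_of_ord k, true)) y).
      by have [] := QE [:: 0] y by_; rewrite /= -pdE.
    rewrite -limN //; congr (limn _); apply/funext => N; rewrite -[RHS]sumrN; apply: eq_bigr => k _.
    by rewrite !cq_pd /cdc /cpr /=; ring.
  have [_ p2] := PE [:: 1 + 1] y by_; have [_ q2] := QE [:: 1 + 1] y by_.
  rewrite /= -pdE in p2 q2; rewrite p2 q2; split.
    rewrite (_ : (fun N => _) = (fun=> 0)) ?lim_cst //; apply/funext => N; rewrite big1 // => k _.
    by rewrite cq_pd /cdc /= mul0r mulr0.
  rewrite (_ : (fun N => _) = (fun=> 0)) ?lim_cst //; apply/funext => N; rewrite big1 // => k _.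
  by rewrite cq_pd /cdc /= mul0r mulr0.
have e0 : 0 < Num.min r (6 * K)^-1 by rewrite lt_min r0 invr_gt0 mulr_gt0.
have bn := open_near (ball_open (0 : E) _) (ballxx _ e0) (fun y h => h).
apply: filterS bn => y by_ ax.
have y1 : y ord0 1 = 0 by exact: ax.
have y2 : y ord0 (1 + 1) = 0 by exact: ax.
have yb : `|y| < Num.min r (6 * K)^-1 by move: by_; rewrite -ball_normE /= sub0r normrN.
have ybr : ball 0 r (0 + y).
  by rewrite add0r -ball_normE /= sub0r normrN; apply: lt_le_trans yb _; rewrite ge_min lexx.
have yk : 3 * K * `|y| <= 2^-1.
  have : `|y| <= (6 * K)^-1 by apply: le_trans (ltW yb) _; rewrite ge_min lexx orbT.
  move=> h; apply: le_trans (_ : 3 * K * (6 * K)^-1 <= _); first by rewrite ler_wpM2l //; lra.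
  by rewrite le_eqVlt; apply/orP; left; apply/eqP; field; rewrite gt_eqF.
split; last first.
  rewrite /Q /series_sum (_ : (fun N => _) = (fun=> 0)) ?lim_cst //; apply/funext => N; rewrite big1 // => k _.
  by rewrite /cq /= cq_axis // mulr0.
have cv : (fun N => \sum_(k < N) c k * cq (nat_of_ord k, false) y) @ \oo --> g y.
  apply/cvgrPdist_lt => e ep.
  have C1 : 0 < C + 1 by lra.
  have h2 : 0 <= (2^-1 : R) by rewrite invr_ge0.
  have h1 : (2^-1 : R) < 1 by rewrite invf_lt1 //; lra.
  have [N0 N0P] := pow_small h2 h1 (divr_gt0 ep C1).
  exists N0 => // N /= NN.
  have := taylor N gb ybr; rewrite add0r.
  rewrite (_ : \sum_(k < N) _ = \sum_(k < N) c k * cq (nat_of_ord k, false) y); last first.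
    apply: eq_bigr => k _; rewrite axis_words // /cq /= cq_axis //= /c; ring.
  move=> h; apply: le_lt_trans h _.
  apply: le_lt_trans (_ : (C + 1) * 2^-1 ^+ N0 < e); last first.
    by rewrite mulrC -ltr_pdivlMr.
  apply: ler_pM => //; [by rewrite exprn_ge0 // !mulr_ge0 //; lra|lra|].
  apply: le_trans (_ : 2^-1 ^+ N <= _); last by apply: ler_wiXn2l => //; exact: ltW.
  by apply: lerXn2r; rewrite ?nnegrE // !mulr_ge0 //; lra.
by rewrite /P /series_sum; exact: cvg_lim.
Qed.

End HarmonicExtension.

(** * Primitives in the third coordinate *)

Section Primitive.
Context {R : realType}.
Local Notation E := 'rV[R]_3.
Implicit Types (i j : 'I_3) (x y p : E) (w : seq 'I_3).

Lemma an_of_partials (F : E -> R) p : (\forall y \near p, differentiable F y) ->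
  (forall i, an (partial i F) p) -> an F p.
Proof.
move=> Fd Fp; have [r [C [K [r0 C0 K1 b]]]] := anb_common3 Fp.
have Fc : {for p, continuous F}.
  by apply: differentiable_continuous; exact: nbhs_singleton Fd.
have Fb : \forall y \near p, `|F y| <= `|F p| + 1.
  move/cvgrPdist_lt: Fc => /(_ 1 ltr01); apply: filterS => y /= h.
  rewrite -lerBlDl; apply: le_trans (ltW h); rewrite distrC; exact: lerB_dist.
have /nbhs_ballP[d /= d0 dP] := nearI Fd Fb.
pose r' := Num.min r d; pose C' := C + (`|F p| + 1).
have M0 : 0 <= `|F p| + 1 by have := normr_ge0 (F p); lra.
have K0 : 0 <= K by lra.
exists r', C', K; split=> //; first by rewrite lt_min r0.
  by rewrite /C'; lra.
have sub : ball p r' `<=` ball p r by apply: le_ball; rewrite ge_min lexx.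
have subd : ball p r' `<=` ball p d by apply: le_ball; rewrite ge_min lexx orbT.
move=> n; apply: (@bnd_sub _ n.+1 n); first exact: leqnSn.
apply: bnd_step => [y /subd/dP[]//|y /subd/dP[_ h]|i].
  by rewrite expr0 fact0 !mulr1 /C'; lra.
have bi : bnd n (ball p r') (partial i F) (fun k => C * K ^+ k * k`!%:R).
  move=> w y wn /sub by_; exact: (b i n w y wn by_).
apply: bnd_le bi => k _ /=.
rewrite -!mulrA; apply: ler_pM => //; [by rewrite mulr_ge0 // exprn_ge0|by rewrite /C'; lra|].
apply: ler_pM => //; [exact: exprn_ge0|by rewrite exprS ler_peMl // exprn_ge0|].
by rewrite ler_nat factS leq_pmull.
Qed.

Lemma vertical_primitive (F : E -> R) :
  (\forall y \near (0 : E), [/\ an F y, pd 0 F y = 0 & pd 1 F y = 0]) ->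
  exists Phi : E -> R, (\forall y \near (0 : E),
    [/\ an Phi y, pd 0 Phi y = 0, pd 1 Phi y = 0 & pd (1 + 1) Phi y = F y]) /\
    (forall y : E, y ord0 (1 + 1) = 0 -> Phi y = 0).
Proof.
move=> F0; have /nbhs_ballP[d /= d0 dP] := nearI F0 (vertical F0).
pose h (t : R) := F (rv3 0 0 t).
have rvb t : `|t| < d -> ball 0 d (rv3 0 0 t).
  move=> td; rewrite -ball_normE /= sub0r normrN; apply: le_lt_trans td.
  by apply: norm_le_coord => //; apply: all3; rewrite mxE /= ?normr0.
have hc t : `|t| < d -> {for t, continuous h}.
  move=> /rvb/dP[[Fa _ _] _].
  pose e : E := delta_mx ord0 (1 + 1).
  have re s : rv3 0 0 s = 0 + s *: e.
    by apply: rowP3; rewrite !mxE /= ?mulr0 ?mulr1 ?add0r.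
  have -> : h = (fun s => F (0 + s *: e)) by apply/funext => s; rewrite /h re.
  apply: differentiable_continuous; apply/derivable1_diffP.
  by have [] := derive_line (x := 0) (h := e) (t := t) (F := F); rewrite -?re; [exact: an_diff|].
pose I (t : R) := (\int[lebesgue_measure]_(s in [set` Interval (BLeft (- (d / 2))) (BRight t)]) h s)%R.
have Id t : `|t| < d / 2 -> derivable I t 1 /\ derive1 I t = h t.
  move=> td; have tu : t < d / 2 by move: td; rewrite ltr_norml; lra.
  apply: (continuous_FTC1 (u := d / 2)) => //.
  - apply: continuous_compact_integrable; first exact: segment_compact.
    apply: continuous_in_subspaceT => s; rewrite inE /= in_itv /= => /andP[s1 s2].
    by apply: hc; rewrite ltr_norml; lra.
  - by rewrite /= lte_fin; move: td; rewrite ltr_norml; lra.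
  - by apply: hc; lra.
pose Phi (y : E) := I (y ord0 (1 + 1)) - I 0.
have d2 : 0 < d / 2 by lra.
have Pp y : ball (0 : E) (d / 2) y -> differentiable Phi y /\ forall i, pd i Phi y = (i == 1 + 1)%:R * F y.
  move=> by_; have yn : `|y ord0 (1 + 1)| < d / 2.
    by apply: le_lt_trans (norm_coord _ _) _; move: by_; rewrite -ball_normE /= sub0r normrN.
  have [Iy Iy'] := Id _ yn.
  have cd : differentiable (fun y : E => y ord0 (1 + 1)) y by exact/an_diff/an_coord.
  have D1 : differentiable (fun y : E => I (y ord0 (1 + 1))) y by exact: (differentiable_comp1 (g := I)).
  have Fy : F y = h (y ord0 (1 + 1)).
    by have [_ ->] : ([/\ an F y, pd 0 F y = 0 & pd 1 F y = 0] /\ F y = F (rv3 0 0 (y ord0 (1 + 1)))) by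
      apply: dP; apply: le_ball by_; lra.
  split; first exact: differentiableB.
  move=> i; rewrite pdE partialB // partial_cst subr0 (partial_comp1 i (g := I)) // partial_coord Iy'.
  by rewrite Fy mulrC.
have bn : \forall y \near (0 : E), ball (0 : E) (d / 2) y.
  exact: open_near (ball_open _ _) (ballxx _ d2) (fun y h => h).
have Pa : an Phi 0.
  apply: an_of_partials; first by apply: filterS bn => y /Pp[].
  move=> i; apply: (an_near (F := fun y => (i == 1 + 1)%:R * F y)).
    by apply: filterS bn => y /Pp[_ e]; rewrite -e pdE.
  by have [Fa _ _] := nbhs_singleton F0; an_.
exists Phi; split; last by move=> y y2; rewrite /Phi y2 subrr.
apply: filterS2 (an_nbhs Pa) bn => y Py /Pp[_ e].
by rewrite !e /= !mul0r mul1r.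
Qed.

End Primitive.

(** * Beltrami fields in adapted coordinates *)

Section FrameAlgebra.
Context {R : realType}.
Local Notation E := 'rV[R]_3.

(** A vector that returns to its opposite after two products with n is orthogonal to
    n, and |n| = 1. *)
Lemma rotated_frame (n a b : E) : cross n a = b -> cross n b = - a -> a != 0 ->
  [/\ dot n a = 0, dot n b = 0, dot a b = 0, dot n n = 1 & dot b b = dot a a].
Proof.
move=> na nb a0.
have nb0 : dot n b = 0 by rewrite -na !dot3 !crossE; ring.
have na0 : dot n a = 0.
  have : dot n (cross n b) = 0 by rewrite !dot3 !crossE; ring.
  by rewrite nb -scaleN1r dotZr mulN1r => /eqP; rewrite oppr_eq0 => /eqP.
have ab : dot a b = 0 by rewrite -na !dot3 !crossE; ring.
have bac : cross n (cross n a) = dot n a *: n - dot n n *: a.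
  by apply: rowP3; rewrite !(mxE, crossE, dot3) ?i3_3 ?i3_1; ring.
have nn : dot n n = 1.
  move: bac; rewrite na nb na0 scale0r sub0r => /oppr_inj /eqP.
  rewrite -{1}[a]scale1r -subr_eq0 -scalerBl scaler_eq0 (negPf a0) orbF subr_eq0 => /eqP.
  by [].
split=> //.
have : dot (cross n a) (cross n a) = dot n n * dot a a - dot n a ^+ 2.
  by rewrite !dot3 !crossE; ring.
by rewrite na nn na0 => ->; ring.
Qed.

Lemma frame_independent (n a b : E) (x y z : R) : cross n a = b -> cross n b = - a -> a != 0 ->
  x *: cross a b + y *: b + z *: a = 0 -> [/\ x = 0, y = 0 & z = 0].
Proof.
move=> na nb a0; have [na0 nb0 ab nn bb] := rotated_frame na nb a0.
have q0 : dot a a != 0 by rewrite gt_eqF // dot_gt0.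
have cn : dot (cross a b) n = dot a a.
  by rewrite -bb -{2}na !dot3 !crossE; ring.
have ca : dot (cross a b) a = 0 by rewrite !dot3 !crossE; ring.
have cb : dot (cross a b) b = 0 by rewrite !dot3 !crossE; ring.
move=> e.
have e1 := congr1 (fun v => dot v n) e; have e2 := congr1 (fun v => dot v a) e; have e3 := congr1 (fun v => dot v b) e.
have z0 (v : E) : dot 0 v = 0 by rewrite /dot big1 // => i _; rewrite mxE mul0r.
rewrite /= !dotDl !dotZl z0 cn (dotC b n) nb0 (dotC a n) na0 !mulr0 !addr0 in e1.
rewrite /= !dotDl !dotZl z0 ca (dotC b a) ab !mulr0 !add0r in e2.
rewrite /= !dotDl !dotZl z0 cb ab bb !mulr0 add0r addr0 in e3.
by split; apply: (mulIf q0); rewrite mul0r.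
Qed.

Lemma frame_decompose (n a b v : E) : cross n a = b -> cross n b = - a -> a != 0 -> dot v n = 0 ->
  v = (dot v a / dot a a) *: a + (dot v b / dot a a) *: b.
Proof.
move=> na nb a0 vn; have [na0 nb0 ab nn bb] := rotated_frame na nb a0.
have q0 : dot a a != 0 by rewrite gt_eqF // dot_gt0.
apply: (scalerI q0).
have : dot n n *: (dot a a *: v) = dot v n *: (dot a a *: n) + dot n n *: (dot v a *: a + dot v b *: b).
  have e : dot n n *: (dot a a *: v) = dot v n *: (dot a a *: n) + dot v a *: (dot n n *: a) + dot v (cross n a) *: cross n a
     + dot n a *: (dot n a *: v - dot v n *: a - dot v a *: n).
    by apply: rowP3; rewrite !(mxE, crossE, dot3) ?i3_3 ?i3_1; ring.
  by rewrite e na na0 nn !scale1r scale0r addr0 -addrA.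
rewrite nn vn scale0r add0r !scale1r => ->.
by rewrite scalerDr !scalerA; congr (_ *: _ + _ *: _); rewrite mulrCA mulfV // mulr1.
Qed.
End FrameAlgebra.

Section Local.
Context {R : realType}.
Local Notation E := 'rV[R]_3.
Implicit Types (i j : 'I_3) (x y : E).
Variables (U : set E) (f g : E -> R) (p : E) (phi psi : E -> E).
Hypotheses (Uo : open U) (ga : forall x, U x -> an g x).
Hypotheses (Up : U p) (ch : chart g p phi psi).
Local Notation psi_ j := (fun x => psi x ord0 j).
Local Notation F := (fun y => f (phi y)).

Let nU : \forall x \near p, U x. Proof. exact: open_near Uo Up (fun y h => h). Qed.
Let nga : \forall x \near p, an g x. Proof. by apply: filterS nU => x; exact: ga. Qed.

Let phi0 : phi 0 = p. Proof. by case: ch => -[]. Qed.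
Let psi0 : psi p = 0. Proof. by case: ch => -[]. Qed.

Lemma chart_inverse : \forall y \near (0 : E), forall i l,
  \sum_j pd j (psi_ l) (phi y) * pd i (fun z => phi z ord0 j) y = (i == l)%:R.
Proof.
have [_ n0 np _ _] := ch.
apply: filterS3 n0 (near_join n0) (chart_pull ch np) => y [pa yy] n0y [qa _] i l.
rewrite -(pd_comp i pa (qa l)).
transitivity (pd i (fun z : E => z ord0 l) y); last exact: pd_coord.
by apply: pd_near; apply: filterS n0y => z [_ ->].
Qed.

Lemma near_frame : \forall x \near p, [/\ U x, forall j, an (psi_ j) x, phi (psi x) = x,
  (forall i, pd i (psi_ (1 + 1)) x = pd i g x) &
  [/\ cross (grad g x) (grad (psi_ 0) x) = grad (psi_ 1) x,
      cross (grad g x) (grad (psi_ 1) x) = - grad (psi_ 0) x & grad (psi_ 0) x != 0]].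
Proof.
have [_ n0 np gp cr] := ch.
have inv := chart_push ch chart_inverse.
apply: filterS3 (nearI np cr) (nearI inv (near_join gp)) (nearI nU nga) => x [[pa xx] [c1 c2]] [iv gpx] [Ux gx].
split=> //.
  by move=> i; rewrite (pd_near i gpx) pdB // pd_cst subr0.
split=> //; apply/eqP => z.
have := iv 0 0; rewrite xx big1 => [/eqP|j _].
  by rewrite eq_sym oner_eq0.
by rewrite -grad_pd z mxE mul0r.
Qed.

Lemma near_hess_sym : \forall x \near p, forall i j k, pd i (pd j (psi_ k)) x = pd j (pd i (psi_ k)) x.
Proof. by apply: filterS near_frame => x [_ pa _ _ _] i j k; exact: pdC. Qed.

(** grad eta = grad g x grad xi is divergence free, and so is grad xi. *)
Lemma near_harmonic : \forall x \near p, \sum_i pd i (pd i (psi_ 0)) x = 0 /\ \sum_i pd i (pd i (psi_ 1)) x = 0.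
Proof.
have div0 (a b : E -> R) x : (\forall z \near x, an g z) -> (\forall z \near x, an a z) ->
    (\forall z \near x, forall i, pd i b z = pd (i + 1) g z * pd (i + 1 + 1) a z - pd (i + 1 + 1) g z * pd (i + 1) a z) ->
    \sum_i pd i (pd i b) x = 0.
  move=> gn an_ e.
  have gx := nbhs_singleton gn; have ax := nbhs_singleton an_.
  have e' i : pd i (pd i b) x = pd i (fun z => pd (i + 1) g z * pd (i + 1 + 1) a z - pd (i + 1 + 1) g z * pd (i + 1) a z) x.
    by apply: pd_near; apply: filterS e => z.
  under eq_bigr => i _ do rewrite e' pdB ?pdM //.
  rewrite (big3 0) ?i3_1 ?i3_3 ?i3_1.
  rewrite (pdC 1 0 gx) (pdC (1 + 1) 0 gx) (pdC (1 + 1) 1 gx) (pdC 1 0 ax) (pdC (1 + 1) 0 ax) (pdC (1 + 1) 1 ax).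
  ring.
have nn := near_join near_frame.
apply: filterS3 nn (near_join nga) nU => x nf ng Ux.
have na k : \forall z \near x, an (psi_ k) z by apply: filterS nf => z [].
split; last first.
  apply: (div0 (psi_ 0) (psi_ 1)) => //; apply: filterS nf => z [_ _ _ _ [c _ _]] i.
  by have := congr1 (fun v : E => v ord0 i) c; rewrite !mxE -!pdE => <-.
have e : \sum_i pd i (pd i (fun z => - psi z ord0 0)) x = 0.
  apply: (div0 (psi_ 1) _) => //; apply: filterS nf => z [_ pz _ _ [_ c _]] i.
  rewrite pdN //; have := congr1 (fun v : E => v ord0 i) c; rewrite !mxE -!pdE => <-; ring.
apply/eqP; rewrite -oppr_eq0 -sumrN; apply/eqP; rewrite -[RHS]e; apply: eq_bigr => i _.
rewrite -pdN; last by apply: pd_an; exact: nbhs_singleton (na 0).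
by apply: pd_near; apply: filterS (na 0) => z za; rewrite pdN.
Qed.

(** u = P(psi) grad xi - Q(psi) grad eta. *)
Section Ansatz.
Variables (P Q : E -> R).
Hypotheses (Pa : \forall y \near (0 : E), an P y) (Qa : \forall y \near (0 : E), an Q y).
Variable u : E -> E.
Hypothesis uE : \forall x \near p, forall j,
  u x ord0 j = P (psi x) * pd j (psi_ 0) x - Q (psi x) * pd j (psi_ 1) x.

Lemma ansatz_pd : \forall x \near p, (forall j, an (fun z => u z ord0 j) x) /\ forall k j,
  pd k (fun z => u z ord0 j) x =
    (\sum_l pd l P (psi x) * pd k (psi_ l) x) * pd j (psi_ 0) x + P (psi x) * pd k (pd j (psi_ 0)) x
    - ((\sum_l pd l Q (psi x) * pd k (psi_ l) x) * pd j (psi_ 1) x + Q (psi x) * pd k (pd j (psi_ 1)) x).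
Proof.
apply: filterS3 near_frame (near_join uE) (chart_push ch (nearI Pa Qa)) => x [_ pa _ _ _] ue [Px Qx].
have aP : an (fun z => P (psi z)) x by exact: an_comp.
have aQ : an (fun z => Q (psi z)) x by exact: an_comp.
have e j : \forall z \near x, P (psi z) * pd j (psi_ 0) z - Q (psi z) * pd j (psi_ 1) z = u z ord0 j.
  by apply: filterS ue => z.
have p0 := pa 0; have p1 := pa 1.
split=> [j|k j]; first by apply: an_near (e j) _; an_.
rewrite -(pd_near k (e j)) pdB; [|by an_|by an_].
by rewrite (pdM k aP (pd_an j p0)) (pdM k aQ (pd_an j p1)) (pd_comp k pa Px) (pd_comp k pa Qx).
Qed.

(** The curl of P grad xi is grad P x grad xi; the products of the gradients of
    xi, eta and g are known from the chart. *)
Lemma ansatz_curl : \forall x \near p, forall i,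
  pd (i + 1) (fun y => u y ord0 (i + 1 + 1)) x - pd (i + 1 + 1) (fun y => u y ord0 (i + 1)) x =
  - (pd 1 P (psi x) + pd 0 Q (psi x)) * cross (grad (psi_ 0) x) (grad (psi_ 1) x) ord0 i
  + pd (1 + 1) P (psi x) * pd i (psi_ 1) x + pd (1 + 1) Q (psi x) * pd i (psi_ 0) x.
Proof.
apply: filterS3 near_frame ansatz_pd near_hess_sym => x [_ pa _ zg [c1 c2 _]] [_ up] sy i.
rewrite !up (sy (i + 1 + 1) (i + 1) 0) (sy (i + 1 + 1) (i + 1) 1).
rewrite !(big3 0) ?i3_1 !zg.
have e1 := congr1 (fun v : E => v ord0 i) c1; have e2 := congr1 (fun v : E => v ord0 i) c2.
rewrite !mxE -!pdE in e1 e2; rewrite !mxE -!pdE -e1.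
have -> : pd i (psi_ 0) x = - (pd (i + 1) g x * pd (i + 1 + 1) (psi_ 1) x - pd (i + 1 + 1) g x * pd (i + 1) (psi_ 1) x).
  by rewrite e2 opprK.
ring.
Qed.

(** Only grad P . grad xi - grad Q . grad eta remains, as xi and eta are harmonic
    and their gradients are orthogonal of equal length. *)
Lemma ansatz_div : \forall x \near p, \sum_i pd i (fun y => u y ord0 i) x =
  (pd 0 P (psi x) - pd 1 Q (psi x)) * dot (grad (psi_ 0) x) (grad (psi_ 0) x).
Proof.
apply: filterS3 near_frame ansatz_pd near_harmonic => x [_ pa _ zg [c1 c2 a0]] [_ up] [h0 h1].
have [na nb ab nn bb] := rotated_frame c1 c2 a0.
have dE k l : dot (grad (psi_ k) x) (grad (psi_ l) x) = \sum_i pd i (psi_ k) x * pd i (psi_ l) x.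
  by apply: eq_bigr => i _; rewrite !mxE -pdE.
have gE l : dot (grad g x) (grad (psi_ l) x) = \sum_i pd i (psi_ (1 + 1)) x * pd i (psi_ l) x.
  by apply: eq_bigr => i _; rewrite !mxE -pdE zg.
under eq_bigr => i _ do rewrite up.
transitivity (pd 0 P (psi x) * dot (grad (psi_ 0) x) (grad (psi_ 0) x) + pd 1 P (psi x) * dot (grad (psi_ 0) x) (grad (psi_ 1) x)
  + pd (1 + 1) P (psi x) * dot (grad g x) (grad (psi_ 0) x) + P (psi x) * (\sum_i pd i (pd i (psi_ 0)) x)
  - (pd 0 Q (psi x) * dot (grad (psi_ 0) x) (grad (psi_ 1) x) + pd 1 Q (psi x) * dot (grad (psi_ 1) x) (grad (psi_ 1) x)
  + pd (1 + 1) Q (psi x) * dot (grad g x) (grad (psi_ 1) x) + Q (psi x) * (\sum_i pd i (pd i (psi_ 1)) x))).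
  by rewrite !dE !gE !(big3 0) ?i3_1; ring.
by rewrite na nb ab h0 h1 bb; ring.
Qed.

Lemma ansatz_beltrami : (\forall y \near (0 : E), [/\ pd 0 P y = pd 1 Q y, pd 1 P y = - pd 0 Q y,
     pd (1 + 1) P y = - F y * Q y & pd (1 + 1) Q y = F y * P y]) ->
  exists V : set E, [/\ open V, V p & beltr f V u].
Proof.
move=> sys.
have : \forall x \near p, [/\ forall j, an (fun y => u y ord0 j) x,
      forall i, pd (i + 1) (fun y => u y ord0 (i + 1 + 1)) x
              - pd (i + 1 + 1) (fun y => u y ord0 (i + 1)) x = f x * u x ord0 i &
      \sum_i pd i (fun y => u y ord0 i) x = 0].
  apply: filterS3 (nearI ansatz_pd uE) (nearI ansatz_curl ansatz_div) (nearI near_frame (chart_push ch sys)).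
  move=> x [[ua _] ue] [cu di] [[_ _ xx _ _] [s1 s2 s3 s4]]; split=> //.
    by move=> i; rewrite cu s2 s3 s4 xx ue; ring.
  by rewrite di s1 subrr mul0r.
move=> /nbhs_ballP[d /= d0 dP]; exists (ball p d); split; [exact: ball_open|exact: ballxx|exact: dP].
Qed.

(** The gradients of xi and eta and their product are independent, so the
    equations can be read off from [ansatz_curl]. *)
Lemma ansatz_converse V : open V -> V p -> beltr f V u ->
  \forall y \near (0 : E), [/\ pd 0 P y = pd 1 Q y, pd 1 P y = - pd 0 Q y,
     pd (1 + 1) P y = - F y * Q y & pd (1 + 1) Q y = F y * P y].
Proof.
move=> Vo Vp ub.
have nV : \forall x \near p, V x by exact: open_near Vo Vp (fun y h => h).
have h : \forall x \near p, [/\ pd 0 P (psi x) = pd 1 Q (psi x), pd 1 P (psi x) = - pd 0 Q (psi x),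
     pd (1 + 1) P (psi x) = - f x * Q (psi x) & pd (1 + 1) Q (psi x) = f x * P (psi x)].
  apply: filterS3 (nearI nV uE) (nearI ansatz_curl ansatz_div) near_frame.
  move=> x [Vx ue] [cu di] [_ _ xx _ [c1 c2 a0]]; have [_ uc ud] := ub x Vx.
  have q0 := dot_gt0 a0.
  have : - (pd 1 P (psi x) + pd 0 Q (psi x)) *: cross (grad (psi_ 0) x) (grad (psi_ 1) x)
     + (pd (1 + 1) P (psi x) + f x * Q (psi x)) *: grad (psi_ 1) x
     + (pd (1 + 1) Q (psi x) - f x * P (psi x)) *: grad (psi_ 0) x = 0.
    apply: rowPo => i; have := uc i; rewrite cu ue => e.
    rewrite [RHS]mxE -[RHS](subrr (f x * (P (psi x) * pd i (psi_ 0) x - Q (psi x) * pd i (psi_ 1) x))) -{1}e.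
    have zD (v w : E) : (v + w) ord0 i = v ord0 i + w ord0 i by rewrite mxE.
    have zZ c (v : E) : (c *: v) ord0 i = c * v ord0 i by rewrite mxE.
    by rewrite !zD !zZ !grad_pd; ring.
  move=> /(frame_independent c1 c2 a0)[z1 z2 z3]; split.
  - move: ud; rewrite di => /eqP; rewrite mulf_eq0 (gt_eqF q0) orbF subr_eq0 => /eqP; exact.
  - by move: z1; lra.
  - by move: z2; lra.
  - by move: z3; lra.
have [_ n0 _ _ _] := ch.
by apply: filterS2 n0 (chart_pull ch h) => y [_ yy]; rewrite yy.
Qed.

End Ansatz.
End Local.

(** * The initial value problem *)

Section Rotation.
Context {R : realType}.
Local Notation E := 'rV[R]_3.
Implicit Types (A B P Q c d Phi : E -> R) (i : 'I_3) (x y : E).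

(** A + i B is holomorphic in y0 + i y1, and its derivative with respect to y2 is
    i c (A + i B). *)
Definition cr_system c A B := \forall y \near (0 : E),
  [/\ an A y /\ an B y, pd 0 A y = pd 1 B y, pd 1 A y = - pd 0 B y,
      pd (1 + 1) A y = - c y * B y & pd (1 + 1) B y = c y * A y].

Definition phase d Phi := \forall y \near (0 : E),
  [/\ an Phi y, pd 0 Phi y = 0, pd 1 Phi y = 0 & pd (1 + 1) Phi y = d y].

Lemma pd_cos i F y : an F y -> pd i (fun z => cos (F z)) y = - sin (F y) * pd i F y.
Proof.
move=> Fa; rewrite pdE partial_comp1; [|exact: derivable_cos|exact: an_diff].
by rewrite derive1E derive_val.
Qed.

Lemma pd_sin i F y : an F y -> pd i (fun z => sin (F z)) y = cos (F y) * pd i F y.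
Proof.
move=> Fa; rewrite pdE partial_comp1; [|exact: derivable_sin|exact: an_diff].
by rewrite derive1E derive_val.
Qed.

(** Multiplication of A + i B by exp (i Phi). *)
Lemma rotate_system c d A B Phi : cr_system c A B -> phase d Phi ->
  cr_system (fun y => c y + d y) (fun y => cos (Phi y) * A y - sin (Phi y) * B y)
    (fun y => sin (Phi y) * A y + cos (Phi y) * B y).
Proof.
move=> cr ph; apply: filterS2 cr ph => y [[aA aB] e0 e1 eA eB] [aP p0 p1 p2].
have aC := an_cos aP; have aS := an_sin aP.
have cA : an (fun z => cos (Phi z) * A z) y by an_.
have sB : an (fun z => sin (Phi z) * B z) y by an_.
have sA : an (fun z => sin (Phi z) * A z) y by an_.
have cB : an (fun z => cos (Phi z) * B z) y by an_.
have eP i : pd i (fun z => cos (Phi z) * A z - sin (Phi z) * B z) y =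
   cos (Phi y) * pd i A y - sin (Phi y) * pd i B y - pd i Phi y * (sin (Phi y) * A y + cos (Phi y) * B y).
  by rewrite pdB // (pdM i aC aA) (pdM i aS aB) pd_cos // pd_sin //; ring.
have eQ i : pd i (fun z => sin (Phi z) * A z + cos (Phi z) * B z) y =
   sin (Phi y) * pd i A y + cos (Phi y) * pd i B y + pd i Phi y * (cos (Phi y) * A y - sin (Phi y) * B y).
  by rewrite pdD // (pdM i aS aA) (pdM i aC aB) pd_cos // pd_sin //; ring.
split; [by split; an_| | | |]; rewrite ?eP ?eQ ?p0 ?p1 ?p2 ?e0 ?e1 ?eA ?eB; ring.
Qed.

Lemma axis_pd A : (\forall y \near (0 : E), an A y) ->
  (\forall y \near (0 : E), coord_subspace 1 y -> A y = 0) ->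
  \forall y \near (0 : E), coord_subspace 1 y -> pd 0 A y = 0.
Proof.
move=> aA zA; apply: filterS2 aA (near_join zA) => y ay zy ax.
have dy : differentiable A (y + 0 *: delta_mx ord0 0) by rewrite scale0r addr0; exact: an_diff.
have dl := derive_line dy.
have lE : linform (fun i => partial i A (y + 0 *: delta_mx ord0 0)) (delta_mx ord0 0) = pd 0 A y.
  rewrite scale0r addr0 /linform (bigD1 0) //= big1 => [|i i0]; rewrite mxE ?eqxx /=.
    by rewrite mul1r addr0 pdE.
  by rewrite (negPf i0) mul0r.
rewrite -lE -(derive_val (is_derive := dl)) -[RHS](derive_cst (0 : R) (0 : R) (1 : R)).
apply: near_eq_derive.
have : (fun s : R => y + s *: delta_mx ord0 0 : E) @ (0 : R) --> y.
  rewrite -[X in _ --> X](_ : y + (0 : R) *: delta_mx ord0 0 = y); last by rewrite scale0r addr0.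
  by apply: cvgD; [exact: cvg_cst | apply: cvgZr_tmp; exact: cvg_id].
move=> cv; have zs : \forall s \near (0 : R), coord_subspace 1 (y + s *: delta_mx ord0 0) -> A (y + s *: delta_mx ord0 0) = 0.
  exact: cv zy.
apply: filterS zs => s h; apply: h => j j1; rewrite !mxE (ax j j1) add0r.
by have [j0|_] := eqVneq j 0; [move: j1; rewrite j0 | rewrite andbF mulr0].
Qed.

(** The partial derivatives of a solution form a solution again, and they vanish on
    the axis as well: d_0 does because it is tangent to the axis, d_1 by the
    Cauchy-Riemann equations. *)
Lemma cr_vanish w A B : cr_system (fun=> 0) A B ->
  (\forall y \near (0 : E), coord_subspace 1 y -> A y = 0 /\ B y = 0) ->
  iter_partial w A 0 = 0 /\ iter_partial w B 0 = 0.
Proof.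
elim/last_ind: w A B => [|w i IH] A B cr z.
  by apply: (nbhs_singleton z) => j _; rewrite mxE.
rewrite !iter_partial_rcons -!pdE; apply: IH.
  apply: filterS (near_join cr) => y n.
  have [[aA aB] _ _ _ _] := nbhs_singleton n.
  split; first by split; apply: pd_an.
  - by rewrite (pdC 0 i aA) (pdC 1 i aB); apply: pd_near; apply: filterS n => z' [].
  - rewrite (pdC 1 i aA) (pdC 0 i aB) -pdN; last exact: pd_an.
    by apply: pd_near; apply: filterS n => z' [].
  - rewrite oppr0 mul0r (pdC (1 + 1) i aA) -[RHS](pd_cst i 0 y).
    by apply: pd_near; apply: filterS n => z' [_ _ _ -> _]; rewrite oppr0 mul0r.
  - rewrite mul0r (pdC (1 + 1) i aB) -[RHS](pd_cst i 0 y).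
    by apply: pd_near; apply: filterS n => z' [_ _ _ _ ->]; rewrite mul0r.
have zA : \forall y \near (0 : E), coord_subspace 1 y -> pd 0 A y = 0.
  by apply: axis_pd; [apply: filterS cr => y [[]] | apply: filterS z => y h /h[]].
have zB : \forall y \near (0 : E), coord_subspace 1 y -> pd 0 B y = 0.
  by apply: axis_pd; [apply: filterS cr => y [[]] | apply: filterS z => y h /h[]].
apply: filterS3 zA zB cr => y yA yB [_ e0 e1 e2 e3] ax; move: (yA ax) (yB ax) => A0 B0.
move: i; apply: all3; first by split.
  by rewrite e1 B0 oppr0 -e0 A0.
by rewrite e2 e3 oppr0 !mul0r.
Qed.

Lemma cr_unique A B : cr_system (fun=> 0) A B ->
  (\forall y \near (0 : E), coord_subspace 1 y -> A y = 0 /\ B y = 0) ->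
  \forall y \near (0 : E), A y = 0 /\ B y = 0.
Proof.
move=> cr z; have [[aA aB] _ _ _ _] := nbhs_singleton cr.
by apply: nearI; apply: an_zero_near => // w; have [] := cr_vanish w cr z.
Qed.

End Rotation.

Section Data.
Context {R : realType}.
Local Notation E := 'rV[R]_3.
Implicit Types (i j : 'I_3) (x y : E).
Variables (U : set E) (f g : E -> R) (p : E) (phi psi : E -> E).
Hypotheses (Uo : open U) (fa : forall x, U x -> an f x).
Hypotheses (gf0 : forall x, U x -> grad f x != 0).
Hypotheses (ga : forall x, U x -> an g x) (fg : forall x, U x -> cross (grad f x) (grad g x) = 0).
Hypotheses (Up : U p) (ch : chart g p phi psi).
Local Notation psi_ j := (fun x => psi x ord0 j).
Local Notation F := (fun y => f (phi y)).
Local Notation gxi x := (grad (psi_ 0) x).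
Local Notation geta x := (grad (psi_ 1) x).
(** Coefficients of the linear form that extracts P, respectively Q, from
    P grad xi - Q grad eta. *)
Definition datum_coef (first : bool) (j : 'I_3) x :=
  if first then pd j (psi_ 0) x / dot (gxi x) (gxi x) else - pd j (psi_ 1) x / dot (gxi x) (gxi x).
Definition datum first (u : E -> E) x := \sum_j datum_coef first j x * u x ord0 j.

Let nU : \forall x \near p, U x. Proof. exact: open_near Uo Up (fun y h => h). Qed.
Let nf := near_frame Uo ga Up ch.

Lemma datumE (u : E -> E) x : datum true u x = dot (u x) (gxi x) / dot (gxi x) (gxi x) /\
  datum false u x = - (dot (u x) (geta x) / dot (gxi x) (gxi x)).
Proof.
rewrite /datum /datum_coef; set q := dot (gxi x) (gxi x).
by rewrite !dot3 !(big3 0) !i3_1 !grad_pd; split; ring.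
Qed.

Lemma datum_coef_an first j : an (datum_coef first j) p.
Proof.
have [_ pa _ _ [_ _ a0]] := nbhs_singleton nf.
have p0 := pa 0; have p1 := pa 1.
have iq : an (fun x => (dot (gxi x) (gxi x))^-1) p.
  apply: anV; first by rewrite dot_eq0.
  apply: (an_near (F := fun x => \sum_i pd i (psi_ 0) x * pd i (psi_ 0) x)); last by an_.
  by apply: filterE => x; apply: eq_bigr => i _; rewrite !grad_pd.
by case: first; rewrite /datum_coef; an_.
Qed.

Let Fvert : \forall y \near (0 : E), [/\ an F y, pd 0 F y = 0 & pd 1 F y = 0].
Proof.
have nfa : \forall x \near p, an f x by apply: filterS nU => x; exact: fa.
have nga : \forall x \near p, an g x by apply: filterS nU => x; exact: ga.
have nfg : \forall x \near p, cross (grad f x) (grad g x) = 0 by apply: filterS nU => x; exact: fg.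
apply: filterS (chart_factor_grad ch nfa nga nfg) => y [la [_ a e]].
by split=> //; rewrite e /= mulr0.
Qed.

(** The two data are the real and the imaginary part of a function on the axis;
    each is extended separately, as A1 + i B1 and A2 + i B2, and
    A1 + i B1 + i (A2 + i B2) is rotated by the primitive of f.  The primitive
    vanishes for y2 = 0, so the rotation does not affect the data. *)
Lemma datum_surjective (g1 g2 : E -> R) : an g1 0 -> an g2 0 ->
  exists u V, [/\ open V, V p & beltr f V u] /\
   \forall y \near (0 : E), coord_subspace 1 y ->
     datum true u (phi y) = g1 y /\ datum false u (phi y) = g2 y.
Proof.
move=> /harmonic_extension[A1 [B1 [h1 x1]]] /harmonic_extension[A2 [B2 [h2 x2]]].
have [Phi [ph ph0]] := vertical_primitive Fvert.
pose A y := A1 y - B2 y; pose B y := B1 y + A2 y.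
have cr : cr_system (fun=> 0) A B.
  apply: filterS2 h1 h2 => y [a1 b1 [c1 d1] [e1 k1]] [a2 b2 [c2 d2] [e2 k2]].
  split; first by split; [exact: anB|exact: anD].
  - by rewrite pdB // pdD // c1 d2; ring.
  - by rewrite pdB // pdD // d1 c2; ring.
  - by rewrite pdB // e1 k2; ring.
  - by rewrite pdD // k1 e2; ring.
have := rotate_system cr ph.
set P := (fun y => cos (Phi y) * A y - _); set Q := (fun y => sin (Phi y) * A y + _) => sys.
pose u x := P (psi x) *: gxi x - Q (psi x) *: geta x.
have Pa : \forall y \near (0 : E), an P y by apply: filterS sys => y [[]].
have Qa : \forall y \near (0 : E), an Q y by apply: filterS sys => y [[]].
have uE : \forall x \near p, forall j, u x ord0 j = P (psi x) * pd j (psi_ 0) x - Q (psi x) * pd j (psi_ 1) x.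
  by apply: filterE => x j; rewrite !mxE !pdE.
have [V [Vo Vp ub]] : exists V : set E, [/\ open V, V p & beltr f V u].
  apply: (ansatz_beltrami Uo ga Up ch Pa Qa uE).
  by apply: filterS sys => y [_ -> -> -> ->]; rewrite add0r.
exists u, V; split=> //; have [_ n0 _ _ _] := ch.
apply: filterS3 (nearI x1 x2) (chart_pull ch nf) n0 => y [{}x1 {}x2] [_ _ _ _ [c1 c2 a0]] [_ yy] ax.
have [A1y B1y] := x1 ax; have [A2y B2y] := x2 ax.
have [_ _ ab _ bb] := rotated_frame c1 c2 a0.
have q0 : dot (gxi (phi y)) (gxi (phi y)) != 0 by rewrite gt_eqF // dot_gt0.
have [-> ->] := datumE u (phi y); rewrite /u yy -scaleNr !dotDl !dotZl (dotC (geta _) (gxi _)) ab bb.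
rewrite /P /Q ph0 ?cos0 ?sin0; last exact: ax.
by rewrite /A /B A1y B1y A2y B2y; split; field.
Qed.

(** The difference of two solutions is tangent to the leaves, hence of the form
    P grad xi - Q grad eta with P and Q read off by the data; the rotation by the
    negative phase removes f. *)
Lemma datum_injective (u v : E -> E) V V' : open V -> V p -> beltr f V u ->
  open V' -> V' p -> beltr f V' v ->
  (\forall y \near (0 : E), coord_subspace 1 y -> forall b, datum b u (phi y) = datum b v (phi y)) ->
  \forall x \near p, u x = v x.
Proof.
move=> Vo Vp ub V'o V'p vb dat.
pose w x := u x - v x; pose W := V `&` V' `&` U.
have Wo : open W by apply: openI => //; exact: openI.
have wb : beltr f W w.
  move=> x [[Vx V'x] Ux]; have [ua uc ud] := ub x Vx; have [va vc vd] := vb x V'x.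
  have wE j : (fun y => w y ord0 j) = (fun y => u y ord0 j - v y ord0 j).
    by apply/funext => y; rewrite !mxE.
  split=> [j|i|].
  - by rewrite wE; exact: anB.
  - rewrite !wE !pdB //; have := uc i; have := vc i; rewrite !mxE mulrBr => <- <-; ring.
  - under eq_bigr => i _ do rewrite wE pdB //.
    by rewrite sumrB ud vd subrr.
have wd : \forall y \near (0 : E), coord_subspace 1 y -> forall b, datum b w (phi y) = 0.
  apply: filterS dat => y h ax b; move: (h ax b); rewrite /datum => /eqP.
  rewrite -subr_eq0 -sumrB => /eqP e; rewrite -[RHS]e; apply: eq_bigr => j _.
  by rewrite !mxE mulrBr.
have Wp : W p by [].
have nW : \forall x \near p, W x by exact: open_near Wo Wp (fun y h => h).
have [_ n0 np _ _] := ch.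
pose P y := datum true w (phi y); pose Q y := datum false w (phi y).
have da : \forall x \near p, forall b, an (datum b w) x.
  have ca : \forall x \near p, forall b j, an (datum_coef b j) x.
    have h b : \forall x \near p, forall j, an (datum_coef b j) x.
      by apply: near_forall3 => j; apply: an_nbhs; exact: datum_coef_an.
    by apply: filterS2 (h true) (h false) => x h1 h2 [].
  apply: filterS2 ca nW => x cx /wb[wa _ _] b; rewrite /datum; an_; exact: cx.
have DA b : \forall y \near (0 : E), an (fun y => datum b w (phi y)) y.
  by apply: filterS2 (chart_pull ch da) n0 => y dy [py _]; exact: an_comp.
have wE : \forall x \near p, w x = P (psi x) *: gxi x - Q (psi x) *: geta x.
  apply: filterS3 nf nW np => x [_ _ _ _ [c1 c2 a0]] Wx [_ xx].
  have wn : dot (w x) (grad g x) = 0.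
    have Ux : U x by case: Wx.
    have [_ _ _ nn _] := rotated_frame c1 c2 a0.
    have n0' : grad g x != 0.
      by apply/eqP => z; move: nn; rewrite z /dot big1 => [/eqP|i _]; rewrite ?mxE ?mul0r // eq_sym oner_eq0.
    have := cross_eq0 n0' (fg Ux); set la := _ / _ => fE.
    have la0 : la != 0.
      by apply/eqP => z; have := gf0 Ux; rewrite fE z scale0r eqxx.
    have Wsub : forall z, W z -> an f z by move=> z [_ /fa].
    have := beltrami_orth Wo Wsub wb Wx.
    under eq_bigr => j _ do rewrite -grad_pd fE mxE -mulrA.
    rewrite -mulr_sumr => /eqP; rewrite mulf_eq0 (negPf la0) /= => /eqP e.
    by rewrite dotC.
  have := frame_decompose c1 c2 a0 wn; rewrite /P /Q xx; have [-> ->] := datumE w x.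
  by rewrite scaleNr opprK.
have uE : \forall x \near p, forall j, w x ord0 j = P (psi x) * pd j (psi_ 0) x - Q (psi x) * pd j (psi_ 1) x.
  by apply: filterS wE => x -> j; rewrite !mxE !pdE.
have sys := ansatz_converse Uo ga Up ch (DA true) (DA false) uE Wo Wp wb.
have [Phi [ph ph0]] := vertical_primitive Fvert.
have ph' : phase (fun y => - F y) (fun y => - Phi y).
  by apply: filterS ph => y [a e0 e1 e2]; rewrite !pdN // e0 e1 e2 oppr0; split=> //; exact: anN.
have cr : cr_system F P Q by apply: filterS3 sys (DA true) (DA false) => y [].
have := rotate_system cr ph'; set A := (fun y => cos _ * P y - _); set B := (fun y => sin _ * P y + _) => crA.
have crA' : cr_system (fun=> 0) A B.
  by apply: filterS crA => y [h e0 e1 e2 e3]; split=> //; [apply: etrans e2 _ | apply: etrans e3 _]; rewrite subrr.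
have AB0 : \forall y \near (0 : E), A y = 0 /\ B y = 0.
  apply: cr_unique crA' _; apply: filterS wd => y h ax.
  by rewrite /A /B /P /Q !(h ax) !mulr0 subr0 addr0.
have PQ0 : \forall y \near (0 : E), P y = 0 /\ Q y = 0.
  apply: filterS AB0 => y; rewrite /A /B cosN sinN => -[a b].
  have t := cos2Dsin2 (Phi y).
  split.
    transitivity ((cos (Phi y) ^+ 2 + sin (Phi y) ^+ 2) * P y); first by rewrite t mul1r.
    transitivity (cos (Phi y) * (cos (Phi y) * P y - - sin (Phi y) * Q y) - sin (Phi y) * (- sin (Phi y) * P y + cos (Phi y) * Q y)); first by ring.
    by rewrite a b !mulr0 subr0.
  transitivity ((cos (Phi y) ^+ 2 + sin (Phi y) ^+ 2) * Q y); first by rewrite t mul1r.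
  transitivity (sin (Phi y) * (cos (Phi y) * P y - - sin (Phi y) * Q y) + cos (Phi y) * (- sin (Phi y) * P y + cos (Phi y) * Q y)); first by ring.
  by rewrite a b !mulr0 addr0.
apply: filterS2 wE (chart_push ch PQ0) => x e [p0 q0].
by apply/eqP; rewrite -subr_eq0; apply/eqP; rewrite -/(w x) e p0 q0 !scale0r subr0.
Qed.

(** psi supplies an inverse. *)
Lemma chart_jacobian : jacobian phi 0 \in unitmx.
Proof.
have [[phi0 _] n0 _ _ _] := ch; have [pa _] := nbhs_singleton n0.
have inv := nbhs_singleton (chart_inverse ch).
pose K : 'M[R]_3 := \matrix_(j, l) pd j (psi_ l) (phi 0).
suff /mulmx1_unit[] : jacobian phi 0 *m K = 1%:M by [].
have dphi : differentiable phi 0 by apply: differentiable_rV => j; exact: an_diff.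
apply/matrixP => i l; rewrite !mxE -(inv i l); apply: eq_bigr => j _.
rewrite !mxE mulrC; congr (_ * _).
rewrite diff_rV // /linform (bigD1 i) //= big1 => [|k ki]; rewrite mxE ?eqxx /=.
  by rewrite mul1r addr0 pdE.
by rewrite (negPf ki) mul0r.
Qed.

Lemma ord2_ind (T : forall i : 'I_2, 'I_(i + i) -> Prop) :
  T ord_max ord0 -> T ord_max ord_max -> forall (i : 'I_2) (l : 'I_(i + i)), T i l.
Proof.
move=> t0 t1 i; have [->|->] : i = ord_max \/ i = ord0.
- by case: i => -[|[|//]] hi; [right|left]; exact: val_inj.
- move=> l; have [->|->] : l = ord0 \/ l = ord_max by case: l => -[|[|//]] hl; [left|right]; exact: val_inj.
  + by [].
  + by [].
- by case.
Qed.

Lemma diff_op0 (a : seq 'I_3 -> 'I_3 -> E -> R) (u : E -> E) x :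
  diff_op 0 a u x = \sum_j a [::] j x * u x ord0 j.
Proof.
rewrite /diff_op big_ord1 (big_pred1 [tuple]) // => w.
by apply/esym/eqP; exact: tuple0.
Qed.

(** There are i + i data of level i, that is none of level 0 and two of level 1. *)
Theorem parametrized : parametrized_at (beltrami f) 2 1 p.
Proof.
have [[phi0 psi0] n0 np _ _] := ch.
exists phi, (fun i : 'I_2 => (i + i)%N), 0%N,
  (fun (i : 'I_2) (l : 'I_(i + i)) w j => datum_coef (l == 0%N :> nat) j).
split=> //.
- split=> //; last exact: chart_jacobian.
  by move=> i; apply: an_analytic_at; have [] := nbhs_singleton n0.
- by move=> i l w j; apply: an_analytic_at; exact: datum_coef_an.
move=> G Ga; split.
  have [u [V [[Vo Vp ub] ud]]] := datum_surjective (analytic_at_an (Ga ord_max ord0)) (analytic_at_an (Ga ord_max ord_max)).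
  exists u; first by exists V; split=> //; apply/beltramiP.
  apply: ord2_ind; apply: filterS ud => y h ax; rewrite diff_op0; have [h0 h1] := h ax.
    exact: h0.
  exact: h1.
move=> u v [V [Vo Vp /beltramiP ub]] [V' [Vo' Vp' /beltramiP vb]] ud vd.
apply: (datum_injective Vo Vp ub Vo' Vp' vb).
have u0 := ud ord_max ord0; have u1 := ud ord_max ord_max.
have v0 := vd ord_max ord0; have v1 := vd ord_max ord_max.
apply: filterS2 (nearI u0 u1) (nearI v0 v1) => y [a b] [c d] ax.
move: (a ax) (b ax) (c ax) (d ax); rewrite !diff_op0 => {}a {}b {}c {}d [].
  by rewrite /datum; transitivity (G ord_max ord0 y).
by rewrite /datum; transitivity (G ord_max ord_max y).
Qed.

End Data.

Unset Implicit Arguments.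

Theorem theorem1p3 (R : realType) (U : set 'rV[R]_3) (f : 'rV[R]_3 -> R)
    (U_open : open U) (U_connected : connected U)
    (f_analytic : forall x, U x -> analytic_at f x)
    (f_neq0 : forall x, U x -> f x != 0)
    (grad_neq0 : forall x, U x -> grad f x != 0) :
  ((forall x, U x -> umbilic f x) ->
     (~ (in_parallel_planes U f \/ in_concentric_spheres U f) ->
        forall u, beltrami f U u -> forall x, U x -> u x = 0) /\
     (in_parallel_planes U f \/ in_concentric_spheres U f ->
        locally_parametrized U (beltrami f) 2 1)) /\
  ((forall x, U x -> ~ umbilic f x) ->
     dim_at_most U (beltrami f U) 3).
Proof.
have fa x : U x -> an f x by move=> Ux; apply: analytic_at_an; exact: f_analytic.
split; last exact: nonumbilic_dim.
move=> umb; split.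
  move=> nfol u /beltramiP ub x Ux; apply/eqP; apply: contra_notT nfol => ux0.
  exact: (umbilic_rigidity U_open fa grad_neq0 U_connected f_neq0 umb ub Ux ux0).
move=> /(foliation_height U_open fa grad_neq0)[g [ga fg gch]].
exists U; split=> //; first exact: subset_closure.
move=> p Up; have [phi [psi ch]] := gch p Up.
exact: (parametrized U_open fa grad_neq0 ga fg Up ch).
Qed.
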